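(* Let $0$ be an umbilic point of a $C^r$ immersion $\alpha$, $r\ge4$, parametrized in a Monge chart by $\alpha(x,y)=(x,y,z(x,y))$ with $$z(x,y)=\frac k2(x^2+y^2)+\frac a6x^3+\frac b2xy^2+\frac c6y^3+O(4).$$ Suppose that $kb(b-a)\neq0$ and put $$\Delta_m=4c^2(2a-b)^2-[3c^2+(a-5b)^2][3(a-5b)(a-b)+c^2].$$ Consider the cases $M_1$: $\Delta_m>0$; $\quad M_2$: $\Delta_m<0$ and $\frac ab>1$; $\quad M_3$: $\frac ab<1$. Then, for every mean curvature function $\mathcal M$, each of the foliations $\mathbb H^{\mathcal M}_1,\mathbb H^{\mathcal M}_2$ has, in a neighborhood of $0$: one hyperbolic sector in case $M_1$; one parabolic and one hyperbolic sector in case $M_2$; three hyperbolic sectors in case $M_3$.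
   Context: For an oriented surface immersed in $\mathbb R^3$ with positive unit normal $N$, let $I=E\,du^2+2F\,du\,dv+G\,dv^2$ and $II=e\,du^2+2f\,du\,dv+g\,dv^2$ be the first and second fundamental forms, $k_n=II/I$, $k_1\le k_2$ the principal curvatures, $\mathcal H=(k_1+k_2)/2$, $\mathcal K=k_1k_2$. A mean curvature function $\mathcal M=m(H,K)$ satisfies: (1) $(m-H)^2\le H^2-K$ on $H^2\ge K\ge 0$; (2) $m$ is continuous on $H^2\ge K\ge0$ and analytic on $K>0$; (3) $m(tH,t^2K)=t\,m(H,K)$ for $t\ge 0$. On the surface, $\mathcal M$ also denotes $m(\mathcal H,\mathcal K)$. Lines of $\mathcal M$-mean curvature are the regular curves along which $k_n=\mathcal M$, i.e. solutions of $(g-\mathcal MG)dv^2+2(f-\mathcal MF)du\,dv+(e-\mathcal ME)du^2=0$. Through each non-umbilic point with $\mathcal K>0$ pass two of them, forming two transversal foliations: $\mathbb H^{\mathcal M}_1$ (minimal; geodesic torsion $\tau_g=-\sqrt{(k_2-\mathcal M)(\mathcal M-k_1)}$) and $\mathbb H^{\mathcal M}_2$ (maximal; $\tau_g=+\sqrt{(k_2-\mathcal M)(\mathcal M-k_1)}$), with a singularity at each umbilic point. *)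

(* Defs.v *)
From Stdlib Require Import Reals List.
From Coquelicot Require Import Coquelicot.
Open Scope R_scope.

Definition R3 : Type := (R * R * R)%type.
Definition pr1 (x : R3) : R := fst (fst x).
Definition pr2 (x : R3) : R := snd (fst x).
Definition pr3 (x : R3) : R := snd x.

Definition vadd (x y : R3) : R3 := (pr1 x + pr1 y, pr2 x + pr2 y, pr3 x + pr3 y).
Definition vscal (t : R) (x : R3) : R3 := (t * pr1 x, t * pr2 x, t * pr3 x).
Definition vdot (x y : R3) : R := pr1 x * pr1 y + pr2 x * pr2 y + pr3 x * pr3 y.
Definition vcross (x y : R3) : R3 :=
  (pr2 x * pr3 y - pr3 x * pr2 y,
   pr3 x * pr1 y - pr1 x * pr3 y,
   pr1 x * pr2 y - pr2 x * pr1 y).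
Definition vnorm (x : R3) : R := sqrt (vdot x x).

Definition Du (f : R -> R -> R) (u v : R) : R := Derive (fun s => f s v) u.
Definition Dv (f : R -> R -> R) (u v : R) : R := Derive (fun s => f u s) v.

Fixpoint class_C (r : nat) (U : R * R -> Prop) (f : R -> R -> R) : Prop :=
  (forall u v, U (u, v) -> continuity_2d_pt f u v) /\
  match r with
  | O => True
  | S r' =>
      (forall u v, U (u, v) ->
         ex_derive (fun s => f s v) u /\ ex_derive (fun s => f u s) v) /\
      class_C r' U (Du f) /\ class_C r' U (Dv f)
  end.

Definition Du3 (X : R -> R -> R3) (u v : R) : R3 :=
  (Du (fun s t => pr1 (X s t)) u v,
   Du (fun s t => pr2 (X s t)) u v,
   Du (fun s t => pr3 (X s t)) u v).
Definition Dv3 (X : R -> R -> R3) (u v : R) : R3 :=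
  (Dv (fun s t => pr1 (X s t)) u v,
   Dv (fun s t => pr2 (X s t)) u v,
   Dv (fun s t => pr3 (X s t)) u v).

Definition Cr_immersion (r : nat) (U : R * R -> Prop) (alpha : R -> R -> R3) : Prop :=
  class_C r U (fun u v => pr1 (alpha u v)) /\
  class_C r U (fun u v => pr2 (alpha u v)) /\
  class_C r U (fun u v => pr3 (alpha u v)) /\
  (forall u v, U (u, v) -> vcross (Du3 alpha u v) (Dv3 alpha u v) <> (0, 0, 0)).

Definition monge (z : R -> R -> R) : R -> R -> R3 := fun x y => (x, y, z x y).

(* The chart is taken to be positively oriented, so this is the positive normal. *)
Definition normal (alpha : R -> R -> R3) (u v : R) : R3 :=
  let w := vcross (Du3 alpha u v) (Dv3 alpha u v) in vscal (/ vnorm w) w.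

Definition ffE alpha u v := vdot (Du3 alpha u v) (Du3 alpha u v).
Definition ffF alpha u v := vdot (Du3 alpha u v) (Dv3 alpha u v).
Definition ffG alpha u v := vdot (Dv3 alpha u v) (Dv3 alpha u v).
Definition sfe alpha u v := vdot (normal alpha u v) (Du3 (Du3 alpha) u v).
Definition sff alpha u v := vdot (normal alpha u v) (Du3 (Dv3 alpha) u v).
Definition sfg alpha u v := vdot (normal alpha u v) (Dv3 (Dv3 alpha) u v).

Definition first_form alpha u v (du dv : R) : R :=
  ffE alpha u v * du ^ 2 + 2 * ffF alpha u v * du * dv + ffG alpha u v * dv ^ 2.
Definition second_form alpha u v (du dv : R) : R :=
  sfe alpha u v * du ^ 2 + 2 * sff alpha u v * du * dv + sfg alpha u v * dv ^ 2.

Definition normal_curvature alpha u v (du dv : R) : R :=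
  second_form alpha u v du dv / first_form alpha u v du dv.

(* The principal curvatures are the extreme values of the normal curvature
   over all tangent directions. *)
Definition normal_curvature_values alpha u v : R -> Prop :=
  fun kappa => exists du dv : R,
    (du, dv) <> (0, 0) /\ kappa = normal_curvature alpha u v du dv.
Definition k1 alpha u v : R := real (Glb_Rbar (normal_curvature_values alpha u v)).
Definition k2 alpha u v : R := real (Lub_Rbar (normal_curvature_values alpha u v)).

Definition mean_curvature alpha u v : R := (k1 alpha u v + k2 alpha u v) / 2.
Definition gauss_curvature alpha u v : R := k1 alpha u v * k2 alpha u v.

Definition umbilic alpha u v : Prop := k1 alpha u v = k2 alpha u v.

(* The coefficient tau_g of the Darboux frame equation
   dN/ds = - k_n T - tau_g (N /\ T) of a curve with unit tangent T,
   for T the normalization of d alpha (du, dv). *)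
Definition geodesic_torsion alpha u v (du dv : R) : R :=
  let dalpha := vadd (vscal du (Du3 alpha u v)) (vscal dv (Dv3 alpha u v)) in
  let dN := vadd (vscal du (Du3 (normal alpha) u v))
                 (vscal dv (Dv3 (normal alpha) u v)) in
  let T := vscal (/ vnorm dalpha) dalpha in
  - vdot (vscal (/ vnorm dalpha) dN) (vcross (normal alpha u v) T).

Definition mcf_domain (H K : R) : Prop := 0 <= K <= H ^ 2.

(* Near (H0, K0), [m] coincides on [D] with the sum of a double power series
   converging absolutely on a full neighbourhood of (H0, K0); so at boundary
   points of [D] analyticity means having a local analytic extension. *)
Definition analytic_within (D : R -> R -> Prop) (m : R -> R -> R) (H0 K0 : R) : Prop :=
  exists (coef : nat -> nat -> R) (rho : R), 0 < rho /\
  forall h l : R, Rabs h < rho -> Rabs l < rho ->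
    ex_series (fun n => sum_n (fun i =>
      Rabs (coef i (n - i)%nat * h ^ i * l ^ (n - i))) n) /\
    (D (H0 + h) (K0 + l) ->
     is_series (fun n => sum_n (fun i =>
       coef i (n - i)%nat * h ^ i * l ^ (n - i)) n) (m (H0 + h) (K0 + l))).

Record mean_curvature_function (m : R -> R -> R) : Prop := {
  mcf_between : forall H K, mcf_domain H K -> (m H K - H) ^ 2 <= H ^ 2 - K;
  mcf_continuous : forall H K, mcf_domain H K ->
    filterlim (fun p : R * R => m (fst p) (snd p))
      (within (fun p : R * R => mcf_domain (fst p) (snd p)) (locally (H, K)))
      (locally (m H K));
  mcf_analytic : forall H K, mcf_domain H K -> 0 < K -> analytic_within mcf_domain m H K;
  mcf_homogeneous : forall H K t, mcf_domain H K -> 0 <= t ->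
    m (t * H) (t ^ 2 * K) = t * m H K
}.

Definition calM (m : R -> R -> R) alpha u v : R :=
  m (mean_curvature alpha u v) (gauss_curvature alpha u v).

(* [L p w] : the nonzero vector [w] is tangent at [p] to the foliation [L]. *)
Definition line_field : Type := R * R -> R * R -> Prop.

Inductive mean_family : Type := minimal | maximal.
Definition torsion_sign (i : mean_family) : R :=
  match i with minimal => -1 | maximal => 1 end.

Definition mean_foliation (U : R * R -> Prop) (alpha : R -> R -> R3)
    (m : R -> R -> R) (i : mean_family) : line_field :=
  fun p w =>
    let '(u, v) := p in
    let '(du, dv) := w in
    let M := calM m alpha u v in
    U (u, v) /\ 0 < gauss_curvature alpha u v /\ ~ umbilic alpha u v /\
    (du, dv) <> (0, 0) /\
    normal_curvature alpha u v du dv = M /\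
    geodesic_torsion alpha u v du dv =
      torsion_sign i * sqrt ((k2 alpha u v - M) * (M - k1 alpha u v)).

(* At an end point of [J] in [J] the derivatives are still two-sided: [gamma] is
   any C^1 extension of the arc, and only its values on [J] are constrained. *)
Definition regular_integral_curve (L : line_field) (J : R -> Prop) (gamma : R -> R * R) : Prop :=
  let x := fun t => fst (gamma t) in
  let y := fun t => snd (gamma t) in
  forall t, J t ->
    ex_derive x t /\ ex_derive y t /\
    continuous (Derive x) t /\ continuous (Derive y) t /\
    (Derive x t, Derive y t) <> (0, 0) /\
    L (gamma t) (Derive x t, Derive y t).

Definition is_interval (J : R -> Prop) : Prop :=
  forall s t w, J s -> J t -> s <= w <= t -> J w.

Definition leaf_arc (L : line_field) (A : R * R -> Prop) : Prop :=
  exists (J : R -> Prop) (gamma : R -> R * R),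
    is_interval J /\ regular_integral_curve L J gamma /\
    (forall x, A x <-> exists t, J t /\ x = gamma t).

Definition square (p : R * R) : Prop := 0 <= fst p <= 1 /\ 0 <= snd p <= 1.

Inductive sector_type : Type := hyperbolic | parabolic.

(* The leaf through [p] of the model foliation of the square [0,1]^2 minus its
   corner (0,0): for a hyperbolic sector, the phase curves of the quarter of a
   saddle, i.e. the two half-axes and the hyperbolas s t = const; for a
   parabolic sector, those of the quarter of a node, i.e. the rays from (0,0).
   In both models the two sides through the corner are leaves. *)
Definition model_leaf (sigma : sector_type) (p q : R * R) : Prop :=
  square q /\ q <> (0, 0) /\
  match sigma with
  | hyperbolic => fst q * snd q = fst p * snd p /\ (fst q = 0 <-> fst p = 0)
  | parabolic => fst q * snd p = snd q * fst p
  end.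

(* A neighbourhood of [o] is cut by leaves ending at [o] into closed sectors,
   listed in cyclic order with their types.  The i-th one is the image of the
   square under [phi i], which sends the corner to [o] and the leaves of the
   model onto arcs of leaves of [L].  The side s = 0 of each square is glued to
   the side t = 0 of the next one; nothing else is identified.  When there is
   a single sector its two sides are glued together, so that it is a disk slit
   along one separatrix. *)
Definition sector_decomposition (L : line_field) (o : R * R)
    (types : list sector_type) (phi : nat -> R * R -> R * R) : Prop :=
  let n := length types in
  let next := fun i => Nat.modulo (S i) n in
  (forall i p, (i < n)%nat -> square p ->
     filterlim (phi i) (within square (locally p)) (locally (phi i p))) /\
  (forall i, (i < n)%nat -> phi i (0, 0) = o) /\
  (forall i s, (i < n)%nat -> 0 <= s <= 1 -> phi i (0, s) = phi (next i) (s, 0)) /\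
  (forall i j p q, (i < n)%nat -> (j < n)%nat -> square p -> square q ->
     phi i p = phi j q ->
     (p = (0, 0) /\ q = (0, 0)) \/
     (i = j /\ p = q) \/
     (j = next i /\ exists s, p = (0, s) /\ q = (s, 0)) \/
     (i = next j /\ exists s, p = (s, 0) /\ q = (0, s))) /\
  (forall i p, (i < n)%nat -> square p -> p <> (0, 0) ->
     leaf_arc L (fun x => exists q, model_leaf (nth i types hyperbolic) p q /\ x = phi i q)) /\
  locally o (fun x => exists i p, (i < n)%nat /\ square p /\ x = phi i p).

Definition has_sectors (L : line_field) (o : R * R) (types : list sector_type) : Prop :=
  exists phi : nat -> R * R -> R * R, sector_decomposition L o types phi.

Definition Delta_m (a b c : R) : R :=
  4 * c ^ 2 * (2 * a - b) ^ 2
  - (3 * c ^ 2 + (a - 5 * b) ^ 2) * (3 * (a - 5 * b) * (a - b) + c ^ 2).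

(* Main.v *)
(* At a direction with k_n = M the numerator of tau_g is the Jacobian of II - M I
   and I, so each foliation is the solution, selected by a sign, of an equation
   A (dy^2 - dx^2) + 2 B dx dy + t (dx^2 + dy^2) = 0.  Condition (1) gives
   m(h, h^2) = h, and m is analytic at (k, k^2), so M - H has zero derivative at
   the umbilic: up to a term with vanishing strict derivative, and up to the sign,
   (A, B, t) = ((b - a) x / 2 + c y / 2, b y, 0), whatever m is.

   In polar coordinates the leaves solve an equation for the angle as a function
   of ln r, Lipschitz uniformly in r, whose limit at r = 0 only depends on
   (a, b, c).  The radial directions of the limit field lie on the real root lines
   of (a - b) x^3 - c x^2 y + (5 b - a) x y^2 + c y^3, whose discriminant is
   - (4/3) Delta_m; at one end of each line the field is radial, at the other one
   it is orthogonal to the line.  If Delta_m > 0 there is one radial end, a saddle.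
   If a/b < 1 there are three, all saddles, separated by orthogonal ends.  If
   Delta_m < 0 and a/b > 1 there are three, in a common half-plane, and the
   outermost ones are saddles; between them the leaves run into the umbilic.

   Around these cores the circles are replaced by star-shaped curves, with corners
   between successive cores, which are transverse to the leaves on both sides of
   a corner.  A leaf of a hyperbolic sector is then determined by the size at
   which it passes the corner, and the hyperbolas of the model are mapped to
   leaves accordingly. *)

Require Import Defs.
From Stdlib Require Import Reals List ZArith Lra Lia Psatz.
From Coquelicot Require Import Coquelicot.
Import ListNotations.
Open Scope R_scope.

(** * Ordinary differential equations *)

(** The direction field is never differentiated away from the umbilic: only the strict derivative of
    its coefficients there is used, which controls differences between two nearby points. Divided by
    the radius it becomes a Lipschitz bound in the angle, uniform in the size, and Picard iteration
    asks for no more. In place of a stable manifold theorem, a separatrix is the monotone limit of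
    leaves that start on the side of a sector at smaller and smaller sizes. With ln r as time a core
    attracts, so the leaves that issue from the origin stay in it: at a saddle the field contracts
    and there is one such leaf; between two saddles, two barriers keep the extreme ones apart,
    whatever happens in the middle. The obstacle is that a leaf of a hyperbolic sector is tangent to
    some circle, where the angle is not a function of the radius; hence the star-shaped curves,
    tilted so that the tangency falls on a corner. The field is frozen above a small size and
    clamped in the angle, so that all solutions exist for all times. The two foliations differ by
    the sign of (a, b, c), that is by a half-turn of the limit field. *)

Lemma is_derive_continuity_pt (u : R -> R) (s l : R) : is_derive u s l -> continuity_pt u s.
Proof.
  intro H. apply continuity_pt_filterlim. apply (ex_derive_continuous u s). now exists l.
Qed.

Lemma is_derive_continuous (u : R -> R) (s l : R) : is_derive u s l -> continuous u s.
Proof. intro H. apply (ex_derive_continuous u s). now exists l. Qed.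

Lemma mvt_le (u du : R -> R) (x y : R) : x <= y ->
  (forall s, x <= s <= y -> is_derive u s (du s)) ->
  exists s, x <= s <= y /\ u y - u x = du s * (y - x).
Proof.
  intros Hxy Hd.
  destruct (MVT_gen u x y du) as [s [Hs He]].
  - intros s Hs. rewrite Rmin_left, Rmax_right in Hs by lra. apply Hd; lra.
  - intros s Hs. rewrite Rmin_left, Rmax_right in Hs by lra.
    apply (is_derive_continuity_pt _ _ (du s)), Hd; lra.
  - rewrite Rmin_left, Rmax_right in Hs by lra. now exists s.
Qed.

Lemma decreasing_of_derive (u du : R -> R) (x y : R) : x <= y ->
  (forall s, x <= s <= y -> is_derive u s (du s)) ->
  (forall s, x <= s <= y -> du s <= 0) -> u y <= u x.
Proof.
  intros Hxy Hd Hn. destruct (mvt_le u du x y Hxy Hd) as [s [Hs He]].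
  specialize (Hn s Hs). nra.
Qed.

Lemma lipschitz_of_derive (u du : R -> R) (B x y : R) :
  (forall s, is_derive u s (du s)) -> (forall s, Rabs (du s) <= B) ->
  Rabs (u x - u y) <= B * Rabs (x - y).
Proof.
  intros Hd HB.
  assert (key : forall x y, x <= y -> Rabs (u x - u y) <= B * Rabs (x - y)).
  { clear x y. intros x y Hxy.
    destruct (mvt_le u du x y Hxy) as [s [Hs He]]; [now intros; apply Hd|].
    rewrite Rabs_minus_sym, He, Rabs_mult, (Rabs_minus_sym x y).
    apply Rmult_le_compat_r; [apply Rabs_pos|apply HB]. }
  destruct (Rle_dec x y) as [H|H]; [now apply key|].
  rewrite Rabs_minus_sym, (Rabs_minus_sym x y). apply key; lra.
Qed.

Lemma lipschitz_continuous (u : R -> R) (B s : R) :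
  (forall x y, Rabs (u x - u y) <= B * Rabs (x - y)) -> continuous u s.
Proof.
  intro HL. apply filterlim_locally. intro eps.
  assert (HB : 0 < Rabs B + 1) by (pose proof (Rabs_pos B); lra).
  assert (Hd : 0 < eps / (Rabs B + 1)) by (apply Rdiv_lt_0_compat; [apply cond_pos|easy]).
  exists (mkposreal _ Hd). intros y Hy. change (Rabs (y - s) < eps / (Rabs B + 1)) in Hy.
  change (Rabs (u y - u s) < eps).
  apply Rle_lt_trans with (1 := HL y s).
  apply Rle_lt_trans with ((Rabs B + 1) * Rabs (y - s)).
  - apply Rmult_le_compat_r; [apply Rabs_pos|]. pose proof (Rle_abs B). lra.
  - apply Rmult_lt_compat_l with (r := Rabs B + 1) in Hy; [|easy].
    replace ((Rabs B + 1) * (eps / (Rabs B + 1))) with (pos eps) in Hy by (field; lra). exact Hy.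
Qed.

Lemma exp_le_compat (x y : R) : x <= y -> exp x <= exp y.
Proof. intros [H| ->]; [left; now apply exp_increasing|apply Rle_refl]. Qed.

(** Errors are measured against the weight [exp (k * Rabs (x - c))] on the whole line instead of on
    a bounded interval; integrating it from [c] costs a factor [/ k]. With [k] twice the Lipschitz
    constant, each Picard step halves the error. *)
Lemma exp_growth_bound (u du : R -> R) (c M k s : R) : 0 < k -> 0 <= M ->
  u c = 0 -> (forall x, is_derive u x (du x)) ->
  (forall x, Rabs (du x) <= M * exp (k * Rabs (x - c))) ->
  Rabs (u s) <= M / k * exp (k * Rabs (s - c)).
Proof.
  intros Hk HM H0 Hd HB.
  assert (HMk : 0 <= M / k) by (apply Rmult_le_pos; [easy|left; now apply Rinv_0_lt_compat]).
  (* [e] is the direction of time and [d] the sign of [u]; the four cases share one monotonicity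
     argument. *)
  assert (key : forall (e d : R), (d = 1 \/ d = -1) -> (e = 1 \/ e = -1) -> 0 <= e * (s - c) ->
    d * u s <= M / k * exp (k * (e * (s - c)))).
  { intros e d Hde He Hs.
    set (v := fun x => d * u (c + e * x) - M / k * exp (k * x)).
    assert (Hv : v (e * (s - c)) <= v 0).
    { apply (decreasing_of_derive v (fun x => d * (e * du (c + e * x)) - M * exp (k * x))); [easy| |].
      - intros x _. unfold v.
        assert (H1 : is_derive (fun x => u (c + e * x)) x (e * du (c + e * x))).
        { apply (is_derive_comp u (fun x => c + e * x)). apply Hd. auto_derive; [easy|ring]. }
        apply (is_derive_minus (fun x => d * u (c + e * x)) (fun x => M / k * exp (k * x))).
        + apply (is_derive_scal (fun x => u (c + e * x)) x d _ H1).
        + auto_derive; [easy|field; lra].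
      - intros x Hx. pose proof (HB (c + e * x)) as H2.
        replace (Rabs (c + e * x - c)) with x in H2.
        2:{ replace (c + e * x - c) with (e * x) by ring. destruct He as [->| ->].
            rewrite Rmult_1_l, Rabs_pos_eq; lra. rewrite Rabs_left1; lra. }
        apply Rabs_le_between in H2.
        destruct Hde as [->| ->], He as [->| ->]; lra. }
    unfold v in Hv. rewrite Rmult_0_r, Rplus_0_r, H0, Rmult_0_r in Hv.
    replace (c + e * (e * (s - c))) with s in Hv by (destruct He as [->| ->]; ring).
    pose proof (exp_pos (k * 0)). assert (0 <= M / k * exp (k * 0)) by (apply Rmult_le_pos; lra).
    lra. }
  assert (exists e, (e = 1 \/ e = -1) /\ e * (s - c) = Rabs (s - c)) as [e [He Hes]].
  { destruct (Rle_dec 0 (s - c)); [exists 1|exists (-1)]; split; auto.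
    rewrite Rabs_pos_eq; lra. rewrite Rabs_left1; lra. }
  assert (Hp : 0 <= e * (s - c)) by (rewrite Hes; apply Rabs_pos).
  rewrite <- Hes. apply Rabs_le.
  pose proof (key e 1 (or_introl eq_refl) He Hp).
  pose proof (key e (-1) (or_intror eq_refl) He Hp). lra.
Qed.

(** The bounds are global in time and space, so that one flow defined on all of R serves every leaf.
    The fields of the cells are extended by constants to meet them. *)
Record lipschitz_field (g : R -> R -> R) (L B : R) : Prop := {
  lf_pos : 0 < L;
  lf_bounded : forall s x, Rabs (g s x) <= B;
  lf_lipschitz : forall s x y, Rabs (g s x - g s y) <= L * Rabs (x - y);
  lf_continuous : forall x s, continuous (fun s => g s x) s }.

Definition solution (g : R -> R -> R) (u : R -> R) : Prop :=
  forall s, is_derive u s (g s (u s)).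

Lemma lf_bound_pos g L B : lipschitz_field g L B -> 0 <= B.
Proof. intro H. apply Rle_trans with (2 := lf_bounded _ _ _ H 0 0), Rabs_pos. Qed.

Lemma lf_continuous_along g L B u s : lipschitz_field g L B -> continuous u s ->
  continuous (fun s => g s (u s)) s.
Proof.
  intros HF Hu. apply filterlim_locally. intro eps.
  pose proof (lf_pos _ _ _ HF) as HL.
  assert (He : 0 < eps / 2) by (pose proof (cond_pos eps); lra).
  assert (He' : 0 < eps / 2 / L) by now apply Rdiv_lt_0_compat.
  pose proof (proj1 (filterlim_locally _ _) (lf_continuous _ _ _ HF (u s) s) (mkposreal _ He)) as H1.
  pose proof (proj1 (filterlim_locally _ _) Hu (mkposreal _ He')) as H2.
  generalize (filter_and _ _ H1 H2). apply filter_imp. intros x [Ha Hb].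
  change (Rabs (g x (u s) - g s (u s)) < eps / 2) in Ha.
  change (Rabs (u x - u s) < eps / 2 / L) in Hb.
  change (Rabs (g x (u x) - g s (u s)) < eps).
  replace (g x (u x) - g s (u s)) with ((g x (u x) - g x (u s)) + (g x (u s) - g s (u s))) by ring.
  apply Rle_lt_trans with (1 := Rabs_triang _ _).
  pose proof (lf_lipschitz _ _ _ HF x (u x) (u s)).
  apply Rmult_lt_compat_l with (r := L) in Hb; [|easy].
  replace (L * (eps / 2 / L)) with (eps / 2) in Hb by (field; lra). lra.
Qed.

Fixpoint picard (g : R -> R -> R) (c x0 : R) (n : nat) (s : R) : R :=
  match n with
  | O => x0
  | S n => x0 + RInt (fun t => g t (picard g c x0 n t)) c s
  end.

Lemma is_derive_primitive (f : R -> R) (c x0 s : R) : (forall t, continuous f t) ->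
  is_derive (fun s => x0 + RInt f c s) s (f s).
Proof.
  intro Hf. replace (f s) with (plus 0 (f s)) by (unfold plus; simpl; ring).
  apply (is_derive_plus (fun _ => x0) (fun s => RInt f c s)); [apply (is_derive_const x0)|].
  apply (is_derive_RInt f (fun s => RInt f c s) c); [|apply Hf].
  apply filter_forall. intro t. apply (RInt_correct f). apply (ex_RInt_continuous f); intros; apply Hf.
Qed.

Lemma picard_continuous g L B c x0 n s : lipschitz_field g L B -> continuous (picard g c x0 n) s.
Proof.
  intro HF. revert s. induction n as [|n IH]; intro s; [apply continuous_const|].
  apply (is_derive_continuous _ _ (g s (picard g c x0 n s))). simpl.
  apply (is_derive_primitive (fun t => g t (picard g c x0 n t))).
  intro t. apply (lf_continuous_along g L B); auto.
Qed.

Lemma picard_derive g L B c x0 n s : lipschitz_field g L B ->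
  is_derive (picard g c x0 (S n)) s (g s (picard g c x0 n s)).
Proof.
  intro HF. simpl. apply (is_derive_primitive (fun t => g t (picard g c x0 n t))).
  intro t. apply (lf_continuous_along g L B); auto. now apply (picard_continuous g L B).
Qed.

Lemma picard_initial g c x0 n : picard g c x0 n c = x0.
Proof. destruct n; simpl; [easy|]. rewrite RInt_point. apply Rplus_0_r. Qed.

Lemma picard_lipschitz g L B c x0 n x y : lipschitz_field g L B ->
  Rabs (picard g c x0 n x - picard g c x0 n y) <= B * Rabs (x - y).
Proof.
  intro HF. destruct n as [|n].
  - simpl. rewrite Rminus_diag, Rabs_R0. apply Rmult_le_pos; [now apply (lf_bound_pos g L B)|apply Rabs_pos].
  - apply (lipschitz_of_derive _ (fun s => g s (picard g c x0 n s))).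
    + intro s. now apply (picard_derive g L B).
    + intro s. apply (lf_bounded _ _ _ HF).
Qed.

Lemma picard_step g L B c x0 n s : lipschitz_field g L B ->
  Rabs (picard g c x0 (S n) s - picard g c x0 n s)
    <= B / (2 * L) * (/ 2) ^ n * exp (2 * L * Rabs (s - c)).
Proof.
  intro HF. pose proof (lf_pos _ _ _ HF) as HL. pose proof (lf_bound_pos _ _ _ HF) as HB.
  assert (HBL : 0 <= B / (2 * L)) by (apply Rmult_le_pos; [easy|left; apply Rinv_0_lt_compat; lra]).
  revert s. induction n as [|n IH]; intro s.
  - apply Rle_trans with (B / (2 * L) * exp (2 * L * Rabs (s - c))); [|right; simpl; ring].
    apply (exp_growth_bound (fun s => picard g c x0 1 s - picard g c x0 0 s) (fun s => g s x0)); try lra.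
    + rewrite !picard_initial; ring.
    + intro x. replace (g x x0) with (minus (g x x0) 0) by (unfold minus, opp, plus; simpl; ring).
      apply (is_derive_minus (picard g c x0 1) (fun _ => x0)); [now apply (picard_derive g L B)|apply (is_derive_const x0)].
    + intro x. apply Rle_trans with B; [apply (lf_bounded _ _ _ HF)|].
      rewrite <- (Rmult_1_r B) at 1. apply Rmult_le_compat_l; [easy|].
      rewrite <- exp_0. apply exp_le_compat. apply Rmult_le_pos; [lra|apply Rabs_pos].
  - apply Rle_trans with (L * (B / (2 * L) * (/ 2) ^ n) / (2 * L) * exp (2 * L * Rabs (s - c))).
    2:{ right. simpl. field. lra. }
    assert (0 <= (/ 2) ^ n) by (apply pow_le; lra).
    apply (exp_growth_bound (fun s => picard g c x0 (S (S n)) s - picard g c x0 (S n) s)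
      (fun s => g s (picard g c x0 (S n) s) - g s (picard g c x0 n s))); try lra.
    + apply Rmult_le_pos; [lra|]. now apply Rmult_le_pos.
    + rewrite !picard_initial; ring.
    + intro x. apply (is_derive_minus (picard g c x0 (S (S n))) (picard g c x0 (S n))); now apply (picard_derive g L B).
    + intro x. apply Rle_trans with (1 := lf_lipschitz _ _ _ HF x _ _).
      rewrite Rmult_assoc. apply Rmult_le_compat_l; [lra|apply IH].
Qed.

Lemma geometric_cauchy (u : nat -> R) (K : R) :
  (forall n, Rabs (u (S n) - u n) <= K * (/ 2) ^ n) ->
  forall n, Rabs (real (Lim_seq u) - u n) <= 2 * K * (/ 2) ^ n.
Proof.
  intro H.
  assert (Htail : forall n p, Rabs (u (n + p)%nat - u n) <= 2 * K * (/ 2) ^ n * (1 - (/ 2) ^ p)).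
  { intros n p. induction p as [|p IH].
    - rewrite Nat.add_0_r, Rminus_diag, Rabs_R0. simpl. lra.
    - replace (n + S p)%nat with (S (n + p)) by lia.
      replace (u (S (n + p)) - u n) with ((u (S (n + p)) - u (n + p)%nat) + (u (n + p)%nat - u n)) by ring.
      apply Rle_trans with (1 := Rabs_triang _ _).
      pose proof (H (n + p)%nat) as H1. rewrite pow_add in H1. simpl. lra. }
  assert (HK : 0 <= K) by (pose proof (H 0%nat) as H0; simpl in H0; pose proof (Rabs_pos (u 1%nat - u 0%nat)); lra).
  assert (Htail' : forall n p, Rabs (u (n + p)%nat - u n) <= 2 * K * (/ 2) ^ n).
  { intros n p. apply Rle_trans with (1 := Htail n p). rewrite <- (Rmult_1_r (2 * K * _)) at 2.
    assert (0 <= (/ 2) ^ n) by (apply pow_le; lra). assert (0 <= (/ 2) ^ p) by (apply pow_le; lra).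
    apply Rmult_le_compat_l; [|lra]. apply Rmult_le_pos; lra. }
  assert (Hex : ex_finite_lim_seq u).
  { apply ex_lim_seq_cauchy_corr. intro eps.
    assert (Hg : is_lim_seq (fun n => 2 * K * (/ 2) ^ n) 0).
    { replace (Finite 0) with (Rbar_mult (2 * K) 0) by (simpl; f_equal; ring).
      apply is_lim_seq_scal_l. apply is_lim_seq_geom. rewrite Rabs_pos_eq; lra. }
    apply is_lim_seq_spec in Hg.
    assert (He : 0 < eps / 2) by (pose proof (cond_pos eps); lra).
    destruct (Hg (mkposreal _ He)) as [N HN]. exists N. intros n m Hn Hm.
    specialize (HN N (le_n N)). simpl in HN. rewrite Rminus_0_r in HN. apply Rabs_def2 in HN.
    pose proof (Htail' N (n - N)%nat) as H1. pose proof (Htail' N (m - N)%nat) as H2.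
    replace (N + (n - N))%nat with n in H1 by lia. replace (N + (m - N))%nat with m in H2 by lia.
    replace (u n - u m) with ((u n - u N) + - (u m - u N)) by ring.
    apply Rle_lt_trans with (1 := Rabs_triang _ _). rewrite Rabs_Ropp. lra. }
  destruct Hex as [l Hl]. rewrite (is_lim_seq_unique _ _ Hl). simpl real. intro n.
  assert (Hn : is_lim_seq (fun p => Rabs (u (p + n)%nat - u n)) (Rabs (l - u n))).
  { apply (is_lim_seq_abs _ (l - u n)). apply is_lim_seq_minus'; [|apply is_lim_seq_const].
    now apply (is_lim_seq_incr_n u n). }
  apply (is_lim_seq_le _ (fun _ => 2 * K * (/ 2) ^ n) _ (2 * K * (/ 2) ^ n)) in Hn; [exact Hn| |apply is_lim_seq_const].
  intro p. rewrite Nat.add_comm. apply Htail'.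
Qed.

Definition flow (g : R -> R -> R) (c x0 s : R) : R := real (Lim_seq (fun n => picard g c x0 n s)).

Lemma flow_spec g L B c x0 : lipschitz_field g L B ->
  solution g (flow g c x0) /\ flow g c x0 c = x0.
Proof.
  intro HF. pose proof (lf_pos _ _ _ HF) as HL. pose proof (lf_bound_pos _ _ _ HF) as HB.
  set (K := fun s => B / (2 * L) * exp (2 * L * Rabs (s - c))).
  set (u := flow g c x0).
  assert (Hu : forall s n, Rabs (u s - picard g c x0 n s) <= 2 * K s * (/ 2) ^ n).
  { intro s. apply geometric_cauchy. intro n. apply Rle_trans with (1 := picard_step g L B c x0 n s HF).
    unfold K. right; ring. }
  assert (Hz : forall a K, (forall n, Rabs a <= K * (/ 2) ^ n) -> a = 0).
  { intros a K0 H. assert (Hg : is_lim_seq (fun n => K0 * (/ 2) ^ n) 0).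
    { replace (Finite 0) with (Rbar_mult K0 0) by (simpl; f_equal; ring).
      apply is_lim_seq_scal_l. apply is_lim_seq_geom. rewrite Rabs_pos_eq; lra. }
    assert (Rbar_le (Rabs a) 0) as H0.
    { apply (is_lim_seq_le (fun _ => Rabs a) (fun n => K0 * (/ 2) ^ n)); auto. apply is_lim_seq_const. }
    simpl in H0. pose proof (Rabs_pos a). destruct (Req_dec a 0) as [|Ha]; [easy|].
    apply Rabs_pos_lt in Ha. lra. }
  (* The limit inherits the constant [B] of the iterates; its continuity is needed before it can be
     put under the integral. *)
  assert (Hlip : forall x y, Rabs (u x - u y) <= B * Rabs (x - y)).
  { intros x y. apply le_epsilon. intros eps Heps.
    assert (Hg : is_lim_seq (fun n => 2 * K x * (/ 2) ^ n + 2 * K y * (/ 2) ^ n) (0 + 0)).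
    { apply is_lim_seq_plus'; [replace (Finite 0) with (Rbar_mult (2 * K x) 0) by (simpl; f_equal; ring)
        |replace (Finite 0) with (Rbar_mult (2 * K y) 0) by (simpl; f_equal; ring)];
        apply is_lim_seq_scal_l; apply is_lim_seq_geom; rewrite Rabs_pos_eq; lra. }
    apply is_lim_seq_spec in Hg. destruct (Hg (mkposreal _ Heps)) as [n Hn].
    specialize (Hn n (le_n n)). simpl in Hn. apply Rabs_def2 in Hn.
    pose proof (Hu x n) as H1. pose proof (Hu y n) as H2. pose proof (picard_lipschitz g L B c x0 n x y HF) as H3.
    replace (u x - u y) with ((u x - picard g c x0 n x) + (picard g c x0 n x - picard g c x0 n y)
      + - (u y - picard g c x0 n y)) by ring.
    apply Rle_trans with (1 := Rabs_triang _ _). rewrite Rabs_Ropp.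
    apply Rle_trans with (1 := Rplus_le_compat_r _ _ _ (Rabs_triang _ _)). lra. }
  assert (Hcu : forall t, continuous (fun t => g t (u t)) t).
  { intro t. apply (lf_continuous_along g L B); [easy|]. now apply (lipschitz_continuous u B). }
  assert (HE : forall s, u s = x0 + RInt (fun t => g t (u t)) c s).
  { intro s. apply Rminus_diag_uniq. apply (Hz _ (2 * K s)). intro n.
    replace (u s - (x0 + RInt (fun t => g t (u t)) c s)) with
      ((u s - picard g c x0 (S n) s) + - ((x0 + RInt (fun t => g t (u t)) c s) - picard g c x0 (S n) s)) by ring.
    apply Rle_trans with (1 := Rabs_triang _ _). rewrite Rabs_Ropp.
    (* The weighted bound once more: the integral of the limit is as close to the next iterate as
       the limit is to the present one, up to a factor [/ 2]. *)
    assert (H2 : Rabs ((x0 + RInt (fun t => g t (u t)) c s) - picard g c x0 (S n) s) <=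
      L * (2 * (B / (2 * L)) * (/ 2) ^ n) / (2 * L) * exp (2 * L * Rabs (s - c))).
    { assert (0 <= B / (2 * L)) by (apply Rmult_le_pos; [easy|left; apply Rinv_0_lt_compat; lra]).
      assert (0 <= (/ 2) ^ n) by (apply pow_le; lra).
      apply (exp_growth_bound (fun s => (x0 + RInt (fun t => g t (u t)) c s) - picard g c x0 (S n) s)
        (fun s => g s (u s) - g s (picard g c x0 n s))); try lra.
      - apply Rmult_le_pos; [lra|]. apply Rmult_le_pos; lra.
      - rewrite picard_initial, RInt_point. unfold zero; simpl. ring.
      - intro x. apply (is_derive_minus (fun s => x0 + RInt (fun t => g t (u t)) c s) (picard g c x0 (S n))).
        + now apply (is_derive_primitive (fun t => g t (u t))).
        + now apply (picard_derive g L B).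
      - intro x. apply Rle_trans with (1 := lf_lipschitz _ _ _ HF x _ _).
        rewrite Rmult_assoc. apply Rmult_le_compat_l; [lra|].
        apply Rle_trans with (1 := Hu x n). unfold K. right; ring. }
    pose proof (Hu s (S n)) as H1. simpl pow in H1.
    apply Rle_trans with (1 := Rplus_le_compat _ _ _ _ H1 H2). unfold K. right. field. lra. }
  split.
  - intro s. apply (is_derive_ext (fun s => x0 + RInt (fun t => g t (u t)) c s)); [intro; symmetry; apply HE|].
    now apply (is_derive_primitive (fun t => g t (u t))).
  - rewrite HE, RInt_point. apply Rplus_0_r.
Qed.

Lemma solution_lipschitz g L B u x y : lipschitz_field g L B -> solution g u ->
  Rabs (u x - u y) <= B * Rabs (x - y).
Proof.
  intros HF Hu. apply (lipschitz_of_derive _ (fun s => g s (u s))); [apply Hu|].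
  intro; apply (lf_bounded _ _ _ HF).
Qed.

Lemma solution_gronwall g L B u v c s : lipschitz_field g L B -> solution g u -> solution g v ->
  Rabs (u s - v s) <= Rabs (u c - v c) * exp (L * Rabs (s - c)).
Proof.
  intros HF Hu Hv. pose proof (lf_pos _ _ _ HF) as HL.
  assert (key : forall e, (e = 1 \/ e = -1) -> 0 <= e * (s - c) ->
     (u s - v s) ^ 2 <= (u c - v c) ^ 2 * exp (L * (e * (s - c))) ^ 2).
  { intros e He Hs.
    (* The square is differentiable where the two solutions meet, unlike the absolute value; the
       exponential factor makes it nonincreasing in the direction [e]. *)
    set (h := fun x => (u (c + e * x) - v (c + e * x)) ^ 2 * exp (- 2 * L * x)).
    assert (Hh : h (e * (s - c)) <= h 0).
    { apply (decreasing_of_derive h (fun x => let p := c + e * x in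
         (2 * (u p - v p) * (e * (g p (u p) - g p (v p))) - 2 * L * (u p - v p) ^ 2) * exp (- 2 * L * x))); [easy| |].
      - intros x _. unfold h. cbv zeta. set (p := c + e * x).
        assert (H1 : is_derive (fun x => u (c + e * x) - v (c + e * x)) x (e * (g p (u p) - g p (v p)))).
        { apply (is_derive_comp (fun y => u y - v y) (fun x => c + e * x)); [|auto_derive; [easy|ring]].
          apply (is_derive_minus u v); [apply Hu|apply Hv]. }
        assert (H2 : is_derive (fun x => exp (- 2 * L * x)) x (- 2 * L * exp (- 2 * L * x))) by (auto_derive; [easy|ring]).
        pose proof (is_derive_pow _ 2 _ _ H1) as H3. 
        pose proof (is_derive_mult _ _ _ _ _ H3 H2 Rmult_comm) as H4.
        simpl in H4. unfold plus, mult in H4; simpl in H4.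
        evar_last; [exact H4|]. fold p. simpl. ring.
      - intros x _. cbv zeta. set (p := c + e * x).
        pose proof (exp_pos (- 2 * L * x)). pose proof (lf_lipschitz _ _ _ HF p (u p) (v p)) as H1.
        assert ((u p - v p) * (e * (g p (u p) - g p (v p))) <= L * (u p - v p) ^ 2).
        { apply Rle_trans with (1 := Rle_abs _). rewrite !Rabs_mult.
          replace (Rabs e) with 1 by (destruct He as [->| ->]; [rewrite Rabs_R1|rewrite Rabs_left1]; lra).
          rewrite <- (pow2_abs (u p - v p)). pose proof (Rabs_pos (u p - v p)). nra. }
        nra. }
    unfold h in Hh. rewrite !Rmult_0_r, Rplus_0_r, exp_0, Rmult_1_r in Hh.
    replace (c + e * (e * (s - c))) with s in Hh by (destruct He as [->| ->]; ring).
    set (y := e * (s - c)) in *.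
    assert (HE : exp (-2 * L * y) * exp (L * y) ^ 2 = 1).
    { simpl. rewrite Rmult_1_r, <- !exp_plus. rewrite <- exp_0. f_equal. ring. }
    pose proof (exp_pos (L * y)) as Hy.
    apply Rmult_le_compat_r with (r := exp (L * y) ^ 2) in Hh; [|nra].
    rewrite Rmult_assoc, HE in Hh. lra. }
  assert (exists e, (e = 1 \/ e = -1) /\ e * (s - c) = Rabs (s - c)) as [e [He Hes]].
  { destruct (Rle_dec 0 (s - c)); [exists 1|exists (-1)]; split; auto.
    rewrite Rabs_pos_eq; lra. rewrite Rabs_left1; lra. }
  specialize (key e He ltac:(rewrite Hes; apply Rabs_pos)). rewrite Hes in key.
  pose proof (exp_pos (L * Rabs (s - c))).
  apply Rsqr_incr_0_var; [|apply Rmult_le_pos; [apply Rabs_pos|lra]].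
  rewrite Rsqr_mult, <- !Rsqr_abs, !Rsqr_pow2. exact key.
Qed.

Lemma solution_unique g L B u v c s : lipschitz_field g L B -> solution g u -> solution g v ->
  u c = v c -> u s = v s.
Proof.
  intros HF Hu Hv He. pose proof (solution_gronwall g L B u v c s HF Hu Hv) as H.
  rewrite He, Rminus_diag, Rabs_R0, Rmult_0_l in H.
  apply Rminus_diag_uniq. destruct (Req_dec (u s - v s) 0) as [|Hn]; [easy|].
  apply Rabs_pos_lt in Hn. lra.
Qed.

Lemma solution_order g L B u v c s : lipschitz_field g L B -> solution g u -> solution g v ->
  u c < v c -> u s < v s.
Proof.
  intros HF Hu Hv Hc. apply Rnot_le_lt. intro Hs.
  destruct (IVT_gen (fun x => u x - v x) c s 0) as [t [_ Ht]].
  - intro x. apply continuity_pt_minus; eapply is_derive_continuity_pt; [apply Hu|apply Hv].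
  - split; [apply Rle_trans with (1 := Rmin_l _ _); lra|apply Rle_trans with (2 := Rmax_r _ _); lra].
  - pose proof (solution_unique g L B u v t c HF Hu Hv ltac:(lra)). lra.
Qed.

Lemma solution_order_le g L B u v c s : lipschitz_field g L B -> solution g u -> solution g v ->
  u c <= v c -> u s <= v s.
Proof.
  intros HF Hu Hv [Hc|Hc]; [left; now apply (solution_order g L B u v c)|right; now apply (solution_unique g L B u v c)].
Qed.

(** * Separatrices of an attracting field *)

Lemma Rlt_minus_pos x y : x < y -> 0 < y - x.
Proof. lra. Qed.

(** Taken at the supremum of the times where [u <= y]. Barrier arguments then concern only the final
    stretch, on which the solution is strictly beyond the barrier. *)
Lemma last_crossing (u : R -> R) (a b y : R) : (forall s, continuous u s) -> a <= b ->
  u a <= y < u b -> exists s, a <= s < b /\ u s = y /\ forall t, s < t <= b -> y < u t.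
Proof.
  intros Hc Hab [Ha Hb].
  destruct (completeness (fun s => a <= s <= b /\ u s <= y)) as [s [Hs1 Hs2]].
  { exists b. intros s Hs. apply Hs. }
  { exists a. split; lra. }
  assert (Hsa : a <= s) by (apply Hs1; lra).
  assert (Hsb : s <= b) by (apply Hs2; intros t Ht; lra).
  assert (Haft : forall t, s < t <= b -> y < u t).
  { intros t Ht. apply Rnot_le_lt. intro H. assert (t <= s) by (apply Hs1; lra). lra. }
  assert (Hle : u s <= y).
  { apply Rnot_lt_le. intro H.
    destruct (proj1 (filterlim_locally _ _) (Hc s) (mkposreal _ (Rlt_minus_pos _ _ H))) as [d Hd].
    assert (s <= s - d).
    { apply Hs2. intros t Ht. apply Rnot_lt_le. intro Ht'.
      assert (t <= s) by (now apply Hs1).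
      specialize (Hd t). change (Rabs (t - s) < d -> Rabs (u t - u s) < u s - y) in Hd.
      rewrite (Rabs_left1 (t - s)) in Hd by lra. specialize (Hd ltac:(lra)). apply Rabs_def2 in Hd. lra. }
    pose proof (cond_pos d). lra. }
  assert (Hsb' : s < b) by (destruct Hsb as [| ->]; lra).
  exists s. split; [lra|split; [|easy]].
  apply Rle_antisym; [easy|]. apply Rnot_lt_le. intro H.
  destruct (proj1 (filterlim_locally _ _) (Hc s) (mkposreal _ (Rlt_minus_pos _ _ H))) as [d Hd].
  pose proof (cond_pos d) as Hdp.
  set (t := Rmin b (s + d / 2)).
  assert (s < t <= b) by (unfold t; split; [apply Rmin_glb_lt; lra|apply Rmin_l]).
  assert (t <= s + d / 2) by apply Rmin_r.
  specialize (Hd t). change (Rabs (t - s) < d -> Rabs (u t - u s) < y - u s) in Hd.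
  rewrite (Rabs_pos_eq (t - s)) in Hd by lra. specialize (Hd ltac:(lra)). apply Rabs_def2 in Hd.
  pose proof (Haft t ltac:(lra)). lra.
Qed.

Lemma solution_continuous g u s : solution g u -> continuous u s.
Proof. intro H. apply (is_derive_continuous _ _ _ (H s)). Qed.

(** Right after a last crossing of [y] the difference quotients would be positive, against the
    negative derivative there. *)
Lemma barrier (g : R -> R -> R) (u : R -> R) (y a b : R) : solution g u ->
  (forall s, g s y < 0) -> a <= b -> u a <= y -> u b <= y.
Proof.
  intros Hu Hg Hab Ha. apply Rnot_lt_le. intro Hb.
  destruct (last_crossing u a b y (fun s => solution_continuous g u s Hu) Hab ltac:(lra)) as [s [Hs [Hy Haft]]].
  pose proof (Hu s) as Hd. rewrite Hy in Hd. pose proof (Hg s) as Hn.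
  apply is_derive_Reals in Hd.
  destruct (Hd (- g s y) ltac:(lra)) as [d Hd']. pose proof (cond_pos d) as Hdp.
  set (h := Rmin (d / 2) (b - s)).
  assert (0 < h) by (apply Rmin_glb_lt; lra).
  assert (h <= d / 2) by apply Rmin_l. assert (h <= b - s) by apply Rmin_r.
  specialize (Hd' h ltac:(lra)). rewrite Rabs_pos_eq in Hd' by lra. specialize (Hd' ltac:(lra)).
  apply Rabs_def2 in Hd'. specialize (Haft (s + h) ltac:(lra)).
  assert (0 < (u (s + h) - u s) / h) by (apply Rdiv_lt_0_compat; lra). lra.
Qed.

(** As long as the solution is above [q] it loses at least [m] per unit of time. If it ends above
    [q], the stretch since its last visit to [q], or since [a], gives the bound. *)
Lemma descend (g : R -> R -> R) (u : R -> R) (q m a b : R) : solution g u -> 0 < m ->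
  (forall s x, q <= x -> g s x <= - m) -> a <= b -> u b <= Rmax q (u a - m * (b - a)).
Proof.
  intros Hu Hm Hg Hab. apply Rnot_lt_le. intro H.
  assert (H1 : q < u b) by (apply Rle_lt_trans with (2 := H), Rmax_l).
  assert (H2 : u a - m * (b - a) < u b) by (apply Rle_lt_trans with (2 := H), Rmax_r).
  assert (Hex : exists s, a <= s <= b /\ (forall t, s <= t <= b -> q <= u t) /\ u s - m * (b - s) < u b).
  { destruct (Rle_dec (u a) q) as [Hq|Hq].
    - destruct (last_crossing u a b q (fun s => solution_continuous g u s Hu) Hab ltac:(lra)) as [s [Hs [Hy Haft]]].
      exists s. split; [lra|split].
      + intros t [[Ht| <-] Ht']; [left; now apply Haft|lra].
      + assert (0 <= m * (b - s)) by (apply Rmult_le_pos; lra). lra.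
    - destruct (Classical_Prop.classic (exists t, a <= t <= b /\ u t <= q)) as [[t [Ht Htq]]|Hn].
      + destruct (last_crossing u t b q (fun s => solution_continuous g u s Hu) ltac:(lra) ltac:(lra)) as [s [Hs [Hy Haft]]].
        exists s. split; [lra|split].
        * intros t' [[Ht'| <-] Ht'']; [left; now apply Haft|lra].
        * assert (0 <= m * (b - s)) by (apply Rmult_le_pos; lra). lra.
      + exists a. split; [lra|split; [|easy]]. intros t Ht. apply Rnot_lt_le. intro. apply Hn. exists t. lra. }
  destruct Hex as [s [Hs [Hq Hlt]]].
  destruct (mvt_le u (fun t => g t (u t)) s b ltac:(lra)) as [t [Ht He]]; [intros; apply Hu|].
  pose proof (Hg t (u t) (Hq t Ht)). nra.
Qed.

(** The conjugate of the field by [x -> - x]. It exchanges the two sides of an attracting interval,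
    so that only one side has to be studied. *)
Definition reflect_field (g : R -> R -> R) (s x : R) : R := - g s (- x).

Lemma reflect_lipschitz_field g L B : lipschitz_field g L B -> lipschitz_field (reflect_field g) L B.
Proof.
  intros [H1 H2 H3 H4]. unfold reflect_field. split; auto.
  - intros s x. rewrite Rabs_Ropp. apply H2.
  - intros s x y. replace (- g s (- x) - - g s (- y)) with (- (g s (- x) - g s (- y))) by ring.
    rewrite Rabs_Ropp. apply Rle_trans with (1 := H3 _ _ _). right. f_equal.
    replace (- x - - y) with (- (x - y)) by ring. apply Rabs_Ropp.
  - intros x s. apply (continuous_opp (fun s => g s (- x))). apply H4.
Qed.

Lemma reflect_solution g u : solution (reflect_field g) u -> solution g (fun s => - u s).
Proof.
  intros H s. pose proof (is_derive_opp _ _ _ (H s)) as H1.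
  evar_last; [exact H1|]. unfold reflect_field, opp; simpl. ring.
Qed.

(* The separatrix: the limit as [c] tends to minus infinity of the solutions
   leaving [hi] at time [c]. *)
Definition edge (g : R -> R -> R) (hi s : R) : R :=
  real (Glb_Rbar (fun y => exists c, c <= s /\ y = flow g c hi s)).

(** Outside [[p, q]] the field points towards this interval with speed at least [m]. Only the upper
    side carries a starting height [hi]; the lower side is obtained from the reflected field. *)
Record attracted (g : R -> R -> R) (L B p q hi m : R) : Prop := {
  at_field : lipschitz_field g L B;
  at_pos : 0 < m;
  at_order : p <= q < hi;
  at_above : forall s x, q <= x -> g s x <= - m;
  at_below : forall s x, x <= p -> m <= g s x }.

Lemma attracted_ge g L B p q hi m u a b : attracted g L B p q hi m -> solution g u ->
  a <= b -> p <= u a -> p <= u b.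
Proof.
  intros HA Hu Hab Ha.
  pose proof (descend (reflect_field g) (fun s => - u s) (- p) m a b) as H.
  destruct HA as [_ Hm _ _ Hb].
  assert (Hs : solution (reflect_field g) (fun s => - u s)).
  { intro s. unfold reflect_field. rewrite Ropp_involutive. apply (is_derive_opp u). apply Hu. }
  specialize (H Hs Hm).
  assert (- u b <= Rmax (- p) (- u a - m * (b - a))).
  { apply H; [|easy]. intros s x Hx. unfold reflect_field. specialize (Hb s (- x)). lra. }
  assert (0 <= m * (b - a)) by (apply Rmult_le_pos; lra).
  rewrite Rmax_left in H0; lra.
Qed.

Section Attracted.
Context (g : R -> R -> R) (L B p q hi m : R) (HA : attracted g L B p q hi m).

Let HF : lipschitz_field g L B := at_field _ _ _ _ _ _ _ HA.

Lemma flow_sol c x0 : solution g (flow g c x0).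
Proof. apply (flow_spec g L B c x0 HF). Qed.

Lemma flow_init c x0 : flow g c x0 c = x0.
Proof. apply (flow_spec g L B c x0 HF). Qed.

Lemma flow_below c s : c < s -> flow g c hi s < hi.
Proof.
  intro Hcs. pose proof (at_pos _ _ _ _ _ _ _ HA) as Hm. pose proof (at_order _ _ _ _ _ _ _ HA) as Ho. pose proof (at_above _ _ _ _ _ _ _ HA) as Ha.
  apply Rle_lt_trans with (1 := descend g (flow g c hi) q m c s (flow_sol c hi) Hm Ha (Rlt_le _ _ Hcs)).
  rewrite flow_init. apply Rmax_lub_lt; [lra|]. assert (0 < m * (s - c)) by (apply Rmult_lt_0_compat; lra). lra.
Qed.

Lemma flow_above c s : c <= s -> p <= flow g c hi s.
Proof.
  intro Hcs. apply (attracted_ge g L B p q hi m _ c s HA); [apply flow_sol|easy|].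
  rewrite flow_init. pose proof (at_order _ _ _ _ _ _ _ HA). lra.
Qed.

(** At the later starting time the earlier solution has already dropped below [hi], and solutions do
    not cross. Hence the limit for [c] tending to minus infinity is monotone and may be taken as an
    infimum. *)
Lemma flow_mono c c' s : c < c' -> flow g c hi s < flow g c' hi s.
Proof.
  intros Hc. apply (solution_order g L B _ _ c' s HF); [apply flow_sol|apply flow_sol|].
  rewrite flow_init. now apply flow_below.
Qed.

Lemma edge_glb s : is_glb_Rbar (fun y => exists c, c <= s /\ y = flow g c hi s) (edge g hi s).
Proof.
  unfold edge. set (E := fun y => _).
  pose proof (Glb_Rbar_correct E) as H.
  assert (Hf : is_finite (Glb_Rbar E)).
  { destruct H as [H1 H2].
    assert (Hl : Rbar_le p (Glb_Rbar E)).
    { apply H2. intros y [c [Hc ->]]. simpl. now apply flow_above. }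
    assert (Hu : Rbar_le (Glb_Rbar E) (flow g s hi s)) by (apply H1; exists s; split; [lra|easy]).
    destruct (Glb_Rbar E); simpl in *; easy. }
  rewrite Hf. exact H.
Qed.

Lemma edge_lt c s : c <= s -> edge g hi s < flow g c hi s.
Proof.
  intro Hc. destruct (edge_glb s) as [H1 _].
  apply Rle_lt_trans with (flow g (c - 1) hi s).
  - apply H1. exists (c - 1). split; [lra|easy].
  - apply flow_mono; lra.
Qed.

Lemma edge_approx s eps : 0 < eps ->
  exists c0, c0 <= s /\ forall c, c <= c0 -> Rabs (flow g c hi s - edge g hi s) < eps.
Proof.
  intro Heps. destruct (edge_glb s) as [H1 H2].
  destruct (Classical_Prop.classic (exists c, c <= s /\ flow g c hi s < edge g hi s + eps)) as [[c0 [Hc Hlt]]|Hn].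
  - exists c0. split; [easy|]. intros c Hcc.
    assert (flow g c hi s <= flow g c0 hi s) by (destruct Hcc as [Hcc| ->]; [left; now apply flow_mono|lra]).
    pose proof (edge_lt c s ltac:(lra)). apply Rabs_def1; lra.
  - exfalso. assert (Hl : Rbar_le (edge g hi s + eps) (edge g hi s)).
    { apply H2. intros y [c [Hc ->]]. simpl. apply Rnot_lt_le. intro. apply Hn. now exists c. }
    simpl in Hl. lra.
Qed.

(** A flow started early enough is close to [edge] both at [s0] and at [s], and Gronwall's bound
    over the fixed time from [s0] to [s] compares it with the flow through [edge g hi s0]. In this
    way the infimum is itself a solution. *)
Lemma edge_flow s0 s : edge g hi s = flow g s0 (edge g hi s0) s.
Proof.
  apply Rminus_diag_uniq. apply Rabs_eq_0, Rle_antisym; [|apply Rabs_pos]. apply le_epsilon. intros eps Heps.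
  set (K := exp (L * Rabs (s - s0))). assert (HK : 0 < K) by apply exp_pos.
  assert (He1 : 0 < eps / 2) by lra.
  assert (He2 : 0 < eps / 2 / K) by (apply Rdiv_lt_0_compat; lra).
  destruct (edge_approx s _ He1) as [c1 [_ Hc1]]. destruct (edge_approx s0 _ He2) as [c2 [_ Hc2]].
  set (c := Rmin c1 c2). specialize (Hc1 c (Rmin_l _ _)). specialize (Hc2 c (Rmin_r _ _)).
  pose proof (solution_gronwall g L B _ _ s0 s HF (flow_sol c hi) (flow_sol s0 (edge g hi s0))) as H.
  rewrite flow_init in H. fold K in H.
  replace (edge g hi s - flow g s0 (edge g hi s0) s) with
    (- (flow g c hi s - edge g hi s) + (flow g c hi s - flow g s0 (edge g hi s0) s)) by ring.
  apply Rle_trans with (1 := Rabs_triang _ _). rewrite Rabs_Ropp.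
  apply Rmult_lt_compat_r with (r := K) in Hc2; [|easy].
  replace (eps / 2 / K * K) with (eps / 2) in Hc2 by (field; lra). lra.
Qed.

Lemma edge_solution : solution g (edge g hi).
Proof.
  intro s. apply (is_derive_ext (flow g s (edge g hi s))).
  - intro t. symmetry. apply edge_flow.
  - pose proof (flow_sol s (edge g hi s) s) as H. rewrite flow_init in H. exact H.
Qed.

Lemma edge_bounds s : p <= edge g hi s <= q.
Proof.
  split.
  - destruct (edge_glb s) as [_ H2].
    assert (Hl : Rbar_le p (edge g hi s)); [|exact Hl].
    apply H2. intros y [c [Hc ->]]. simpl. now apply flow_above.
  - pose proof (at_pos _ _ _ _ _ _ _ HA) as Hm. pose proof (at_order _ _ _ _ _ _ _ HA) as Ho. pose proof (at_above _ _ _ _ _ _ _ HA) as Ha.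
    (* Started this early and falling at speed [m], the solution has covered the distance from [hi]
       to [q] by time [s]. *)
    set (c := s - (hi - q) / m).
    assert (Hmc : m * (s - c) = hi - q) by (unfold c; field; lra).
    assert (c <= s) by (unfold c; assert (0 < (hi - q) / m) by (apply Rdiv_lt_0_compat; lra); lra).
    apply Rle_trans with (1 := Rlt_le _ _ (edge_lt c s H)).
    apply Rle_trans with (1 := descend g (flow g c hi) q m c s (flow_sol c hi) Hm Ha H).
    rewrite flow_init, Hmc. apply Rmax_lub; lra.
Qed.

(* Leaves are indexed by the size [C] at which they leave [hi]; [C = 0] stands
   for the separatrix. *)
Definition right_leaf (C r : R) : R :=
  if Rlt_dec 0 C then flow g (ln C) hi (ln r) else edge g hi (ln r).

Lemma right_leaf_pos C R : 0 < C -> right_leaf C R = flow g (ln C) hi (ln R).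
Proof. intro H. unfold right_leaf. destruct (Rlt_dec 0 C); [easy|lra]. Qed.

Lemma right_leaf_0 R : right_leaf 0 R = edge g hi (ln R).
Proof. unfold right_leaf. destruct (Rlt_dec 0 0); [lra|easy]. Qed.

Lemma right_leaf_diag R : 0 < R -> right_leaf R R = hi.
Proof. intro H. rewrite right_leaf_pos by easy. apply flow_init. Qed.

Lemma ln_le_compat x y : 0 < x -> x <= y -> ln x <= ln y.
Proof. intros H [H1| ->]; [left; now apply ln_increasing|lra]. Qed.

Lemma right_leaf_mono C C' R : 0 <= C < C' -> C' <= R -> right_leaf C R < right_leaf C' R.
Proof.
  intros [[HC| <-] HC'] HR.
  - rewrite !right_leaf_pos by lra. apply flow_mono. apply ln_increasing; lra.
  - rewrite right_leaf_0, right_leaf_pos by lra. apply edge_lt. apply ln_le_compat; lra.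
Qed.

Lemma right_leaf_bounds C R : 0 <= C <= R -> 0 < R -> p <= right_leaf C R <= hi.
Proof.
  intros HC HR. split.
  - destruct (proj1 HC) as [H| <-].
    + rewrite right_leaf_pos by lra. apply flow_above. apply ln_le_compat; lra.
    + rewrite right_leaf_0. apply edge_bounds.
  - rewrite <- (right_leaf_diag R HR). destruct (proj2 HC) as [H| ->]; [|lra].
    left. apply right_leaf_mono; lra.
Qed.

Lemma flow_start_lipschitz c c' s :
  Rabs (flow g c hi s - flow g c' hi s) <= B * Rabs (c - c') * exp (L * Rabs (s - c)).
Proof.
  apply Rle_trans with (1 := solution_gronwall g L B _ _ c s HF (flow_sol c hi) (flow_sol c' hi)).
  apply Rmult_le_compat_r; [left; apply exp_pos|].
  rewrite flow_init. rewrite <- (flow_init c' hi) at 1. rewrite (Rabs_minus_sym c c').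
  apply (solution_lipschitz g L B _ _ _ HF). apply flow_sol.
Qed.

Lemma continuous_eps (f : R -> R) (x : R) : continuous f x -> forall eps, 0 < eps ->
  exists d, 0 < d /\ forall y, Rabs (y - x) < d -> Rabs (f y - f x) < eps.
Proof.
  intros H eps He. destruct (proj1 (filterlim_locally _ _) H (mkposreal _ He)) as [d Hd].
  exists d. split; [apply cond_pos|]. intros y Hy. apply (Hd y Hy).
Qed.

Lemma continuous_ln x : 0 < x -> continuous ln x.
Proof. intro H. apply (is_derive_continuous _ _ (/ x)). apply is_derive_Reals. now apply derivable_pt_lim_ln. Qed.

(** Joint continuity must hold down to [C = 0], where [ln C] is lost. For [C0 > 0] the starting time
    varies continuously and Gronwall's bound transports it; for [C0 = 0] all small [C] are handled
    together by the convergence to [edge]. *)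
Lemma right_leaf_continuous C0 R0 : 0 <= C0 <= R0 -> 0 < R0 -> forall eps, 0 < eps ->
  exists d, 0 < d /\ forall C R, 0 <= C <= R -> Rabs (C - C0) < d -> Rabs (R - R0) < d ->
    Rabs (right_leaf C R - right_leaf C0 R0) < eps.
Proof.
  intros HC0 HR0 eps Heps. pose proof (lf_pos _ _ _ HF) as HL. pose proof (lf_bound_pos _ _ _ HF) as HB.
  assert (Hs : exists d, 0 < d <= R0 / 2 /\ forall R u, solution g u -> Rabs (R - R0) < d ->
    Rabs (u (ln R) - u (ln R0)) < eps / 2).
  { destruct (continuous_eps ln R0 (continuous_ln R0 HR0) (eps / 2 / (B + 1))) as [d [Hd Hd']].
    { apply Rdiv_lt_0_compat; lra. }
    exists (Rmin d (R0 / 2)). split; [split; [apply Rmin_glb_lt; lra|apply Rmin_r]|]. intros R u Hu HR.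
    pose proof (Rmin_l d (R0 / 2)). specialize (Hd' R ltac:(lra)).
    apply Rle_lt_trans with (1 := solution_lipschitz g L B u _ _ HF Hu).
    apply Rle_lt_trans with ((B + 1) * Rabs (ln R - ln R0)).
    - apply Rmult_le_compat_r; [apply Rabs_pos|lra].
    - apply Rmult_lt_compat_l with (r := B + 1) in Hd'; [|lra].
      replace ((B + 1) * (eps / 2 / (B + 1))) with (eps / 2) in Hd' by (field; lra). easy. }
  destruct Hs as [d1 [Hd1 Hs]].
  destruct (proj1 HC0) as [HC|HC].
  (* The starting time moves by at most 1, which bounds the Gronwall factor uniformly in [C]. *)
  - set (K := (B + 1) * exp (L * (Rabs (ln R0 - ln C0) + 1))).
    assert (HK : 0 < K) by (apply Rmult_lt_0_compat; [lra|apply exp_pos]).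
    destruct (continuous_eps ln C0 (continuous_ln C0 HC) (Rmin 1 (eps / 2 / K))) as [d2 [Hd2 Hd2']].
    { apply Rmin_glb_lt; [lra|]. apply Rdiv_lt_0_compat; lra. }
    exists (Rmin d1 (Rmin d2 C0)). split; [repeat apply Rmin_glb_lt; lra|].
    intros C R HCR HdC HdR.
    pose proof (Rmin_l d1 (Rmin d2 C0)). pose proof (Rmin_r d1 (Rmin d2 C0)).
    pose proof (Rmin_l d2 C0). pose proof (Rmin_r d2 C0).
    assert (0 < C) by (assert (Hx : Rabs (C - C0) < C0) by lra; apply Rabs_def2 in Hx; lra).
    rewrite !right_leaf_pos by lra.
    specialize (Hd2' C ltac:(lra)).
    specialize (Hs R _ (flow_sol (ln C) hi) ltac:(lra)).
    replace (flow g (ln C) hi (ln R) - flow g (ln C0) hi (ln R0)) with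
      ((flow g (ln C) hi (ln R) - flow g (ln C) hi (ln R0)) + (flow g (ln C) hi (ln R0) - flow g (ln C0) hi (ln R0))) by ring.
    apply Rle_lt_trans with (1 := Rabs_triang _ _).
    pose proof (flow_start_lipschitz (ln C) (ln C0) (ln R0)) as H4.
    pose proof (Rmin_l 1 (eps / 2 / K)). pose proof (Rmin_r 1 (eps / 2 / K)).
    assert (H7 : exp (L * Rabs (ln R0 - ln C)) <= exp (L * (Rabs (ln R0 - ln C0) + 1))).
    { apply exp_le_compat. apply Rmult_le_compat_l; [lra|].
      replace (ln R0 - ln C) with ((ln R0 - ln C0) + - (ln C - ln C0)) by ring.
      apply Rle_trans with (1 := Rabs_triang _ _). rewrite Rabs_Ropp. lra. }
    assert (H8 : B * Rabs (ln C - ln C0) * exp (L * Rabs (ln R0 - ln C)) <= K * Rabs (ln C - ln C0)).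
    { unfold K. pose proof (Rabs_pos (ln C - ln C0)). pose proof (exp_pos (L * Rabs (ln R0 - ln C))).
      apply Rle_trans with ((B + 1) * Rabs (ln C - ln C0) * exp (L * Rabs (ln R0 - ln C))).
      - apply Rmult_le_compat_r; [lra|]. apply Rmult_le_compat_r; lra.
      - apply Rle_trans with ((B + 1) * Rabs (ln C - ln C0) * exp (L * (Rabs (ln R0 - ln C0) + 1))); [|right; ring].
        apply Rmult_le_compat_l; [|easy]. apply Rmult_le_pos; lra. }
    assert (H9 : K * Rabs (ln C - ln C0) < K * (eps / 2 / K)) by (apply Rmult_lt_compat_l; lra).
    replace (K * (eps / 2 / K)) with (eps / 2) in H9 by (field; lra).
    lra.
  - subst C0. rewrite right_leaf_0.
    assert (He2 : 0 < eps / 2) by lra.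
    destruct (edge_approx (ln R0) _ He2) as [c0 [Hc0 Hc]].
    exists (Rmin d1 (exp c0)). split; [apply Rmin_glb_lt; [lra|apply exp_pos]|].
    intros C R HCR HdC HdR. rewrite Rminus_0_r, Rabs_pos_eq in HdC by lra.
    pose proof (Rmin_l d1 (exp c0)). pose proof (Rmin_r d1 (exp c0)).
    destruct (proj1 HCR) as [HCp|<-].
    + rewrite right_leaf_pos by easy.
      assert (Hln : ln C <= c0) by (rewrite <- (ln_exp c0); apply ln_le_compat; lra).
      specialize (Hc _ Hln). specialize (Hs R _ (flow_sol (ln C) hi) ltac:(lra)).
      replace (flow g (ln C) hi (ln R) - edge g hi (ln R0)) with
       ((flow g (ln C) hi (ln R) - flow g (ln C) hi (ln R0)) + (flow g (ln C) hi (ln R0) - edge g hi (ln R0))) by ring.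
      apply Rle_lt_trans with (1 := Rabs_triang _ _). lra.
    + rewrite right_leaf_0. specialize (Hs R _ edge_solution ltac:(lra)). lra.
Qed.

Lemma right_leaf_onto R x : 0 < R -> right_leaf 0 R <= x <= hi -> exists C, 0 <= C <= R /\ right_leaf C R = x.
Proof.
  intros HR Hx.
  (* Clamping the index to [[0, R]] gives a continuous function on the whole line, as the
     intermediate value theorem requires. *)
  set (f := fun t => right_leaf (Rmax 0 (Rmin t R)) R).
  assert (Hclamp : forall t, 0 <= Rmax 0 (Rmin t R) <= R).
  { intro t. split; [apply Rmax_l|]. apply Rmax_lub; [lra|apply Rmin_r]. }
  destruct (IVT_gen f 0 R x) as [t [_ Ht]].
  - intro t. apply continuity_pt_filterlim. apply filterlim_locally. intro eps.
    destruct (right_leaf_continuous _ _ (Hclamp t) HR eps (cond_pos eps)) as [d [Hd Hd']].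
    exists (mkposreal _ Hd). intros y Hy. change (Rabs (y - t) < d) in Hy.
    apply (Hd' (Rmax 0 (Rmin y R)) R (Hclamp y)).
    + apply Rle_lt_trans with (2 := Hy). unfold Rmax, Rmin.
      repeat destruct Rle_dec; apply Rabs_le; apply Rabs_def2 in Hy; unfold Rabs; destruct Rcase_abs; lra.
    + rewrite Rminus_diag, Rabs_R0. easy.
  - assert (H0 : f 0 = right_leaf 0 R) by (unfold f; f_equal; rewrite Rmin_left, Rmax_left; lra).
    assert (H1 : f R = hi) by (unfold f; rewrite Rmin_left, Rmax_right by lra; now apply right_leaf_diag).
    rewrite H0, H1, Rmin_left, Rmax_right; lra.
  - exists (Rmax 0 (Rmin t R)). split; [apply Hclamp|exact Ht].
Qed.
End Attracted.

(** * Cells *)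

(** Backwards in time the difference of the two solutions grows. If it is [d > 0] at [s], it was at
    least [d] before, hence decreased at rate at least [nu * d], and early enough it exceeds the
    width [b - a]. *)
Lemma contraction_unique (g : R -> R -> R) (u v : R -> R) (a b nu s : R) :
  solution g u -> solution g v -> 0 < nu ->
  (forall s x y, a <= y <= x -> x <= b -> g s x - g s y <= - nu * (x - y)) ->
  (forall s, a <= v s <= u s) -> (forall s, u s <= b) -> u s = v s.
Proof.
  intros Hu Hv Hnu Hc Ha Hb. apply Rle_antisym; [|apply Ha]. apply Rnot_lt_le. intro Hlt.
  set (d := u s - v s). assert (Hd : 0 < d) by (unfold d; lra).
  assert (HD : forall t, is_derive (fun t => u t - v t) t (g t (u t) - g t (v t))).
  { intro t. apply (is_derive_minus u v); [apply Hu|apply Hv]. }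
  assert (Hmon : forall t, t <= s -> d <= u t - v t).
  { intros t Ht. apply (decreasing_of_derive (fun t => u t - v t) (fun t => g t (u t) - g t (v t)) t s Ht).
    - intros; apply HD.
    - intros x _. specialize (Hc x (u x) (v x) (Ha x) (Hb x)).
      specialize (Ha x). assert (0 <= nu * (u x - v x)) by (apply Rmult_le_pos; lra). lra. }
  set (t := s - (b - a) / (nu * d)).
  assert (Hnd : 0 < nu * d) by now apply Rmult_lt_0_compat.
  assert (Hba : 0 < b - a) by (pose proof (Ha s); pose proof (Hb s); lra).
  assert (Hts : t < s) by (unfold t; assert (0 < (b - a) / (nu * d)) by (now apply Rdiv_lt_0_compat); lra).
  destruct (mvt_le (fun t => u t - v t) (fun t => g t (u t) - g t (v t)) t s ltac:(lra)) as [x [Hx He]]; [intros; apply HD|].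
  specialize (Hmon x ltac:(lra)). specialize (Hc x (u x) (v x) (Ha x) (Hb x)).
  assert (nu * d <= nu * (u x - v x)) by (apply Rmult_le_compat_l; lra).
  assert (Hst : (nu * d) * (s - t) = b - a) by (unfold t; field; lra).
  assert ((g x (u x) - g x (v x)) * (s - t) <= - (nu * d) * (s - t)) by (apply Rmult_le_compat_r; lra).
  pose proof (Ha t). pose proof (Hb t). unfold d in *. lra.
Qed.

Record trapped (g : R -> R -> R) (L B lo p q hi m : R) : Prop := {
  tr_field : lipschitz_field g L B;
  tr_pos : 0 < m;
  tr_order : lo < p /\ p <= q /\ q < hi;
  tr_above : forall s x, q <= x -> g s x <= - m;
  tr_below : forall s x, x <= p -> m <= g s x }.

Lemma trapped_right g L B lo p q hi m : trapped g L B lo p q hi m -> attracted g L B p q hi m.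
Proof. intros [H1 H2 H3 H4 H5]. split; auto. lra. Qed.

Lemma trapped_left g L B lo p q hi m : trapped g L B lo p q hi m ->
  attracted (reflect_field g) L B (- q) (- p) (- lo) m.
Proof.
  intros [H1 H2 H3 H4 H5]. split; auto; unfold reflect_field.
  - now apply reflect_lipschitz_field.
  - lra.
  - intros s x Hx. specialize (H5 s (- x)). lra.
  - intros s x Hx. specialize (H4 s (- x)). lra.
Qed.

Definition left_leaf (g : R -> R -> R) (lo C r : R) : R := - right_leaf (reflect_field g) (- lo) C r.

Definition glue (f1 f2 : R -> R) (t : R) : R := if Rle_dec t 0 then f1 t else f2 t.

Lemma glue_neg f1 f2 t : t <= 0 -> glue f1 f2 t = f1 t.
Proof. intro H. unfold glue. destruct (Rle_dec t 0); [easy|lra]. Qed.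

Lemma glue_pos f1 f2 t : f1 0 = f2 0 -> 0 <= t -> glue f1 f2 t = f2 t.
Proof.
  intros H Ht. unfold glue. destruct (Rle_dec t 0); [|easy]. replace t with 0 by lra. exact H.
Qed.

Lemma glue_continuous f1 f2 t : (forall s, continuous f1 s) -> (forall s, continuous f2 s) ->
  f1 0 = f2 0 -> continuous (glue f1 f2) t.
Proof.
  intros H1 H2 H0. apply filterlim_locally. intro eps.
  pose proof (proj1 (filterlim_locally _ _) (H1 t) eps) as K1.
  pose proof (proj1 (filterlim_locally _ _) (H2 t) eps) as K2.
  destruct (Rtotal_order t 0) as [Ht|[->|Ht]].
  - pose proof (open_lt 0 t Ht) as Ho. generalize (filter_and _ _ K1 Ho). apply filter_imp.
    intros x [Hx Hx0]. simpl in Hx0. rewrite !glue_neg by lra. exact Hx.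
  - generalize (filter_and _ _ K1 K2). apply filter_imp. intros x [Hx1 Hx2].
    destruct (Rle_dec x 0).
    + rewrite !glue_neg by lra. exact Hx1.
    + rewrite !(glue_pos f1 f2) by (easy || lra). exact Hx2.
  - pose proof (open_gt 0 t Ht) as Ho. generalize (filter_and _ _ K2 Ho). apply filter_imp.
    intros x [Hx Hx0]. simpl in Hx0. rewrite !(glue_pos f1 f2) by (easy || lra). exact Hx.
Qed.

Lemma glue_derive f1 f2 d1 d2 t : (forall s, is_derive f1 s (d1 s)) -> (forall s, is_derive f2 s (d2 s)) ->
  f1 0 = f2 0 -> d1 0 = d2 0 -> is_derive (glue f1 f2) t (glue d1 d2 t).
Proof.
  intros H1 H2 H0 Hd.
  destruct (Rtotal_order t 0) as [Ht|[->|Ht]].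
  - rewrite glue_neg by lra. apply (is_derive_ext_loc f1); [|apply H1].
    generalize (open_lt 0 t Ht). apply filter_imp. intros x Hx. simpl in Hx. rewrite glue_neg; [easy|lra].
  - rewrite glue_neg by lra. apply is_derive_Reals. intros eps Heps.
    pose proof (H1 0) as K1. pose proof (H2 0) as K2. apply is_derive_Reals in K1. apply is_derive_Reals in K2.
    destruct (K1 eps Heps) as [e1 E1]. destruct (K2 eps Heps) as [e2 E2].
    assert (He : 0 < Rmin e1 e2) by (apply Rmin_glb_lt; apply cond_pos).
    exists (mkposreal _ He). intros h Hh Hhe. simpl in Hhe.
    pose proof (Rmin_l e1 e2). pose proof (Rmin_r e1 e2).
    rewrite (glue_neg f1 f2 0) by lra. rewrite Rplus_0_l.
    destruct (Rle_dec h 0).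
    + rewrite glue_neg by lra. specialize (E1 h Hh ltac:(lra)). now rewrite Rplus_0_l in E1.
    + rewrite (glue_pos f1 f2) by (easy || lra). specialize (E2 h Hh ltac:(lra)). rewrite Rplus_0_l in E2.
      now rewrite Hd, H0.
  - rewrite glue_pos by (easy || lra). apply (is_derive_ext_loc f2); [|apply H2].
    generalize (open_gt 0 t Ht). apply filter_imp. intros x Hx. simpl in Hx. rewrite glue_pos; [easy|easy|lra].
Qed.

(** Arcs are restrictions of curves that are C^1 on the whole line, because [regular_integral_curve]
    asks for two-sided derivatives at the ends of the interval. *)
Record c1_curve (gamma dgamma : R -> R * R) : Prop := {
  c1_fst : forall t, is_derive (fun t => fst (gamma t)) t (fst (dgamma t));
  c1_snd : forall t, is_derive (fun t => snd (gamma t)) t (snd (dgamma t));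
  c1_fst_cont : forall t, continuous (fun t => fst (dgamma t)) t;
  c1_snd_cont : forall t, continuous (fun t => snd (dgamma t)) t }.

Definition scale (k : R) (w : R * R) : R * R := (k * fst w, k * snd w).

Lemma c1_curve_affine gamma dgamma k c : c1_curve gamma dgamma ->
  c1_curve (fun t => gamma (c + k * t)) (fun t => scale k (dgamma (c + k * t))).
Proof.
  intros [H1 H2 H3 H4].
  assert (Ha : forall t, is_derive (fun t => c + k * t) t k) by (intro; auto_derive; [easy|ring]).
  assert (Hc : forall t, continuous (fun t => c + k * t) t) by (intro; now apply (is_derive_continuous _ _ k)).
  split; intro t; simpl.
  - apply (is_derive_comp (fun t => fst (gamma t)) (fun t => c + k * t)); auto.
  - apply (is_derive_comp (fun t => snd (gamma t)) (fun t => c + k * t)); auto.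
  - apply (continuous_scal_r k (fun t => fst (dgamma (c + k * t)))).
    apply (continuous_comp (fun t => c + k * t) (fun t => fst (dgamma t))); auto.
  - apply (continuous_scal_r k (fun t => snd (dgamma (c + k * t)))).
    apply (continuous_comp (fun t => c + k * t) (fun t => snd (dgamma t))); auto.
Qed.

Definition glue2 (f1 f2 : R -> R * R) (t : R) : R * R :=
  (glue (fun t => fst (f1 t)) (fun t => fst (f2 t)) t, glue (fun t => snd (f1 t)) (fun t => snd (f2 t)) t).

Lemma glue2_neg f1 f2 t : t <= 0 -> glue2 f1 f2 t = f1 t.
Proof. intro H. unfold glue2. rewrite !glue_neg by easy. now destruct (f1 t). Qed.

Lemma glue2_pos f1 f2 t : f1 0 = f2 0 -> 0 <= t -> glue2 f1 f2 t = f2 t.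
Proof. intros H Ht. unfold glue2. rewrite !glue_pos by (easy || now rewrite H). now destruct (f2 t). Qed.

Lemma glue2_c1_curve f1 d1 f2 d2 : c1_curve f1 d1 -> c1_curve f2 d2 -> f1 0 = f2 0 -> d1 0 = d2 0 ->
  c1_curve (glue2 f1 f2) (glue2 d1 d2).
Proof.
  intros [A1 A2 A3 A4] [B1 B2 B3 B4] H0 Hd. split; intro t; simpl.
  - apply (glue_derive (fun t => fst (f1 t)) (fun t => fst (f2 t)) (fun t => fst (d1 t)) (fun t => fst (d2 t))); auto; congruence.
  - apply (glue_derive (fun t => snd (f1 t)) (fun t => snd (f2 t)) (fun t => snd (d1 t)) (fun t => snd (d2 t))); auto; congruence.
  - apply (glue_continuous (fun t => fst (d1 t)) (fun t => fst (d2 t))); auto; congruence.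
  - apply (glue_continuous (fun t => snd (d1 t)) (fun t => snd (d2 t))); auto; congruence.
Qed.

Lemma c1_curve_leaf_arc (L : line_field) (gamma dgamma : R -> R * R) (J : R -> Prop) (A : R * R -> Prop) :
  c1_curve gamma dgamma -> is_interval J ->
  (forall t, J t -> dgamma t <> (0, 0) /\ L (gamma t) (dgamma t)) ->
  (forall x, A x <-> exists t, J t /\ x = gamma t) -> leaf_arc L A.
Proof.
  intros [H1 H2 H3 H4] HJ HL HA. exists J, gamma. split; [easy|split; [|easy]].
  intros t Ht.
  assert (E1 : forall t, Derive (fun t => fst (gamma t)) t = fst (dgamma t)) by (intro; now apply is_derive_unique).
  assert (E2 : forall t, Derive (fun t => snd (gamma t)) t = snd (dgamma t)) by (intro; now apply is_derive_unique).
  rewrite E1, E2. rewrite <- surjective_pairing.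
  split; [now exists (fst (dgamma t))|]. split; [now exists (snd (dgamma t))|].
  split; [now apply (continuous_ext (fun t => fst (dgamma t)))|].
  split; [now apply (continuous_ext (fun t => snd (dgamma t)))|]. now apply HL.
Qed.

(* A sector around the origin on which leaves are the graphs of solutions of
   [dx / d(ln r) = field (ln r) x], for [x] the polar angle and [r] the size of
   the star-shaped curve below; [slope] is the derivative of [height]. *)
Record cell : Type := Cell { lo : R; hi : R; height : R -> R; slope : R -> R; field : R -> R -> R }.

(* The point whose polar angle is [x] on the star-shaped curve of size [r]:
   its radius is [r * exp (- height x)]. *)
Definition point (c : cell) (r x : R) : R * R :=
  (r * exp (- height c x) * cos x, r * exp (- height c x) * sin x).

(** The derivative of [point] with respect to [ln r] along a solution: the logarithm of the
    Euclidean radius is [ln r - height], which has derivative [1 - slope * g], and the polar angle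
    has derivative [g]. *)
Definition velocity (c : cell) (r x : R) : R * R :=
  let g := field c (ln r) x in
  let rho := r * exp (- height c x) in
  (rho * ((1 - slope c x * g) * cos x - g * sin x), rho * ((1 - slope c x * g) * sin x + g * cos x)).

Definition smooth_height (c : cell) : Prop :=
  (forall x, is_derive (height c) x (slope c x)) /\ (forall x, continuous (slope c) x).

Lemma velocity_neq_0 c r x : 0 < r -> velocity c r x <> (0, 0).
Proof.
  intros Hr H. unfold velocity in H. injection H. intros H2 H1.
  set (g := field c (ln r) x) in *. pose proof (exp_pos (- height c x)).
  assert (Hrho : r * exp (- height c x) <> 0) by (apply Rgt_not_eq, Rmult_lt_0_compat; lra).
  apply Rmult_integral in H1. apply Rmult_integral in H2.
  destruct H1 as [H1|H1]; [easy|]. destruct H2 as [H2|H2]; [easy|].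
  pose proof (sin2_cos2 x) as Hsc. unfold Rsqr in Hsc.
  (* The angular component is [g]; if it vanishes, the radial component is 1. *)
  assert (Hg : g = 0).
  { replace g with (cos x * ((1 - slope c x * g) * sin x + g * cos x) - sin x * ((1 - slope c x * g) * cos x - g * sin x)); [rewrite H1, H2; ring|].
    transitivity (g * (sin x * sin x + cos x * cos x)); [ring|rewrite Hsc; ring]. }
  rewrite Hg in H1, H2. assert (cos x = 0) by lra. assert (sin x = 0) by lra. nra.
Qed.

Lemma trajectory_c1_curve c L B u : smooth_height c -> lipschitz_field (field c) L B ->
  solution (field c) u -> c1_curve (fun s => point c (exp s) (u s)) (fun s => velocity c (exp s) (u s)).
Proof.
  intros [Hh Hs] HF Hu.
  assert (Huc : forall s, continuous u s) by (intro; now apply (solution_continuous (field c))).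
  assert (Hg : forall s, continuous (fun s => field c (ln (exp s)) (u s)) s).
  { intro s. apply (continuous_ext (fun s => field c s (u s))); [intro; now rewrite ln_exp|].
    now apply (lf_continuous_along (field c) L B). }
  assert (Hhu : forall s, is_derive (fun s => height c (u s)) s (slope c (u s) * field c s (u s))).
  { intro s. evar_last; [apply (is_derive_comp (height c) u s _ _ (Hh (u s)) (Hu s))|].
    unfold scal; simpl; unfold mult; simpl. ring. }
  assert (Hrho : forall s, is_derive (fun s => exp s * exp (- height c (u s))) s
    (exp s * exp (- height c (u s)) * (1 - slope c (u s) * field c s (u s)))).
  { intro s. evar_last.
    - apply (is_derive_mult exp (fun s => exp (- height c (u s)))); [apply is_derive_exp| |apply Rmult_comm].
      apply (is_derive_comp exp (fun s => - height c (u s))); [apply is_derive_exp|].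
      apply (is_derive_opp (fun s => height c (u s))). apply Hhu.
    - unfold plus, mult, scal, opp; simpl; unfold mult; simpl. ring. }
  assert (Hcu : forall s, continuous (fun s => cos (u s)) s).
  { intro s. apply (continuous_comp u cos); [easy|]. apply (is_derive_continuous _ _ (- sin (u s))). apply is_derive_cos. }
  assert (Hsu : forall s, continuous (fun s => sin (u s)) s).
  { intro s. apply (continuous_comp u sin); [easy|]. apply (is_derive_continuous _ _ (cos (u s))). apply is_derive_sin. }
  assert (Hrc : forall s, continuous (fun s => exp s * exp (- height c (u s))) s).
  { intro s. apply (is_derive_continuous _ _ _ (Hrho s)). }
  assert (Hsl : forall s, continuous (fun s => 1 - slope c (u s) * field c (ln (exp s)) (u s)) s).
  { intro s. apply (continuous_minus (fun _ => 1) (fun s => slope c (u s) * field c (ln (exp s)) (u s))); [apply continuous_const|].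
    apply (continuous_mult (fun s => slope c (u s)) (fun s => field c (ln (exp s)) (u s))); [|apply Hg].
    now apply (continuous_comp u (slope c)). }
  split; intro s; unfold point, velocity; simpl.
  - evar_last.
    + apply (is_derive_mult (fun s => exp s * exp (- height c (u s))) (fun s => cos (u s))); [apply Hrho| |apply Rmult_comm].
      apply (is_derive_comp cos u); [apply is_derive_cos|apply Hu].
    + rewrite ln_exp. unfold plus, mult, scal, opp; simpl; unfold mult; simpl. ring.
  - evar_last.
    + apply (is_derive_mult (fun s => exp s * exp (- height c (u s))) (fun s => sin (u s))); [apply Hrho| |apply Rmult_comm].
      apply (is_derive_comp sin u); [apply is_derive_sin|apply Hu].
    + rewrite ln_exp. unfold plus, mult, scal, opp; simpl; unfold mult; simpl. ring.
  - apply (continuous_mult (fun s => exp s * exp (- height c (u s)))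
      (fun s => (1 - slope c (u s) * field c (ln (exp s)) (u s)) * cos (u s) - field c (ln (exp s)) (u s) * sin (u s))); [apply Hrc|].
    apply (continuous_minus (fun s => (1 - slope c (u s) * field c (ln (exp s)) (u s)) * cos (u s)) (fun s => field c (ln (exp s)) (u s) * sin (u s))).
    + apply (continuous_mult (fun s => 1 - slope c (u s) * field c (ln (exp s)) (u s)) (fun s => cos (u s))); auto.
    + apply (continuous_mult (fun s => field c (ln (exp s)) (u s)) (fun s => sin (u s))); auto.
  - apply (continuous_mult (fun s => exp s * exp (- height c (u s)))
      (fun s => (1 - slope c (u s) * field c (ln (exp s)) (u s)) * sin (u s) + field c (ln (exp s)) (u s) * cos (u s))); [apply Hrc|].
    apply (continuous_plus (fun s => (1 - slope c (u s) * field c (ln (exp s)) (u s)) * sin (u s)) (fun s => field c (ln (exp s)) (u s) * cos (u s))).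
    + apply (continuous_mult (fun s => 1 - slope c (u s) * field c (ln (exp s)) (u s)) (fun s => sin (u s))); auto.
    + apply (continuous_mult (fun s => field c (ln (exp s)) (u s)) (fun s => cos (u s))); auto.
Qed.

Lemma filterlim_pair_R {T : Type} (F : (T -> Prop) -> Prop) {FF : Filter F} (f g : T -> R) (a b : R) :
  filterlim f F (locally a) -> filterlim g F (locally b) ->
  filterlim (fun x => (f x, g x)) F (locally (a, b)).
Proof.
  intros Hf Hg. apply filterlim_locally. intro eps.
  generalize (filter_and _ _ (proj1 (filterlim_locally _ _) Hf eps) (proj1 (filterlim_locally _ _) Hg eps)).
  apply filter_imp. intros x [H1 H2]. now split.
Qed.

Lemma filterlim_mult_R {T : Type} (F : (T -> Prop) -> Prop) {FF : Filter F} (f g : T -> R) (a b : R) :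
  filterlim f F (locally a) -> filterlim g F (locally b) ->
  filterlim (fun x => f x * g x) F (locally (a * b)).
Proof.
  intros Hf Hg. refine (filterlim_comp_2 (G:=locally a) (H:=locally b) f g Rmult Hf Hg _).
  apply (filterlim_mult a b).
Qed.

Lemma point_filterlim {T : Type} (F : (T -> Prop) -> Prop) {FF : Filter F} c (r x : T -> R) (a b : R) :
  smooth_height c -> filterlim r F (locally a) -> filterlim x F (locally b) ->
  filterlim (fun q => point c (r q) (x q)) F (locally (point c a b)).
Proof.
  intros [Hh _] Hr Hx.
  assert (Hcomp : forall h : R -> R, continuous h b -> filterlim (fun q => h (x q)) F (locally (h b))).
  { intros h Hc. apply (filterlim_comp _ _ _ x h F (locally b)); auto. }
  assert (H1 : filterlim (fun q => exp (- height c (x q))) F (locally (exp (- height c b)))).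
  { apply (Hcomp (fun x => exp (- height c x))).
    apply (continuous_comp (fun x => - height c x) exp).
    - apply (continuous_opp (height c)). apply (is_derive_continuous _ _ _ (Hh b)).
    - apply (is_derive_continuous _ _ _ (is_derive_exp _)). }
  assert (H2 : filterlim (fun q => cos (x q)) F (locally (cos b))).
  { apply (Hcomp cos). apply (is_derive_continuous _ _ _ (is_derive_cos b)). }
  assert (H3 : filterlim (fun q => sin (x q)) F (locally (sin b))).
  { apply (Hcomp sin). apply (is_derive_continuous _ _ _ (is_derive_sin b)). }
  unfold point. apply filterlim_pair_R; [easy| |]; (apply filterlim_mult_R; [easy| |easy]); now apply filterlim_mult_R.
Qed.

(** What the maps of the squares need from the leaves in one half of a cell. [Y C r] is the angle at
    size [r] of the leaf that meets the side [x0] at size [C]; the index [C = 0] is the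
    separatrix. *)
Record half_cell (c : cell) (Y : R -> R -> R) (x0 : R) : Prop := {
  hc_diag : forall r, 0 < r -> Y r r = x0;
  hc_bounds : forall C r, 0 <= C <= r -> 0 < r -> lo c <= Y C r <= hi c;
  hc_continuous : forall C0 r0, 0 <= C0 <= r0 -> 0 < r0 -> forall eps, 0 < eps ->
    exists d, 0 < d /\ forall C r, 0 <= C <= r -> Rabs (C - C0) < d -> Rabs (r - r0) < d ->
      Rabs (Y C r - Y C0 r0) < eps;
  hc_injective : forall C C' r, 0 <= C <= r -> 0 <= C' <= r -> 0 < r -> Y C r = Y C' r -> C = C';
  hc_solution : forall C, 0 <= C -> exists u, solution (field c) u /\ forall r, 0 < r -> Y C r = u (ln r) }.

Definition upper (c : cell) : R -> R -> R := right_leaf (field c) (hi c).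
Definition lower (c : cell) : R -> R -> R := left_leaf (field c) (lo c).

Lemma upper_half_cell c L B p q m : trapped (field c) L B (lo c) p q (hi c) m -> half_cell c (upper c) (hi c).
Proof.
  intro HT. pose proof (trapped_right _ _ _ _ _ _ _ _ HT) as HA. pose proof (tr_order _ _ _ _ _ _ _ _ HT) as Ho.
  unfold upper. split.
  - intros r Hr. now apply (right_leaf_diag _ L B p q (hi c) m HA).
  - intros C r HC Hr. pose proof (right_leaf_bounds _ L B p q (hi c) m HA C r HC Hr). lra.
  - apply (right_leaf_continuous _ L B p q (hi c) m HA).
  - intros C C' r HC HC' Hr He. destruct (Rtotal_order C C') as [Hlt|[|Hgt]]; [|easy|].
    + pose proof (right_leaf_mono _ L B p q (hi c) m HA C C' r). lra.
    + pose proof (right_leaf_mono _ L B p q (hi c) m HA C' C r). lra.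
  - intros C [HC|<-].
    + exists (flow (field c) (ln C) (hi c)). split; [apply (flow_sol _ L B p q (hi c) m HA)|].
      intros r Hr. now apply right_leaf_pos.
    + exists (edge (field c) (hi c)). split; [apply (edge_solution _ L B p q (hi c) m HA)|].
      intros r Hr. apply right_leaf_0.
Qed.

Lemma lower_half_cell c L B p q m : trapped (field c) L B (lo c) p q (hi c) m -> half_cell c (lower c) (lo c).
Proof.
  intro HT. pose proof (trapped_left _ _ _ _ _ _ _ _ HT) as HA. pose proof (tr_order _ _ _ _ _ _ _ _ HT) as Ho.
  unfold lower, left_leaf. split.
  - intros r Hr. rewrite (right_leaf_diag _ L B _ _ _ m HA) by easy. ring.
  - intros C r HC Hr. pose proof (right_leaf_bounds _ L B _ _ _ m HA C r HC Hr). lra.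
  - intros C0 r0 HC0 Hr0 eps Heps. destruct (right_leaf_continuous _ L B _ _ _ m HA C0 r0 HC0 Hr0 eps Heps) as [d [Hd H]].
    exists d. split; [easy|]. intros C r H1 H2 H3. specialize (H C r H1 H2 H3).
    replace (- _ - - _) with (- (right_leaf (reflect_field (field c)) (- lo c) C r - right_leaf (reflect_field (field c)) (- lo c) C0 r0)) by ring.
    now rewrite Rabs_Ropp.
  - intros C C' r HC HC' Hr He. destruct (Rtotal_order C C') as [Hlt|[|Hgt]]; [|easy|].
    + pose proof (right_leaf_mono _ L B _ _ _ m HA C C' r). lra.
    + pose proof (right_leaf_mono _ L B _ _ _ m HA C' C r). lra.
  - intros C [HC|<-].
    + exists (fun s => - flow (reflect_field (field c)) (ln C) (- lo c) s).
      split; [apply reflect_solution, (flow_sol _ L B _ _ _ m HA)|].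
      intros r Hr. f_equal. now apply right_leaf_pos.
    + exists (fun s => - edge (reflect_field (field c)) (- lo c) s).
      split; [apply reflect_solution, (edge_solution _ L B _ _ _ m HA)|].
      intros r Hr. f_equal. apply right_leaf_0.
Qed.

Lemma lower_lt c L B p q m C r : trapped (field c) L B (lo c) p q (hi c) m ->
  0 < C <= r -> lower c C r < lower c 0 r.
Proof.
  intros HT HC. pose proof (trapped_left _ _ _ _ _ _ _ _ HT) as HA. unfold lower, left_leaf.
  apply Ropp_lt_contravar. apply (right_leaf_mono _ L B _ _ _ m HA); lra.
Qed.

Lemma upper_lt c L B p q m C r : trapped (field c) L B (lo c) p q (hi c) m ->
  0 < C <= r -> upper c 0 r < upper c C r.
Proof.
  intros HT HC. pose proof (trapped_right _ _ _ _ _ _ _ _ HT) as HA. unfold upper.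
  apply (right_leaf_mono _ L B _ _ _ m HA); lra.
Qed.

Lemma upper_onto c L B p q m r x : trapped (field c) L B (lo c) p q (hi c) m -> 0 < r ->
  upper c 0 r <= x <= hi c -> exists C, 0 <= C <= r /\ upper c C r = x.
Proof. intros HT. apply (right_leaf_onto _ L B p q (hi c) m (trapped_right _ _ _ _ _ _ _ _ HT)). Qed.

Lemma lower_onto c L B p q m r x : trapped (field c) L B (lo c) p q (hi c) m -> 0 < r ->
  lo c <= x <= lower c 0 r -> exists C, 0 <= C <= r /\ lower c C r = x.
Proof.
  intros HT Hr Hx. unfold lower, left_leaf in *.
  destruct (right_leaf_onto _ L B _ _ _ m (trapped_left _ _ _ _ _ _ _ _ HT) r (- x) Hr ltac:(lra)) as [C [HC He]].
  exists C. split; [easy|lra].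
Qed.

(** Multiples of both signs occur, because a leaf is run through backwards in one of the two cells
    that it crosses. *)
Definition tangent_cell (F : line_field) (r0 : R) (c : cell) : Prop :=
  forall r x k, 0 < r <= r0 -> lo c <= x <= hi c -> k <> 0 -> F (point c r x) (scale k (velocity c r x)).

(** The bound on [exp (- height)] bounds the Euclidean radius by a multiple of [r], for continuity
    at the corner of the square. *)
Definition good_cell (F : line_field) (r0 : R) (c : cell) : Prop :=
  smooth_height c /\ (exists H, forall x, lo c <= x <= hi c -> exp (- height c x) <= H) /\
  tangent_cell F r0 c /\ exists L B p q m, trapped (field c) L B (lo c) p q (hi c) m.

(** The negative factor says that a leaf crossing the common side has [r] decreasing before the
    crossing, in one cell, and increasing after it, in the other. *)
Definition adjacent (r0 : R) (c d : cell) : Prop :=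
  (forall r, point c r (hi c) = point d r (lo d)) /\
  (forall r, 0 < r <= r0 -> exists k, 0 < k /\ velocity d r (lo d) = scale (- k) (velocity c r (hi c))).

Lemma scale_neq_0 k w : k <> 0 -> w <> (0, 0) -> scale k w <> (0, 0).
Proof.
  destruct w as [x y]. unfold scale; simpl. intros Hk Hw H. apply Hw. injection H. intros H2 H1.
  apply Rmult_integral in H1. apply Rmult_integral in H2. destruct H1, H2; try easy. now subst.
Qed.

Lemma single_arc F r0 c u (A : R * R -> Prop) : good_cell F r0 c -> 0 < r0 -> solution (field c) u ->
  (forall s, s <= ln r0 -> lo c <= u s <= hi c) ->
  (forall x, A x <-> exists r, 0 < r <= r0 /\ x = point c r (u (ln r))) -> leaf_arc F A.
Proof.
  intros [Hh [_ [Ht [L [B [p [q [m HT]]]]]]]] Hr0 Hu Hb HA.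
  apply (c1_curve_leaf_arc F (fun s => point c (exp s) (u s)) (fun s => velocity c (exp s) (u s)) (fun s => s <= ln r0)).
  - apply (trajectory_c1_curve c L B); [easy|apply (tr_field _ _ _ _ _ _ _ _ HT)|easy].
  - intros s t w _ H1 H2. lra.
  - intros s Hs. split; [apply velocity_neq_0, exp_pos|].
    assert (He : exp s <= r0) by (rewrite <- (exp_ln r0) by easy; now apply exp_le_compat).
    pose proof (Ht (exp s) (u s) 1 (conj (exp_pos s) He) (Hb s Hs) ltac:(lra)) as H.
    unfold scale in H. rewrite !Rmult_1_l in H. now rewrite <- surjective_pairing in H.
  - intro x. rewrite HA. split.
    + intros [r [Hr ->]]. exists (ln r). split; [apply ln_le_compat; lra|]. now rewrite exp_ln.
    + intros [s [Hs ->]]. exists (exp s). rewrite ln_exp. split; [|easy]. split; [apply exp_pos|].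
      rewrite <- (exp_ln r0) by easy. now apply exp_le_compat.
Qed.

Lemma joined_arc F r0 c d C u v (A : R * R -> Prop) : good_cell F r0 c -> good_cell F r0 d -> adjacent r0 c d ->
  0 < C <= r0 -> solution (field c) u -> solution (field d) v -> u (ln C) = hi c -> v (ln C) = lo d ->
  (forall s, ln C <= s <= ln r0 -> lo c <= u s <= hi c) ->
  (forall s, ln C <= s <= ln r0 -> lo d <= v s <= hi d) ->
  (forall x, A x <-> exists r, C <= r <= r0 /\ (x = point c r (u (ln r)) \/ x = point d r (v (ln r)))) -> leaf_arc F A.
Proof.
  intros [Hh [_ [Ht [L [B [p [q [m HT]]]]]]]] [Hh' [_ [Ht' [L' [B' [p' [q' [m' HT']]]]]]]] [Hg Hk] HC Hu Hv Hu0 Hv0 Hub Hvb HA.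
  destruct (Hk C HC) as [k [Hk0 Hvel]].
  pose proof (trajectory_c1_curve c L B u Hh (tr_field _ _ _ _ _ _ _ _ HT) Hu) as Ca.
  pose proof (trajectory_c1_curve d L' B' v Hh' (tr_field _ _ _ _ _ _ _ _ HT') Hv) as Cb.
  (* Time 0 is the crossing of the common side. Time runs backwards in [c] and is rescaled by [/ k]
     in [d], so that the velocities agree at 0. *)
  apply (c1_curve_affine _ _ (-1) (ln C)) in Ca. apply (c1_curve_affine _ _ (/ k) (ln C)) in Cb.
  assert (HlC : ln C <= ln r0) by (apply ln_le_compat; lra).
  assert (Hik : 0 < / k) by now apply Rinv_0_lt_compat.
  set (T := ln r0 - ln C) in *.
  match type of Ca with c1_curve ?f ?g => set (fa := f) in *; set (da := g) in * end.
  match type of Cb with c1_curve ?f ?g => set (fb := f) in *; set (db := g) in * end.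
  assert (Hf0 : fa 0 = fb 0).
  { unfold fa, fb. rewrite !Rmult_0_r, Rplus_0_r, Hu0, Hv0, exp_ln by lra. apply Hg. }
  assert (Hd0 : da 0 = db 0).
  { unfold da, db. rewrite !Rmult_0_r, Rplus_0_r, Hu0, Hv0, exp_ln by lra. rewrite Hvel.
    unfold scale; simpl. f_equal; field; lra. }
  assert (Hrange : forall s, ln C <= s <= ln r0 -> 0 < exp s <= r0).
  { intros s Hs. split; [apply exp_pos|]. rewrite <- (exp_ln r0) by lra. now apply exp_le_compat. }
  apply (c1_curve_leaf_arc F (glue2 fa fb) (glue2 da db) (fun t => - T <= t <= k * T)).
  - now apply glue2_c1_curve.
  - intros s t w H1 H2 H3. lra.
  - intros t HtJ. destruct (Rle_dec t 0) as [Hn|Hp].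
    + rewrite !glue2_neg by lra. unfold fa, da.
      assert (Hs : ln C <= ln C + -1 * t <= ln r0) by (unfold T in *; lra).
      split; [apply scale_neq_0; [lra|apply velocity_neq_0, exp_pos]|].
      apply Ht; [now apply Hrange|now apply Hub|lra].
    + rewrite !glue2_pos by (easy || lra). unfold fb, db.
      assert (Hs : ln C <= ln C + / k * t <= ln r0).
      { assert (0 <= / k * t) by (apply Rmult_le_pos; lra).
        assert (/ k * t <= / k * (k * T)) by (apply Rmult_le_compat_l; lra).
        replace (/ k * (k * T)) with T in * by (field; lra). unfold T in *; lra. }
      split; [apply scale_neq_0; [lra|apply velocity_neq_0, exp_pos]|].
      apply Ht'; [now apply Hrange|now apply Hvb|lra].
  - intro x. rewrite HA. split.
    + intros [r [Hr [-> | ->]]].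
      * assert (ln C <= ln r) by (apply ln_le_compat; lra). assert (ln r <= ln r0) by (apply ln_le_compat; lra).
        assert (0 <= k * T) by (apply Rmult_le_pos; unfold T; lra).
        exists (- (ln r - ln C)). split; [unfold T in *; lra|]. rewrite glue2_neg by lra. unfold fa.
        replace (ln C + -1 * - (ln r - ln C)) with (ln r) by ring. rewrite exp_ln by lra. easy.
      * assert (ln C <= ln r) by (apply ln_le_compat; lra). assert (ln r <= ln r0) by (apply ln_le_compat; lra).
        assert (0 <= k * (ln r - ln C)) by (apply Rmult_le_pos; lra).
        exists (k * (ln r - ln C)). split; [split; [unfold T; lra|apply Rmult_le_compat_l; unfold T; lra]|].
        rewrite glue2_pos by (easy || lra). unfold fb.
        replace (ln C + / k * (k * (ln r - ln C))) with (ln r) by (field; lra). rewrite exp_ln by lra. easy.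
    + intros [t [HtJ ->]]. destruct (Rle_dec t 0) as [Hn|Hp].
      * exists (exp (ln C + -1 * t)). rewrite glue2_neg by lra. unfold fa. rewrite ln_exp. split; [|now left].
        split; [rewrite <- (exp_ln C) at 1 by lra; apply exp_le_compat; lra|].
        rewrite <- (exp_ln r0) by lra. apply exp_le_compat. unfold T in *; lra.
      * exists (exp (ln C + / k * t)). rewrite glue2_pos by (easy || lra). unfold fb. rewrite ln_exp. split; [|now right].
        assert (0 <= / k * t) by (apply Rmult_le_pos; lra).
        assert (/ k * t <= / k * (k * T)) by (apply Rmult_le_compat_l; lra).
        replace (/ k * (k * T)) with T in * by (field; lra).
        split; [rewrite <- (exp_ln C) at 1 by lra; apply exp_le_compat; lra|].
        rewrite <- (exp_ln r0) by lra. apply exp_le_compat. unfold T in *; lra.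
Qed.

(** * Hyperbolic sectors *)

Lemma point_0 c x : point c 0 x = (0, 0).
Proof. unfold point. f_equal; ring. Qed.

Lemma point_small c H r x : 0 <= r -> exp (- height c x) <= H ->
  Rabs (fst (point c r x)) <= r * H /\ Rabs (snd (point c r x)) <= r * H.
Proof.
  intros Hr HH. unfold point; simpl. pose proof (exp_pos (- height c x)) as He.
  assert (Hm : r * exp (- height c x) <= r * H) by now apply Rmult_le_compat_l.
  assert (Hp : 0 <= r * exp (- height c x)) by (apply Rmult_le_pos; lra).
  pose proof (COS_bound x). pose proof (SIN_bound x).
  split; rewrite Rabs_mult, (Rabs_pos_eq (r * _)) by easy.
  - apply Rle_trans with (r * exp (- height c x) * 1); [|lra]. apply Rmult_le_compat_l; [easy|].
    apply Rabs_le; lra.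
  - apply Rle_trans with (r * exp (- height c x) * 1); [|lra]. apply Rmult_le_compat_l; [easy|].
    apply Rabs_le; lra.
Qed.

Lemma leaf_filterlim {T : Type} (F : (T -> Prop) -> Prop) {FF : Filter F} c Y x0 (k r : T -> R) (a b : R) :
  smooth_height c -> half_cell c Y x0 -> filterlim k F (locally a) -> filterlim r F (locally b) ->
  F (fun q => 0 <= k q <= r q) -> 0 <= a <= b -> 0 < b ->
  filterlim (fun q => point c (r q) (Y (k q) (r q))) F (locally (point c b (Y a b))).
Proof.
  intros Hh HY Hk Hr HF Ha Hb. apply (point_filterlim F); try easy.
  apply filterlim_locally. intro eps.
  destruct (hc_continuous _ _ _ HY a b Ha Hb eps (cond_pos eps)) as [d [Hd HYc]].
  generalize (filter_and _ _ HF (filter_and _ _ (proj1 (filterlim_locally _ _) Hk (mkposreal _ Hd)) (proj1 (filterlim_locally _ _) Hr (mkposreal _ Hd)))).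
  apply filter_imp. intros q [H1 [H2 H3]]. now apply HYc.
Qed.

Lemma filterlim_fst_R (D : R * R -> Prop) (p : R * R) : filterlim fst (within D (locally p)) (locally (fst p)).
Proof.
  apply filterlim_locally. intro eps. exists eps. intros q [H _] _. exact H.
Qed.

Lemma filterlim_snd_R (D : R * R -> Prop) (p : R * R) : filterlim snd (within D (locally p)) (locally (snd p)).
Proof.
  apply filterlim_locally. intro eps. exists eps. intros q [_ H] _. exact H.
Qed.

Lemma filterlim_comp_R {T : Type} (F : (T -> Prop) -> Prop) {FF : Filter F} (h : R -> R) (f : T -> R) (a : R) :
  continuous h a -> filterlim f F (locally a) -> filterlim (fun q => h (f q)) F (locally (h a)).
Proof. intros Hh Hf. apply (filterlim_comp _ _ _ f h F (locally a)); auto. Qed.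

(** The geometric mean of the sizes [r0 * s] and [r0 * t]. It is constant on the hyperbolas of the
    model and equals the size on the diagonal, which is sent to the common side of the two cells. *)
Definition level (r0 : R) (p : R * R) : R := r0 * sqrt (fst p * snd p).

Lemma level_bounds r0 p : 0 < r0 -> square p -> 0 <= level r0 p /\
  (snd p <= fst p -> level r0 p <= r0 * fst p) /\ (fst p <= snd p -> level r0 p <= r0 * snd p).
Proof.
  destruct p as [s t]. unfold square, level; simpl. intros Hr [Hs Ht].
  split; [apply Rmult_le_pos; [lra|apply sqrt_pos]|].
  split; intro H; apply Rmult_le_compat_l; try lra.
  - rewrite <- (sqrt_square s) at 2 by lra. apply sqrt_le_1; nra.
  - rewrite <- (sqrt_square t) at 2 by lra. apply sqrt_le_1; nra.
Qed.

Lemma level_square r0 p : square p -> level r0 p * level r0 p = r0 * r0 * (fst p * snd p).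
Proof.
  intros [H1 H2]. unfold level. 
  replace (r0 * sqrt (fst p * snd p) * (r0 * sqrt (fst p * snd p))) with (r0 * r0 * (sqrt (fst p * snd p) * sqrt (fst p * snd p))) by ring.
  rewrite sqrt_sqrt; [easy|nra].
Qed.

Lemma level_filterlim r0 (D : R * R -> Prop) (p : R * R) :
  filterlim (level r0) (within D (locally p)) (locally (level r0 p)).
Proof.
  unfold level. apply (filterlim_mult_R (within D (locally p)) (fun _ => r0)); [apply filterlim_const|].
  apply (filterlim_comp_R (within D (locally p)) sqrt); [apply continuous_sqrt|].
  apply (filterlim_mult_R (within D (locally p))); [apply filterlim_fst_R|apply filterlim_snd_R].
Qed.

(* Along [s t] constant, [hyp_map] follows one leaf: it comes in through the cell
   [c], crosses the side common to [c] and [d] at size [level], and goes out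
   through [d]. *)
Definition hyp_map (c d : cell) (r0 : R) (p : R * R) : R * R :=
  if Rle_dec (snd p) (fst p)
  then point c (r0 * fst p) (upper c (level r0 p) (r0 * fst p))
  else point d (r0 * snd p) (lower d (level r0 p) (r0 * snd p)).

Lemma level_diag r0 p : 0 <= fst p -> fst p = snd p -> level r0 p = r0 * fst p.
Proof. intros Hp He. unfold level. rewrite <- He. now rewrite sqrt_square. Qed.

Section Hyperbolic.
Context (F : line_field) (r0 : R) (c d : cell) (Hr0 : 0 < r0) (Hc : good_cell F r0 c) (Hd : good_cell F r0 d) (Hcd : adjacent r0 c d).

Lemma good_upper e : good_cell F r0 e -> half_cell e (upper e) (hi e).
Proof. intros [_ [_ [_ [L [B [p [q [m HT]]]]]]]]. now apply (upper_half_cell e L B p q m). Qed.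

Lemma good_lower e : good_cell F r0 e -> half_cell e (lower e) (lo e).
Proof. intros [_ [_ [_ [L [B [p [q [m HT]]]]]]]]. now apply (lower_half_cell e L B p q m). Qed.

Lemma hyp_map_right p : snd p <= fst p -> hyp_map c d r0 p = point c (r0 * fst p) (upper c (level r0 p) (r0 * fst p)).
Proof. intro H. unfold hyp_map. destruct (Rle_dec (snd p) (fst p)); [easy|lra]. Qed.

Lemma hyp_map_left p : 0 < snd p -> fst p <= snd p -> hyp_map c d r0 p = point d (r0 * snd p) (lower d (level r0 p) (r0 * snd p)).
Proof.
  intros Hp H. unfold hyp_map. destruct (Rle_dec (snd p) (fst p)); [|easy].
  assert (He : fst p = snd p) by lra. rewrite (level_diag r0 p) by lra. rewrite He.
  rewrite (hc_diag _ _ _ (good_upper c Hc)), (hc_diag _ _ _ (good_lower d Hd)) by (apply Rmult_lt_0_compat; lra).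
  apply Hcd.
Qed.

Lemma hyp_map_corner : hyp_map c d r0 (0, 0) = (0, 0).
Proof. rewrite hyp_map_right by (simpl; lra). simpl. rewrite Rmult_0_r. apply point_0. Qed.

Lemma square_max_pos p : square p -> p <> (0, 0) -> 0 < Rmax (fst p) (snd p).
Proof.
  destruct p as [s t]. intros [H1 H2] Hn. simpl in *.
  destruct (Rle_lt_dec s 0) as [Hs|Hs]; [|apply Rlt_le_trans with (1 := Hs), Rmax_l].
  destruct (Rle_lt_dec t 0) as [Ht|Ht]; [|apply Rlt_le_trans with (1 := Ht), Rmax_r].
  exfalso. apply Hn. f_equal; lra.
Qed.

Lemma hyp_map_continuous p : square p ->
  filterlim (hyp_map c d r0) (within square (locally p)) (locally (hyp_map c d r0 p)).
Proof.
  intro Hp.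
  destruct (Classical_Prop.classic (p = (0, 0))) as [->|Hn].
  - rewrite hyp_map_corner. apply filterlim_locally. intro eps.
    destruct Hc as [_ [[H1 HH1] _]]. destruct Hd as [_ [[H2 HH2] _]].
    set (K := Rabs H1 + Rabs H2 + 1). assert (HK : 0 < K) by (unfold K; pose proof (Rabs_pos H1); pose proof (Rabs_pos H2); lra).
    assert (Hdel : 0 < eps / (r0 * K)) by (apply Rdiv_lt_0_compat; [apply cond_pos|now apply Rmult_lt_0_compat]).
    assert (Hgoal : forall e H r x, Rabs H <= K -> exp (- height e x) <= H -> 0 <= r < eps / (r0 * K) ->
      ball (0, 0) eps (point e (r0 * r) x)).
    { intros e H r x HHK HH Hr.
      assert (Hb : r0 * r * H < eps).
      { apply Rle_lt_trans with (r0 * r * K); [apply Rmult_le_compat_l; [apply Rmult_le_pos; lra|apply Rle_trans with (2 := HHK), Rle_abs]|].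
        replace (pos eps) with (r0 * K * (eps / (r0 * K))) by (field; lra).
        replace (r0 * r * K) with (r0 * K * r) by ring. apply Rmult_lt_compat_l; [now apply Rmult_lt_0_compat|lra]. }
      destruct (point_small e H (r0 * r) x ltac:(apply Rmult_le_pos; lra) HH) as [G1 G2].
      split; [change (Rabs (fst (point e (r0 * r) x) - 0) < eps)|change (Rabs (snd (point e (r0 * r) x) - 0) < eps)]; rewrite Rminus_0_r; lra. }
    assert (Hsmall : forall q : R * R, square q -> fst q < eps / (r0 * K) -> snd q < eps / (r0 * K) ->
      ball (0, 0) eps (hyp_map c d r0 q)).
    { intros q Hsq Hfst Hsnd.
    destruct (level_bounds r0 q Hr0 Hsq) as [L0 [L1 L2]].
    unfold hyp_map. destruct (Rle_dec (snd q) (fst q)) as [Hle|Hle].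
    + destruct (Req_dec (fst q) 0) as [Hz|Hz].
      { rewrite Hz, Rmult_0_r, point_0. apply ball_center. }
      apply (Hgoal c H1); [unfold K; pose proof (Rabs_pos H2); lra| |destruct Hsq; lra].
      apply HH1. apply (hc_bounds _ _ _ (good_upper c Hc)); [split; [easy|now apply L1]|].
      apply Rmult_lt_0_compat; [easy|]. destruct Hsq; lra.
    + apply (Hgoal d H2); [unfold K; pose proof (Rabs_pos H1); lra| |destruct Hsq; lra].
      apply HH2. apply (hc_bounds _ _ _ (good_lower d Hd)); [split; [easy|apply L2; lra]|].
      apply Rmult_lt_0_compat; [easy|]. destruct Hsq; lra. }
    exists (mkposreal _ Hdel). intros q Hq Hsq.
    assert (Hfst : fst q < eps / (r0 * K)).
    { destruct Hq as [Hq _]. change (Rabs (fst q - 0) < eps / (r0 * K)) in Hq. apply Rabs_def2 in Hq. lra. }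
    assert (Hsnd : snd q < eps / (r0 * K)).
    { destruct Hq as [_ Hq]. change (Rabs (snd q - 0) < eps / (r0 * K)) in Hq. apply Rabs_def2 in Hq. lra. }
    now apply Hsmall.
  - pose proof (square_max_pos p Hp Hn) as Hmax.
    (* The two formulas are continuous on the two halves of the square and agree on the diagonal,
       where both give the common side. *)
    assert (FR : snd p <= fst p -> filterlim (hyp_map c d r0) (within (fun q => square q /\ snd q <= fst q) (locally p)) (locally (hyp_map c d r0 p))).
    { intro Hle. rewrite Rmax_left in Hmax by easy. rewrite hyp_map_right by easy.
      apply (filterlim_within_ext _ (fun q => point c (r0 * fst q) (upper c (level r0 q) (r0 * fst q)))).
      { intros q [_ Hq]. now rewrite hyp_map_right. }
      apply (leaf_filterlim _ c (upper c) (hi c) (level r0) (fun q => r0 * fst q)); [apply Hc|now apply good_upper| | | | |].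
      - apply level_filterlim.
      - apply (filterlim_mult_R _ (fun _ => r0)); [apply filterlim_const|apply filterlim_fst_R].
      - unfold within. apply filter_forall. intros q [Hq Hq']. destruct (level_bounds r0 q Hr0 Hq) as [L0 [L1 _]]. split; auto.
      - destruct (level_bounds r0 p Hr0 Hp) as [L0 [L1 _]]. split; auto.
      - now apply Rmult_lt_0_compat. }
    assert (FL : fst p <= snd p -> filterlim (hyp_map c d r0) (within (fun q => square q /\ 0 < snd q /\ fst q <= snd q) (locally p)) (locally (hyp_map c d r0 p))).
    { intro Hle. rewrite Rmax_right in Hmax by easy. rewrite hyp_map_left by easy.
      apply (filterlim_within_ext _ (fun q => point d (r0 * snd q) (lower d (level r0 q) (r0 * snd q)))).
      { intros q [_ Hq]. now rewrite hyp_map_left. }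
      apply (leaf_filterlim _ d (lower d) (lo d) (level r0) (fun q => r0 * snd q)); [apply Hd|now apply good_lower| | | | |].
      - apply level_filterlim.
      - apply (filterlim_mult_R _ (fun _ => r0)); [apply filterlim_const|apply filterlim_snd_R].
      - unfold within. apply filter_forall. intros q [Hq Hq']. destruct (level_bounds r0 q Hr0 Hq) as [L0 [_ L2]]. split; [easy|apply L2; lra].
      - destruct (level_bounds r0 p Hr0 Hp) as [L0 [_ L2]]. split; auto.
      - now apply Rmult_lt_0_compat. }
    apply filterlim_locally. intro eps.
    assert (Hcase : forall f g : R * R -> R, (forall q, continuous f q) -> (forall q, continuous g q) -> f p < g p ->
      locally p (fun q => f q < g q)).
    { intros f g Hf Hg Hlt. 
      assert (He : 0 < (g p - f p) / 2) by lra.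
      generalize (filter_and _ _ (proj1 (filterlim_locally _ _) (Hf p) (mkposreal _ He)) (proj1 (filterlim_locally _ _) (Hg p) (mkposreal _ He))).
      apply filter_imp. change (forall q : R * R, ball (f p) ((g p - f p) / 2) (f q) /\ ball (g p) ((g p - f p) / 2) (g q) -> f q < g q). intros q [Q1 Q2].
      change (Rabs (f q - f p) < (g p - f p) / 2) in Q1. change (Rabs (g q - g p) < (g p - f p) / 2) in Q2.
      apply Rabs_def2 in Q1. apply Rabs_def2 in Q2. lra. }
    assert (Hcf : forall q : R * R, continuous fst q) by (intro; apply continuous_fst).
    assert (Hcs : forall q : R * R, continuous snd q) by (intro; apply continuous_snd).
    destruct (Rtotal_order (fst p) (snd p)) as [Hlt|[He|Hgt]].
    + pose proof (proj1 (filterlim_locally _ _) (FL (Rlt_le _ _ Hlt)) eps) as H1.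
      refine (filter_imp (F:=locally p) _ _ _ (filter_and (F:=locally p) _ _ H1 (Hcase fst snd Hcf Hcs Hlt))).
      intros q [Q1 Q2] Hq. apply Q1. split; [easy|].
      split; [apply Rle_lt_trans with (2 := Q2), Hq|now left].
    + pose proof (proj1 (filterlim_locally _ _) (FL (Req_le _ _ He)) eps) as H1.
      pose proof (proj1 (filterlim_locally _ _) (FR (Req_le _ _ (eq_sym He))) eps) as H2.
      refine (filter_imp (F:=locally p) _ _ _ (filter_and (F:=locally p) _ _ H1 H2)).
      intros q [Q1 Q2] Hq. destruct (Rle_lt_dec (snd q) (fst q)) as [Hl|Hl]; [now apply Q2|].
      apply Q1. split; [easy|]. split; [apply Rle_lt_trans with (2 := Hl), Hq|now left].
    + pose proof (proj1 (filterlim_locally _ _) (FR (Rlt_le _ _ Hgt)) eps) as H1.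
      refine (filter_imp (F:=locally p) _ _ _ (filter_and (F:=locally p) _ _ H1 (Hcase snd fst Hcs Hcf Hgt))).
      intros q [Q1 Q2] Hq. apply Q1. split; [easy|]. now left.
Qed.

(** The half-axes go to separatrices, each inside one cell; a hyperbola goes to a leaf that crosses
    the common side once and is glued there. *)
Lemma hyp_map_leaf p : square p -> p <> (0, 0) ->
  leaf_arc F (fun x => exists q, model_leaf hyperbolic p q /\ x = hyp_map c d r0 q).
Proof.
  intros Hp Hn. pose proof (good_upper c Hc) as HU. pose proof (good_lower d Hd) as HL.
  pose proof (proj1 Hp) as Hs. pose proof (proj2 Hp) as Ht.
  destruct (Req_dec (fst p * snd p) 0) as [Hz|Hz].
  - assert (Hsol0 : forall e Y x0 u, half_cell e Y x0 -> (forall r, 0 < r -> Y 0 r = u (ln r)) ->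
      forall s, s <= ln r0 -> lo e <= u s <= hi e).
    { intros e Y x0 u HY Hu s _. rewrite <- (ln_exp s), <- Hu by apply exp_pos.
      apply (hc_bounds _ _ _ HY); [|apply exp_pos]. pose proof (exp_pos s). lra. }
    destruct (Req_dec (fst p) 0) as [Hf|Hf].
    + destruct (hc_solution _ _ _ HL 0 ltac:(lra)) as [v [Hv Hv']].
      apply (single_arc F r0 d v _ Hd Hr0 Hv); [now apply (Hsol0 d (lower d) (lo d))|].
      intro x. split.
      * intros [[s t] [[[Q1 Q2] [Q3 [Q4 Q5]]] ->]]. simpl in *. assert (s = 0) by tauto. subst s.
        assert (0 < t) by (destruct (Req_dec t 0) as [->|]; [easy|lra]).
        exists (r0 * t). split; [split; [now apply Rmult_lt_0_compat|rewrite <- (Rmult_1_r r0) at 2; apply Rmult_le_compat_l; lra]|].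
        rewrite hyp_map_left by (simpl; lra). simpl. unfold level; simpl. rewrite Rmult_0_l, sqrt_0, Rmult_0_r.
        rewrite <- Hv'; [easy|now apply Rmult_lt_0_compat].
      * intros [r [Hr ->]]. assert (Hq : 0 < r / r0 <= 1).
        { split; [apply Rdiv_lt_0_compat; lra|]. apply (Rmult_le_reg_r r0); [lra|]. field_simplify; lra. }
        exists (0, r / r0). split.
        -- split; [split; simpl; lra|split].
           ++ intro E. injection E. lra.
           ++ simpl. rewrite Hf. split; [lra|tauto].
        -- rewrite hyp_map_left by (simpl; lra). simpl. unfold level; simpl. rewrite Rmult_0_l, sqrt_0, Rmult_0_r.
           replace (r0 * (r / r0)) with r by (field; lra). now rewrite <- Hv'.
    + assert (Hs0 : snd p = 0) by (apply Rmult_integral in Hz; tauto).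
      destruct (hc_solution _ _ _ HU 0 ltac:(lra)) as [v [Hv Hv']].
      apply (single_arc F r0 c v _ Hc Hr0 Hv); [now apply (Hsol0 c (upper c) (hi c))|].
      intro x. split.
      * intros [[s t] [[[Q1 Q2] [Q3 [Q4 Q5]]] ->]]. simpl in *.
        assert (Hsn : s <> 0) by tauto.
        assert (t = 0) by (rewrite Hs0, Rmult_0_r in Q4; apply Rmult_integral in Q4; tauto). subst t.
        assert (0 < s) by lra.
        exists (r0 * s). split; [split; [now apply Rmult_lt_0_compat|rewrite <- (Rmult_1_r r0) at 2; apply Rmult_le_compat_l; lra]|].
        rewrite hyp_map_right by (simpl; lra). simpl. unfold level; simpl. rewrite Rmult_0_r, sqrt_0, Rmult_0_r.
        rewrite <- Hv'; [easy|now apply Rmult_lt_0_compat].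
      * intros [r [Hr ->]]. assert (Hq : 0 < r / r0 <= 1).
        { split; [apply Rdiv_lt_0_compat; lra|]. apply (Rmult_le_reg_r r0); [lra|]. field_simplify; lra. }
        exists (r / r0, 0). split.
        -- split; [split; simpl; lra|split].
           ++ intro E. injection E. lra.
           ++ simpl. rewrite Hs0. split; [ring|]. split; intro; lra.
        -- rewrite hyp_map_right by (simpl; lra). simpl. unfold level; simpl. rewrite Rmult_0_r, sqrt_0, Rmult_0_r.
           replace (r0 * (r / r0)) with r by (field; lra). now rewrite <- Hv'.
  - assert (Hsp : 0 < fst p) by (destruct (Req_dec (fst p) 0) as [E|]; [rewrite E in Hz; lra|lra]).
    assert (Htp : 0 < snd p) by (destruct (Req_dec (snd p) 0) as [E|]; [rewrite E in Hz; lra|lra]).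
    set (C := level r0 p). set (h := fst p * snd p) in *.
    assert (Hh : 0 < h) by now apply Rmult_lt_0_compat.
    assert (HC : 0 < C) by (unfold C, level; fold h; apply Rmult_lt_0_compat; [easy|now apply sqrt_lt_R0]).
    assert (HC2 : C * C = r0 * r0 * h) by (apply level_square; easy).
    assert (Hh1 : h <= 1) by (unfold h; nra).
    assert (HC1 : C <= r0) by nra.
    destruct (hc_solution _ _ _ HU C ltac:(lra)) as [u [Hu Hu']].
    destruct (hc_solution _ _ _ HL C ltac:(lra)) as [v [Hv Hv']].
    assert (HlC : forall s, ln C <= s -> C <= exp s) by (intros s H; rewrite <- (exp_ln C) by easy; now apply exp_le_compat).
    apply (joined_arc F r0 c d C u v _ Hc Hd Hcd (conj HC HC1) Hu Hv).
    + rewrite <- Hu' by easy. now apply (hc_diag _ _ _ HU).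
    + rewrite <- Hv' by easy. now apply (hc_diag _ _ _ HL).
    + intros s H. rewrite <- (ln_exp s), <- Hu' by apply exp_pos. apply (hc_bounds _ _ _ HU); [|apply exp_pos].
      split; [lra|now apply HlC].
    + intros s H. rewrite <- (ln_exp s), <- Hv' by apply exp_pos. apply (hc_bounds _ _ _ HL); [|apply exp_pos].
      split; [lra|now apply HlC].
    + intro x. split.
      * intros [q [[Q1 [Q3 [Q4 Q5]]] ->]]. fold h in Q4.
        assert (HlC' : level r0 q = C) by (unfold C, level; fold h; now rewrite Q4).
        destruct Q1 as [Q1 Q2]. destruct (level_bounds r0 q Hr0 (conj Q1 Q2)) as [L0 [L1 L2]].
        assert (Hq1 : 0 < fst q) by (destruct (Req_dec (fst q) 0) as [E|]; [rewrite E in Q4; lra|lra]).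
        assert (Hq2 : 0 < snd q) by (destruct (Req_dec (snd q) 0) as [E|]; [rewrite E in Q4; lra|lra]).
        destruct (Rle_dec (snd q) (fst q)) as [Hle|Hle].
        -- exists (r0 * fst q). rewrite hyp_map_right by easy. rewrite HlC' in *. split; [split; [now apply L1|]|].
           ++ rewrite <- (Rmult_1_r r0) at 2. apply Rmult_le_compat_l; lra.
           ++ left. rewrite Hu'; [easy|now apply Rmult_lt_0_compat].
        -- exists (r0 * snd q). rewrite hyp_map_left by lra. rewrite HlC' in *. split; [split; [apply L2; lra|]|].
           ++ rewrite <- (Rmult_1_r r0) at 2. apply Rmult_le_compat_l; lra.
           ++ right. rewrite Hv'; [easy|now apply Rmult_lt_0_compat].
      * intros [r [Hr Hx]]. assert (Hr' : 0 < r) by lra.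
        (* The point of size [r] on the hyperbola of level [C]: the larger coordinate is [r / r0],
           and the product of the coordinates gives the other one. *)
        set (a := r / r0). set (b := C * C / (r * r0)).
        assert (Ha : 0 < a <= 1).
        { split; [apply Rdiv_lt_0_compat; lra|]. apply (Rmult_le_reg_r r0); [lra|]. unfold a. field_simplify; lra. }
        assert (Hrr : 0 < r * r0) by now apply Rmult_lt_0_compat.
        assert (Hb : 0 < b) by (apply Rdiv_lt_0_compat; [now apply Rmult_lt_0_compat|easy]).
        assert (Hba : b <= a).
        { apply (Rmult_le_reg_r (r * r0)); [easy|]. unfold a, b.
          replace (C * C / (r * r0) * (r * r0)) with (C * C) by (field; lra).
          replace (r / r0 * (r * r0)) with (r * r) by (field; lra). nra. }
        assert (Hab : a * b = h).
        { unfold a, b. rewrite HC2. field. lra. }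
        assert (Har : r0 * a = r) by (unfold a; field; lra).
        destruct Hx as [-> | ->].
        -- exists (a, b). split.
           ++ split; [split; simpl; lra|split; [intro E; injection E; lra|]]. simpl. split; [exact Hab|split; intro; lra].
           ++ rewrite hyp_map_right by (simpl; lra). unfold level; simpl. rewrite Hab, Har. change (r0 * sqrt h) with C. now rewrite Hu'.
        -- exists (b, a). split.
           ++ split; [split; simpl; lra|split; [intro E; injection E; lra|]]. simpl. split; [rewrite Rmult_comm; exact Hab|split; intro; lra].
           ++ rewrite hyp_map_left by (simpl; lra). unfold level; simpl. rewrite (Rmult_comm b a), Hab, Har. change (r0 * sqrt h) with C. now rewrite Hv'.
Qed.

End Hyperbolic.

(** * Rings of cells *)

Definition next (n i : nat) : nat := Nat.modulo (S i) n.

Lemma next_lt n i : (i < n)%nat -> (next n i < n)%nat.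
Proof. intro H. apply Nat.mod_upper_bound. lia. Qed.

Lemma next_succ n i : (S i < n)%nat -> next n i = S i.
Proof. intro H. now apply Nat.mod_small. Qed.

Lemma next_last n i : S i = n -> next n i = 0%nat.
Proof. intros <-. apply Nat.Div0.mod_same. Qed.

Lemma next_inj n i j : (i < n)%nat -> (j < n)%nat -> next n i = next n j -> i = j.
Proof.
  intros Hi Hj H.
  destruct (Nat.eq_dec (S i) n) as [Ei|Ei]; destruct (Nat.eq_dec (S j) n) as [Ej|Ej]; try lia.
  - rewrite (next_last n i Ei), next_succ in H by lia. lia.
  - rewrite (next_last n j Ej), next_succ in H by lia. lia.
  - rewrite !next_succ in H by lia. lia.
Qed.

Lemma next_onto n i : (i < n)%nat -> exists j, (j < n)%nat /\ next n j = i.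
Proof.
  intro H. destruct i as [|i].
  - exists (n - 1)%nat. split; [lia|]. apply next_last. lia.
  - exists i. split; [lia|]. now apply next_succ.
Qed.

(** For [n = 1] the last two alternatives describe the slit: the only cell meets itself along its
    two sides. *)
Definition cells_injective (n : nat) (c : nat -> cell) : Prop :=
  forall i j r r' x y, (i < n)%nat -> (j < n)%nat -> 0 < r -> 0 < r' ->
    lo (c i) <= x <= hi (c i) -> lo (c j) <= y <= hi (c j) -> point (c i) r x = point (c j) r' y ->
    r = r' /\ ((i = j /\ x = y) \/ (j = next n i /\ x = hi (c i) /\ y = lo (c j)) \/
               (i = next n j /\ y = hi (c j) /\ x = lo (c i))).

Definition cells_cover (n : nat) (c : nat -> cell) (r0 : R) : Prop :=
  locally (0, 0) (fun p => p = (0, 0) \/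
    exists i r x, (i < n)%nat /\ 0 < r <= r0 /\ lo (c i) <= x <= hi (c i) /\ p = point (c i) r x).

Record cell_ring (F : line_field) (r0 : R) (n : nat) (c : nat -> cell) : Prop := {
  cr_pos : 0 < r0;
  cr_good : forall i, (i < n)%nat -> good_cell F r0 (c i);
  cr_adjacent : forall i, (i < n)%nat -> adjacent r0 (c i) (c (next n i));
  cr_injective : cells_injective n c;
  cr_cover : cells_cover n c r0 }.

Lemma level_recover r0 p q : 0 < r0 -> square p -> square q -> level r0 p = level r0 q ->
  (fst p = fst q -> 0 < fst p -> p = q) /\ (snd p = snd q -> 0 < snd p -> p = q).
Proof.
  intros Hr0 Hp Hq Hl. pose proof (level_square r0 p Hp) as H1. pose proof (level_square r0 q Hq) as H2.
  rewrite Hl, H2 in H1. destruct p as [s t], q as [s' t']; simpl in *.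
  assert (Hr : r0 * r0 <> 0) by (apply Rgt_not_eq, Rmult_lt_0_compat; lra).
  apply Rmult_eq_reg_l in H1; [|easy].
  split; intros E Hpos; f_equal; try easy; subst.
  - apply (Rmult_eq_reg_l s'); lra.
  - apply (Rmult_eq_reg_r t'); lra.
Qed.

Lemma level_0 r0 p : 0 < r0 -> square p -> level r0 p = 0 -> fst p = 0 \/ snd p = 0.
Proof.
  intros Hr0 Hp Hl. pose proof (level_square r0 p Hp) as H. rewrite Hl in H.
  assert (Hr : r0 * r0 <> 0) by (apply Rgt_not_eq, Rmult_lt_0_compat; lra).
  assert (E : fst p * snd p = 0) by (apply (Rmult_eq_reg_l (r0 * r0)); lra).
  now apply Rmult_integral.
Qed.

Lemma square_cases p : square p -> p <> (0, 0) ->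
  (snd p <= fst p /\ 0 < fst p) \/ (fst p < snd p /\ 0 < snd p).
Proof.
  intros Hp Hn. pose proof (square_max_pos p Hp Hn) as H. destruct (Rle_lt_dec (snd p) (fst p)) as [Hl|Hl].
  - left. rewrite Rmax_left in H; easy.
  - right. rewrite Rmax_right in H; lra.
Qed.

Section Ring.
Context (F : line_field) (r0 : R) (n : nat) (c : nat -> cell) (HR : cell_ring F r0 n c).

Let Hr0 : 0 < r0 := cr_pos _ _ _ _ HR.

(** The inequality [k <= r] is strict on the other branch only, so that points of the diagonal are
    counted once. *)
Definition right_branch (i : nat) (r k x : R) : Prop := 0 <= k <= r /\ x = upper (c i) k r.
Definition left_branch (i : nat) (r k x : R) : Prop := 0 <= k < r /\ x = lower (c i) k r.

Lemma upper_range i k r : (i < n)%nat -> 0 <= k <= r -> 0 < r ->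
  lo (c i) < upper (c i) k r <= hi (c i) /\ upper (c i) 0 r <= upper (c i) k r /\
  (upper (c i) k r = hi (c i) -> k = r) /\ (upper (c i) k r = upper (c i) 0 r -> k = 0).
Proof.
  intros Hi Hk Hr. pose proof (cr_good _ _ _ _ HR i Hi) as HG. pose proof (good_upper F r0 _ HG) as HU.
  destruct HG as [_ [_ [_ [L [B [p [q [m HT]]]]]]]].
  split; [|split; [|split]].
  - split; [|apply (hc_bounds _ _ _ HU); lra].
    pose proof (right_leaf_bounds _ L B p q (hi (c i)) m (trapped_right _ _ _ _ _ _ _ _ HT) k r Hk Hr).
    pose proof (tr_order _ _ _ _ _ _ _ _ HT). unfold upper. lra.
  - destruct (proj1 Hk) as [Hk0|<-]; [|lra]. left. apply (upper_lt _ L B p q m); [easy|lra].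
  - intro E. rewrite <- (hc_diag _ _ _ HU r Hr) in E. apply (hc_injective _ _ _ HU) in E; lra.
  - intro E. apply (hc_injective _ _ _ HU) in E; lra.
Qed.

Lemma lower_range i k r : (i < n)%nat -> 0 <= k <= r -> 0 < r ->
  lo (c i) <= lower (c i) k r < hi (c i) /\ lower (c i) k r <= lower (c i) 0 r /\
  (lower (c i) k r = lo (c i) -> k = r) /\ (lower (c i) k r = lower (c i) 0 r -> k = 0).
Proof.
  intros Hi Hk Hr. pose proof (cr_good _ _ _ _ HR i Hi) as HG. pose proof (good_lower F r0 _ HG) as HU.
  destruct HG as [_ [_ [_ [L [B [p [q [m HT]]]]]]]].
  split; [|split; [|split]].
  - split; [apply (hc_bounds _ _ _ HU); lra|].
    pose proof (right_leaf_bounds _ L B _ _ _ m (trapped_left _ _ _ _ _ _ _ _ HT) k r Hk Hr).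
    pose proof (tr_order _ _ _ _ _ _ _ _ HT). unfold lower, left_leaf. lra.
  - destruct (proj1 Hk) as [Hk0|<-]; [|lra]. left. apply (lower_lt _ L B p q m); [easy|lra].
  - intro E. rewrite <- (hc_diag _ _ _ HU r Hr) in E. apply (hc_injective _ _ _ HU) in E; lra.
  - intro E. apply (hc_injective _ _ _ HU) in E; lra.
Qed.

Definition sector_map (i : nat) : R * R -> R * R := hyp_map (c i) (c (next n i)) r0.

Lemma sector_map_cases i p : (i < n)%nat -> square p -> p <> (0, 0) ->
  (0 < fst p /\ snd p <= fst p /\ exists x, right_branch i (r0 * fst p) (level r0 p) x /\
     sector_map i p = point (c i) (r0 * fst p) x) \/
  (0 < snd p /\ fst p < snd p /\ exists x, left_branch (next n i) (r0 * snd p) (level r0 p) x /\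
     sector_map i p = point (c (next n i)) (r0 * snd p) x).
Proof.
  intros Hi Hp Hn. destruct (level_bounds r0 p Hr0 Hp) as [L0 [L1 L2]].
  destruct (square_cases p Hp Hn) as [[Hl Hpos]|[Hl Hpos]].
  - left. split; [easy|split; [easy|]]. exists (upper (c i) (level r0 p) (r0 * fst p)).
    split; [split; [split; auto|easy]|]. unfold sector_map. now rewrite hyp_map_right.
  - right. split; [easy|split; [easy|]]. exists (lower (c (next n i)) (level r0 p) (r0 * snd p)).
    split; [split; [split; [easy|]|easy]|].
    + destruct (L2 ltac:(lra)) as [|E]; [easy|exfalso].
      pose proof (level_square r0 p Hp) as H. rewrite E in H.
      assert (Hr : r0 * r0 <> 0) by (apply Rgt_not_eq, Rmult_lt_0_compat; lra).
      assert (E' : snd p * snd p = fst p * snd p) by (apply (Rmult_eq_reg_l (r0 * r0)); lra).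
      apply Rmult_eq_reg_r in E'; lra.
    + unfold sector_map. rewrite (hyp_map_left F); try easy; try lra; [now apply (cr_good _ _ _ _ HR)|
        apply (cr_good _ _ _ _ HR); now apply next_lt|now apply (cr_adjacent _ _ _ _ HR)].
Qed.

Lemma point_pos_neq_0 e r x : 0 < r -> point e r x <> (0, 0).
Proof.
  intros Hr H. unfold point in H. injection H. intros H2 H1.
  pose proof (exp_pos (- height e x)). 
  assert (Hrho : r * exp (- height e x) <> 0) by (apply Rgt_not_eq, Rmult_lt_0_compat; lra).
  apply Rmult_integral in H1. apply Rmult_integral in H2.
  destruct H1 as [H1|H1]; [easy|]. destruct H2 as [H2|H2]; [easy|].
  pose proof (sin2_cos2 x) as Hsc. rewrite H1, H2 in Hsc. unfold Rsqr in Hsc. lra.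
Qed.

Lemma sector_map_neq_0 i p : (i < n)%nat -> square p -> p <> (0, 0) -> sector_map i p <> (0, 0).
Proof.
  intros Hi Hp Hn.
  destruct (sector_map_cases i p Hi Hp Hn) as [[Hpos [_ [x [_ ->]]]]|[Hpos [_ [x [_ ->]]]]];
    apply point_pos_neq_0; now apply Rmult_lt_0_compat.
Qed.

Lemma sector_map_corner i : sector_map i (0, 0) = (0, 0).
Proof. apply hyp_map_corner. Qed.

Lemma same_radius p q : 0 < p -> r0 * p = r0 * q -> p = q.
Proof. intros Hp H. apply (Rmult_eq_reg_l r0); lra. Qed.

(* Only the relative position of the two separatrices of each cell enters:
   [lower <= upper] suffices here, so that a cell may carry a parabolic sector. *)
Lemma sector_map_injective i j p q :
  (forall i r, (i < n)%nat -> 0 < r -> lower (c i) 0 r <= upper (c i) 0 r) ->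
  (i < n)%nat -> (j < n)%nat -> square p -> square q -> p <> (0, 0) -> q <> (0, 0) ->
  sector_map i p = sector_map j q ->
  (i = j /\ p = q) \/
  (j = next n i /\ (exists s, p = (0, s) /\ q = (s, 0)) /\ exists r, 0 < r /\ lower (c j) 0 r = upper (c j) 0 r) \/
  (i = next n j /\ (exists s, p = (s, 0) /\ q = (0, s)) /\ exists r, 0 < r /\ lower (c i) 0 r = upper (c i) 0 r).
Proof.
  intros Hlu Hi Hj Hp Hq Hpn Hqn HE.
  assert (Hni : (next n i < n)%nat) by now apply next_lt.
  assert (Hnj : (next n j < n)%nat) by now apply next_lt.
  destruct (sector_map_cases i p Hi Hp Hpn) as [[Pp [Pl [x [[Pk Px] PE]]]]|[Pp [Pl [x [[Pk Px] PE]]]]];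
  destruct (sector_map_cases j q Hj Hq Hqn) as [[Qp [Ql [y [[Qk Qy] QE]]]]|[Qp [Ql [y [[Qk Qy] QE]]]]];
  rewrite PE, QE in HE; clear PE QE.
  - assert (Rp : 0 < r0 * fst p) by now apply Rmult_lt_0_compat.
    assert (Rq : 0 < r0 * fst q) by now apply Rmult_lt_0_compat.
    destruct (upper_range i _ _ Hi Pk Rp) as [X1 [X2 [X3 X4]]]. destruct (upper_range j _ _ Hj Qk Rq) as [Y1 [Y2 [Y3 Y4]]].
    rewrite <- Px in *. rewrite <- Qy in *.
    destruct (cr_injective _ _ _ _ HR i j _ _ x y Hi Hj Rp Rq ltac:(lra) ltac:(lra) HE) as [HR' [[<- Hxy]|[[_ [_ H]]|[_ [_ H]]]]]; try lra.
    left. split; [easy|]. apply same_radius in HR'; [|easy].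
    rewrite Px, Qy, HR' in Hxy. rewrite HR' in Pk.
    apply (hc_injective _ _ _ (good_upper F r0 _ (cr_good _ _ _ _ HR i Hi))) in Hxy; try easy.
    now apply (proj1 (level_recover r0 p q Hr0 Hp Hq Hxy)).
  - assert (Rp : 0 < r0 * fst p) by now apply Rmult_lt_0_compat.
    assert (Rq : 0 < r0 * snd q) by now apply Rmult_lt_0_compat.
    destruct (upper_range i _ _ Hi Pk Rp) as [X1 [X2 [X3 X4]]]. destruct (lower_range (next n j) _ _ Hnj (conj (proj1 Qk) (Rlt_le _ _ (proj2 Qk))) Rq) as [Y1 [Y2 [Y3 Y4]]].
    rewrite <- Px in *. rewrite <- Qy in *.
    destruct (cr_injective _ _ _ _ HR i (next n j) _ _ x y Hi Hnj Rp Rq ltac:(lra) ltac:(lra) HE) as [HR' [[Hij Hxy]|[[_ [_ H]]|[_ [H _]]]]].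
    (* An upper leaf of a cell meets a lower one only if both are its separatrices and these
       coincide; both points then lie on sides of the squares. *)
    + right. right. split; [easy|]. pose proof (Hlu i _ Hi Rp) as Hlu'.
      apply same_radius in HR'; [|easy]. rewrite <- Hij, <- HR' in *.
      assert (Kp : level r0 p = 0) by (apply X4; lra). assert (Kq : level r0 q = 0) by (apply Y4; lra).
      split; [|exists (r0 * fst p); split; [easy|lra]].
      exists (fst p). apply level_0 in Kp; [|easy|easy]. apply level_0 in Kq; [|easy|easy].
      destruct p as [s t], q as [s' t']; simpl in *. split; f_equal; lra.
    + specialize (Y3 H). lra.
    + lra.
  - assert (Rp : 0 < r0 * snd p) by now apply Rmult_lt_0_compat.
    assert (Rq : 0 < r0 * fst q) by now apply Rmult_lt_0_compat.
    destruct (upper_range j _ _ Hj Qk Rq) as [X1 [X2 [X3 X4]]]. destruct (lower_range (next n i) _ _ Hni (conj (proj1 Pk) (Rlt_le _ _ (proj2 Pk))) Rp) as [Y1 [Y2 [Y3 Y4]]].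
    rewrite <- Px in *. rewrite <- Qy in *.
    destruct (cr_injective _ _ _ _ HR (next n i) j _ _ x y Hni Hj Rp Rq ltac:(lra) ltac:(lra) HE) as [HR' [[Hij Hxy]|[[_ [H _]]|[_ [_ H]]]]].
    + right. left. split; [easy|]. pose proof (Hlu j _ Hj Rq) as Hlu'.
      apply same_radius in HR'; [|easy]. rewrite Hij, HR' in *.
      assert (Kq : level r0 q = 0) by (apply X4; lra). assert (Kp : level r0 p = 0) by (apply Y4; lra).
      split; [|exists (r0 * fst q); split; [easy|lra]].
      exists (fst q). apply level_0 in Kp; [|easy|easy]. apply level_0 in Kq; [|easy|easy].
      destruct p as [s t], q as [s' t']; simpl in *. split; f_equal; lra.
    + lra.
    + specialize (Y3 H). lra.
  - assert (Rp : 0 < r0 * snd p) by now apply Rmult_lt_0_compat.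
    assert (Rq : 0 < r0 * snd q) by now apply Rmult_lt_0_compat.
    destruct (lower_range (next n i) _ _ Hni (conj (proj1 Pk) (Rlt_le _ _ (proj2 Pk))) Rp) as [X1 [X2 [X3 X4]]].
    destruct (lower_range (next n j) _ _ Hnj (conj (proj1 Qk) (Rlt_le _ _ (proj2 Qk))) Rq) as [Y1 [Y2 [Y3 Y4]]].
    rewrite <- Px in *. rewrite <- Qy in *.
    destruct (cr_injective _ _ _ _ HR (next n i) (next n j) _ _ x y Hni Hnj Rp Rq ltac:(lra) ltac:(lra) HE) as [HR' [[Hij Hxy]|[[_ [H _]]|[_ [H _]]]]]; try lra.
    left. split; [now apply (next_inj n)|]. apply same_radius in HR'; [|easy].
    rewrite Px, Qy, HR', <- Hij in Hxy. rewrite HR' in Pk.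
    apply (hc_injective _ _ _ (good_lower F r0 _ (cr_good _ _ _ _ HR _ Hni))) in Hxy; try easy; try lra.
    now apply (proj2 (level_recover r0 p q Hr0 Hp Hq Hxy)).
Qed.

Lemma sector_map_side i s : (i < n)%nat -> 0 < s ->
  sector_map i (s, 0) = point (c i) (r0 * s) (upper (c i) 0 (r0 * s)) /\
  sector_map i (0, s) = point (c (next n i)) (r0 * s) (lower (c (next n i)) 0 (r0 * s)).
Proof.
  intros Hi Hs. unfold sector_map. split.
  - rewrite hyp_map_right by (simpl; lra). unfold level; simpl. now rewrite Rmult_0_r, sqrt_0, Rmult_0_r.
  - rewrite (hyp_map_left F); simpl; try lra; [|now apply (cr_good _ _ _ _ HR)|
        apply (cr_good _ _ _ _ HR); now apply next_lt|now apply (cr_adjacent _ _ _ _ HR)].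
    unfold level; simpl. now rewrite Rmult_0_l, sqrt_0, Rmult_0_r.
Qed.

Lemma level_coordinates r k : 0 < r <= r0 -> 0 <= k <= r ->
  let a := r / r0 in let b := k * k / (r * r0) in
  0 < a <= 1 /\ 0 <= b <= a /\ r0 * a = r /\ level r0 (a, b) = k /\ level r0 (b, a) = k.
Proof.
  intros Hr Hk a b.
  assert (Hrr : 0 < r * r0) by (apply Rmult_lt_0_compat; lra).
  assert (Ha : 0 < a <= 1).
  { split; [apply Rdiv_lt_0_compat; lra|]. apply (Rmult_le_reg_r r0); [lra|]. unfold a. field_simplify; lra. }
  assert (Hb : 0 <= b).
  { apply Rmult_le_pos; [apply Rmult_le_pos; lra|]. left. now apply Rinv_0_lt_compat. }
  assert (Hba : b <= a).
  { apply (Rmult_le_reg_r (r * r0)); [easy|]. unfold a, b.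
    replace (k * k / (r * r0) * (r * r0)) with (k * k) by (field; lra).
    replace (r / r0 * (r * r0)) with (r * r) by (field; lra). nra. }
  assert (Hl : level r0 (a, b) = k).
  { unfold level; simpl. replace (a * b) with ((k / r0) * (k / r0)) by (unfold a, b; field; lra).
    rewrite sqrt_square; [field; lra|]. apply Rmult_le_pos; [lra|]. left. now apply Rinv_0_lt_compat. }
  repeat split; try lra; try easy.
  - unfold a; field; lra.
  - rewrite <- Hl. unfold level; simpl. now rewrite (Rmult_comm b a).
Qed.

Lemma sector_map_onto_right i r x : (i < n)%nat -> 0 < r <= r0 -> upper (c i) 0 r <= x <= hi (c i) ->
  exists p, square p /\ point (c i) r x = sector_map i p.
Proof.
  intros Hi Hr Hx. destruct (cr_good _ _ _ _ HR i Hi) as [_ [_ [_ [L [B [p [q [m HT]]]]]]]].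
  destruct (upper_onto _ L B p q m r x HT ltac:(lra) Hx) as [k [Hk <-]].
  destruct (level_coordinates r k Hr Hk) as [Ha [Hb [Har [Hl _]]]].
  exists (r / r0, k * k / (r * r0)). split; [split; simpl; lra|].
  unfold sector_map. rewrite hyp_map_right by (simpl; lra). rewrite Hl. simpl. now rewrite Har.
Qed.

Lemma sector_map_onto_left i r x : (i < n)%nat -> 0 < r <= r0 -> lo (c (next n i)) <= x <= lower (c (next n i)) 0 r ->
  exists p, square p /\ point (c (next n i)) r x = sector_map i p.
Proof.
  intros Hi Hr Hx. pose proof (next_lt n i Hi) as Hni.
  destruct (cr_good _ _ _ _ HR _ Hni) as [_ [_ [_ [L [B [p [q [m HT]]]]]]]].
  destruct (lower_onto _ L B p q m r x HT ltac:(lra) Hx) as [k [Hk <-]].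
  destruct (level_coordinates r k Hr Hk) as [Ha [Hb [Har [_ Hl]]]].
  exists (k * k / (r * r0), r / r0). split; [split; simpl; lra|].
  unfold sector_map. rewrite (hyp_map_left F); simpl; try lra; [|now apply (cr_good _ _ _ _ HR)|
        now apply (cr_good _ _ _ _ HR)|now apply (cr_adjacent _ _ _ _ HR)].
  rewrite Hl. now rewrite Har.
Qed.

Lemma sector_map_side_0 i : sector_map i (0, 0) = sector_map (next n i) (0, 0).
Proof. now rewrite !sector_map_corner. Qed.

(** The sector [i] fills the upper half of the cell [i] and the lower half of the next cell. When
    each cell has a single separatrix these halves leave nothing uncovered, and consecutive sectors
    share a separatrix. *)
Theorem thin_sectors : (0 < n)%nat ->
  (forall i r, (i < n)%nat -> 0 < r -> lower (c i) 0 r = upper (c i) 0 r) ->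
  has_sectors F (0, 0) (repeat hyperbolic n).
Proof.
  intros Hn Hthin. exists sector_map. unfold sector_decomposition. rewrite repeat_length.
  split; [|split; [|split; [|split; [|split]]]].
  - intros i p Hi Hp. apply (hyp_map_continuous F); try easy; [now apply (cr_good _ _ _ _ HR)|
        apply (cr_good _ _ _ _ HR); now apply next_lt|now apply (cr_adjacent _ _ _ _ HR)].
  - intros i _. apply sector_map_corner.
  - intros i s Hi [[Hs| <-] _]; [|apply sector_map_side_0].
    change (Nat.modulo (S i) n) with (next n i). pose proof (next_lt n i Hi) as Hni.
    rewrite (proj2 (sector_map_side i s Hi Hs)), (proj1 (sector_map_side _ s Hni Hs)).
    f_equal. apply Hthin; [easy|now apply Rmult_lt_0_compat].
  - intros i j p q Hi Hj Hp Hq HE.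
    destruct (Classical_Prop.classic (p = (0, 0))) as [->|Hpn].
    { left. split; [easy|]. apply Classical_Prop.NNPP. intro Hqn. rewrite sector_map_corner in HE.
      now apply (sector_map_neq_0 j q Hj Hq Hqn). }
    destruct (Classical_Prop.classic (q = (0, 0))) as [->|Hqn].
    { exfalso. rewrite sector_map_corner in HE. now apply (sector_map_neq_0 i p Hi Hp Hpn). }
    right. assert (Hle : forall i r, (i < n)%nat -> 0 < r -> lower (c i) 0 r <= upper (c i) 0 r) by (intros; right; auto).
    destruct (sector_map_injective i j p q Hle Hi Hj Hp Hq Hpn Hqn HE) as [H|[[H1 [H2 _]]|[H1 [H2 _]]]]; auto.
  - intros i p Hi Hp Hpn. rewrite nth_repeat. apply (hyp_map_leaf F); try easy; [now apply (cr_good _ _ _ _ HR)|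
        apply (cr_good _ _ _ _ HR); now apply next_lt|now apply (cr_adjacent _ _ _ _ HR)].
  - refine (filter_imp _ _ _ (cr_cover _ _ _ _ HR)). intros x [->|[i [r [y [Hi [Hr [Hy ->]]]]]]].
    + exists 0%nat, (0, 0). split; [easy|split; [split; simpl; lra|now rewrite sector_map_corner]].
    + destruct (Rle_lt_dec (upper (c i) 0 r) y) as [Hl|Hl].
      * destruct (sector_map_onto_right i r y Hi Hr ltac:(lra)) as [p [Hp HE]]. now exists i, p.
      (* Below the separatrix of its cell a point belongs to the previous sector. *)
      * destruct (next_onto n i Hi) as [j [Hj Hji]].
        assert (Hy' : lo (c (next n j)) <= y <= lower (c (next n j)) 0 r) by (rewrite Hji, Hthin; [lra|easy|lra]).
        destruct (sector_map_onto_left j r y Hj Hr Hy') as [p [Hp HE]]. exists j, p.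
        rewrite Hji in HE. easy.
Qed.
End Ring.

(** * Parabolic sectors *)

(** The leaves of the parabolic model are its level sets; together with the larger coordinate, which
    plays the role of the size, it determines a point of the square. *)
Definition ray (p : R * R) : R := snd p / (fst p + snd p).

Lemma ray_bounds p : square p -> p <> (0, 0) -> 0 < fst p + snd p /\ 0 <= ray p <= 1.
Proof.
  intros Hp Hn. assert (Hs : 0 < fst p + snd p).
  { destruct Hp as [H1 H2]. destruct (square_cases p (conj H1 H2) Hn); lra. }
  split; [easy|]. destruct Hp as [H1 H2]. unfold ray. split.
  - apply Rmult_le_pos; [lra|]. left. now apply Rinv_0_lt_compat.
  - apply (Rmult_le_reg_r (fst p + snd p)); [easy|]. field_simplify; lra.
Qed.

Lemma ray_max_injective p q : square p -> square q -> p <> (0, 0) -> q <> (0, 0) ->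
  Rmax (fst p) (snd p) = Rmax (fst q) (snd q) -> ray p = ray q -> p = q.
Proof.
  intros Hp Hq Hpn Hqn Hm Hr.
  destruct (ray_bounds p Hp Hpn) as [Sp _]. destruct (ray_bounds q Hq Hqn) as [Sq _].
  assert (E : fst p * snd q = fst q * snd p).
  { unfold ray in Hr. apply (f_equal (fun x => x * (fst p + snd p) * (fst q + snd q))) in Hr.
    field_simplify in Hr; lra. }
  destruct Hp as [H1 H2], Hq as [H3 H4], p as [s t], q as [s' t']; simpl in *.
  revert Hm. unfold Rmax. destruct (Rle_dec s t), (Rle_dec s' t'); intro Hm; f_equal; try easy; subst; try nra.
Qed.

Lemma ray_exists r0 r k : 0 < r <= r0 -> 0 <= k <= 1 ->
  exists p, square p /\ p <> (0, 0) /\ r0 * Rmax (fst p) (snd p) = r /\ ray p = k.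
Proof.
  intros Hr Hk. set (a := r / r0).
  assert (Ha : 0 < a <= 1).
  { split; [apply Rdiv_lt_0_compat; lra|]. apply (Rmult_le_reg_r r0); [lra|]. unfold a. field_simplify; lra. }
  assert (Har : r0 * a = r) by (unfold a; field; lra).
  (* The ratio decides which of the two coordinates is the larger one, equal to [r / r0]. *)
  destruct (Rle_dec k (1 / 2)) as [Hk2|Hk2].
  - assert (0 < / (1 - k)) by (apply Rinv_0_lt_compat; lra).
    set (b := a * (k / (1 - k))).
    assert (Hb0 : 0 <= k / (1 - k)) by (apply Rmult_le_pos; lra).
    assert (Hb1 : k / (1 - k) <= 1) by (apply (Rmult_le_reg_r (1 - k)); [lra|]; field_simplify; lra).
    assert (0 <= b <= a) by (unfold b; split; [apply Rmult_le_pos; lra|rewrite <- (Rmult_1_r a) at 2; apply Rmult_le_compat_l; lra]).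
    exists (a, b). split; [split; simpl; lra|split; [intro E; injection E; lra|split]].
    + simpl. rewrite Rmax_left; lra.
    + unfold ray, b; simpl. field. lra.
  - assert (0 < / k) by (apply Rinv_0_lt_compat; lra).
    set (b := a * ((1 - k) / k)).
    assert (Hb0 : 0 <= (1 - k) / k) by (apply Rmult_le_pos; lra).
    assert (Hb1 : (1 - k) / k <= 1) by (apply (Rmult_le_reg_r k); [lra|]; field_simplify; lra).
    assert (0 <= b <= a) by (unfold b; split; [apply Rmult_le_pos; lra|rewrite <- (Rmult_1_r a) at 2; apply Rmult_le_compat_l; lra]).
    exists (b, a). split; [split; simpl; lra|split; [intro E; injection E; lra|split]].
    + simpl. rewrite Rmax_right; lra.
    + unfold ray, b; simpl. field. lra.
Qed.

Section Fat.
Context (F : line_field) (r0 : R) (cs : nat -> cell) (HR : cell_ring F r0 1 cs).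
Context (Hfat : forall r, 0 < r -> lower (cs 0%nat) 0 r < upper (cs 0%nat) 0 r).

Local Notation c := (cs 0%nat).
Let Hr0 : 0 < r0 := cr_pos _ _ _ _ HR.
Let HG : good_cell F r0 c := cr_good _ _ _ _ HR 0%nat Nat.lt_0_1.

(* The ray [t / (s + t) = k] goes to the leaf which, at size [r0], divides the
   interval between the two separatrices in the ratio [k]. *)
Definition par_start (k : R) : R := (1 - k) * lower c 0 r0 + k * upper c 0 r0.
Definition par_leaf (k r : R) : R := flow (field c) (ln r0) (par_start k) (ln r).
Definition par_map (p : R * R) : R * R :=
  let r := r0 * Rmax (fst p) (snd p) in point c r (par_leaf (ray p) r).

Lemma good_field : exists L B, lipschitz_field (field c) L B.
Proof. destruct HG as [_ [_ [_ [L [B [p [q [m HT]]]]]]]]. exists L, B. apply (tr_field _ _ _ _ _ _ _ _ HT). Qed.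

Lemma par_leaf_solution k : solution (field c) (flow (field c) (ln r0) (par_start k)).
Proof. destruct good_field as [L [B HF]]. apply (flow_spec _ L B _ _ HF). Qed.

Lemma par_start_mono k k' : k < k' -> par_start k < par_start k'.
Proof. intro H. unfold par_start. pose proof (Hfat r0 Hr0) as H1. nra. Qed.

Lemma par_leaf_mono k k' r : k < k' -> par_leaf k r < par_leaf k' r.
Proof.
  intro H. destruct good_field as [L [B HF]]. unfold par_leaf.
  apply (solution_order _ L B _ _ (ln r0) _ HF); try apply par_leaf_solution.
  rewrite !(proj2 (flow_spec _ L B _ _ HF)). now apply par_start_mono.
Qed.

Lemma par_leaf_0 r : 0 < r -> par_leaf 0 r = lower c 0 r.
Proof.
  intro Hr. destruct good_field as [L [B HF]].
  destruct (hc_solution _ _ _ (good_lower F r0 c HG) 0 ltac:(lra)) as [u [Hu Hu']].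
  rewrite (Hu' r Hr). unfold par_leaf. apply (solution_unique _ L B _ _ (ln r0) _ HF); [apply par_leaf_solution|easy|].
  rewrite (proj2 (flow_spec _ L B _ _ HF)), <- (Hu' r0 Hr0). unfold par_start. ring.
Qed.

Lemma par_leaf_1 r : 0 < r -> par_leaf 1 r = upper c 0 r.
Proof.
  intro Hr. destruct good_field as [L [B HF]].
  destruct (hc_solution _ _ _ (good_upper F r0 c HG) 0 ltac:(lra)) as [u [Hu Hu']].
  rewrite (Hu' r Hr). unfold par_leaf. apply (solution_unique _ L B _ _ (ln r0) _ HF); [apply par_leaf_solution|easy|].
  rewrite (proj2 (flow_spec _ L B _ _ HF)), <- (Hu' r0 Hr0). unfold par_start. ring.
Qed.

Lemma par_leaf_bounds k r : 0 <= k <= 1 -> 0 < r ->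
  lower c 0 r <= par_leaf k r <= upper c 0 r /\ lo c < par_leaf k r < hi c /\
  (par_leaf k r = lower c 0 r -> k = 0) /\ (par_leaf k r = upper c 0 r -> k = 1).
Proof.
  intros Hk Hr. pose proof (par_leaf_0 r Hr) as E0. pose proof (par_leaf_1 r Hr) as E1.
  assert (H0 : lower c 0 r <= par_leaf k r).
  { rewrite <- E0. destruct (proj1 Hk) as [H|<-]; [left; now apply par_leaf_mono|lra]. }
  assert (H1 : par_leaf k r <= upper c 0 r).
  { rewrite <- E1. destruct (proj2 Hk) as [H| ->]; [left; now apply par_leaf_mono|lra]. }
  destruct (upper_range F r0 1 cs HR 0 0 r Nat.lt_0_1 ltac:(lra) Hr) as [_ [_ [U _]]].
  destruct (lower_range F r0 1 cs HR 0 0 r Nat.lt_0_1 ltac:(lra) Hr) as [_ [_ [V _]]].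
  destruct (upper_range F r0 1 cs HR 0 0 r Nat.lt_0_1 ltac:(lra) Hr) as [U1 _].
  destruct (lower_range F r0 1 cs HR 0 0 r Nat.lt_0_1 ltac:(lra) Hr) as [V1 _].
 
  assert (upper c 0 r <> hi c) by (intro E; specialize (U E); lra).
  assert (lower c 0 r <> lo c) by (intro E; specialize (V E); lra).
  split; [lra|split; [lra|split]]; intro E.
  - destruct (proj1 Hk) as [Hlt|<-]; [|easy]. apply (par_leaf_mono _ _ r) in Hlt. lra.
  - destruct (proj2 Hk) as [Hgt| ->]; [|easy]. apply (par_leaf_mono _ _ r) in Hgt. lra.
Qed.

(** The leaf through the given point is followed to size [r0]. The order between solutions keeps it
    between the two separatrices, where its ratio is read off. *)
Lemma par_leaf_onto r x : 0 < r -> lower c 0 r <= x <= upper c 0 r -> exists k, 0 <= k <= 1 /\ par_leaf k r = x.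
Proof.
  intros Hr Hx. destruct good_field as [L [B HF]].
  set (v := flow (field c) (ln r) x).
  destruct (flow_spec _ L B (ln r) x HF) as [Hv Hv0]. fold v in Hv, Hv0.
  assert (H0 : lower c 0 r0 <= v (ln r0)).
  { rewrite <- (par_leaf_0 r0 Hr0). unfold par_leaf. apply (solution_order_le _ L B _ _ (ln r) _ HF); [apply par_leaf_solution|easy|].
    change (par_leaf 0 r <= v (ln r)). rewrite par_leaf_0, Hv0; lra. }
  assert (H1 : v (ln r0) <= upper c 0 r0).
  { rewrite <- (par_leaf_1 r0 Hr0). unfold par_leaf. apply (solution_order_le _ L B _ _ (ln r) _ HF); [easy|apply par_leaf_solution|].
    change (v (ln r) <= par_leaf 1 r). rewrite par_leaf_1, Hv0; lra. }
  pose proof (Hfat r0 Hr0) as Hf.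
  set (d := upper c 0 r0 - lower c 0 r0). assert (Hd : 0 < d) by (unfold d; lra).
  set (k := (v (ln r0) - lower c 0 r0) / d).
  exists k. split; [split|].
  - apply Rmult_le_pos; [lra|]. left. now apply Rinv_0_lt_compat.
  - apply (Rmult_le_reg_r d); [easy|]. unfold k. field_simplify; [|lra]. unfold d. lra.
  - rewrite <- Hv0. unfold par_leaf. apply (solution_unique _ L B _ _ (ln r0) _ HF); [apply par_leaf_solution|easy|].
    rewrite (proj2 (flow_spec _ L B _ _ HF)). unfold par_start.
    replace (v (ln r0)) with (lower c 0 r0 + k * d) by (unfold k; field; lra). unfold d. ring.
Qed.

Lemma par_leaf_continuous k0 a : 0 < a -> forall eps, 0 < eps ->
  exists d, 0 < d /\ forall k r, Rabs (k - k0) < d -> Rabs (r - a) < d -> Rabs (par_leaf k r - par_leaf k0 a) < eps.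
Proof.
  intros Ha eps Heps. destruct good_field as [L [B HF]].
  pose proof (lf_pos _ _ _ HF) as HL. pose proof (lf_bound_pos _ _ _ HF) as HB.
  destruct (continuous_eps ln a (continuous_ln a Ha) (eps / 2 / (B + 1))) as [d1 [Hd1 Hd1']].
  { apply Rdiv_lt_0_compat; lra. }
  set (K := (upper c 0 r0 - lower c 0 r0) * exp (L * Rabs (ln a - ln r0))).
  pose proof (Hfat r0 Hr0) as Hf.
  assert (HK : 0 < K) by (apply Rmult_lt_0_compat; [lra|apply exp_pos]).
  assert (Hd2 : 0 < eps / 2 / K) by (apply Rdiv_lt_0_compat; lra).
  exists (Rmin d1 (eps / 2 / K)). split; [now apply Rmin_glb_lt|].
  intros k r Hk Hr. pose proof (Rmin_l d1 (eps / 2 / K)). pose proof (Rmin_r d1 (eps / 2 / K)).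
  replace (par_leaf k r - par_leaf k0 a) with ((par_leaf k r - par_leaf k a) + (par_leaf k a - par_leaf k0 a)) by ring.
  apply Rle_lt_trans with (1 := Rabs_triang _ _).
  assert (H1 : Rabs (par_leaf k r - par_leaf k a) < eps / 2).
  { apply Rle_lt_trans with (1 := solution_lipschitz _ L B _ (ln r) (ln a) HF (par_leaf_solution k)).
    specialize (Hd1' r ltac:(lra)).
    apply Rle_lt_trans with ((B + 1) * Rabs (ln r - ln a)); [apply Rmult_le_compat_r; [apply Rabs_pos|lra]|].
    apply Rmult_lt_compat_l with (r := B + 1) in Hd1'; [|lra].
    replace ((B + 1) * (eps / 2 / (B + 1))) with (eps / 2) in Hd1' by (field; lra). easy. }
  assert (H2 : Rabs (par_leaf k a - par_leaf k0 a) < eps / 2).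
  { apply Rle_lt_trans with (1 := solution_gronwall _ L B _ _ (ln r0) (ln a) HF (par_leaf_solution k) (par_leaf_solution k0)).
    rewrite !(proj2 (flow_spec _ L B _ _ HF)).
    replace (par_start k - par_start k0) with ((upper c 0 r0 - lower c 0 r0) * (k - k0)) by (unfold par_start; ring).
    rewrite Rabs_mult, (Rabs_pos_eq (upper c 0 r0 - _)) by lra.
    replace (_ * _ * exp _) with (K * Rabs (k - k0)) by (unfold K; ring).
    replace (eps / 2) with (K * (eps / 2 / K)) by (field; lra). apply Rmult_lt_compat_l; lra. }
  lra.
Qed.

Lemma par_map_0 : par_map (0, 0) = (0, 0).
Proof. unfold par_map. simpl. rewrite Rmax_left, Rmult_0_r by lra. apply point_0. Qed.

Lemma max_filterlim (D : R * R -> Prop) (p : R * R) :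
  filterlim (fun q => r0 * Rmax (fst q) (snd q)) (within D (locally p)) (locally (r0 * Rmax (fst p) (snd p))).
Proof.
  apply (filterlim_mult_R (within D (locally p)) (fun _ => r0)); [apply filterlim_const|].
  apply filterlim_locally. intro eps. exists eps. intros q [H1 H2] _.
  change (Rabs (fst q - fst p) < eps) in H1. change (Rabs (snd q - snd p) < eps) in H2.
  change (Rabs (Rmax (fst q) (snd q) - Rmax (fst p) (snd p)) < eps).
  apply Rabs_def2 in H1. apply Rabs_def2 in H2. 
  unfold Rmax. destruct (Rle_dec (fst q) (snd q)), (Rle_dec (fst p) (snd p)); apply Rabs_def1; lra.
Qed.

Lemma par_map_continuous p : square p -> filterlim par_map (within square (locally p)) (locally (par_map p)).
Proof.
  intro Hp. destruct (Classical_Prop.classic (p = (0, 0))) as [->|Hn].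
  - rewrite par_map_0. apply filterlim_locally. intro eps.
    destruct HG as [_ [[H1 HH1] _]].
    set (K := Rabs H1 + 1). assert (HK : 0 < K) by (unfold K; pose proof (Rabs_pos H1); lra).
    assert (Hdel : 0 < eps / (r0 * K)) by (apply Rdiv_lt_0_compat; [apply cond_pos|now apply Rmult_lt_0_compat]).
    assert (Hsmall : forall q : R * R, square q -> fst q < eps / (r0 * K) -> snd q < eps / (r0 * K) -> ball (0, 0) eps (par_map q)).
    { intros q Hsq Hf Hs. destruct (Classical_Prop.classic (q = (0, 0))) as [->|Hqn]; [rewrite par_map_0; apply ball_center|].
      pose proof (square_max_pos q Hsq Hqn) as Hm. destruct (ray_bounds q Hsq Hqn) as [_ Hk].
      unfold par_map. set (a := Rmax (fst q) (snd q)) in *. set (x := par_leaf (ray q) (r0 * a)).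
      assert (Ha : a < eps / (r0 * K)) by now apply Rmax_lub_lt.
      assert (Hra : 0 < r0 * a) by now apply Rmult_lt_0_compat.
      destruct (par_leaf_bounds (ray q) (r0 * a) Hk Hra) as [_ [Hx _]]. fold x in Hx.
      assert (Hb : r0 * a * H1 < eps).
      { apply Rle_lt_trans with (r0 * a * K); [apply Rmult_le_compat_l; [lra|pose proof (Rle_abs H1); unfold K; lra]|].
        replace (pos eps) with (r0 * K * (eps / (r0 * K))) by (field; lra).
        replace (r0 * a * K) with (r0 * K * a) by ring. apply Rmult_lt_compat_l; [now apply Rmult_lt_0_compat|lra]. }
      destruct (point_small c H1 (r0 * a) x ltac:(lra) (HH1 x ltac:(lra))) as [G1 G2].
      split; [change (Rabs (fst (point c (r0 * a) x) - 0) < eps)|change (Rabs (snd (point c (r0 * a) x) - 0) < eps)]; rewrite Rminus_0_r; lra. }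
    exists (mkposreal _ Hdel). intros q Hq Hsq.
    assert (Hfst : fst q < eps / (r0 * K)).
    { destruct Hq as [Hq _]. change (Rabs (fst q - 0) < eps / (r0 * K)) in Hq. apply Rabs_def2 in Hq. lra. }
    assert (Hsnd : snd q < eps / (r0 * K)).
    { destruct Hq as [_ Hq]. change (Rabs (snd q - 0) < eps / (r0 * K)) in Hq. apply Rabs_def2 in Hq. lra. }
    now apply Hsmall.
  - pose proof (square_max_pos p Hp Hn) as Hm. destruct (ray_bounds p Hp Hn) as [Hsum _].
    unfold par_map. apply (point_filterlim (within square (locally p)) c (fun q => r0 * Rmax (fst q) (snd q))
      (fun q => par_leaf (ray q) (r0 * Rmax (fst q) (snd q)))); [apply HG|apply max_filterlim|].
    assert (Hray : filterlim ray (within square (locally p)) (locally (ray p))).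
    { unfold ray, Rdiv. apply (filterlim_mult_R (within square (locally p))); [apply filterlim_snd_R|].
      apply (filterlim_comp_R (within square (locally p)) Rinv (fun q => fst q + snd q)).
      - apply (continuous_Rinv (fst p + snd p)). now apply Rgt_not_eq.
      - refine (filterlim_comp_2 (G:=locally (fst p)) (H:=locally (snd p)) fst snd Rplus (filterlim_fst_R _ _) (filterlim_snd_R _ _) _).
        apply (filterlim_plus (fst p) (snd p)). }
    apply filterlim_locally. intro eps.
    destruct (par_leaf_continuous (ray p) (r0 * Rmax (fst p) (snd p)) ltac:(now apply Rmult_lt_0_compat) eps (cond_pos eps)) as [d [Hd Hc]].
    generalize (filter_and _ _ (proj1 (filterlim_locally _ _) Hray (mkposreal _ Hd)) (proj1 (filterlim_locally _ _) (max_filterlim square p) (mkposreal _ Hd))).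
    apply filter_imp. intros q [Q1 Q2]. now apply Hc.
Qed.

Lemma par_map_leaf p : square p -> p <> (0, 0) ->
  leaf_arc F (fun x => exists q, model_leaf parabolic p q /\ x = par_map q).
Proof.
  intros Hp Hn. destruct (ray_bounds p Hp Hn) as [Hsum Hk].
  apply (single_arc F r0 c (flow (field c) (ln r0) (par_start (ray p))) _ HG Hr0 (par_leaf_solution _)).
  - intros s _. rewrite <- (ln_exp s). change (lo c <= par_leaf (ray p) (exp s) <= hi c).
    destruct (par_leaf_bounds (ray p) (exp s) Hk (exp_pos s)) as [_ [H _]]. lra.
  - assert (Hmodel : forall q, square q -> q <> (0, 0) -> (fst q * snd p = snd q * fst p <-> ray q = ray p)).
    { intros q Hq Hqn. destruct (ray_bounds q Hq Hqn) as [Sq _]. unfold ray. split; intro E.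
      - apply (Rmult_eq_reg_r ((fst q + snd q) * (fst p + snd p))); [|apply Rgt_not_eq; now apply Rmult_lt_0_compat].
        field_simplify; lra.
      - apply (f_equal (fun x => x * (fst p + snd p) * (fst q + snd q))) in E. field_simplify in E; lra. }
    intro x. split.
    + intros [q [[Hq [Hqn HE]] ->]]. apply Hmodel in HE; [|easy|easy].
      pose proof (square_max_pos q Hq Hqn) as Hm.
      exists (r0 * Rmax (fst q) (snd q)). split.
      * split; [now apply Rmult_lt_0_compat|]. rewrite <- (Rmult_1_r r0) at 2. apply Rmult_le_compat_l; [lra|].
        destruct Hq. apply Rmax_lub; lra.
      * unfold par_map. now rewrite HE.
    + intros [r [Hr ->]]. destruct (ray_exists r0 r (ray p) Hr Hk) as [q [Hq [Hqn [HM HE]]]].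
      exists q. split; [split; [easy|split; [easy|now apply Hmodel]]|].
      unfold par_map. now rewrite HM, HE.
Qed.

Lemma par_map_side s : 0 < s ->
  par_map (s, 0) = point c (r0 * s) (lower c 0 (r0 * s)) /\ par_map (0, s) = point c (r0 * s) (upper c 0 (r0 * s)).
Proof.
  intro Hs. assert (Hrs : 0 < r0 * s) by now apply Rmult_lt_0_compat.
  unfold par_map, ray; simpl. rewrite Rmax_left, Rmax_right by lra.
  replace (0 / (s + 0)) with 0 by (field; lra). replace (s / (0 + s)) with 1 by (field; lra).
  now rewrite par_leaf_0, par_leaf_1.
Qed.

Lemma par_map_neq_0 p : square p -> p <> (0, 0) -> par_map p <> (0, 0).
Proof.
  intros Hp Hn. apply point_pos_neq_0. apply Rmult_lt_0_compat; [easy|]. now apply square_max_pos.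
Qed.

Lemma ray_0 p : square p -> p <> (0, 0) -> ray p = 0 -> p = (fst p, 0) /\ 0 < fst p /\ Rmax (fst p) (snd p) = fst p.
Proof.
  intros Hp Hn H. destruct (ray_bounds p Hp Hn) as [Hs _]. unfold ray in H.
  apply Rmult_integral in H. destruct H as [H|H]; [|apply Rinv_neq_0_compat in H; lra].
  destruct p as [s t]; simpl in *. subst. rewrite Rmax_left by lra. split; [easy|lra].
Qed.

Lemma ray_1 p : square p -> p <> (0, 0) -> ray p = 1 -> p = (0, snd p) /\ 0 < snd p /\ Rmax (fst p) (snd p) = snd p.
Proof.
  intros Hp Hn H. destruct (ray_bounds p Hp Hn) as [Hs _]. unfold ray in H.
  assert (E : fst p = 0) by (apply (f_equal (fun x => x * (fst p + snd p))) in H; field_simplify in H; lra).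
  destruct p as [s t]; simpl in *. subst. rewrite Rmax_right by lra. split; [easy|lra].
Qed.

(** The parabolic sector occupies the angles between the two separatrices and the hyperbolic one the
    angles beyond them. A common point therefore lies on a separatrix, where [ray] is 0 or 1 and
    [level] is 0. *)
Lemma par_sector_meet p q : square p -> square q -> p <> (0, 0) -> q <> (0, 0) ->
  par_map p = sector_map r0 1 cs 0 q ->
  (exists s, p = (0, s) /\ q = (s, 0)) \/ (exists s, p = (s, 0) /\ q = (0, s)).
Proof.
  intros Hp Hq Hpn Hqn HE.
  pose proof (square_max_pos p Hp Hpn) as Hm. destruct (ray_bounds p Hp Hpn) as [_ Hk].
  assert (Hrm : 0 < r0 * Rmax (fst p) (snd p)) by now apply Rmult_lt_0_compat.
  destruct (par_leaf_bounds (ray p) _ Hk Hrm) as [B1 [B2 [B3 B4]]].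
  pose proof (Hfat _ Hrm) as Hf.
  destruct (sector_map_cases F r0 1 cs HR 0 q Nat.lt_0_1 Hq Hqn) as [[Qp [Ql [y [[Qk Qy] QE]]]]|[Qp [Ql [y [[Qk Qy] QE]]]]];
    rewrite QE in HE; clear QE; unfold par_map in HE.
  - assert (Rq : 0 < r0 * fst q) by now apply Rmult_lt_0_compat.
    destruct (upper_range F r0 1 cs HR 0 _ _ Nat.lt_0_1 Qk Rq) as [Y1 [Y2 [Y3 Y4]]]. rewrite <- Qy in *.
    destruct (cr_injective _ _ _ _ HR 0%nat 0%nat _ _ (par_leaf (ray p) (r0 * Rmax (fst p) (snd p))) y Nat.lt_0_1 Nat.lt_0_1 Hrm Rq
      ltac:(lra) ltac:(lra) HE) as [HR' [[_ Hxy]|[[_ [H _]]|[_ [_ H]]]]]; try lra.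
    left. apply same_radius with (F := F) (n := 1%nat) (c := cs) in HR'; [|easy|easy].
    rewrite <- HR' in *. assert (K0 : level r0 q = 0) by (apply Y4; lra).
    apply level_0 in K0; [|easy|easy].
    destruct (ray_1 p Hp Hpn ltac:(apply B4; lra)) as [P1 [P2 P3]].
    exists (snd p). split; [easy|]. destruct q as [s t]; simpl in *. f_equal; lra.
  - change (next 1 0) with 0%nat in *.
    assert (Rq : 0 < r0 * snd q) by now apply Rmult_lt_0_compat.
    destruct (lower_range F r0 1 cs HR 0 _ _ Nat.lt_0_1 (conj (proj1 Qk) (Rlt_le _ _ (proj2 Qk))) Rq) as [Y1 [Y2 [Y3 Y4]]].
    rewrite <- Qy in *.
    destruct (cr_injective _ _ _ _ HR 0%nat 0%nat _ _ (par_leaf (ray p) (r0 * Rmax (fst p) (snd p))) y Nat.lt_0_1 Nat.lt_0_1 Hrm Rq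
      ltac:(lra) ltac:(lra) HE) as [HR' [[_ Hxy]|[[_ [H _]]|[_ [_ H]]]]]; try lra.
    right. apply same_radius with (F := F) (n := 1%nat) (c := cs) in HR'; [|easy|easy].
    rewrite <- HR' in *. assert (K0 : level r0 q = 0) by (apply Y4; lra).
    apply level_0 in K0; [|easy|easy].
    destruct (ray_0 p Hp Hpn ltac:(apply B3; lra)) as [P1 [P2 P3]].
    exists (fst p). split; [easy|]. destruct q as [s t]; simpl in *. f_equal; lra.
Qed.

Lemma par_map_injective p q : square p -> square q -> p <> (0, 0) -> q <> (0, 0) -> par_map p = par_map q -> p = q.
Proof.
  intros Hp Hq Hpn Hqn HE.
  pose proof (square_max_pos p Hp Hpn) as Hm. destruct (ray_bounds p Hp Hpn) as [_ Hk].
  pose proof (square_max_pos q Hq Hqn) as Hm'. destruct (ray_bounds q Hq Hqn) as [_ Hk'].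
  assert (Hrm : 0 < r0 * Rmax (fst p) (snd p)) by now apply Rmult_lt_0_compat.
  assert (Hrm' : 0 < r0 * Rmax (fst q) (snd q)) by now apply Rmult_lt_0_compat.
  destruct (par_leaf_bounds (ray p) _ Hk Hrm) as [B1 [B2 _]].
  destruct (par_leaf_bounds (ray q) _ Hk' Hrm') as [C1 [C2 _]].
  unfold par_map in HE.
  destruct (cr_injective _ _ _ _ HR 0%nat 0%nat _ _ _ _ Nat.lt_0_1 Nat.lt_0_1 Hrm Hrm'
      (conj (Rlt_le _ _ (proj1 B2)) (Rlt_le _ _ (proj2 B2))) (conj (Rlt_le _ _ (proj1 C2)) (Rlt_le _ _ (proj2 C2))) HE) as [HR' [[_ Hxy]|[[_ [H _]]|[_ [_ H]]]]]; try lra.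
  apply same_radius with (F := F) (n := 1%nat) (c := cs) in HR'; [|easy|easy].
  apply ray_max_injective; try easy. rewrite HR' in Hxy.
  destruct (Rtotal_order (ray p) (ray q)) as [H|[H|H]]; [|easy|];
    apply (par_leaf_mono _ _ (r0 * Rmax (fst q) (snd q))) in H; lra.
Qed.

(** A single cell with two distinct separatrices: the gap between them is the parabolic sector, and
    one hyperbolic sector goes from the upper separatrix, across the side where the cell meets
    itself, to the lower one. *)
Theorem fat_sectors : has_sectors F (0, 0) [parabolic; hyperbolic].
Proof.
  set (sm := sector_map r0 1 cs 0).
  exists (fun i => match i with O => par_map | _ => sm end). unfold sector_decomposition. simpl length.
  assert (Hc0 : forall i, (match i with O => par_map | S _ => sm end) (0, 0) = (0, 0)).
  { intros [|i]; [apply par_map_0|apply sector_map_corner]. }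
  assert (Hadj : adjacent r0 c c) by (apply (cr_adjacent _ _ _ _ HR 0%nat Nat.lt_0_1)).
  split; [|split; [|split; [|split; [|split]]]].
  - intros [|i] p _ Hp; [now apply par_map_continuous|]. now apply (hyp_map_continuous F).
  - intros i _. apply Hc0.
  - intros i s Hi [[Hs| <-] _]; [|now rewrite !Hc0].
    destruct i as [|[|i]]; [| |lia]; simpl.
    + rewrite (proj2 (par_map_side s Hs)). symmetry. apply (sector_map_side F r0 1 cs HR 0 s Nat.lt_0_1 Hs).
    + rewrite (proj1 (par_map_side s Hs)). apply (sector_map_side F r0 1 cs HR 0 s Nat.lt_0_1 Hs).
  - intros i j p q Hi Hj Hp Hq HE.
    assert (Hn0 : forall i p, square p -> p <> (0, 0) -> (match i with O => par_map | S _ => sm end) p <> (0, 0)).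
    { intros [|k] x Hx Hxn; [now apply par_map_neq_0|]. now apply (sector_map_neq_0 F r0 1 cs HR 0 x Nat.lt_0_1). }
    destruct (Classical_Prop.classic (p = (0, 0))) as [->|Hpn].
    { left. split; [easy|]. apply Classical_Prop.NNPP. intro Hqn. rewrite Hc0 in HE. now apply (Hn0 j q Hq Hqn). }
    destruct (Classical_Prop.classic (q = (0, 0))) as [->|Hqn].
    { exfalso. rewrite Hc0 in HE. now apply (Hn0 i p Hp Hpn). }
    right. destruct i as [|[|i]]; [| |lia]; (destruct j as [|[|j]]; [| |lia]); simpl in *.
    + left. split; [easy|]. now apply par_map_injective.
    + destruct (par_sector_meet p q Hp Hq Hpn Hqn HE) as [H|H]; auto.
    + symmetry in HE. destruct (par_sector_meet q p Hq Hp Hqn Hpn HE) as [[s [H1 H2]]|[s [H1 H2]]]; right; [right|left]; split; try easy; now exists s.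
    + left. split; [easy|].
      (* Since the separatrices are distinct, the two sides of the hyperbolic sector are not
         identified with each other. *)
      destruct (sector_map_injective F r0 1 cs HR 0 0 p q) as [[_ H]|[[_ [_ [r [Hr H]]]]|[_ [_ [r [Hr H]]]]]]; try easy; try lia.
      * intros [|i] r Hi' Hr; [|lia]. left. now apply Hfat.
      * specialize (Hfat r Hr). lra.
      * specialize (Hfat r Hr). lra.
  - intros i p Hi Hp Hpn. destruct i as [|[|i]]; [| |lia]; simpl.
    + now apply par_map_leaf.
    + now apply (hyp_map_leaf F).
  - refine (filter_imp _ _ _ (cr_cover _ _ _ _ HR)). intros x [->|[i [r [y [Hi [Hr [Hy ->]]]]]]].
    + exists 0%nat, (0, 0). split; [lia|split; [split; simpl; lra|symmetry; apply (Hc0 0%nat)]].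
    + destruct i as [|i]; [|lia].
      destruct (Rle_lt_dec (upper c 0 r) y) as [Hl|Hl].
      * destruct (sector_map_onto_right F r0 1 cs HR 0 r y Nat.lt_0_1 Hr ltac:(lra)) as [p [Hp HE]]. exists 1%nat, p. split; [lia|easy].
      * destruct (Rle_lt_dec y (lower c 0 r)) as [Hl'|Hl'].
        -- destruct (sector_map_onto_left F r0 1 cs HR 0 r y Nat.lt_0_1 Hr (conj (proj1 Hy) Hl')) as [p [Hp HE]]. exists 1%nat, p. split; [lia|easy].
        -- destruct (par_leaf_onto r y ltac:(lra) ltac:(lra)) as [k [Hk HE]].
           destruct (ray_exists r0 r k Hr Hk) as [p [Hp [Hpn [HM HK]]]].
           exists 0%nat, p. split; [lia|split; [easy|]]. unfold par_map. now rewrite HM, HK, HE.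
Qed.
End Fat.

(** * First-order calculus *)

Section Small.
Context {T : Type} (F : (T * T -> Prop) -> Prop) {FF : Filter F} (dist : T -> T -> R)
  (dist_pos : forall p q, 0 <= dist p q).

(* [F] is a filter on pairs of points.  For pairs close to the origin of the
   plane, [small f] says that [f] vanishes at the origin with strict derivative
   zero; it is stable under division by [r] in polar coordinates. *)
Definition lipb (f : T -> R) : Prop := exists K, 0 <= K /\
  F (fun pq => Rabs (f (fst pq) - f (snd pq)) <= K * dist (fst pq) (snd pq) /\
     Rabs (f (fst pq)) <= K /\ Rabs (f (snd pq)) <= K).

Definition small (f : T -> R) : Prop := forall eps, 0 < eps ->
  F (fun pq => Rabs (f (fst pq) - f (snd pq)) <= eps * dist (fst pq) (snd pq) /\
     Rabs (f (fst pq)) <= eps /\ Rabs (f (snd pq)) <= eps).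

Definition away (f : T -> R) : Prop := exists m, 0 < m /\ F (fun pq => m <= f (fst pq) /\ m <= f (snd pq)).

Lemma small_lipb f : small f -> lipb f.
Proof. intro H. exists 1. split; [lra|]. apply H; lra. Qed.

Lemma lipb_const k : lipb (fun _ => k).
Proof.
  exists (Rabs k). split; [apply Rabs_pos|]. apply filter_forall. intros [p q]; simpl.
  rewrite Rminus_diag, Rabs_R0. split; [|lra]. apply Rmult_le_pos; [apply Rabs_pos|apply dist_pos].
Qed.

Lemma small_0 : small (fun _ => 0).
Proof.
  intros eps He. apply filter_forall. intros [p q]; simpl.
  rewrite Rminus_diag, Rabs_R0. split; [|lra]. apply Rmult_le_pos; [lra|apply dist_pos].
Qed.

Lemma lipb_ext f g : (forall p, f p = g p) -> lipb f -> lipb g.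
Proof.
  intros H [K [HK Hf]]. exists K. split; [easy|]. revert Hf. apply filter_imp. intros pq. now rewrite !H.
Qed.

Lemma small_ext f g : (forall p, f p = g p) -> small f -> small g.
Proof. intros H Hf eps He. generalize (Hf eps He). apply filter_imp. intros pq. now rewrite !H. Qed.

Lemma lipb_plus f g : lipb f -> lipb g -> lipb (fun p => f p + g p).
Proof.
  intros [K [HK Hf]] [K' [HK' Hg]]. exists (K + K'). split; [lra|].
  generalize (filter_and _ _ Hf Hg). apply filter_imp. intros [p q] [[H1 [H2 H3]] [H4 [H5 H6]]]; simpl in *.
  split; [|split].
  - replace (f p + g p - (f q + g q)) with ((f p - f q) + (g p - g q)) by ring.
    apply Rle_trans with (1 := Rabs_triang _ _). lra.
  - apply Rle_trans with (1 := Rabs_triang _ _). lra.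
  - apply Rle_trans with (1 := Rabs_triang _ _). lra.
Qed.

Lemma small_plus f g : small f -> small g -> small (fun p => f p + g p).
Proof.
  intros Hf Hg eps He. 
  assert (He' : 0 < eps / 2) by lra. generalize (filter_and _ _ (Hf _ He') (Hg _ He')). apply filter_imp.
  intros [p q] [[H1 [H2 H3]] [H4 [H5 H6]]]; simpl in *.
  split; [|split].
  - replace (f p + g p - (f q + g q)) with ((f p - f q) + (g p - g q)) by ring.
    apply Rle_trans with (1 := Rabs_triang _ _). lra.
  - apply Rle_trans with (1 := Rabs_triang _ _). lra.
  - apply Rle_trans with (1 := Rabs_triang _ _). lra.
Qed.

Lemma product_bound (a b c d K K' D : R) : 0 <= K -> 0 <= K' -> 0 <= D ->
  Rabs (a - b) <= K * D -> Rabs a <= K -> Rabs b <= K ->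
  Rabs (c - d) <= K' * D -> Rabs c <= K' -> Rabs d <= K' ->
  Rabs (a * c - b * d) <= 2 * (K * K') * D /\ Rabs (a * c) <= 2 * (K * K') /\ Rabs (b * d) <= 2 * (K * K').
Proof.
  intros HK HK' HD H1 H2 H3 H4 H5 H6. assert (0 <= K * K') by now apply Rmult_le_pos.
  assert (E1 : Rabs (a * c) <= K * K') by (rewrite Rabs_mult; apply Rmult_le_compat; auto using Rabs_pos).
  assert (E2 : Rabs (b * d) <= K * K') by (rewrite Rabs_mult; apply Rmult_le_compat; auto using Rabs_pos).
  split; [|lra].
  replace (a * c - b * d) with ((a - b) * c + b * (c - d)) by ring.
  apply Rle_trans with (1 := Rabs_triang _ _). rewrite !Rabs_mult.
  assert (Rabs (a - b) * Rabs c <= K * D * K') by (apply Rmult_le_compat; auto using Rabs_pos).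
  assert (Rabs b * Rabs (c - d) <= K * (K' * D)) by (apply Rmult_le_compat; auto using Rabs_pos). lra.
Qed.

Lemma lipb_mult f g : lipb f -> lipb g -> lipb (fun p => f p * g p).
Proof.
  intros [K [HK Hf]] [K' [HK' Hg]]. exists (2 * (K * K')). pose proof (Rmult_le_pos _ _ HK HK') as HKK. split; [lra|].
  generalize (filter_and _ _ Hf Hg). apply filter_imp. intros [p q] [[H1 [H2 H3]] [H4 [H5 H6]]]; simpl in *.
  apply product_bound; auto.
Qed.

Lemma small_mult_l f g : small f -> lipb g -> small (fun p => f p * g p).
Proof.
  intros Hf [K [HK Hg]] eps He.
  assert (He' : 0 < eps / (2 * (K + 1))) by (apply Rdiv_lt_0_compat; lra).
  generalize (filter_and _ _ (Hf _ He') Hg). apply filter_imp. intros [p q] [[H1 [H2 H3]] [H4 [H5 H6]]]; simpl in *.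
  pose proof (dist_pos p q).
  destruct (product_bound (f p) (f q) (g p) (g q) (eps / (2 * (K + 1))) (K + 1) (dist p q)) as [G1 [G2 G3]]; try lra.
  replace (2 * (eps / (2 * (K + 1)) * (K + 1))) with eps in * by (field; lra). auto.
Qed.

Lemma small_mult_r f g : lipb f -> small g -> small (fun p => f p * g p).
Proof. intros Hf Hg. apply (small_ext (fun p => g p * f p)); [intro; ring|now apply small_mult_l]. Qed.

Lemma lipb_opp f : lipb f -> lipb (fun p => - f p).
Proof.
  intro H. apply (lipb_ext (fun p => -1 * f p)); [intro; ring|]. apply lipb_mult; [apply lipb_const|easy].
Qed.

Lemma lipb_minus f g : lipb f -> lipb g -> lipb (fun p => f p - g p).
Proof. intros Hf Hg. apply (lipb_plus f (fun p => - g p)); [easy|now apply lipb_opp]. Qed.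

Lemma small_opp f : small f -> small (fun p => - f p).
Proof.
  intro H. apply (small_ext (fun p => -1 * f p)); [intro; ring|]. apply small_mult_r; [apply lipb_const|easy].
Qed.

Lemma lipb_inv f : lipb f -> away f -> lipb (fun p => / f p).
Proof.
  intros [K [HK Hf]] [m [Hm Ha]]. pose proof (Rinv_0_lt_compat _ Hm) as Him.
  assert (HKm : 0 <= K * (/ m * / m)) by (apply Rmult_le_pos; [easy|apply Rmult_le_pos; lra]).
  exists (K * (/ m * / m) + / m). split; [lra|].
  generalize (filter_and _ _ Hf Ha). apply filter_imp. intros [p q] [[H1 [H2 H3]] [H4 H5]]; simpl in *.
  pose proof (dist_pos p q) as Hd.
  assert (Gp : 0 < / f p <= / m) by (split; [apply Rinv_0_lt_compat; lra|now apply Rinv_le_contravar]).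
  assert (Gq : 0 < / f q <= / m) by (split; [apply Rinv_0_lt_compat; lra|now apply Rinv_le_contravar]).
  rewrite !(Rabs_pos_eq (/ _)) by lra. split; [|lra].
  replace (/ f p - / f q) with (- ((f p - f q) * (/ f p * / f q))) by (field; lra).
  rewrite Rabs_Ropp, Rabs_mult, (Rabs_pos_eq (/ f p * / f q)) by (apply Rmult_le_pos; lra).
  apply Rle_trans with (K * dist p q * (/ m * / m)).
  - apply Rmult_le_compat; try lra; [apply Rabs_pos|apply Rmult_le_pos; lra|apply Rmult_le_compat; lra].
  - assert (0 <= / m * dist p q) by (apply Rmult_le_pos; lra). lra.
Qed.

Lemma lipb_sqrt f : lipb f -> away f -> lipb (fun p => sqrt (f p)).
Proof.
  intros [K [HK Hf]] [m [Hm Ha]]. pose proof (sqrt_lt_R0 _ Hm) as Hsm. pose proof (Rinv_0_lt_compat _ Hsm) as Him.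
  assert (HKm : 0 <= K * / sqrt m) by (apply Rmult_le_pos; lra).
  exists (K * / sqrt m + (K + 1)). split; [lra|].
  generalize (filter_and _ _ Hf Ha). apply filter_imp. intros [p q] [[H1 [H2 H3]] [H4 H5]]; simpl in *.
  pose proof (dist_pos p q) as Hd.
  assert (HsK : forall y, Rabs y <= K -> m <= y -> sqrt m <= sqrt y <= K + 1).
  { intros y Hy Hmy. split; [apply sqrt_le_1; lra|]. rewrite Rabs_pos_eq in Hy by lra.
    rewrite <- (sqrt_square (K + 1)) by lra. apply sqrt_le_1; nra. }
  destruct (HsK _ H2 H4) as [P1 P2]. destruct (HsK _ H3 H5) as [Q1 Q2].
  rewrite !(Rabs_pos_eq (sqrt _)) by apply sqrt_pos. split; [|lra].
  assert (E : sqrt (f p) - sqrt (f q) = (f p - f q) * / (sqrt (f p) + sqrt (f q))).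
  { rewrite <- (sqrt_sqrt (f p)) at 2 by lra. rewrite <- (sqrt_sqrt (f q)) at 2 by lra. field. lra. }
  assert (Hi : 0 < / (sqrt (f p) + sqrt (f q)) <= / sqrt m) by (split; [apply Rinv_0_lt_compat; lra|apply Rinv_le_contravar; lra]).
  rewrite E, Rabs_mult, (Rabs_pos_eq (/ _)) by lra.
  apply Rle_trans with (K * dist p q * / sqrt m); [apply Rmult_le_compat; try lra; apply Rabs_pos|].
  assert (0 <= (K + 1) * dist p q) by (apply Rmult_le_pos; lra). lra.
Qed.

Lemma away_small f g : away f -> small (fun p => g p - f p) -> away g.
Proof.
  intros [m [Hm Ha]] Hs. exists (m / 2). split; [lra|].
  assert (Hm' : 0 < m / 2) by lra. generalize (filter_and _ _ Ha (Hs _ Hm')). apply filter_imp.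
  intros [p q] [[H1 H2] [_ [H3 H4]]]; simpl in *. apply Rabs_le_between in H3. apply Rabs_le_between in H4. lra.
Qed.

Lemma lipb_of_small f g : lipb f -> small (fun p => g p - f p) -> lipb g.
Proof.
  intros Hf Hs. apply (lipb_ext (fun p => (g p - f p) + f p)); [intro; ring|].
  apply lipb_plus; [now apply small_lipb|easy].
Qed.

(** [f] carries the Lipschitz bound and [g] inherits it through the small difference. With both
    bounds at hand the relation passes to products, and to inverses and roots away from 0. *)
Definition approx (g f : T -> R) : Prop := lipb f /\ small (fun p => g p - f p).

Lemma approx_refl f : lipb f -> approx f f.
Proof. intro H. split; [easy|]. apply (small_ext (fun _ => 0)); [intro; ring|apply small_0]. Qed.

Lemma approx_lipb g f : approx g f -> lipb g.
Proof. intros [H1 H2]. now apply (lipb_of_small f g). Qed.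

Lemma approx_ext g g' f f' : (forall p, g p = g' p) -> (forall p, f p = f' p) -> approx g f -> approx g' f'.
Proof.
  intros H H' [H1 H2]. split; [now apply (lipb_ext f)|].
  apply (small_ext (fun p => g p - f p)); [|easy]. intro p. now rewrite H, H'.
Qed.

Lemma approx_const k : approx (fun _ => k) (fun _ => k).
Proof. apply approx_refl, lipb_const. Qed.

Lemma approx_plus g f g' f' : approx g f -> approx g' f' -> approx (fun p => g p + g' p) (fun p => f p + f' p).
Proof.
  intros [H1 H2] [H3 H4]. split; [now apply lipb_plus|].
  apply (small_ext (fun p => (g p - f p) + (g' p - f' p))); [intro; ring|now apply small_plus].
Qed.

Lemma approx_mult g f g' f' : approx g f -> approx g' f' -> approx (fun p => g p * g' p) (fun p => f p * f' p).
Proof.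
  intros [H1 H2] [H3 H4]. split; [now apply lipb_mult|].
  apply (small_ext (fun p => (g p - f p) * g' p + f p * (g' p - f' p))); [intro; ring|].
  apply small_plus; [apply small_mult_l; [easy|now apply (lipb_of_small f')]|now apply small_mult_r].
Qed.

Lemma approx_opp g f : approx g f -> approx (fun p => - g p) (fun p => - f p).
Proof.
  intros [H1 H2]. split; [now apply lipb_opp|].
  apply (small_ext (fun p => - (g p - f p))); [intro; ring|now apply small_opp].
Qed.

Lemma approx_minus g f g' f' : approx g f -> approx g' f' -> approx (fun p => g p - g' p) (fun p => f p - f' p).
Proof. intros H1 H2. apply (approx_plus g f (fun p => - g' p) (fun p => - f' p)); [easy|now apply approx_opp]. Qed.

Lemma approx_away g f : approx g f -> away f -> away g.
Proof. intros [_ H] Ha. now apply (away_small f). Qed.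

Lemma small_ext_away f g u v : away u -> away v ->
  (forall p, 0 < u p -> 0 < v p -> f p = g p) -> small f -> small g.
Proof.
  intros [m [Hm Ha]] [m' [Hm' Ha']] H Hf eps He.
  generalize (filter_and _ _ (Hf eps He) (filter_and _ _ Ha Ha')). apply filter_imp.
  intros [p q] [H1 [[H2 H3] [H4 H5]]]; simpl in *. rewrite <- !H by lra. exact H1.
Qed.

Lemma approx_inv g f : approx g f -> away f -> approx (fun p => / g p) (fun p => / f p).
Proof.
  intros H Ha. pose proof (approx_away g f H Ha) as Hg. pose proof (approx_lipb g f H) as Lg. destruct H as [H1 H2].
  split; [now apply lipb_inv|].
  apply (small_ext_away (fun p => - (g p - f p) * (/ g p * / f p)) _ g f); [easy|easy| |].
  - intros p Hp Hq. field. lra.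
  - apply small_mult_l; [now apply small_opp|]. apply lipb_mult; now apply lipb_inv.
Qed.

Lemma approx_sqrt g f : approx g f -> away f -> approx (fun p => sqrt (g p)) (fun p => sqrt (f p)).
Proof.
  intros H Ha. pose proof (approx_away g f H Ha) as Hg. pose proof (approx_lipb g f H) as Lg. destruct H as [H1 H2].
  split; [now apply lipb_sqrt|].
  apply (small_ext_away (fun p => (g p - f p) * / (sqrt (g p) + sqrt (f p))) _ g f); [easy|easy| |].
  - intros p Hp Hq. rewrite <- (sqrt_sqrt (g p)) at 1 by lra. rewrite <- (sqrt_sqrt (f p)) at 1 by lra.
    pose proof (sqrt_lt_R0 _ Hp). pose proof (sqrt_lt_R0 _ Hq). field. lra.
  - apply small_mult_l; [easy|]. apply lipb_inv; [apply lipb_plus; now apply lipb_sqrt|].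
    destruct Hg as [m [Hm Hg]], Ha as [m' [Hm' Ha]]. exists (sqrt m + sqrt m').
    pose proof (sqrt_lt_R0 _ Hm). pose proof (sqrt_lt_R0 _ Hm'). split; [lra|].
    generalize (filter_and _ _ Hg Ha). apply filter_imp. intros [p q] [[G1 G2] [G3 G4]]; simpl in *.
    split; apply Rplus_le_compat; apply sqrt_le_1; lra.
Qed.

Lemma small_ext_ev f g : F (fun pq => f (fst pq) = g (fst pq) /\ f (snd pq) = g (snd pq)) -> small f -> small g.
Proof.
  intros H Hf eps He. generalize (filter_and _ _ H (Hf eps He)). apply filter_imp.
  intros pq [[H1 H2] H3]. now rewrite <- H1, <- H2.
Qed.

End Small.

(** * Direction fields in polar coordinates *)

(* The direction [(cos psi, sin psi)] solving
   [a (y^2 - x^2) + 2 b x y + t (x^2 + y^2) = 0] and [b (x^2 - y^2) + 2 a x y > 0]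
   satisfies [(a^2 + b^2) (cos (2 psi), sin (2 psi)) = (dir_re, dir_im)]. *)
Definition dir_root (a b t : R) : R := sqrt (a * a + b * b - t * t).
Definition dir_re (a b t : R) : R := t * a + dir_root a b t * b.
Definition dir_im (a b t : R) : R := dir_root a b t * a - t * b.
(** [polar_re + i polar_im] is [dir_re + i dir_im] times the conjugate of [(u + i v)^2]: the double
    angle measured from the radius [(u, v)] instead of the x-axis. *)
Definition polar_re (a b t u v : R) : R := dir_re a b t * (u * u - v * v) + dir_im a b t * (2 * (u * v)).
Definition polar_im (a b t u v : R) : R := dir_im a b t * (u * u - v * v) - dir_re a b t * (2 * (u * v)).
(** Let [phi] be the angle from the radius to the direction and [N = a^2 + b^2]. Then
    [vnum = 2 N sin phi (cos phi + w sin phi)] and [vden = 2 N (cos phi + w sin phi)^2], so that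
    [vfield = sin phi / (cos phi + w sin phi)], the derivative of the polar angle in [ln r] when the
    height has slope [w]. The common factor makes both expressions functions of [2 phi], hence
    defined without orienting the direction. *)
Definition vnum (a b t u v w : R) : R := polar_im a b t u v + w * (a * a + b * b - polar_re a b t u v).
Definition vrad (a b t u v w : R) : R := a * a + b * b + polar_re a b t u v + w * polar_im a b t u v.
Definition vden (a b t u v w : R) : R := vrad a b t u v w + w * vnum a b t u v w.
Definition vfield (a b t u v w : R) : R := vnum a b t u v w * / vden a b t u v w.

Lemma polar_norm a b t u v : 0 <= a * a + b * b - t * t -> u * u + v * v = 1 ->
  polar_re a b t u v * polar_re a b t u v + polar_im a b t u v * polar_im a b t u v = (a * a + b * b) * (a * a + b * b).
Proof.
  intros Hs Hu. unfold polar_re, polar_im, dir_re, dir_im, dir_root.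
  pose proof (sqrt_sqrt _ Hs) as E. set (s := sqrt (a * a + b * b - t * t)) in *.
  transitivity ((t * t + s * s) * (a * a + b * b) * ((u * u + v * v) * (u * u + v * v))); [ring|]. rewrite Hu, E. ring.
Qed.

Lemma polar_dir a b t u v : u * u + v * v = 1 ->
  polar_re a b t u v * (u * u - v * v) - polar_im a b t u v * (2 * (u * v)) = dir_re a b t /\
  polar_re a b t u v * (2 * (u * v)) + polar_im a b t u v * (u * u - v * v) = dir_im a b t.
Proof.
  intro Hu. unfold polar_re, polar_im. set (X := dir_re a b t). set (Y := dir_im a b t). split.
  - transitivity (X * ((u * u + v * v) * (u * u + v * v))); [ring|rewrite Hu; ring].
  - transitivity (Y * ((u * u + v * v) * (u * u + v * v))); [ring|rewrite Hu; ring].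
Qed.

(* In the rotating frame the direction field is half of the angle of
   [polar_re + i polar_im]: the square of [vrad + i vnum] is a multiple of it. *)
Lemma vfield_direction a b t u v w : 0 < a * a + b * b - t * t -> u * u + v * v = 1 -> 0 < vden a b t u v w ->
  let g := vfield a b t u v w in
  let x := (1 - w * g) * u - g * v in let y := (1 - w * g) * v + g * u in
  a * (y ^ 2 - x ^ 2) + 2 * b * x * y + t * (x ^ 2 + y ^ 2) = 0 /\
  0 < b * (x ^ 2 - y ^ 2) + 2 * a * x * y.
Proof.
  intros Hs Hu Hd g x y.
  pose proof (polar_norm a b t u v (Rlt_le _ _ Hs) Hu) as HN.
  destruct (polar_dir a b t u v Hu) as [HX HY].
  assert (Hrad : 1 - w * g = vrad a b t u v w * / vden a b t u v w).
  { unfold g, vfield. transitivity ((vden a b t u v w - w * vnum a b t u v w) * / vden a b t u v w); [field; lra|].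
    f_equal. unfold vden. ring. }
  set (X := dir_re a b t) in *. set (Y := dir_im a b t) in *.
  assert (HXY : - a * X + b * Y + t * (a * a + b * b) = 0 /\ b * X + a * Y = dir_root a b t * (a * a + b * b)).
  { unfold X, Y, dir_re, dir_im. split; ring. }
  assert (E1 : vrad a b t u v w * vrad a b t u v w - vnum a b t u v w * vnum a b t u v w = 2 * vden a b t u v w * polar_re a b t u v /\
     2 * (vrad a b t u v w * vnum a b t u v w) = 2 * vden a b t u v w * polar_im a b t u v /\
     vrad a b t u v w * vrad a b t u v w + vnum a b t u v w * vnum a b t u v w = 2 * vden a b t u v w * (a * a + b * b)).
  { unfold vden, vrad, vnum. set (N := a * a + b * b) in *. set (P := polar_re a b t u v) in *. set (Q := polar_im a b t u v) in *.
    assert (HQ : Q * Q = N * N - P * P) by lra.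
    split; [|split].
    - transitivity (N * N + P * P + 2 * N * P - (1 - w * w) * (Q * Q) - w * w * (N - P) * (N - P) + 2 * w * Q * (N + P) - 2 * w * Q * (N - P)); [ring|rewrite HQ; ring].
    - transitivity (2 * (Q * (N + P) + w * (Q * Q) + w * (N + P) * (N - P) + w * w * Q * (N - P))); [ring|].
      transitivity (2 * (Q * (N + P) + 2 * w * (Q * Q) + w * w * Q * (N - P))); [|ring].
      replace ((N + P) * (N - P)) with (N * N - P * P) by ring.
      replace (w * (N + P) * (N - P)) with (w * (N * N - P * P)) by ring. rewrite <- HQ. ring.
    - transitivity ((N + P) * (N + P) + (1 + w * w) * (Q * Q) + 2 * w * Q * (N + P) + 2 * w * Q * (N - P) + w * w * (N - P) * (N - P)); [ring|rewrite HQ; ring]. }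
  destruct E1 as [E1 [E2 E3]].
  set (D := vden a b t u v w) in *. set (Wr := vrad a b t u v w) in *. set (Wt := vnum a b t u v w) in *.
  assert (Hg : g = Wt * / D) by easy.
  set (i := / D) in *. assert (HDi : D * i = 1) by (unfold i; field; lra).
  assert (Hi : 0 < i) by now apply Rinv_0_lt_compat.
  assert (F1 : x ^ 2 - y ^ 2 = 2 * i * X).
  { unfold x, y. rewrite Hrad, Hg, <- HX.
    transitivity (i * i * ((Wr * Wr - Wt * Wt) * (u * u - v * v) - 2 * (Wr * Wt) * (2 * (u * v)))); [ring|].
    rewrite E1, E2. transitivity (2 * i * (D * i) * (polar_re a b t u v * (u * u - v * v) - polar_im a b t u v * (2 * (u * v)))); [ring|].
    rewrite HDi. ring. }
  assert (F2 : 2 * x * y = 2 * i * Y).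
  { unfold x, y. rewrite Hrad, Hg, <- HY.
    transitivity (i * i * ((Wr * Wr - Wt * Wt) * (2 * (u * v)) + 2 * (Wr * Wt) * (u * u - v * v))); [ring|].
    rewrite E1, E2. transitivity (2 * i * (D * i) * (polar_re a b t u v * (2 * (u * v)) + polar_im a b t u v * (u * u - v * v))); [ring|].
    rewrite HDi. ring. }
  assert (F3 : x ^ 2 + y ^ 2 = 2 * i * (a * a + b * b)).
  { unfold x, y. rewrite Hrad, Hg.
    transitivity (i * i * (Wr * Wr + Wt * Wt) * (u * u + v * v)); [ring|].
    rewrite E3, Hu. transitivity (2 * i * (D * i) * (a * a + b * b)); [ring|]. rewrite HDi. ring. }
  split.
  - replace (y ^ 2 - x ^ 2) with (- (x ^ 2 - y ^ 2)) by ring.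
    replace (2 * b * x * y) with (b * (2 * x * y)) by ring. rewrite F1, F2, F3.
    transitivity (2 * i * (- a * X + b * Y + t * (a * a + b * b))); [ring|]. rewrite (proj1 HXY). ring.
  - replace (2 * a * x * y) with (a * (2 * x * y)) by ring. rewrite F1, F2.
    replace (b * (2 * i * X) + a * (2 * i * Y)) with (2 * i * (b * X + a * Y)) by ring. rewrite (proj2 HXY).
    assert (0 < dir_root a b t) by now apply sqrt_lt_R0.
    assert (0 < a * a + b * b) by (assert (0 <= t * t) by apply Rle_0_sqr; lra).
    apply Rmult_lt_0_compat; [lra|]. now apply Rmult_lt_0_compat.
Qed.

(** The ratio of the radial component [1 - w g] to the angular component [g] is the cotangent of an
    angle that does not depend on the gauge. At a corner the slope jumps, but the direction of the
    leaf does not. *)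
Lemma vfield_join a b t u v w w' : 0 <= a * a + b * b - t * t -> u * u + v * v = 1 ->
  vden a b t u v w <> 0 -> vden a b t u v w' <> 0 ->
  let g := vfield a b t u v w in let g' := vfield a b t u v w' in
  (1 - w' * g') * g = (1 - w * g) * g'.
Proof.
  intros Hs Hu Hd Hd' g g'. pose proof (polar_norm a b t u v Hs Hu) as HN.
  assert (Hrad : forall w, vden a b t u v w <> 0 -> 1 - w * vfield a b t u v w = vrad a b t u v w * / vden a b t u v w).
  { intros z Hz. unfold vfield. transitivity ((vden a b t u v z - z * vnum a b t u v z) * / vden a b t u v z); [field; easy|].
    f_equal. unfold vden. ring. }
  unfold g, g'. rewrite !Hrad by easy. unfold vfield.
  transitivity (vrad a b t u v w' * vnum a b t u v w * (/ vden a b t u v w * / vden a b t u v w')); [ring|].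
  transitivity (vrad a b t u v w * vnum a b t u v w' * (/ vden a b t u v w * / vden a b t u v w')); [|ring].
  f_equal. unfold vrad, vnum. set (N := a * a + b * b) in *. set (P := polar_re a b t u v) in *. set (Q := polar_im a b t u v) in *.
  assert (HQ : Q * Q = N * N - P * P) by lra.
  transitivity (Q * (N + P) + w * (N * N - P * P) + w' * (Q * Q) + w * w' * Q * (N - P)); [ring|].
  transitivity (Q * (N + P) + w' * (N * N - P * P) + w * (Q * Q) + w * w' * Q * (N - P)); [|ring]. rewrite HQ. ring.
Qed.

Section VfieldCalculus.
Context {T : Type} (F : (T * T -> Prop) -> Prop) {FF : Filter F} (dist : T -> T -> R)
  (dist_pos : forall p q, 0 <= dist p q).

Lemma vparts_approx (a b t u v w a' b' t' u' v' w' : T -> R) :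
  approx F dist a a' -> approx F dist b b' -> approx F dist t t' -> approx F dist u u' -> approx F dist v v' -> approx F dist w w' ->
  away F (fun p => a' p * a' p + b' p * b' p - t' p * t' p) ->
  approx F dist (fun p => vnum (a p) (b p) (t p) (u p) (v p) (w p)) (fun p => vnum (a' p) (b' p) (t' p) (u' p) (v' p) (w' p)) /\
  approx F dist (fun p => vden (a p) (b p) (t p) (u p) (v p) (w p)) (fun p => vden (a' p) (b' p) (t' p) (u' p) (v' p) (w' p)).
Proof.
  intros Ha Hb Ht Hu Hv Hw HA.
  assert (Hr : approx F dist (fun p => dir_root (a p) (b p) (t p)) (fun p => dir_root (a' p) (b' p) (t' p))).
  { unfold dir_root. apply (approx_sqrt F dist dist_pos (fun p => a p * a p + b p * b p - t p * t p)); [|easy].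
    apply approx_minus; auto. apply approx_plus; auto; apply approx_mult; auto. apply approx_mult; auto. }
  assert (H2 : approx F dist (fun _ : T => 2) (fun _ => 2)) by now apply approx_const.
  assert (HN : approx F dist (fun p => a p * a p + b p * b p) (fun p => a' p * a' p + b' p * b' p)).
  { apply approx_plus; auto; apply approx_mult; auto. }
  assert (HX : approx F dist (fun p => dir_re (a p) (b p) (t p)) (fun p => dir_re (a' p) (b' p) (t' p))).
  { unfold dir_re. apply approx_plus; auto; apply approx_mult; auto. }
  assert (HY : approx F dist (fun p => dir_im (a p) (b p) (t p)) (fun p => dir_im (a' p) (b' p) (t' p))).
  { unfold dir_im. apply approx_minus; auto; apply approx_mult; auto. }
  assert (Hc : approx F dist (fun p => u p * u p - v p * v p) (fun p => u' p * u' p - v' p * v' p)).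
  { apply approx_minus; auto; apply approx_mult; auto. }
  assert (Hs : approx F dist (fun p => 2 * (u p * v p)) (fun p => 2 * (u' p * v' p))).
  { apply approx_mult; auto. apply approx_mult; auto. }
  assert (HP : approx F dist (fun p => polar_re (a p) (b p) (t p) (u p) (v p)) (fun p => polar_re (a' p) (b' p) (t' p) (u' p) (v' p))).
  { unfold polar_re. apply approx_plus; auto.
    - apply (approx_mult F dist dist_pos (fun p => dir_re (a p) (b p) (t p)) _ (fun p => u p * u p - v p * v p)); auto.
    - apply (approx_mult F dist dist_pos (fun p => dir_im (a p) (b p) (t p)) _ (fun p => 2 * (u p * v p))); auto. }
  assert (HQ : approx F dist (fun p => polar_im (a p) (b p) (t p) (u p) (v p)) (fun p => polar_im (a' p) (b' p) (t' p) (u' p) (v' p))).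
  { unfold polar_im. apply approx_minus; auto.
    - apply (approx_mult F dist dist_pos (fun p => dir_im (a p) (b p) (t p)) _ (fun p => u p * u p - v p * v p)); auto.
    - apply (approx_mult F dist dist_pos (fun p => dir_re (a p) (b p) (t p)) _ (fun p => 2 * (u p * v p))); auto. }
  assert (Hn : approx F dist (fun p => vnum (a p) (b p) (t p) (u p) (v p) (w p)) (fun p => vnum (a' p) (b' p) (t' p) (u' p) (v' p) (w' p))).
  { unfold vnum. apply approx_plus; auto. apply approx_mult; auto. apply approx_minus; auto. }
  split; [easy|].
  unfold vden, vrad. apply approx_plus; auto; [|apply approx_mult; auto].
  apply approx_plus; auto; [|apply approx_mult; auto]. apply approx_plus; auto.
Qed.

Lemma vfield_approx (a b t u v w a' b' t' u' v' w' : T -> R) :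
  approx F dist a a' -> approx F dist b b' -> approx F dist t t' -> approx F dist u u' -> approx F dist v v' -> approx F dist w w' ->
  away F (fun p => a' p * a' p + b' p * b' p - t' p * t' p) ->
  away F (fun p => vden (a' p) (b' p) (t' p) (u' p) (v' p) (w' p)) ->
  approx F dist (fun p => vfield (a p) (b p) (t p) (u p) (v p) (w p)) (fun p => vfield (a' p) (b' p) (t' p) (u' p) (v' p) (w' p)).
Proof.
  intros Ha Hb Ht Hu Hv Hw HA HD.
  destruct (vparts_approx a b t u v w a' b' t' u' v' w' Ha Hb Ht Hu Hv Hw HA) as [Hn Hd].
  unfold vfield. apply approx_mult; auto. now apply approx_inv.
Qed.
End VfieldCalculus.

(* The height is constant on the core [[p, q]]; outside it, a large [k] turns the
   star-shaped curves enough for the leaves to be transverse to them and to move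
   towards the core as [r] grows. *)
Definition gauge_slope (k p q x : R) : R := k * Rmax 0 (p - x) - k * Rmax 0 (x - q).
Definition gauge_height (k p q x : R) : R := - (k / 2) * ((Rmax 0 (x - q)) ^ 2 + (Rmax 0 (p - x)) ^ 2).

Lemma Rmax_lipschitz a b : Rabs (Rmax 0 a - Rmax 0 b) <= Rabs (a - b).
Proof.
  unfold Rmax. destruct (Rle_dec 0 a), (Rle_dec 0 b); unfold Rabs; repeat destruct Rcase_abs; lra.
Qed.

Lemma is_derive_ramp_sqr y : is_derive (fun x => (Rmax 0 x) ^ 2) y (2 * Rmax 0 y).
Proof.
  destruct (Rtotal_order y 0) as [H|[->|H]].
  - apply (is_derive_ext_loc (fun _ => 0)).
    + generalize (open_lt 0 y H). apply filter_imp. intros x Hx. simpl in Hx. change (0 = (Rmax 0 x) ^ 2). rewrite Rmax_left by lra. ring.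
    + rewrite Rmax_left by lra. rewrite Rmult_0_r. apply (is_derive_const 0).
  - rewrite Rmax_left, Rmult_0_r by lra. apply is_derive_Reals. intros eps He. exists (mkposreal _ He). intros h Hh Hhe. simpl in Hhe.
    rewrite Rplus_0_l, (Rmax_left 0 0), Rminus_0_r by lra. unfold Rmax. destruct (Rle_dec 0 h).
    + replace ((h ^ 2 - 0 ^ 2) / h) with h by (field; easy). easy.
    + replace ((0 ^ 2 - 0 ^ 2) / h) with 0 by (field; easy). now rewrite Rabs_R0.
  - apply (is_derive_ext_loc (fun x => x ^ 2)).
    + generalize (open_gt 0 y H). apply filter_imp. intros x Hx. simpl in Hx. change (x ^ 2 = (Rmax 0 x) ^ 2). now rewrite Rmax_right by lra.
    + rewrite Rmax_right by lra. auto_derive; [easy|ring].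
Qed.

Lemma is_derive_gauge_height k p q x : is_derive (gauge_height k p q) x (gauge_slope k p q x).
Proof.
  unfold gauge_height, gauge_slope.
  assert (H1 : is_derive (fun x => (Rmax 0 (x - q)) ^ 2) x (2 * Rmax 0 (x - q))).
  { evar_last; [apply (is_derive_comp (fun y => (Rmax 0 y) ^ 2) (fun x => x - q)); [apply is_derive_ramp_sqr|auto_derive; [easy|reflexivity]]|].
    unfold scal; simpl; unfold mult; simpl. ring. }
  assert (H2 : is_derive (fun x => (Rmax 0 (p - x)) ^ 2) x (- (2 * Rmax 0 (p - x)))).
  { evar_last; [apply (is_derive_comp (fun y => (Rmax 0 y) ^ 2) (fun x => p - x)); [apply is_derive_ramp_sqr|auto_derive; [easy|reflexivity]]|].
    unfold scal; simpl; unfold mult; simpl. ring. }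
  evar_last.
  - apply (is_derive_scal (fun x => (Rmax 0 (x - q)) ^ 2 + (Rmax 0 (p - x)) ^ 2)).
    apply (is_derive_plus (fun x => (Rmax 0 (x - q)) ^ 2) (fun x => (Rmax 0 (p - x)) ^ 2)); [exact H1|exact H2].
  - unfold plus; simpl. field.
Qed.

Lemma gauge_slope_lipschitz k p q x y : 0 <= k -> Rabs (gauge_slope k p q x - gauge_slope k p q y) <= 2 * k * Rabs (x - y).
Proof.
  intro Hk. unfold gauge_slope.
  replace (_ - _) with (k * (Rmax 0 (p - x) - Rmax 0 (p - y)) + - (k * (Rmax 0 (x - q) - Rmax 0 (y - q)))) by ring.
  apply Rle_trans with (1 := Rabs_triang _ _). rewrite Rabs_Ropp, !Rabs_mult, (Rabs_pos_eq k) by easy.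
  pose proof (Rmax_lipschitz (p - x) (p - y)) as H1. pose proof (Rmax_lipschitz (x - q) (y - q)) as H2.
  replace (p - x - (p - y)) with (- (x - y)) in H1 by ring. rewrite Rabs_Ropp in H1.
  replace (x - q - (y - q)) with (x - y) in H2 by ring.
  apply (Rmult_le_compat_l k) in H1; [|easy]. apply (Rmult_le_compat_l k) in H2; [|easy]. lra.
Qed.

Lemma gauge_slope_continuous k p q x : 0 <= k -> continuous (gauge_slope k p q) x.
Proof. intro Hk. apply (lipschitz_continuous _ (2 * k)). intros; now apply gauge_slope_lipschitz. Qed.

Lemma gauge_height_nonpos k p q x : 0 <= k -> gauge_height k p q x <= 0.
Proof. intro Hk. unfold gauge_height. pose proof (pow2_ge_0 (Rmax 0 (x - q))). pose proof (pow2_ge_0 (Rmax 0 (p - x))). nra. Qed.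

(** * Strict derivatives at the origin and their blow-up in polar coordinates *)

Definition Fplane : ((R * R) * (R * R) -> Prop) -> Prop := filter_prod (locally ((0, 0) : R * R)) (locally ((0, 0) : R * R)).
Definition plane_dist (p q : R * R) : R := Rabs (fst p - fst q) + Rabs (snd p - snd q).
Global Instance Fplane_filter : Filter Fplane.
Proof. unfold Fplane. typeclasses eauto. Qed.

Lemma plane_dist_pos p q : 0 <= plane_dist p q.
Proof. unfold plane_dist. pose proof (Rabs_pos (fst p - fst q)). pose proof (Rabs_pos (snd p - snd q)). lra. Qed.

Lemma Fplane_intro (P : (R * R) * (R * R) -> Prop) d : 0 < d ->
  (forall p q : R * R, Rabs (fst p) < d -> Rabs (snd p) < d -> Rabs (fst q) < d -> Rabs (snd q) < d -> P (p, q)) -> Fplane P.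
Proof.
  intros Hd H. exists (fun p => Rabs (fst p) < d /\ Rabs (snd p) < d) (fun p => Rabs (fst p) < d /\ Rabs (snd p) < d).
  - exists (mkposreal _ Hd). intros p [H1 H2]. change (Rabs (fst p - 0) < d) in H1. change (Rabs (snd p - 0) < d) in H2.
    rewrite Rminus_0_r in H1, H2. easy.
  - exists (mkposreal _ Hd). intros p [H1 H2]. change (Rabs (fst p - 0) < d) in H1. change (Rabs (snd p - 0) < d) in H2.
    rewrite Rminus_0_r in H1, H2. easy.
  - intros p q [H1 H2] [H3 H4]. now apply H.
Qed.

Lemma Fplane_elim P : Fplane P -> exists d, 0 < d /\
  forall p q : R * R, Rabs (fst p) < d -> Rabs (snd p) < d -> Rabs (fst q) < d -> Rabs (snd q) < d -> P (p, q).
Proof.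
  intros [Q1 Q2 [d1 H1] [d2 H2] H]. exists (Rmin d1 d2). split; [apply Rmin_glb_lt; apply cond_pos|].
  pose proof (Rmin_l d1 d2). pose proof (Rmin_r d1 d2).
  intros p q Hp1 Hp2 Hq1 Hq2. apply H.
  - apply H1. split; [change (Rabs (fst p - 0) < d1)|change (Rabs (snd p - 0) < d1)]; rewrite Rminus_0_r; lra.
  - apply H2. split; [change (Rabs (fst q - 0) < d2)|change (Rabs (snd q - 0) < d2)]; rewrite Rminus_0_r; lra.
Qed.

Notation plane_small := (small Fplane plane_dist).
Notation plane_lipschitz := (lipb Fplane plane_dist).
Notation plane_approx := (approx Fplane plane_dist).

Lemma plane_lipb_fst : plane_lipschitz fst.
Proof.
  exists 1. split; [lra|]. apply (Fplane_intro _ 1); [lra|]. intros p q H1 H2 H3 H4. cbn [fst snd]. unfold plane_dist.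
  pose proof (Rabs_pos (snd p - snd q)). lra.
Qed.
Lemma plane_lipb_snd : plane_lipschitz snd.
Proof.
  exists 1. split; [lra|]. apply (Fplane_intro _ 1); [lra|]. intros p q H1 H2 H3 H4. cbn [fst snd]. unfold plane_dist.
  pose proof (Rabs_pos (fst p - fst q)). lra.
Qed.

Lemma small_plane_0 f : plane_small f -> f (0, 0) = 0.
Proof.
  intro H. destruct (Req_dec (f (0, 0)) 0) as [|Hn]; [easy|]. exfalso.
  apply Rabs_pos_lt in Hn. destruct (Fplane_elim _ (H (Rabs (f (0, 0)) / 2) ltac:(lra))) as [d [Hd H1]].
  specialize (H1 (0, 0) (0, 0)). simpl in H1. rewrite Rabs_R0 in H1.
  destruct (H1 Hd Hd Hd Hd) as [_ [H2 _]]. lra.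
Qed.

(* Pairs of points of the same small size [r], uniformly in the angles. *)
Definition Fam (lo hi : R) (P : (R * R) * (R * R) -> Prop) : Prop :=
  exists d, 0 < d /\ forall r x y, 0 < r <= d -> lo <= x <= hi -> lo <= y <= hi -> P ((r, x), (r, y)).
Definition angle_dist (p q : R * R) : R := Rabs (snd p - snd q).

Lemma angle_dist_pos p q : 0 <= angle_dist p q.
Proof. apply Rabs_pos. Qed.

Global Instance Fam_filter lo hi : Filter (Fam lo hi).
Proof.
  split.
  - exists 1. split; [lra|easy].
  - intros P Q [d1 [Hd1 H1]] [d2 [Hd2 H2]]. exists (Rmin d1 d2). split; [now apply Rmin_glb_lt|].
    pose proof (Rmin_l d1 d2). pose proof (Rmin_r d1 d2). intros r x y Hr Hx Hy. split; [apply H1|apply H2]; easy || lra.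
  - intros P Q HPQ [d [Hd H]]. exists d. split; [easy|]. intros. apply HPQ. now apply H.
Qed.

Lemma Fam_lipb_fun lo hi (f : R -> R) K : lo <= hi ->
  (forall x y, lo <= x <= hi -> lo <= y <= hi -> Rabs (f x - f y) <= K * Rabs (x - y)) ->
  lipb (Fam lo hi) angle_dist (fun p => f (snd p)).
Proof.
  intros Hlh H. exists (Rabs K + (Rabs (f lo) + Rabs K * (hi - lo))).
  pose proof (Rabs_pos K). pose proof (Rabs_pos (f lo)).
  assert (0 <= Rabs K * (hi - lo)) by (apply Rmult_le_pos; lra).
  split; [lra|]. exists 1. split; [lra|]. intros r x y _ Hx Hy. simpl. unfold angle_dist; simpl.
  assert (HK : forall x y, lo <= x <= hi -> lo <= y <= hi -> Rabs (f x - f y) <= Rabs K * Rabs (x - y)).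
  { intros a b Ha Hb. apply Rle_trans with (1 := H a b Ha Hb). apply Rmult_le_compat_r; [apply Rabs_pos|apply Rle_abs]. }
  assert (HB : forall x, lo <= x <= hi -> Rabs (f x) <= Rabs (f lo) + Rabs K * (hi - lo)).
  { intros a Ha. replace (f a) with (f lo + (f a - f lo)) by ring. apply Rle_trans with (1 := Rabs_triang _ _).
    apply Rplus_le_compat_l. apply Rle_trans with (1 := HK a lo Ha ltac:(lra)). apply Rmult_le_compat_l; [easy|].
    rewrite Rabs_pos_eq; lra. }
  split; [|split].
  - apply Rle_trans with (1 := HK x y Hx Hy). apply Rmult_le_compat_r; [apply Rabs_pos|lra].
  - specialize (HB x Hx). lra.
  - specialize (HB y Hy). lra.
Qed.

Lemma Fam_lipb_global lo hi (f df : R -> R) K : lo <= hi -> (forall x, is_derive f x (df x)) -> (forall x, Rabs (df x) <= K) ->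
  lipb (Fam lo hi) angle_dist (fun p => f (snd p)).
Proof. intros H Hd HK. apply (Fam_lipb_fun lo hi f K H). intros x y _ _. now apply (lipschitz_of_derive f df). Qed.

Lemma Fam_cos lo hi : lo <= hi -> lipb (Fam lo hi) angle_dist (fun p => cos (snd p)).
Proof.
  intro H. apply (Fam_lipb_global lo hi cos (fun x => - sin x) 1 H); [apply is_derive_cos|].
  intro x. rewrite Rabs_Ropp. apply Rabs_le. apply SIN_bound.
Qed.

Lemma Fam_sin lo hi : lo <= hi -> lipb (Fam lo hi) angle_dist (fun p => sin (snd p)).
Proof.
  intro H. apply (Fam_lipb_global lo hi sin cos 1 H); [apply is_derive_sin|].
  intro x. apply Rabs_le. apply COS_bound.
Qed.

Lemma Fam_slope k p q lo hi : 0 <= k -> lo <= hi -> lipb (Fam lo hi) angle_dist (fun x => gauge_slope k p q (snd x)).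
Proof. intros Hk H. apply (Fam_lipb_fun lo hi (gauge_slope k p q) (2 * k) H). intros. now apply gauge_slope_lipschitz. Qed.

Lemma continuous_bounded_on (f : R -> R) a b : a <= b -> (forall x, continuous f x) -> exists M, 0 < M /\ forall x, a <= x <= b -> Rabs (f x) <= M.
Proof.
  intros Hab Hc. destruct (continuity_ab_maj (fun x => Rabs (f x)) a b Hab) as [x0 [H _]].
  - intros x _. apply continuity_pt_filterlim. apply (continuous_comp f Rabs); [apply Hc|apply continuous_Rabs].
  - exists (Rabs (f x0) + 1). split; [pose proof (Rabs_pos (f x0)); lra|]. intros x Hx. specialize (H x Hx). lra.
Qed.

Lemma lipschitz_on_interval (f df : R -> R) a b : a <= b -> (forall x, is_derive f x (df x)) -> (forall x, continuous df x) ->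
  exists K, 0 < K /\ forall x y, a <= x <= b -> a <= y <= b -> Rabs (f x - f y) <= K * Rabs (x - y).
Proof.
  intros Hab Hd Hc. destruct (continuous_bounded_on df a b Hab Hc) as [M [HM HB]]. exists M. split; [easy|].
  assert (key : forall x y, a <= x <= b -> a <= y <= b -> x <= y -> Rabs (f x - f y) <= M * Rabs (x - y)).
  { intros x y Hx Hy Hxy. destruct (mvt_le f df x y Hxy) as [s [Hs He]]; [intros; apply Hd|].
    rewrite Rabs_minus_sym, He, Rabs_mult, (Rabs_minus_sym x y). apply Rmult_le_compat_r; [apply Rabs_pos|]. apply HB. lra. }
  intros x y Hx Hy. destruct (Rle_dec x y); [now apply key|].
  rewrite Rabs_minus_sym, (Rabs_minus_sym x y). apply key; try easy. lra.
Qed.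

Definition radius (k p q r x : R) : R := r * exp (- gauge_height k p q x).
Definition polar (k p q r x : R) : R * R := (radius k p q r x * cos x, radius k p q r x * sin x).
(** The blow-up of [f]: a linear function becomes a function of the angle alone. *)
Definition hat (k p q : R) (f : R * R -> R) (z : R * R) : R :=
  f (polar k p q (fst z) (snd z)) * / radius k p q (fst z) (snd z).

Lemma radius_pos k p q r x : 0 < r -> 0 < radius k p q r x.
Proof. intro H. apply Rmult_lt_0_compat; [easy|apply exp_pos]. Qed.

Lemma polar_bounds k p q lo hi : 0 <= k -> lo <= hi -> exists K, 0 < K /\ forall r x y, 0 < r -> lo <= x <= hi -> lo <= y <= hi ->
  plane_dist (polar k p q r x) (polar k p q r y) <= r * (K * Rabs (x - y)) /\
  Rabs (fst (polar k p q r x)) <= r * K /\ Rabs (snd (polar k p q r x)) <= r * K.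
Proof.
  intros Hk Hlh.
  set (E := fun x => exp (- gauge_height k p q x)).
  assert (HE : forall x, is_derive E x (- gauge_slope k p q x * E x)).
  { intro x. unfold E. evar_last; [apply (is_derive_comp exp (fun x => - gauge_height k p q x)); [apply is_derive_exp|]|].
    apply (is_derive_opp (gauge_height k p q)). apply is_derive_gauge_height.
    unfold scal, opp; simpl; unfold mult; simpl. ring. }
  assert (HEc : forall x, continuous E x) by (intro; eapply is_derive_continuous; apply HE).
  assert (HdE : forall x, continuous (fun x => - gauge_slope k p q x * E x) x).
  { intro x. apply (continuous_mult (fun x => - gauge_slope k p q x) E); [|apply HEc].
    apply (continuous_opp (gauge_slope k p q)). now apply gauge_slope_continuous. }
  assert (Hcc : forall x, continuous cos x) by (intro; eapply is_derive_continuous; apply is_derive_cos).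
  assert (Hsc : forall x, continuous sin x) by (intro; eapply is_derive_continuous; apply is_derive_sin).
  destruct (lipschitz_on_interval (fun x => E x * cos x) (fun x => - gauge_slope k p q x * E x * cos x + E x * - sin x) lo hi Hlh) as [K1 [HK1 L1]].
  { intro x. apply (is_derive_mult E cos); [apply HE|apply is_derive_cos|apply Rmult_comm]. }
  { intro x. apply (continuous_plus (fun x => - gauge_slope k p q x * E x * cos x) (fun x => E x * - sin x)).
    - apply (continuous_mult (fun x => - gauge_slope k p q x * E x) cos); auto.
    - apply (continuous_mult E (fun x => - sin x)); auto. apply (continuous_opp sin); auto. }
  destruct (lipschitz_on_interval (fun x => E x * sin x) (fun x => - gauge_slope k p q x * E x * sin x + E x * cos x) lo hi Hlh) as [K2 [HK2 L2]].
  { intro x. apply (is_derive_mult E sin); [apply HE|apply is_derive_sin|apply Rmult_comm]. }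
  { intro x. apply (continuous_plus (fun x => - gauge_slope k p q x * E x * sin x) (fun x => E x * cos x)).
    - apply (continuous_mult (fun x => - gauge_slope k p q x * E x) sin); auto.
    - apply (continuous_mult E cos); auto. }
  destruct (continuous_bounded_on E lo hi Hlh HEc) as [M [HM HB]].
  exists (K1 + K2 + M). split; [lra|]. intros r x y Hr Hx Hy.
  specialize (L1 x y Hx Hy). specialize (L2 x y Hx Hy). specialize (HB x Hx).
  pose proof (Rabs_pos (x - y)) as Hd.
  unfold plane_dist, polar, radius; simpl. change (exp (- gauge_height k p q x)) with (E x). change (exp (- gauge_height k p q y)) with (E y).
  split; [|split].
  - replace (r * E x * cos x - r * E y * cos y) with (r * (E x * cos x - E y * cos y)) by ring.
    replace (r * E x * sin x - r * E y * sin y) with (r * (E x * sin x - E y * sin y)) by ring.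
    rewrite !Rabs_mult, (Rabs_pos_eq r) by lra. rewrite <- Rmult_plus_distr_l. apply Rmult_le_compat_l; [lra|].
    assert (0 <= M * Rabs (x - y)) by (apply Rmult_le_pos; lra). lra.
  - rewrite !Rabs_mult, (Rabs_pos_eq r), Rmult_assoc by lra. apply Rmult_le_compat_l; [lra|].
    apply Rle_trans with (M * 1); [|lra]. apply Rmult_le_compat; auto using Rabs_pos. apply Rabs_le, COS_bound.
  - rewrite !Rabs_mult, (Rabs_pos_eq r), Rmult_assoc by lra. apply Rmult_le_compat_l; [lra|].
    apply Rle_trans with (M * 1); [|lra]. apply Rmult_le_compat; auto using Rabs_pos. apply Rabs_le, SIN_bound.
Qed.

Lemma Fam_exp_height k p q lo hi : 0 <= k -> lo <= hi -> lipb (Fam lo hi) angle_dist (fun z => exp (gauge_height k p q (snd z))).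
Proof.
  intros Hk Hlh. destruct (lipschitz_on_interval (fun x => exp (gauge_height k p q x)) (fun x => gauge_slope k p q x * exp (gauge_height k p q x)) lo hi Hlh) as [K [HK L]].
  - intro x. evar_last; [apply (is_derive_comp exp (gauge_height k p q)); [apply is_derive_exp|apply is_derive_gauge_height]|].
    unfold scal; simpl; unfold mult; simpl. ring.
  - intro x. apply (continuous_mult (gauge_slope k p q) (fun x => exp (gauge_height k p q x))); [now apply gauge_slope_continuous|].
    apply (continuous_comp (gauge_height k p q) exp); eapply is_derive_continuous; [apply is_derive_gauge_height|apply is_derive_exp].
  - now apply (Fam_lipb_fun lo hi (fun x => exp (gauge_height k p q x)) K).
Qed.

(** Two points of the same size [r] with angles [x] and [y] are at distance [O(r |x - y|)], so a
    strict derivative zero, divided by [r], leaves an arbitrarily small Lipschitz constant in the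
    angle. Comparison with the origin, where [f] vanishes, bounds the values. *)
Lemma hat_small k p q lo hi f : 0 <= k -> lo <= hi -> plane_small f -> small (Fam lo hi) angle_dist (hat k p q f).
Proof.
  intros Hk Hlh Hf. pose proof (small_plane_0 f Hf) as Hf0.
  apply (small_ext_ev (Fam lo hi) angle_dist (fun z => (f (polar k p q (fst z) (snd z)) * / fst z) * exp (gauge_height k p q (snd z)))).
  - exists 1. split; [lra|]. intros r x y Hr _ _. simpl. unfold hat, radius; simpl.
    rewrite !Rinv_mult, !exp_Ropp, !Rinv_inv. split; ring.
  - apply small_mult_l; [typeclasses eauto|apply angle_dist_pos| |now apply Fam_exp_height].
    destruct (polar_bounds k p q lo hi Hk Hlh) as [K [HK HP]].
    intros eps He. set (e := eps / (2 * K)). assert (He' : 0 < e) by (apply Rdiv_lt_0_compat; lra).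
    assert (HeK : e * K + e * K = eps) by (unfold e; field; lra).
    destruct (Fplane_elim _ (Hf e He')) as [d [Hd H]].
    exists (d / (2 * K)). assert (HdK : 0 < d / (2 * K)) by (apply Rdiv_lt_0_compat; lra). split; [easy|].
    intros r x y Hr Hx Hy. simpl. unfold angle_dist; simpl.
    assert (Hin : forall z, lo <= z <= hi -> Rabs (fst (polar k p q r z)) < d /\ Rabs (snd (polar k p q r z)) < d).
    { intros z Hz. destruct (HP r z z (proj1 Hr) Hz Hz) as [_ [H1 H2]].
      assert (r * K < d).
      { apply Rle_lt_trans with (d / (2 * K) * K); [apply Rmult_le_compat_r; lra|]. replace (d / (2 * K) * K) with (d / 2) by (field; lra). lra. }
      lra. }
    assert (Hval : forall z, lo <= z <= hi -> Rabs (f (polar k p q r z) * / r) <= eps).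
    { intros z Hz. destruct (Hin z Hz) as [H1 H2]. destruct (HP r z z (proj1 Hr) Hz Hz) as [_ [H3 H4]].
      destruct (H (polar k p q r z) (0, 0) H1 H2) as [H5 _]; simpl; rewrite ?Rabs_R0; try easy.
      simpl in H5. rewrite Hf0, Rminus_0_r in H5. unfold plane_dist in H5. simpl fst in H5 at 2. simpl snd in H5 at 2. rewrite !Rminus_0_r in H5.
      rewrite Rabs_mult, (Rabs_pos_eq (/ r)) by (left; now apply Rinv_0_lt_compat).
      apply (Rmult_le_reg_r r); [easy|]. rewrite Rmult_assoc, Rinv_l, Rmult_1_r by lra.
      apply Rle_trans with (1 := H5). apply Rle_trans with (e * (r * K + r * K)); [apply Rmult_le_compat_l; [lra|apply Rplus_le_compat; easy]|].
      right. rewrite <- HeK. ring. }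
    split; [|split; now apply Hval].
    destruct (Hin x Hx) as [H1 H2]. destruct (Hin y Hy) as [H3 H4].
    destruct (HP r x y (proj1 Hr) Hx Hy) as [H5 _]. destruct (H _ _ H1 H2 H3 H4) as [H6 _]. cbn [fst snd] in H6.
    replace (f (polar k p q r x) * / r - f (polar k p q r y) * / r) with ((f (polar k p q r x) - f (polar k p q r y)) * / r) by ring.
    rewrite Rabs_mult, (Rabs_pos_eq (/ r)) by (left; now apply Rinv_0_lt_compat).
    apply (Rmult_le_reg_r r); [easy|]. rewrite Rmult_assoc, Rinv_l, Rmult_1_r by lra.
    apply Rle_trans with (1 := H6). apply Rle_trans with (e * (r * (K * Rabs (x - y)))); [apply Rmult_le_compat_l; lra|].
    assert (0 <= e * (r * (K * Rabs (x - y)))) by (apply Rmult_le_pos; [lra|apply Rmult_le_pos; [lra|apply Rmult_le_pos; [lra|apply Rabs_pos]]]).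
    rewrite <- HeK. lra.
Qed.

Lemma hat_approx k p q lo hi f al be : 0 <= k -> lo <= hi ->
  plane_small (fun z => f z - (al * fst z + be * snd z)) ->
  approx (Fam lo hi) angle_dist (hat k p q f) (fun z => al * cos (snd z) + be * sin (snd z)).
Proof.
  intros Hk Hlh Hf. split.
  - apply lipb_plus; try typeclasses eauto; (apply lipb_mult; [typeclasses eauto|apply angle_dist_pos|apply lipb_const; [typeclasses eauto|apply angle_dist_pos]|]);
      [now apply Fam_cos|now apply Fam_sin].
  - apply (small_ext_ev (Fam lo hi) angle_dist (hat k p q (fun z => f z - (al * fst z + be * snd z)))); [|now apply hat_small].
    exists 1. split; [lra|]. intros r x y Hr _ _. simpl. unfold hat, polar; simpl.
    pose proof (radius_pos k p q r x (proj1 Hr)). pose proof (radius_pos k p q r y (proj1 Hr)). split; field; lra.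
Qed.

(** * Cells of a direction field with given linear part *)

Definition clamp (l h x : R) : R := Rmax l (Rmin h x).

Lemma clamp_range l h x : l <= h -> l <= clamp l h x <= h.
Proof. intro H. unfold clamp. split; [apply Rmax_l|]. apply Rmax_lub; [easy|apply Rmin_l]. Qed.

Lemma clamp_id l h x : l <= x <= h -> clamp l h x = x.
Proof. intro H. unfold clamp. rewrite Rmin_right, Rmax_right; lra. Qed.

Lemma clamp_lipschitz l h x y : Rabs (clamp l h x - clamp l h y) <= Rabs (x - y).
Proof.
  unfold clamp, Rmax, Rmin. repeat destruct Rle_dec; unfold Rabs; repeat destruct Rcase_abs; lra.
Qed.

Lemma lipschitz_pos_min (f : R -> R) K a b : a <= b -> (forall x y, a <= x <= b -> a <= y <= b -> Rabs (f x - f y) <= K * Rabs (x - y)) ->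
  (forall x, a <= x <= b -> 0 < f x) -> exists m, 0 < m /\ forall x, a <= x <= b -> m <= f x.
Proof.
  intros Hab HL Hp.
  destruct (continuity_ab_min (fun x => f (clamp a b x)) a b Hab) as [x0 [H Hx0]].
  - intros x _. apply continuity_pt_filterlim. apply (lipschitz_continuous (fun x => f (clamp a b x)) (Rabs K)). intros u v.
    apply Rle_trans with (1 := HL _ _ (clamp_range a b u Hab) (clamp_range a b v Hab)).
    apply Rle_trans with (Rabs K * Rabs (clamp a b u - clamp a b v)).
    + apply Rmult_le_compat_r; [apply Rabs_pos|apply Rle_abs].
    + apply Rmult_le_compat_l; [apply Rabs_pos|apply clamp_lipschitz].
  - exists (f x0). split; [now apply Hp|]. intros x Hx. specialize (H x Hx). now rewrite !clamp_id in H.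
Qed.

Lemma Fam_lipb_elim lo hi (f : R -> R) : lipb (Fam lo hi) angle_dist (fun z => f (snd z)) ->
  exists K, forall x y, lo <= x <= hi -> lo <= y <= hi -> Rabs (f x - f y) <= K * Rabs (x - y).
Proof.
  intros [K [_ [d [Hd H]]]]. exists K. intros x y Hx Hy. apply (H d x y); lra.
Qed.

Lemma Fam_away lo hi (f : R -> R) : lo <= hi -> lipb (Fam lo hi) angle_dist (fun z => f (snd z)) ->
  (forall x, lo <= x <= hi -> 0 < f x) -> away (Fam lo hi) (fun z => f (snd z)).
Proof.
  intros Hlh HL Hp. destruct (Fam_lipb_elim lo hi f HL) as [K HK].
  destruct (lipschitz_pos_min f K lo hi Hlh HK Hp) as [m [Hm H]]. exists m. split; [easy|].
  exists 1. split; [lra|]. intros r x y _ Hx Hy. simpl. auto.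
Qed.

Definition lim_a (a b c x : R) : R := (b - a) / 2 * cos x + c / 2 * sin x.
Definition lim_b (b x : R) : R := b * sin x.
Definition lim_field (a b c k p q x : R) : R := vfield (lim_a a b c x) (lim_b b x) 0 (cos x) (sin x) (gauge_slope k p q x).
Definition lim_num (a b c k p q x : R) : R := vnum (lim_a a b c x) (lim_b b x) 0 (cos x) (sin x) (gauge_slope k p q x).
Definition lim_den (a b c k p q x : R) : R := vden (lim_a a b c x) (lim_b b x) 0 (cos x) (sin x) (gauge_slope k p q x).
Definition lim_norm (a b c x : R) : R := lim_a a b c x * lim_a a b c x + lim_b b x * lim_b b x.

(** As [b <> 0], [lim_b] vanishes only for [sin x = 0], and there [lim_a] is [(b - a) / 2] times
    [cos x], which is nonzero. Thus the limit direction field is defined on every ray. *)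
Lemma lim_norm_pos a b c x : b * (b - a) <> 0 -> 0 < lim_norm a b c x.
Proof.
  intro H. unfold lim_norm.
  pose proof (Rle_0_sqr (lim_a a b c x)) as H1. pose proof (Rle_0_sqr (lim_b b x)) as H2. unfold Rsqr in *.
  apply Rnot_le_lt. intro Hle.
  assert (Ha : lim_a a b c x = 0) by (apply Rsqr_0_uniq; unfold Rsqr; lra).
  assert (Hb : lim_b b x = 0) by (apply Rsqr_0_uniq; unfold Rsqr; lra).
  unfold lim_b in Hb. apply Rmult_integral in Hb. destruct Hb as [Hb|Hs]; [subst; lra|].
  unfold lim_a in Ha. rewrite Hs in Ha.
  assert (Hc : cos x = 0).
  { destruct (Req_dec (cos x) 0) as [|Hc]; [easy|]. exfalso. apply H.
    assert (b - a = 0); [|rewrite H0; ring]. apply (Rmult_eq_reg_r (cos x)); lra. }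
  pose proof (sin2_cos2 x) as E. rewrite Hs, Hc in E. unfold Rsqr in E. lra.
Qed.

(** The zero coefficients are written out so that the three conditions have the shape asked for by
    [hat_approx]. *)
Record jet_data (A B t : R * R -> R) (a b c : R) : Prop := {
  jd_A : plane_small (fun z => A z - ((b - a) / 2 * fst z + c / 2 * snd z));
  jd_B : plane_small (fun z => B z - (0 * fst z + b * snd z));
  jd_t : plane_small (fun z => t z - (0 * fst z + 0 * snd z));
  jd_nondegenerate : b * (b - a) <> 0 }.

Definition pfield (A B t : R * R -> R) (k p q : R) (z : R * R) : R :=
  vfield (hat k p q A z) (hat k p q B z) (hat k p q t z) (cos (snd z)) (sin (snd z)) (gauge_slope k p q (snd z)).
Definition pden (A B t : R * R -> R) (k p q : R) (z : R * R) : R :=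
  vden (hat k p q A z) (hat k p q B z) (hat k p q t z) (cos (snd z)) (sin (snd z)) (gauge_slope k p q (snd z)).
Definition pdisc (A B t : R * R -> R) (k p q : R) (z : R * R) : R :=
  hat k p q A z * hat k p q A z + hat k p q B z * hat k p q B z - hat k p q t z * hat k p q t z.

Section Cells.
Context (A B t : R * R -> R) (a b c : R) (HJ : jet_data A B t a b c).
Context (k p q lo hi : R) (Hk : 0 <= k) (Hlh : lo < hi).

Let Hle : lo <= hi := Rlt_le _ _ Hlh.

Lemma hat_A_approx : approx (Fam lo hi) angle_dist (hat k p q A) (fun z => lim_a a b c (snd z)).
Proof. apply hat_approx; [easy|easy|apply (jd_A _ _ _ _ _ _ HJ)]. Qed.

Lemma hat_B_approx : approx (Fam lo hi) angle_dist (hat k p q B) (fun z => lim_b b (snd z)).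
Proof.
  apply (approx_ext _ _ (hat k p q B) _ (fun z => 0 * cos (snd z) + b * sin (snd z))); [easy|intro; unfold lim_b; ring|].
  apply hat_approx; [easy|easy|apply (jd_B _ _ _ _ _ _ HJ)].
Qed.

Lemma hat_t_approx : approx (Fam lo hi) angle_dist (hat k p q t) (fun _ => 0).
Proof.
  apply (approx_ext _ _ (hat k p q t) _ (fun z => 0 * cos (snd z) + 0 * sin (snd z))); [easy|intro; ring|].
  apply hat_approx; [easy|easy|apply (jd_t _ _ _ _ _ _ HJ)].
Qed.

Lemma lim_disc_away : away (Fam lo hi) (fun z => lim_a a b c (snd z) * lim_a a b c (snd z) + lim_b b (snd z) * lim_b b (snd z) - 0 * 0).
Proof.
  pose proof (proj1 hat_A_approx) as LA. pose proof (proj1 hat_B_approx) as LB.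
  apply (Fam_away lo hi (fun x => lim_a a b c x * lim_a a b c x + lim_b b x * lim_b b x - 0 * 0)); [easy| |].
  - apply lipb_minus; try typeclasses eauto; try apply angle_dist_pos.
    + apply lipb_plus; try typeclasses eauto; apply lipb_mult; try typeclasses eauto; try apply angle_dist_pos; easy.
    + apply lipb_const; [typeclasses eauto|apply angle_dist_pos].
  - intros x _. pose proof (lim_norm_pos a b c x (jd_nondegenerate _ _ _ _ _ _ HJ)). unfold lim_norm in H. lra.
Qed.

Lemma cos_approx : approx (Fam lo hi) angle_dist (fun z => cos (snd z)) (fun z => cos (snd z)).
Proof. apply approx_refl; [typeclasses eauto|apply angle_dist_pos|now apply Fam_cos]. Qed.
Lemma sin_approx : approx (Fam lo hi) angle_dist (fun z => sin (snd z)) (fun z => sin (snd z)).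
Proof. apply approx_refl; [typeclasses eauto|apply angle_dist_pos|now apply Fam_sin]. Qed.
Lemma slope_approx : approx (Fam lo hi) angle_dist (fun z => gauge_slope k p q (snd z)) (fun z => gauge_slope k p q (snd z)).
Proof. apply approx_refl; [typeclasses eauto|apply angle_dist_pos|now apply Fam_slope]. Qed.

Lemma pden_approx : approx (Fam lo hi) angle_dist (pden A B t k p q) (fun z => lim_den a b c k p q (snd z)).
Proof.
  apply (vparts_approx (Fam lo hi) angle_dist angle_dist_pos (hat k p q A) (hat k p q B) (hat k p q t) (fun z => cos (snd z)) (fun z => sin (snd z)) (fun z => gauge_slope k p q (snd z))
    (fun z => lim_a a b c (snd z)) (fun z => lim_b b (snd z)) (fun _ => 0) (fun z => cos (snd z)) (fun z => sin (snd z)) (fun z => gauge_slope k p q (snd z)));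
  [apply hat_A_approx|apply hat_B_approx|apply hat_t_approx|apply cos_approx|apply sin_approx|apply slope_approx|apply lim_disc_away].
Qed.

Lemma pdisc_approx : approx (Fam lo hi) angle_dist (pdisc A B t k p q)
  (fun z => lim_a a b c (snd z) * lim_a a b c (snd z) + lim_b b (snd z) * lim_b b (snd z) - 0 * 0).
Proof.
  pose proof hat_A_approx as H1. pose proof hat_B_approx as H2. pose proof hat_t_approx as H3.
  unfold pdisc. apply (approx_minus (Fam lo hi) angle_dist angle_dist_pos); [apply approx_plus; try typeclasses eauto| ];
    apply (approx_mult (Fam lo hi) angle_dist angle_dist_pos); easy.
Qed.

Context (Hden : forall x, lo <= x <= hi -> 0 < lim_den a b c k p q x).

Lemma lim_den_away : away (Fam lo hi) (fun z => lim_den a b c k p q (snd z)).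
Proof. apply Fam_away; [easy|apply pden_approx|easy]. Qed.

Lemma pfield_approx : approx (Fam lo hi) angle_dist (pfield A B t k p q) (fun z => lim_field a b c k p q (snd z)).
Proof.
  apply (vfield_approx (Fam lo hi) angle_dist angle_dist_pos (hat k p q A) (hat k p q B) (hat k p q t) (fun z => cos (snd z)) (fun z => sin (snd z)) (fun z => gauge_slope k p q (snd z))
    (fun z => lim_a a b c (snd z)) (fun z => lim_b b (snd z)) (fun _ => 0) (fun z => cos (snd z)) (fun z => sin (snd z)) (fun z => gauge_slope k p q (snd z)));
  [apply hat_A_approx|apply hat_B_approx|apply hat_t_approx|apply cos_approx|apply sin_approx|apply slope_approx|apply lim_disc_away|apply lim_den_away].
Qed.

Lemma pparts_positive : exists d, 0 < d /\ forall r x, 0 < r <= d -> lo <= x <= hi ->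
  0 < pden A B t k p q (r, x) /\ 0 < pdisc A B t k p q (r, x).
Proof.
  destruct (approx_away _ _ _ _ pden_approx lim_den_away) as [m [Hm [d [Hd H]]]].
  destruct (approx_away _ _ _ _ pdisc_approx lim_disc_away) as [m' [Hm' [d' [Hd' H']]]].
  exists (Rmin d d'). split; [now apply Rmin_glb_lt|]. pose proof (Rmin_l d d'). pose proof (Rmin_r d d').
  intros r x Hr Hx. specialize (H r x x ltac:(lra) Hx Hx). specialize (H' r x x ltac:(lra) Hx Hx). simpl in *. lra.
Qed.

(** The same calculus is reused at a positive size [r], on pairs of sizes; there it yields the
    continuity of the field in time. *)
Lemma lipb_continuous_at (f : R -> R) r : lipb (filter_prod (locally r) (locally r)) (fun x y => Rabs (x - y)) f -> continuous f r.
Proof.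
  intros [K [HK [P Q [d1 H1] [d2 H2] H]]]. apply filterlim_locally. intro eps.
  assert (He : 0 < eps / (K + 1)) by (apply Rdiv_lt_0_compat; [apply cond_pos|lra]).
  exists (mkposreal _ (Rmin_glb_lt _ _ _ (cond_pos d1) He)). intros y Hy.
  change (Rabs (y - r) < Rmin d1 (eps / (K + 1))) in Hy.
  pose proof (Rmin_l d1 (eps / (K + 1))). pose proof (Rmin_r d1 (eps / (K + 1))).
  change (Rabs (f y - f r) < eps).
  destruct (H y r) as [G _].
  - apply H1. change (Rabs (y - r) < d1). lra.
  - apply H2. apply ball_center.
  - simpl in G. apply Rle_lt_trans with (1 := G).
    apply Rle_lt_trans with ((K + 1) * Rabs (y - r)); [apply Rmult_le_compat_r; [apply Rabs_pos|lra]|].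
    replace (pos eps) with ((K + 1) * (eps / (K + 1))) by (field; lra). apply Rmult_lt_compat_l; lra.
Qed.

Lemma away_at (f : R -> R) r : lipb (filter_prod (locally r) (locally r)) (fun x y => Rabs (x - y)) f -> 0 < f r ->
  away (filter_prod (locally r) (locally r)) f.
Proof.
  intros HL Hp. pose proof (lipb_continuous_at f r HL) as Hc.
  exists (f r / 2). split; [lra|].
  assert (He : 0 < f r / 2) by lra.
  pose proof (proj1 (filterlim_locally _ _) Hc (mkposreal _ He)) as H.
  exists (fun y => f r / 2 <= f y) (fun y => f r / 2 <= f y); try (intros x y H1 H2; easy).
  - revert H. apply filter_imp. intros y Hy. change (Rabs (f y - f r) < f r / 2) in Hy. apply Rabs_def2 in Hy. lra.
  - revert H. apply filter_imp. intros y Hy. change (Rabs (f y - f r) < f r / 2) in Hy. apply Rabs_def2 in Hy. lra.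
Qed.

Lemma plane_lipb al be f : plane_small (fun z => f z - (al * fst z + be * snd z)) -> plane_lipschitz f.
Proof.
  intro H. apply (lipb_of_small Fplane plane_dist (fun z => al * fst z + be * snd z)); [|exact H].
  pose proof (conj plane_lipb_fst plane_lipb_snd) as Hf.
  apply lipb_plus; try typeclasses eauto; (apply lipb_mult; [typeclasses eauto|apply plane_dist_pos|apply lipb_const; [typeclasses eauto|apply plane_dist_pos]|apply Hf]).
Qed.

Lemma hat_lipb_radial f : plane_lipschitz f -> exists d, 0 < d /\ forall r x, 0 < r < d -> lo <= x <= hi ->
  lipb (filter_prod (locally r) (locally r)) (fun x y => Rabs (x - y)) (fun r => hat k p q f (r, x)).
Proof.
  intros [K [HK HF]]. destruct (Fplane_elim _ HF) as [d [Hd H]].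
  destruct (polar_bounds k p q lo hi Hk Hle) as [M [HM HP]].
  exists (d / M). split; [now apply Rdiv_lt_0_compat|]. intros r x Hr Hx.
  assert (Hdp : forall u v : R, 0 <= Rabs (u - v)) by (intros; apply Rabs_pos).
  assert (Hloc : exists P : R -> Prop, locally r P /\ forall r', P r' -> 0 < r' < d / M /\ Rabs r' <= d / M).
  { exists (fun r' => 0 < r' < d / M). split; [|intros r' Hr'; rewrite Rabs_pos_eq; lra].
    apply (filter_and _ _ (open_gt 0 r (proj1 Hr)) (open_lt (d / M) r (proj2 Hr))). }
  destruct Hloc as [P [HP1 HP2]].
  unfold hat; simpl. apply (lipb_mult (filter_prod (locally r) (locally r)) (fun x y => Rabs (x - y)) Hdp (fun r => f (polar k p q r x)) (fun r => / radius k p q r x)).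
  - exists (K * (2 * M) + K). split; [assert (0 <= K * (2 * M)) by (apply Rmult_le_pos; lra); lra|].
    exists P P; try easy. intros u v Hu Hv. simpl. destruct (HP2 u Hu) as [Hu1 _]. destruct (HP2 v Hv) as [Hv1 _].
    assert (Hin : forall w, 0 < w < d / M -> Rabs (fst (polar k p q w x)) < d /\ Rabs (snd (polar k p q w x)) < d).
    { intros w Hw. destruct (HP w x x (proj1 Hw) Hx Hx) as [_ [G1 G2]].
      assert (w * M < d) by (replace d with (d / M * M) by (field; lra); apply Rmult_lt_compat_r; lra). lra. }
    destruct (Hin u Hu1) as [U1 U2]. destruct (Hin v Hv1) as [V1 V2].
    destruct (H _ _ U1 U2 V1 V2) as [G1 [G2 G3]]. cbn [fst snd] in G1, G2, G3.
    assert (HKM : 0 <= K * (2 * M)) by (apply Rmult_le_pos; lra).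
    split; [|lra]. apply Rle_trans with (1 := G1).
    destruct (HP 1 x x ltac:(lra) Hx Hx) as [_ [Q1 Q2]]. rewrite Rmult_1_l in Q1, Q2.
    assert (E : plane_dist (polar k p q u x) (polar k p q v x) <= 2 * M * Rabs (u - v)).
    { unfold plane_dist. replace (fst (polar k p q u x) - fst (polar k p q v x)) with (fst (polar k p q 1 x) * (u - v)) by (unfold polar, radius; simpl; ring).
      replace (snd (polar k p q u x) - snd (polar k p q v x)) with (snd (polar k p q 1 x) * (u - v)) by (unfold polar, radius; simpl; ring).
      rewrite !Rabs_mult. pose proof (Rabs_pos (u - v)).
      assert (Rabs (fst (polar k p q 1 x)) * Rabs (u - v) <= M * Rabs (u - v)) by (apply Rmult_le_compat_r; lra).
      assert (Rabs (snd (polar k p q 1 x)) * Rabs (u - v) <= M * Rabs (u - v)) by (apply Rmult_le_compat_r; lra). lra. }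
    apply Rle_trans with (K * (2 * M * Rabs (u - v))); [now apply Rmult_le_compat_l|].
    assert (0 <= K * Rabs (u - v)) by (apply Rmult_le_pos; [easy|apply Rabs_pos]). lra.
  - assert (Hrad : lipb (filter_prod (locally r) (locally r)) (fun x y => Rabs (x - y)) (fun r => radius k p q r x)).
    { unfold radius. apply lipb_mult; [typeclasses eauto|easy| |now apply lipb_const; [typeclasses eauto|]].
      exists (1 + d / M). assert (0 < d / M) by now apply Rdiv_lt_0_compat. split; [lra|].
      exists P P; try easy. intros u v Hu Hv. simpl. destruct (HP2 u Hu) as [Hu1 Hu2]. destruct (HP2 v Hv) as [Hv1 Hv2].
      assert (0 <= d / M * Rabs (u - v)) by (apply Rmult_le_pos; [lra|apply Rabs_pos]). split; lra. }
    apply lipb_inv; [typeclasses eauto|easy|easy|]. apply away_at; [easy|]. apply radius_pos. easy.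
Qed.

Lemma pfield_continuous : exists d, 0 < d /\ forall r x, 0 < r < d -> lo <= x <= hi -> continuous (fun r => pfield A B t k p q (r, x)) r.
Proof.
  destruct (hat_lipb_radial A (plane_lipb _ _ _ (jd_A _ _ _ _ _ _ HJ))) as [d1 [Hd1 H1]].
  destruct (hat_lipb_radial B (plane_lipb _ _ _ (jd_B _ _ _ _ _ _ HJ))) as [d2 [Hd2 H2]].
  destruct (hat_lipb_radial t (plane_lipb _ _ _ (jd_t _ _ _ _ _ _ HJ))) as [d3 [Hd3 H3]].
  destruct pparts_positive as [d4 [Hd4 H4]].
  exists (Rmin (Rmin d1 d2) (Rmin d3 d4)). split; [repeat apply Rmin_glb_lt; easy|].
  intros r x Hr Hx.
  pose proof (Rmin_l (Rmin d1 d2) (Rmin d3 d4)). pose proof (Rmin_r (Rmin d1 d2) (Rmin d3 d4)).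
  pose proof (Rmin_l d1 d2). pose proof (Rmin_r d1 d2). pose proof (Rmin_l d3 d4). pose proof (Rmin_r d3 d4).
  specialize (H1 r x ltac:(lra) Hx). specialize (H2 r x ltac:(lra) Hx). specialize (H3 r x ltac:(lra) Hx).
  destruct (H4 r x ltac:(lra) Hx) as [P1 P2].
  set (F := filter_prod (locally r) (locally r)) in *. set (D := fun x y : R => Rabs (x - y)) in *.
  assert (Hdp : forall u v : R, 0 <= D u v) by (intros; apply Rabs_pos).
  assert (FF : Filter F) by (unfold F; typeclasses eauto).
  apply lipb_continuous_at. fold F. fold D.
  assert (R1 : approx F D (fun r => hat k p q A (r, x)) (fun r => hat k p q A (r, x))) by now apply approx_refl.
  assert (R2 : approx F D (fun r => hat k p q B (r, x)) (fun r => hat k p q B (r, x))) by now apply approx_refl.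
  assert (R3 : approx F D (fun r => hat k p q t (r, x)) (fun r => hat k p q t (r, x))) by now apply approx_refl.
  assert (Hdisc : away F (fun r => hat k p q A (r, x) * hat k p q A (r, x) + hat k p q B (r, x) * hat k p q B (r, x) - hat k p q t (r, x) * hat k p q t (r, x))).
  { apply away_at; [|exact P2]. apply lipb_minus; try easy; [apply lipb_plus; try easy|]; now apply lipb_mult. }
  pose proof (vparts_approx F D Hdp _ _ _ (fun _ => cos x) (fun _ => sin x) (fun _ => gauge_slope k p q x) _ _ _ (fun _ => cos x) (fun _ => sin x) (fun _ => gauge_slope k p q x)
     R1 R2 R3 ltac:(now apply approx_const) ltac:(now apply approx_const) ltac:(now apply approx_const) Hdisc) as [_ Hd].
  apply (approx_lipb F D) with (f := fun r => pfield A B t k p q (r, x)).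
  apply (vfield_approx F D Hdp (fun r => hat k p q A (r, x)) (fun r => hat k p q B (r, x)) (fun r => hat k p q t (r, x)) (fun _ => cos x) (fun _ => sin x) (fun _ => gauge_slope k p q x)
     (fun r => hat k p q A (r, x)) (fun r => hat k p q B (r, x)) (fun r => hat k p q t (r, x)) (fun _ => cos x) (fun _ => sin x) (fun _ => gauge_slope k p q x) R1 R2 R3); try (now apply approx_const); [exact Hdisc|].
  apply away_at; [|exact P1]. apply (approx_lipb F D) in Hd. exact Hd.
Qed.

(** Sizes above [r0] are replaced by [r0] and angles are clamped to the sector, which makes the
    field globally bounded and Lipschitz. Inside the sector and up to size [r0] nothing is
    changed. *)
Definition polar_cell (r0 : R) : cell :=
  Cell lo hi (gauge_height k p q) (gauge_slope k p q) (fun s x => pfield A B t k p q (Rmin (exp s) r0, clamp lo hi x)).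

Lemma polar_cell_field : exists d, 0 < d /\ forall r0, 0 < r0 <= d -> exists L M, lipschitz_field (field (polar_cell r0)) L M.
Proof.
  destruct (approx_lipb _ _ _ _ pfield_approx) as [K [HK [d1 [Hd1 H1]]]].
  destruct pfield_continuous as [d2 [Hd2 H2]].
  exists (Rmin d1 (d2 / 2)). split; [apply Rmin_glb_lt; lra|]. intros r0 Hr0.
  pose proof (Rmin_l d1 (d2 / 2)). pose proof (Rmin_r d1 (d2 / 2)).
  assert (Hr : forall s, 0 < Rmin (exp s) r0 <= r0).
  { intro s. split; [apply Rmin_glb_lt; [apply exp_pos|easy]|apply Rmin_r]. }
  exists (K + 1), K. split; simpl.
  - lra.
  - intros s x. specialize (Hr s). pose proof (clamp_range lo hi x Hle).
    destruct (H1 (Rmin (exp s) r0) (clamp lo hi x) (clamp lo hi x)) as [_ [G _]]; try lra. exact G.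
  - intros s x y. specialize (Hr s). pose proof (clamp_range lo hi x Hle). pose proof (clamp_range lo hi y Hle).
    destruct (H1 (Rmin (exp s) r0) (clamp lo hi x) (clamp lo hi y)) as [G _]; try lra. cbn [fst snd] in G.
    apply Rle_trans with (1 := G). unfold angle_dist; simpl.
    apply Rmult_le_compat; [easy|apply Rabs_pos|lra|apply clamp_lipschitz].
  - intros x s. specialize (Hr s).
    apply (continuous_comp (fun s => Rmin (exp s) r0) (fun r => pfield A B t k p q (r, clamp lo hi x))).
    + apply filterlim_locally. intro eps.
      pose proof (proj1 (filterlim_locally _ _) (is_derive_continuous _ _ _ (is_derive_exp s)) eps) as He.
      revert He. apply filter_imp. intros y Hy. change (Rabs (exp y - exp s) < eps) in Hy.
      change (Rabs (Rmin (exp y) r0 - Rmin (exp s) r0) < eps).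
      apply Rle_lt_trans with (2 := Hy). unfold Rmin. repeat destruct Rle_dec; unfold Rabs; repeat destruct Rcase_abs; lra.
    + apply H2; [lra|now apply clamp_range].
Qed.

Lemma polar_cell_smooth r0 : smooth_height (polar_cell r0).
Proof. split; simpl; intro x; [apply is_derive_gauge_height|now apply gauge_slope_continuous]. Qed.

Lemma polar_cell_bounded r0 : exists H, forall x, lo <= x <= hi -> exp (- height (polar_cell r0) x) <= H.
Proof.
  destruct (continuous_bounded_on (fun x => exp (- gauge_height k p q x)) lo hi Hle) as [M [_ HM]].
  - intro x. apply (continuous_comp (fun x => - gauge_height k p q x) exp); [|eapply is_derive_continuous; apply is_derive_exp].
    apply (continuous_opp (gauge_height k p q)). eapply is_derive_continuous; apply is_derive_gauge_height.
  - exists M. intros x Hx. simpl. apply Rle_trans with (2 := HM x Hx). apply Rle_abs.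
Qed.

Context (L : line_field).
(** The equation leaves two lines of directions and the inequality selects one of them; both
    conditions are invariant when [w] is multiplied by a nonzero number. *)
Definition contains_directions : Prop := exists d, 0 < d /\ forall z w : R * R, z <> (0, 0) -> Rabs (fst z) < d -> Rabs (snd z) < d ->
  A z * (snd w ^ 2 - fst w ^ 2) + 2 * B z * fst w * snd w + t z * (fst w ^ 2 + snd w ^ 2) = 0 ->
  0 < B z * (fst w ^ 2 - snd w ^ 2) + 2 * A z * fst w * snd w -> L z w.

Lemma polar_cell_value r0 r x : 0 < r <= r0 -> lo <= x <= hi -> field (polar_cell r0) (ln r) x = pfield A B t k p q (r, x).
Proof. intros Hr Hx. simpl. rewrite exp_ln by lra. rewrite Rmin_left by lra. now rewrite clamp_id. Qed.

Lemma polar_cell_tangent : contains_directions -> exists d, 0 < d /\ forall r0, 0 < r0 <= d -> tangent_cell L r0 (polar_cell r0).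
Proof.
  intros [d1 [Hd1 HL]]. destruct pparts_positive as [d2 [Hd2 H2]].
  destruct (polar_bounds k p q lo hi Hk Hle) as [M [HM HP]].
  exists (Rmin (d1 / (2 * M)) d2). assert (0 < d1 / (2 * M)) by (apply Rdiv_lt_0_compat; lra). split; [now apply Rmin_glb_lt|].
  pose proof (Rmin_l (d1 / (2 * M)) d2). pose proof (Rmin_r (d1 / (2 * M)) d2).
  intros r0 Hr0 r x e Hr Hx He. simpl in Hx.
  destruct (H2 r x ltac:(lra) Hx) as [P1 P2].
  destruct (HP r x x (proj1 Hr) Hx Hx) as [_ [Q1 Q2]].
  assert (HrM : r * M < d1).
  { apply Rle_lt_trans with (d1 / (2 * M) * M); [apply Rmult_le_compat_r; lra|]. replace (d1 / (2 * M) * M) with (d1 / 2) by (field; lra). lra. }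
  change (point (polar_cell r0) r x) with (polar k p q r x).
  pose proof (radius_pos k p q r x (proj1 Hr)) as Hrho.
  assert (Hu : cos x * cos x + sin x * sin x = 1) by (pose proof (sin2_cos2 x) as E; unfold Rsqr in E; lra).
  destruct (vfield_direction (hat k p q A (r, x)) (hat k p q B (r, x)) (hat k p q t (r, x)) (cos x) (sin x) (gauge_slope k p q x) P2 Hu P1) as [D1 D2].
  (* The values at the point are the blown-up ones times the radius, so equation and inequality
     carry over from [vfield_direction] up to a positive factor. *)
  assert (EA : forall f, f (polar k p q r x) = radius k p q r x * hat k p q f (r, x)) by (intro f; unfold hat; simpl; field; lra).
  assert (Hv : velocity (polar_cell r0) r x = scale (radius k p q r x)
     ((1 - gauge_slope k p q x * pfield A B t k p q (r, x)) * cos x - pfield A B t k p q (r, x) * sin x,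
      (1 - gauge_slope k p q x * pfield A B t k p q (r, x)) * sin x + pfield A B t k p q (r, x) * cos x)).
  { unfold velocity. rewrite polar_cell_value by easy. reflexivity. }
  rewrite Hv. unfold pfield in *; cbn [fst snd] in *.
  set (g := vfield _ _ _ _ _ _) in *. cbv zeta in D1, D2.
  set (X := (1 - gauge_slope k p q x * g) * cos x - g * sin x) in *. set (Y := (1 - gauge_slope k p q x * g) * sin x + g * cos x) in *.
  apply HL.
  - intro E. unfold polar in E. injection E. intros E2 E1.
    apply Rmult_integral in E1. apply Rmult_integral in E2. destruct E1 as [E1|E1]; [lra|]. destruct E2 as [E2|E2]; [lra|].
    rewrite E1, E2 in Hu. lra.
  - lra.
  - lra.
  - rewrite !EA. unfold scale; simpl. set (rho := radius k p q r x) in *.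
    transitivity (e * e * rho * rho * rho * (hat k p q A (r, x) * (Y ^ 2 - X ^ 2) + 2 * hat k p q B (r, x) * X * Y + hat k p q t (r, x) * (X ^ 2 + Y ^ 2))); [ring|].
    rewrite D1. ring.
  - rewrite !EA. unfold scale; simpl. set (rho := radius k p q r x) in *.
    apply Rlt_le_trans with (e * e * (rho * rho * rho) * (hat k p q B (r, x) * (X ^ 2 - Y ^ 2) + 2 * hat k p q A (r, x) * X * Y)); [|right; ring].
    apply Rmult_lt_0_compat; [|easy]. apply Rmult_lt_0_compat; [|apply Rmult_lt_0_compat; [apply Rmult_lt_0_compat; exact Hrho|exact Hrho]].
    apply Rlt_0_sqr in He. exact He.
Qed.
End Cells.

(** * Cells with one separatrix and cells with two *)

Lemma lower_le_upper F r0 c r : good_cell F r0 c -> 0 < r -> lower c 0 r <= upper c 0 r.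
Proof.
  intros HG Hr. pose proof (good_upper F r0 c HG) as HU. pose proof (good_lower F r0 c HG) as HL.
  destruct HG as [_ [_ [_ [L [B [p [q [m HT]]]]]]]].
  pose proof (tr_field _ _ _ _ _ _ _ _ HT) as HF. pose proof (tr_order _ _ _ _ _ _ _ _ HT) as Ho.
  apply Rnot_lt_le. intro Hlt. set (e := (lower c 0 r - upper c 0 r) / 2). assert (He : 0 < e) by (unfold e; lra).
  destruct (hc_continuous _ _ _ HU 0 r ltac:(lra) Hr e He) as [d1 [Hd1 H1]].
  destruct (hc_continuous _ _ _ HL 0 r ltac:(lra) Hr e He) as [d2 [Hd2 H2]].
  set (C := Rmin r (Rmin d1 d2) / 2).
  assert (HC : 0 < Rmin r (Rmin d1 d2)) by (repeat apply Rmin_glb_lt; easy).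
  pose proof (Rmin_l r (Rmin d1 d2)). pose proof (Rmin_r r (Rmin d1 d2)). pose proof (Rmin_l d1 d2). pose proof (Rmin_r d1 d2).
  assert (HC' : 0 < C) by (unfold C; lra). assert (HCr : C <= r) by (unfold C; lra).
  assert (A1 : Rabs (C - 0) < d1) by (rewrite Rminus_0_r, Rabs_pos_eq; unfold C; lra).
  assert (A2 : Rabs (C - 0) < d2) by (rewrite Rminus_0_r, Rabs_pos_eq; unfold C; lra).
  assert (A0 : forall d, 0 < d -> Rabs (r - r) < d) by (intros; now rewrite Rminus_diag, Rabs_R0).
  specialize (H1 C r ltac:(lra) A1 (A0 _ Hd1)). specialize (H2 C r ltac:(lra) A2 (A0 _ Hd2)).
  apply Rabs_def2 in H1. apply Rabs_def2 in H2.
  destruct (hc_solution _ _ _ HU C ltac:(lra)) as [u [Hu Hu']]. destruct (hc_solution _ _ _ HL C ltac:(lra)) as [v [Hv Hv']].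
  (* For [C > 0] the leaves from [lo] and from [hi] start in this order and keep it; for small [C]
     they are too close to the separatrices for these to be in the opposite order. *)
  assert (Hvu : v (ln r) < u (ln r)).
  { apply (solution_order _ L B _ _ (ln C) _ HF Hv Hu). rewrite <- Hu', <- Hv' by easy.
    rewrite (hc_diag _ _ _ HU), (hc_diag _ _ _ HL) by easy. lra. }
  rewrite <- Hu', <- Hv' in Hvu by easy. unfold e in *. lra.
Qed.

Lemma edges_of_trapped c L B p q m r : trapped (field c) L B (lo c) p q (hi c) m -> 0 < r ->
  upper c 0 r <= q /\ p <= lower c 0 r.
Proof.
  intros HT Hr. unfold upper, lower, left_leaf. rewrite !right_leaf_0. split.
  - apply (edge_bounds _ _ _ _ _ _ _ (trapped_right _ _ _ _ _ _ _ _ HT)).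
  - pose proof (edge_bounds _ _ _ _ _ _ _ (trapped_left _ _ _ _ _ _ _ _ HT) (ln r)). lra.
Qed.

(** Both separatrices stay in [[p, q]] for all times, in the past as well, and there contraction
    leaves room for one solution only. *)
Lemma thin_of_contraction F r0 c L B p q m nu : good_cell F r0 c -> trapped (field c) L B (lo c) p q (hi c) m -> 0 < nu ->
  (forall s x y, p <= y <= x -> x <= q -> field c s x - field c s y <= - nu * (x - y)) ->
  forall r, 0 < r -> lower c 0 r = upper c 0 r.
Proof.
  intros HG HT Hnu Hc r Hr.
  destruct (hc_solution _ _ _ (good_upper F r0 c HG) 0 ltac:(lra)) as [u [Hu Hu']].
  destruct (hc_solution _ _ _ (good_lower F r0 c HG) 0 ltac:(lra)) as [v [Hv Hv']].
  rewrite (Hu' r Hr), (Hv' r Hr). symmetry.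
  assert (Hb : forall s, p <= v s /\ v s <= u s /\ u s <= q).
  { intro s. rewrite <- (ln_exp s), <- Hu', <- Hv' by apply exp_pos.
    destruct (edges_of_trapped c L B p q m (exp s) HT (exp_pos s)) as [H1 H2].
    pose proof (lower_le_upper F r0 c (exp s) HG (exp_pos s)). lra. }
  apply (contraction_unique (field c) u v p q nu); try easy.
  - intro s. destruct (Hb s) as [H1 [H2 H3]]. now split.
  - intro s. apply Hb.
Qed.

(** A leaf that enters from [lo] cannot rise past [x1], and one that enters from [hi] cannot fall
    below [x2]; the separatrices, limits of such leaves, stay apart. *)
Lemma fat_of_barriers F r0 c x1 x2 : good_cell F r0 c -> lo c <= x1 < x2 -> x2 <= hi c ->
  (forall s, field c s x1 < 0) -> (forall s, 0 < field c s x2) ->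
  forall r, 0 < r -> lower c 0 r < upper c 0 r.
Proof.
  intros HG Hx1 Hx2 H1 H2 r Hr. pose proof (good_upper F r0 c HG) as HU. pose proof (good_lower F r0 c HG) as HL.
  assert (Hlim : forall Y x0, half_cell c Y x0 -> forall eps, 0 < eps -> exists C, 0 < C <= r /\ Rabs (Y C r - Y 0 r) < eps).
  { intros Y x0 HY eps He. destruct (hc_continuous _ _ _ HY 0 r ltac:(lra) Hr eps He) as [d [Hd H]].
    exists (Rmin r d / 2). assert (0 < Rmin r d) by now apply Rmin_glb_lt. pose proof (Rmin_l r d). pose proof (Rmin_r r d).
    split; [lra|]. apply H; [lra| |rewrite Rminus_diag, Rabs_R0; easy]. rewrite Rminus_0_r, Rabs_pos_eq; lra. }
  assert (A : lower c 0 r <= x1).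
  { apply le_epsilon. intros eps He. destruct (Hlim _ _ HL eps He) as [C [HC HCe]]. apply Rabs_def2 in HCe.
    destruct (hc_solution _ _ _ HL C ltac:(lra)) as [v [Hv Hv']].
    assert (lower c C r <= x1); [|lra]. rewrite Hv' by easy.
    apply (barrier (field c) v x1 (ln C)); try easy; [apply ln_le_compat; lra|].
    rewrite <- Hv', (hc_diag _ _ _ HL) by lra. lra. }
  assert (B : x2 <= upper c 0 r).
  { apply le_epsilon. intros eps He. destruct (Hlim _ _ HU eps He) as [C [HC HCe]]. apply Rabs_def2 in HCe.
    destruct (hc_solution _ _ _ HU C ltac:(lra)) as [v [Hv Hv']].
    assert (x2 <= upper c C r); [|lra]. rewrite Hv' by easy.
    assert (- v (ln r) <= - x2); [|lra].
    apply (barrier (reflect_field (field c)) (fun s => - v s) (- x2) (ln C)); try easy.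
    - intro s. unfold reflect_field. rewrite Ropp_involutive. apply (is_derive_opp v). apply Hv.
    - intro s. unfold reflect_field. rewrite Ropp_involutive. specialize (H2 s). lra.
    - apply ln_le_compat; lra.
    - rewrite <- Hv', (hc_diag _ _ _ HU) by lra. lra. }
  lra.
Qed.

(* On the circle of size [r] tending to [0], [(lim_d, lim_c)] is proportional to
   [(cos, sin)] of twice the angle from the radius to the direction field.  At a
   zero of [lim_c] the direction is radial if [lim_d > 0], and orthogonal to the
   radius if [lim_d < 0].  [lim_dc] is the derivative of [lim_c]. *)
Definition lim_c (a b c x : R) : R :=
  lim_a a b c x * (cos x * cos x - sin x * sin x) - lim_b b x * (2 * (cos x * sin x)).
Definition lim_d (a b c x : R) : R :=
  lim_b b x * (cos x * cos x - sin x * sin x) + lim_a a b c x * (2 * (cos x * sin x)).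
Definition lim_dc (a b c x : R) : R :=
  ((a - b) / 2 * sin x + c / 2 * cos x) * (cos x * cos x - sin x * sin x) - lim_a a b c x * (4 * (cos x * sin x))
  - b * cos x * (2 * (cos x * sin x)) - lim_b b x * (2 * (cos x * cos x - sin x * sin x)).

Lemma cos2_sin2 x : cos x * cos x + sin x * sin x = 1.
Proof. pose proof (sin2_cos2 x) as E. unfold Rsqr in E. lra. Qed.

Lemma lim_cd_norm a b c x : lim_c a b c x * lim_c a b c x + lim_d a b c x * lim_d a b c x = lim_norm a b c x.
Proof.
  unfold lim_c, lim_d, lim_norm. set (A := lim_a a b c x). set (B := lim_b b x). pose proof (cos2_sin2 x) as E.
  transitivity ((A * A + B * B) * ((cos x * cos x + sin x * sin x) * (cos x * cos x + sin x * sin x))); [ring|rewrite E; ring].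
Qed.

Lemma is_derive_lim_c a b c x : is_derive (lim_c a b c) x (lim_dc a b c x).
Proof. unfold lim_c, lim_dc, lim_a, lim_b. auto_derive; [easy|]. field. Qed.

Lemma continuous_lim_dc a b c x : continuous (lim_dc a b c) x.
Proof. apply (ex_derive_continuous (lim_dc a b c)). unfold lim_dc, lim_a, lim_b. auto_derive. easy. Qed.

Definition lim_n (a b c x : R) : R := sqrt (lim_norm a b c x).

Section Limit.
Context (a b c : R) (Hab : b * (b - a) <> 0).

Lemma lim_n_pos x : 0 < lim_n a b c x.
Proof. apply sqrt_lt_R0. now apply lim_norm_pos. Qed.

Lemma lim_n_sqr x : lim_n a b c x * lim_n a b c x = lim_c a b c x * lim_c a b c x + lim_d a b c x * lim_d a b c x.
Proof. rewrite lim_cd_norm. unfold lim_n. apply sqrt_sqrt. left. now apply lim_norm_pos. Qed.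

Lemma lim_n_ge x : Rabs (lim_d a b c x) <= lim_n a b c x /\ Rabs (lim_c a b c x) <= lim_n a b c x.
Proof.
  pose proof (lim_n_sqr x) as H. pose proof (lim_n_pos x) as Hp.
  split; apply Rsqr_incr_0_var; try lra; rewrite <- Rsqr_abs; unfold Rsqr; rewrite H.
  - pose proof (Rle_0_sqr (lim_c a b c x)) as K. unfold Rsqr in K. lra.
  - pose proof (Rle_0_sqr (lim_d a b c x)) as K. unfold Rsqr in K. lra.
Qed.

(** With [phi] the angle from the radius to the limit direction, [lim_n - lim_d] and [lim_n + lim_d]
    are [2 n sin^2 phi] and [2 n cos^2 phi], where [n = lim_n]: the former vanishes in radial
    directions only, the latter in orthogonal ones. *)
Lemma lim_n_minus x : (lim_c a b c x = 0 -> lim_d a b c x < 0) -> 0 < lim_n a b c x - lim_d a b c x.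
Proof.
  intro H. pose proof (lim_n_sqr x) as E. pose proof (lim_n_pos x) as Hp. destruct (lim_n_ge x) as [Hd _]. apply Rabs_le_between in Hd.
  destruct (Req_dec (lim_n a b c x) (lim_d a b c x)) as [Q|Q]; [|lra].
  rewrite Q in E. assert (lim_c a b c x = 0) by (apply Rsqr_0_uniq; unfold Rsqr; lra). specialize (H H0). lra.
Qed.

Lemma lim_n_plus x : (lim_c a b c x = 0 -> 0 < lim_d a b c x) -> 0 < lim_n a b c x + lim_d a b c x.
Proof.
  intro H. pose proof (lim_n_sqr x) as E. pose proof (lim_n_pos x) as Hp. destruct (lim_n_ge x) as [Hd _]. apply Rabs_le_between in Hd.
  destruct (Req_dec (lim_n a b c x) (- lim_d a b c x)) as [Q|Q]; [|lra].
  rewrite Q in E. assert (lim_c a b c x = 0) by (apply Rsqr_0_uniq; unfold Rsqr; lra). specialize (H H0). lra.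
Qed.

Lemma lim_parts k p q x : let w := gauge_slope k p q x in
  lim_num a b c k p q x = lim_n a b c x * (lim_c a b c x + w * (lim_n a b c x - lim_d a b c x)) /\
  lim_den a b c k p q x = lim_n a b c x * (lim_n a b c x + lim_d a b c x + 2 * w * lim_c a b c x + w * w * (lim_n a b c x - lim_d a b c x)).
Proof.
  intro w. unfold lim_num, lim_den, vden, vrad, vnum, polar_re, polar_im, dir_re, dir_im, dir_root. fold w.
  replace (lim_a a b c x * lim_a a b c x + lim_b b x * lim_b b x - 0 * 0) with (lim_norm a b c x) by (unfold lim_norm; ring).
  fold (lim_n a b c x). pose proof (lim_n_sqr x) as E. rewrite lim_cd_norm in E. 
  change (lim_a a b c x * lim_a a b c x + lim_b b x * lim_b b x) with (lim_norm a b c x). rewrite <- E.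
  unfold lim_c, lim_d. split; ring.
Qed.

(** A radial direction at which the limit field decreases through zero as a function of the angle.
    Neighbouring leaves approach it as [ln r] grows; backwards in time they move away from it, and a
    single leaf near it reaches the origin. *)
Definition saddle (x : R) : Prop := lim_c a b c x = 0 /\ 0 < lim_d a b c x /\ lim_dc a b c x < 0.

Lemma saddle_local x : saddle x -> exists d, 0 < d /\
  (forall y, x < y <= x + d -> lim_c a b c y < 0) /\ (forall y, x - d <= y < x -> 0 < lim_c a b c y).
Proof.
  intros [H0 [_ Hd]].
  destruct (continuous_eps _ _ (continuous_lim_dc a b c x) (- lim_dc a b c x) ltac:(lra)) as [d [Hdp H]].
  exists (d / 2). split; [lra|].
  assert (Hneg : forall y, Rabs (y - x) < d -> lim_dc a b c y < 0) by (intros y Hy; specialize (H y Hy); apply Rabs_def2 in H; lra).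
  split; intros y Hy.
  - destruct (mvt_le (lim_c a b c) (lim_dc a b c) x y ltac:(lra)) as [s [Hs He]]; [intros; apply is_derive_lim_c|].
    assert (lim_dc a b c s < 0) by (apply Hneg; rewrite Rabs_pos_eq; lra). rewrite H0 in He.
    assert (lim_dc a b c s * (y - x) < 0) by (apply Rmult_neg_pos; lra). lra.
  - destruct (mvt_le (lim_c a b c) (lim_dc a b c) y x ltac:(lra)) as [s [Hs He]]; [intros; apply is_derive_lim_c|].
    assert (lim_dc a b c s < 0) by (apply Hneg; rewrite Rabs_left1; lra). rewrite H0 in He.
    assert (lim_dc a b c s * (x - y) < 0) by (apply Rmult_neg_pos; lra). lra.
Qed.

(* All radial directions of the sector [[lo, hi]] lie in [[p, q]], and the
   outermost ones are saddles: [p = q] for one separatrix, while between [p < q]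
   all leaves tend to the origin. *)
Record core (lo p q hi : R) : Prop := {
  co_order : lo < p /\ p <= q /\ q < hi;
  co_left : saddle p;
  co_right : saddle q;
  co_inside : forall x, p <= x <= q -> lim_c a b c x = 0 -> 0 < lim_d a b c x;
  co_above : forall x, q < x <= hi -> lim_c a b c x = 0 -> lim_d a b c x < 0;
  co_below : forall x, lo <= x < p -> lim_c a b c x = 0 -> lim_d a b c x < 0 }.

Lemma gap_bound l h : l <= h -> (forall x, l <= x <= h -> lim_c a b c x = 0 -> lim_d a b c x < 0) ->
  exists e M, 0 < e /\ 0 < M /\ forall x, l <= x <= h -> e <= lim_n a b c x - lim_d a b c x /\ lim_n a b c x <= M.
Proof.
  intros Hlh H.
  assert (Hn : forall x, continuous (lim_n a b c) x).
  { intro x. unfold lim_n. apply (continuous_comp (lim_norm a b c) sqrt); [|apply continuous_sqrt].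
    apply (ex_derive_continuous (lim_norm a b c)). unfold lim_norm, lim_a, lim_b. auto_derive. easy. }
  assert (Hd : forall x, continuous (lim_d a b c) x).
  { intro x. apply (ex_derive_continuous (lim_d a b c)). unfold lim_d, lim_a, lim_b. auto_derive. easy. }
  destruct (continuity_ab_min (fun x => lim_n a b c x - lim_d a b c x) l h Hlh) as [x0 [H1 Hx0]].
  { intros x _. apply continuity_pt_filterlim. apply (continuous_minus (lim_n a b c) (lim_d a b c)); auto. }
  destruct (continuous_bounded_on (lim_n a b c) l h Hlh Hn) as [M [HM HB]].
  exists (lim_n a b c x0 - lim_d a b c x0), M. split; [apply lim_n_minus; auto|split; [easy|]].
  intros x Hx. split; [now apply H1|]. apply Rle_trans with (2 := HB x Hx). apply Rle_abs.
Qed.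

(* Far from the core the terms of highest degree in the slope [w] dominate;
   close to it [lim_c] and [w] have the same sign. *)
Lemma choose_slope lo p q hi : core lo p q hi -> exists k0, 0 < k0 /\ forall k, k0 <= k ->
  (forall x, lo <= x <= hi -> 0 < lim_den a b c k p q x) /\
  (forall x, q < x <= hi -> lim_num a b c k p q x < 0) /\
  (forall x, lo <= x < p -> 0 < lim_num a b c k p q x).
Proof.
  intro HC. pose proof (co_order _ _ _ _ HC) as Ho.
  destruct (saddle_local p (co_left _ _ _ _ HC)) as [d1 [Hd1 [_ Hp]]].
  destruct (saddle_local q (co_right _ _ _ _ HC)) as [d2 [Hd2 [Hq _]]].
  set (d := Rmin (Rmin d1 d2) (Rmin (p - lo) (hi - q))).
  assert (Hd : 0 < d) by (unfold d; repeat apply Rmin_glb_lt; lra).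
  assert (Hdd : d <= d1 /\ d <= d2 /\ d <= p - lo /\ d <= hi - q).
  { unfold d. pose proof (Rmin_l (Rmin d1 d2) (Rmin (p - lo) (hi - q))). pose proof (Rmin_r (Rmin d1 d2) (Rmin (p - lo) (hi - q))).
    pose proof (Rmin_l d1 d2). pose proof (Rmin_r d1 d2). pose proof (Rmin_l (p - lo) (hi - q)). pose proof (Rmin_r (p - lo) (hi - q)). lra. }
  destruct (gap_bound (q + d) hi ltac:(lra)) as [e1 [M1 [He1 [HM1 H1]]]].
  { intros x Hx. apply (co_above _ _ _ _ HC). lra. }
  destruct (gap_bound lo (p - d) ltac:(lra)) as [e2 [M2 [He2 [HM2 H2]]]].
  { intros x Hx. apply (co_below _ _ _ _ HC). lra. }
  assert (Hfar : forall e M, 0 < e -> 0 < M -> exists k0, 0 < k0 /\ forall k, k0 <= k -> forall x w, e <= lim_n a b c x - lim_d a b c x ->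
     lim_n a b c x <= M -> k * d <= Rabs w ->
     0 < lim_n a b c x + lim_d a b c x + 2 * w * lim_c a b c x + w * w * (lim_n a b c x - lim_d a b c x) /\
     M < Rabs w * (lim_n a b c x - lim_d a b c x)).
  (* This [k0] gives [Rabs w * (lim_n - lim_d) >= 2 * M + 1]. The term in [w * w] then beats the
     mixed term, which is at most [2 * Rabs w * M], and in the numerator the slope term beats
     [lim_c]. *)
  { intros e M He HM. exists ((2 * M + 1) / (e * d)). assert (Hed : 0 < e * d) by now apply Rmult_lt_0_compat.
    split; [apply Rdiv_lt_0_compat; lra|]. intros k Hk x w Hx HxM Hw.
    assert (Hkd : 2 * M + 1 <= k * d * e).
    { replace (2 * M + 1) with ((2 * M + 1) / (e * d) * d * e) by (field; lra).
      apply Rmult_le_compat_r; [lra|]. apply Rmult_le_compat_r; lra. }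
    assert (Hwe : 2 * M + 1 <= Rabs w * (lim_n a b c x - lim_d a b c x)).
    { apply Rle_trans with (1 := Hkd). pose proof (Rabs_pos w).
      apply Rle_trans with (Rabs w * e); [apply Rmult_le_compat_r; lra|apply Rmult_le_compat_l; lra]. }
    split; [|lra].
    destruct (lim_n_ge x) as [G1 G2]. apply Rabs_le_between in G1.
    assert (Hwpos : 0 < Rabs w).
    { destruct (Rabs_pos w) as [|E]; [easy|]. rewrite <- E in Hwe. lra. }
    assert (Hww : w * w = Rabs w * Rabs w) by (rewrite <- Rabs_mult; symmetry; apply Rabs_pos_eq; apply Rle_0_sqr).
    assert (Hwc : - (2 * Rabs w * M) <= 2 * w * lim_c a b c x).
    { assert (Hb : Rabs (w * lim_c a b c x) <= Rabs w * M) by (rewrite Rabs_mult; apply Rmult_le_compat_l; lra).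
      apply Rabs_le_between in Hb. lra. }
    assert (Rabs w * (2 * M + 1) <= w * w * (lim_n a b c x - lim_d a b c x)).
    { rewrite Hww, Rmult_assoc. apply Rmult_le_compat_l; lra. }
    lra. }
  destruct (Hfar e1 M1 He1 HM1) as [k1 [Hk1 F1]]. destruct (Hfar e2 M2 He2 HM2) as [k2 [Hk2 F2]].
  exists (Rmax k1 k2). split; [apply Rlt_le_trans with (1 := Hk1), Rmax_l|].
  intros k Hk. pose proof (Rmax_l k1 k2). pose proof (Rmax_r k1 k2).
  assert (Hk0 : 0 < k) by lra.
  assert (Wr : forall x, q <= x -> gauge_slope k p q x = - (k * (x - q))).
  { intros x Hx. unfold gauge_slope. rewrite (Rmax_left 0 (p - x)), (Rmax_right 0 (x - q)) by lra. ring. }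
  assert (Wl : forall x, x <= p -> gauge_slope k p q x = k * (p - x)).
  { intros x Hx. unfold gauge_slope. rewrite (Rmax_right 0 (p - x)), (Rmax_left 0 (x - q)) by lra. ring. }
  assert (Wm : forall x, p <= x <= q -> gauge_slope k p q x = 0).
  { intros x Hx. unfold gauge_slope. rewrite !Rmax_left by lra. ring. }
  assert (Right : forall x, q < x <= hi -> 0 < lim_den a b c k p q x /\ lim_num a b c k p q x < 0).
  { intros x Hx. destruct (lim_parts k p q x) as [-> ->]. pose proof (lim_n_pos x) as Hn.
    assert (Hkx : 0 < k * (x - q)) by (apply Rmult_lt_0_compat; lra).
    destruct (lim_n_ge x) as [G1 G2]. apply Rabs_le_between in G1. apply Rabs_le_between in G2.
    rewrite (Wr x ltac:(lra)). set (w := k * (x - q)) in *.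
    destruct (Rle_dec x (q + d)) as [Hc|Hc].
    - specialize (Hq x ltac:(lra)).
      assert (Hnd : 0 < lim_n a b c x + lim_d a b c x) by (apply lim_n_plus; intro; lra).
      assert (0 <= w * (lim_n a b c x - lim_d a b c x)) by (apply Rmult_le_pos; lra).
      assert (0 <= w * w * (lim_n a b c x - lim_d a b c x)) by (apply Rmult_le_pos; [apply Rle_0_sqr|lra]).
      assert (0 < w * - lim_c a b c x) by (apply Rmult_lt_0_compat; lra).
      split; [apply Rmult_lt_0_compat; lra|].
      assert (0 < lim_n a b c x * - (lim_c a b c x + - w * (lim_n a b c x - lim_d a b c x))) by (apply Rmult_lt_0_compat; lra). lra.
    - destruct (H1 x ltac:(lra)) as [E1 E2].
      assert (Hw : Rabs (- w) = w) by (rewrite Rabs_Ropp; apply Rabs_pos_eq; lra).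
      assert (Hkd : k * d <= Rabs (- w)) by (rewrite Hw; unfold w; apply Rmult_le_compat_l; lra).
      destruct (F1 k ltac:(lra) x (- w) E1 E2 Hkd) as [G3 G4]. rewrite Hw in G4.
      split; [apply Rmult_lt_0_compat; lra|].
      assert (0 < lim_n a b c x * - (lim_c a b c x + - w * (lim_n a b c x - lim_d a b c x))) by (apply Rmult_lt_0_compat; lra). lra. }
  assert (Left : forall x, lo <= x < p -> 0 < lim_den a b c k p q x /\ 0 < lim_num a b c k p q x).
  { intros x Hx. destruct (lim_parts k p q x) as [-> ->]. pose proof (lim_n_pos x) as Hn.
    assert (Hkx : 0 < k * (p - x)) by (apply Rmult_lt_0_compat; lra).
    destruct (lim_n_ge x) as [G1 G2]. apply Rabs_le_between in G1. apply Rabs_le_between in G2.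
    rewrite (Wl x ltac:(lra)). set (w := k * (p - x)) in *.
    destruct (Rle_dec (p - d) x) as [Hc|Hc].
    - specialize (Hp x ltac:(lra)).
      assert (Hnd : 0 < lim_n a b c x + lim_d a b c x) by (apply lim_n_plus; intro; lra).
      assert (0 <= w * (lim_n a b c x - lim_d a b c x)) by (apply Rmult_le_pos; lra).
      assert (0 <= w * w * (lim_n a b c x - lim_d a b c x)) by (apply Rmult_le_pos; [apply Rle_0_sqr|lra]).
      assert (0 < w * lim_c a b c x) by (apply Rmult_lt_0_compat; lra).
      split; apply Rmult_lt_0_compat; lra.
    - destruct (H2 x ltac:(lra)) as [E1 E2].
      assert (Hw : Rabs w = w) by (apply Rabs_pos_eq; lra).
      assert (Hkd : k * d <= Rabs w) by (rewrite Hw; unfold w; apply Rmult_le_compat_l; lra).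
      destruct (F2 k ltac:(lra) x w E1 E2 Hkd) as [G3 G4]. rewrite Hw in G4.
      split; apply Rmult_lt_0_compat; lra. }
  split; [|split; [intros x Hx; now apply Right|intros x Hx; now apply Left]].
  intros x Hx. destruct (Rlt_dec x p) as [Hxp|Hxp]; [now apply Left|]. destruct (Rlt_dec q x) as [Hxq|Hxq]; [now apply Right|].
  destruct (lim_parts k p q x) as [_ ->]. rewrite Wm by lra. pose proof (lim_n_pos x).
  assert (0 < lim_n a b c x + lim_d a b c x) by (apply lim_n_plus; apply (co_inside _ _ _ _ HC); lra).
  apply Rmult_lt_0_compat; lra.
Qed.
End Limit.

(** * Uniqueness of the separatrix at a saddle *)

Definition Floc (x0 : R) : (R * R -> Prop) -> Prop := filter_prod (locally x0) (locally x0).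
Definition line_dist (x y : R) : R := Rabs (x - y).
Global Instance Floc_filter x0 : Filter (Floc x0).
Proof. unfold Floc. typeclasses eauto. Qed.

Lemma line_dist_pos x y : 0 <= line_dist x y.
Proof. apply Rabs_pos. Qed.

Lemma Floc_intro x0 (P : R * R -> Prop) d : 0 < d -> (forall x y, Rabs (x - x0) < d -> Rabs (y - x0) < d -> P (x, y)) -> Floc x0 P.
Proof.
  intros Hd H. exists (fun x => Rabs (x - x0) < d) (fun x => Rabs (x - x0) < d); try (now exists (mkposreal _ Hd)).
  intros x y H1 H2. now apply H.
Qed.

Lemma Floc_elim x0 P : Floc x0 P -> exists d, 0 < d /\ forall x y, Rabs (x - x0) < d -> Rabs (y - x0) < d -> P (x, y).
Proof.
  intros [P1 P2 [d1 H1] [d2 H2] H]. exists (Rmin d1 d2). split; [apply Rmin_glb_lt; apply cond_pos|].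
  pose proof (Rmin_l d1 d2). pose proof (Rmin_r d1 d2).
  intros x y Hx Hy. apply H; [apply H1; change (Rabs (x - x0) < d1); lra|apply H2; change (Rabs (y - x0) < d2); lra].
Qed.

Lemma Floc_lipb_C1 x0 (f df : R -> R) : (forall x, is_derive f x (df x)) -> (forall x, continuous df x) -> lipb (Floc x0) line_dist f.
Proof.
  intros Hd Hc. destruct (lipschitz_on_interval f df (x0 - 1) (x0 + 1) ltac:(lra) Hd Hc) as [K [HK H]].
  destruct (continuous_bounded_on f (x0 - 1) (x0 + 1) ltac:(lra)) as [M [HM HB]]; [intro; eapply is_derive_continuous; apply Hd|].
  exists (K + M). split; [lra|]. apply (Floc_intro _ _ 1 Rlt_0_1). intros x y Hx Hy. apply Rabs_def2 in Hx. apply Rabs_def2 in Hy. cbn [fst snd].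
  specialize (H x y ltac:(lra) ltac:(lra)). pose proof (HB x ltac:(lra)). pose proof (HB y ltac:(lra)).
  assert (0 <= M * line_dist x y) by (apply Rmult_le_pos; [lra|apply line_dist_pos]). unfold line_dist in *. split; lra.
Qed.

Lemma Floc_small_C1 x0 (f df : R -> R) : (forall x, is_derive f x (df x)) -> continuous df x0 -> f x0 = 0 -> df x0 = 0 -> small (Floc x0) line_dist f.
Proof.
  intros Hd Hc H0 H0' eps He.
  destruct (continuous_eps df x0 Hc eps He) as [d [Hdp H]]. rewrite H0' in H.
  apply (Floc_intro _ _ (Rmin d 1)); [apply Rmin_glb_lt; lra|]. pose proof (Rmin_l d 1). pose proof (Rmin_r d 1).
  assert (Hb : forall x, Rabs (x - x0) < d -> Rabs (df x) <= eps) by (intros x Hx; specialize (H x Hx); rewrite Rminus_0_r in H; lra).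
  assert (key : forall x y, x <= y -> Rabs (x - x0) < d -> Rabs (y - x0) < d -> Rabs (f x - f y) <= eps * Rabs (x - y)).
  { intros x y Hxy Hx Hy. destruct (mvt_le f df x y Hxy) as [s [Hs E]]; [intros; apply Hd|].
    rewrite Rabs_minus_sym, E, Rabs_mult, (Rabs_minus_sym x y). apply Rmult_le_compat_r; [apply Rabs_pos|]. apply Hb.
    apply Rabs_def2 in Hx. apply Rabs_def2 in Hy. apply Rabs_def1; lra. }
  assert (key' : forall x y, Rabs (x - x0) < d -> Rabs (y - x0) < d -> Rabs (f x - f y) <= eps * Rabs (x - y)).
  { intros x y Hx Hy. destruct (Rle_dec x y); [now apply key|]. rewrite Rabs_minus_sym, (Rabs_minus_sym x y). apply key; try easy; lra. }
  assert (Hv : forall x, Rabs (x - x0) < Rmin d 1 -> Rabs (f x) <= eps).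
  { intros x Hx. assert (Hx0 : Rabs (x0 - x0) < d) by (rewrite Rminus_diag, Rabs_R0; lra).
    pose proof (key' x x0 ltac:(lra) Hx0) as G. rewrite H0, Rminus_0_r in G. pose proof (Rabs_pos (x - x0)). nra. }
  intros x y Hx Hy. cbn [fst snd]. unfold line_dist. split; [apply key'; lra|split; now apply Hv].
Qed.

(** Both factors are [O(|x - x0|)], and each of the two terms in the difference of the products
    keeps one such factor. *)
Lemma Floc_small_product x0 f g : lipb (Floc x0) line_dist f -> lipb (Floc x0) line_dist g -> f x0 = 0 -> g x0 = 0 ->
  small (Floc x0) line_dist (fun x => f x * g x).
Proof.
  intros [K [HK Hf]] [K' [HK' Hg]] H0 H0' eps He.
  destruct (Floc_elim _ _ Hf) as [d1 [Hd1 F]]. destruct (Floc_elim _ _ Hg) as [d2 [Hd2 G]].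
  assert (HKK : 0 <= K * K') by now apply Rmult_le_pos.
  set (e := eps / (2 * (K * K') + 1)). assert (He' : 0 < e) by (apply Rdiv_lt_0_compat; lra).
  assert (Hee : e * (2 * (K * K') + 1) = eps) by (unfold e; field; lra).
  apply (Floc_intro _ _ (Rmin 1 (Rmin e (Rmin d1 d2)))); [repeat apply Rmin_glb_lt; lra|].
  set (d := Rmin 1 (Rmin e (Rmin d1 d2))).
  assert (Hd : d <= 1 /\ d <= e /\ d <= d1 /\ d <= d2).
  { unfold d. pose proof (Rmin_l 1 (Rmin e (Rmin d1 d2))). pose proof (Rmin_r 1 (Rmin e (Rmin d1 d2))).
    pose proof (Rmin_l e (Rmin d1 d2)). pose proof (Rmin_r e (Rmin d1 d2)). pose proof (Rmin_l d1 d2). pose proof (Rmin_r d1 d2). lra. }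
  assert (Hx00 : forall t, 0 < t -> Rabs (x0 - x0) < t) by (intros; now rewrite Rminus_diag, Rabs_R0).
  assert (Bf : forall x, Rabs (x - x0) < d -> Rabs (f x) <= K * Rabs (x - x0)).
  { intros x Hx. destruct (F x x0 ltac:(lra) (Hx00 _ Hd1)) as [Q _]. cbn [fst snd] in Q. now rewrite H0, Rminus_0_r in Q. }
  assert (Bg : forall x, Rabs (x - x0) < d -> Rabs (g x) <= K' * Rabs (x - x0)).
  { intros x Hx. destruct (G x x0 ltac:(lra) (Hx00 _ Hd2)) as [Q _]. cbn [fst snd] in Q. now rewrite H0', Rminus_0_r in Q. }
  assert (Bfg : forall x, Rabs (x - x0) < d -> Rabs (f x * g x) <= eps).
  { intros x Hx. rewrite Rabs_mult. specialize (Bf x Hx). specialize (Bg x Hx). pose proof (Rabs_pos (x - x0)).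
    assert (Rabs (f x) <= K * e) by (apply Rle_trans with (1 := Bf); apply Rmult_le_compat_l; lra).
    assert (Rabs (g x) <= K' * 1) by (apply Rle_trans with (1 := Bg); apply Rmult_le_compat_l; lra).
    apply Rle_trans with (K * e * (K' * 1)); [apply Rmult_le_compat; auto using Rabs_pos|].
    rewrite <- Hee. assert (0 <= K * K' * e) by (apply Rmult_le_pos; lra). lra. }
  intros x y Hx Hy. cbn [fst snd]. split; [|split; now apply Bfg].
  replace (f x * g x - f y * g y) with (f x * (g x - g y) + (f x - f y) * g y) by ring.
  apply Rle_trans with (1 := Rabs_triang _ _). rewrite !Rabs_mult.
  destruct (F x y ltac:(lra) ltac:(lra)) as [Q1 _]. destruct (G x y ltac:(lra) ltac:(lra)) as [Q2 _]. cbn [fst snd] in Q1, Q2.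
  assert (E1 : Rabs (f x) <= K * e) by (apply Rle_trans with (1 := Bf x Hx); apply Rmult_le_compat_l; lra).
  assert (E2 : Rabs (g y) <= K' * e) by (apply Rle_trans with (1 := Bg y Hy); apply Rmult_le_compat_l; lra).
  pose proof (line_dist_pos x y) as Hl.
  assert (Rabs (f x) * Rabs (g x - g y) <= K * e * (K' * line_dist x y)) by (apply Rmult_le_compat; auto using Rabs_pos).
  assert (Rabs (f x - f y) * Rabs (g y) <= K * line_dist x y * (K' * e)) by (apply Rmult_le_compat; auto using Rabs_pos).
  rewrite <- Hee. assert (0 <= e * line_dist x y) by (apply Rmult_le_pos; lra). lra.
Qed.

Section Slope.
Context (a b c : R) (Hab : b * (b - a) <> 0) (k th : R) (Hk : 0 <= k) (Hs : saddle a b c th).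

Lemma slope_thin x : gauge_slope k th th x = - k * (x - th).
Proof. unfold gauge_slope, Rmax. repeat destruct Rle_dec; lra || nra. Qed.

(** At a saddle [n = d] and [w = 0], so [lim_num] is [n lim_c] to first order and [lim_den] is
    [2 d^2]: the slope of the limit field is [lim_dc / (2 d)], which is negative. It is obtained as
    a strict derivative, from which contraction near the saddle is read off. *)
Lemma thin_lim_field_slope : exists mu, 0 < mu /\ small (Floc th) line_dist (fun x => lim_field a b c k th th x + mu * (x - th)).
Proof.
  destruct Hs as [Hc [Hd Hdc]].
  set (F := Floc th). set (D := line_dist). pose proof line_dist_pos as HD. fold D in HD.
  assert (FF : Filter F) by (unfold F; typeclasses eauto).
  set (n := lim_n a b c). set (cc := lim_c a b c). set (dd := lim_d a b c). set (w := gauge_slope k th th). set (e := fun x => x - th).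
  assert (Le : lipb F D e).
  { apply (Floc_lipb_C1 th e (fun _ => 1)); [intro; unfold e; auto_derive; [easy|ring]|intro; apply continuous_const]. }
  assert (Lw : lipb F D w).
  { apply (lipb_ext F D (fun x => - k * e x)); [intro; unfold w; now rewrite slope_thin|]. now apply (lipb_mult F D HD (fun _ => - k)); [apply lipb_const|]. }
  assert (Lc : lipb F D cc).
  { apply (Floc_lipb_C1 th cc (lim_dc a b c)); [intro; apply is_derive_lim_c|apply continuous_lim_dc]. }
  assert (Ld : lipb F D dd).
  { apply (Floc_lipb_C1 th dd (Derive dd)).
    - intro x. apply Derive_correct. unfold dd, lim_d, lim_a, lim_b. auto_derive. easy.
    - intro x. apply (continuous_ext (fun x => b * cos x * (cos x * cos x - sin x * sin x) - b * sin x * (4 * (cos x * sin x))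
         + ((a - b) / 2 * sin x + c / 2 * cos x) * (2 * (cos x * sin x)) + lim_a a b c x * (2 * (cos x * cos x - sin x * sin x)))).
      + intro y. symmetry. apply is_derive_unique. unfold dd, lim_d, lim_a, lim_b. auto_derive; [easy|]. field.
      + apply (ex_derive_continuous (fun x => b * cos x * (cos x * cos x - sin x * sin x) - b * sin x * (4 * (cos x * sin x))
         + ((a - b) / 2 * sin x + c / 2 * cos x) * (2 * (cos x * sin x)) + lim_a a b c x * (2 * (cos x * cos x - sin x * sin x)))).
        unfold lim_a. auto_derive. easy. }
  assert (Lnn : lipb F D (fun x => cc x * cc x + dd x * dd x)) by (apply lipb_plus; auto; apply lipb_mult; auto).
  assert (Ln : lipb F D n).
  { apply (lipb_ext F D (fun x => sqrt (cc x * cc x + dd x * dd x))).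
    { intro x. unfold n, lim_n, cc, dd. f_equal. apply lim_cd_norm. }
    apply lipb_sqrt; auto. apply away_at; [easy|]. unfold cc, dd. rewrite lim_cd_norm. now apply lim_norm_pos. }
  assert (Hn0 : n th = dd th).
  { pose proof (lim_n_sqr a b c Hab th) as E. rewrite Hc in E. pose proof (lim_n_pos a b c Hab th).
    unfold n, dd. apply Rsqr_inj; try lra. unfold Rsqr. lra. }
  assert (Hw0 : w th = 0) by (unfold w; rewrite slope_thin; ring).
  set (den := fun x => n x * (n x + dd x + 2 * w x * cc x + w x * w x * (n x - dd x))).
  assert (Lden : lipb F D den).
  { unfold den. apply lipb_mult; auto. apply lipb_plus; auto; [apply lipb_plus; auto; [apply lipb_plus; auto|]|].
    - apply lipb_mult; auto. apply lipb_mult; auto. now apply lipb_const.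
    - apply (lipb_mult F D HD (fun x => w x * w x)); [apply lipb_mult; auto|apply lipb_minus; auto]. }
  assert (Hden0 : den th = 2 * dd th * dd th) by (unfold den; rewrite Hn0, Hw0; ring).
  assert (Aden : away F den) by (apply away_at; [easy|]; rewrite Hden0; fold dd in Hd; apply Rmult_lt_0_compat; lra).
  set (dc := lim_dc a b c th). set (mu := - dc / (2 * dd th)).
  assert (Hmu : 0 < mu) by (apply Rdiv_lt_0_compat; unfold dd, dc; lra).
  exists mu. split; [easy|].
  assert (S1 : small F D (fun x => cc x - dc * e x)).
  { apply (Floc_small_C1 th (fun x => cc x - dc * e x) (fun x => lim_dc a b c x - dc * 1)).
    - intro x. apply (is_derive_minus cc (fun x => dc * e x)); [apply is_derive_lim_c|]. apply (is_derive_scal e x dc 1). unfold e. auto_derive; [easy|ring].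
    - apply (continuous_minus (lim_dc a b c) (fun _ => dc * 1)); [apply continuous_lim_dc|apply continuous_const].
    - unfold e, cc. rewrite Hc. ring.
    - unfold dc. ring. }
  assert (S2 : small F D (fun x => (n x - n th) * (dc * e x))).
  { apply Floc_small_product; [apply lipb_minus; auto; now apply lipb_const|apply (lipb_mult F D HD (fun _ => dc)); auto; now apply lipb_const|ring|unfold e; ring]. }
  assert (S3 : small F D (fun x => w x * (n x - dd x))).
  { apply Floc_small_product; [easy|now apply lipb_minus|easy|lra]. }
  assert (S4 : small F D (fun x => (mu * e x) * (den x - den th))).
  { apply Floc_small_product; [apply (lipb_mult F D HD (fun _ => mu)); auto; now apply lipb_const|apply lipb_minus; auto; now apply lipb_const|unfold e; ring|ring]. }
  (* The four terms add up to [den] times the claimed remainder: one contains the remainder of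
     [lim_c], the others a product of two factors that vanish at [th]. *)
  assert (S5 : small F D (fun x => n x * (cc x - dc * e x) + (n x - n th) * (dc * e x) + n x * (w x * (n x - dd x)) + (mu * e x) * (den x - den th))).
  { repeat (apply small_plus; auto); apply (small_mult_r F D HD n); auto. }
  apply (small_ext_away F D (fun x => (n x * (cc x - dc * e x) + (n x - n th) * (dc * e x) + n x * (w x * (n x - dd x)) + (mu * e x) * (den x - den th)) * / den x) _ den den Aden Aden).
  - intros x Hx _. unfold lim_field, vfield. fold (lim_num a b c k th th x) (lim_den a b c k th th x).
    destruct (lim_parts a b c Hab k th th x) as [-> ->]. fold n cc dd w. fold (den x).
    assert (E : mu * den th = - n th * dc) by (rewrite Hden0, Hn0; unfold mu; field; unfold dd; lra).
    apply (Rmult_eq_reg_r (den x)); [|lra]. rewrite Rmult_assoc, Rinv_l, Rmult_1_r by lra.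
    rewrite (Rmult_plus_distr_r _ _ (den x)), (Rmult_assoc _ (/ den x)), Rinv_l, Rmult_1_r by lra.
    replace (mu * e x * (den x - den th)) with (mu * e x * den x - (mu * den th) * e x) by ring. rewrite E. unfold e. ring.
  - apply small_mult_l; auto. now apply lipb_inv.
Qed.
End Slope.

Section CellPackage.
Context (A B t : R * R -> R) (a b c : R) (HJ : jet_data A B t a b c) (L : line_field) (HL : contains_directions A B t L).
Context (lo p q hi k : R) (HC : core a b c lo p q hi) (Hk : 0 <= k).
Context (Hden : forall x, lo <= x <= hi -> 0 < lim_den a b c k p q x)
  (Hright : forall x, q < x <= hi -> lim_num a b c k p q x < 0)
  (Hleft : forall x, lo <= x < p -> 0 < lim_num a b c k p q x).

Let Hab : b * (b - a) <> 0 := jd_nondegenerate _ _ _ _ _ _ HJ.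

Lemma core_lt : lo < hi.
Proof. pose proof (co_order _ _ _ _ _ _ _ HC). lra. Qed.

Let the_cell (r0 : R) : cell := polar_cell A B t k p q lo hi r0.

Lemma field_close eps : 0 < eps -> exists d, 0 < d /\ forall r0, 0 < r0 <= d -> forall s x y, 
  lo <= x <= hi -> lo <= y <= hi ->
  Rabs (field (the_cell r0) s x - lim_field a b c k p q x) <= eps /\
  Rabs ((field (the_cell r0) s x - lim_field a b c k p q x) - (field (the_cell r0) s y - lim_field a b c k p q y)) <= eps * Rabs (x - y).
Proof.
  intro He. destruct (pfield_approx A B t a b c HJ k p q lo hi Hk core_lt Hden) as [_ Hsm].
  destruct (Hsm eps He) as [d [Hd H]]. exists d. split; [easy|]. intros r0 Hr0 s x y Hx Hy.
  assert (Hr : 0 < Rmin (exp s) r0 <= d).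
  { split; [apply Rmin_glb_lt; [apply exp_pos|easy]|]. apply Rle_trans with (1 := Rmin_r _ _). easy. }
  destruct (H _ x y Hr Hx Hy) as [H1 [H2 _]]. cbn [fst snd] in H1, H2. simpl. rewrite !clamp_id by easy. easy.
Qed.

Lemma lim_field_lipschitz : exists K, forall x y, lo <= x <= hi -> lo <= y <= hi ->
  Rabs (lim_field a b c k p q x - lim_field a b c k p q y) <= K * Rabs (x - y).
Proof. apply Fam_lipb_elim. apply (pfield_approx A B t a b c HJ k p q lo hi Hk core_lt Hden). Qed.

Lemma lim_field_sign x : lo <= x <= hi ->
  (lim_num a b c k p q x < 0 -> lim_field a b c k p q x < 0) /\ (0 < lim_num a b c k p q x -> 0 < lim_field a b c k p q x).
Proof.
  intro Hx. pose proof (Rinv_0_lt_compat _ (Hden x Hx)) as Hi.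
  change (lim_field a b c k p q x) with (lim_num a b c k p q x * / lim_den a b c k p q x). split; intro H.
  - apply Rmult_neg_pos; easy.
  - now apply Rmult_lt_0_compat.
Qed.

(** The limit field vanishes at [p] and [q], so the trapping interval is taken slightly larger than
    the core; outside it the limit field has a positive minimum speed towards the core. *)
Lemma cell_trapped p' q' : lo < p' < p -> q < q' < hi -> exists d, 0 < d /\ forall r0, 0 < r0 <= d ->
  good_cell L r0 (the_cell r0) /\ exists K M m, trapped (field (the_cell r0)) K M lo p' q' hi m.
Proof.
  intros Hp' Hq'. pose proof (co_order _ _ _ _ _ _ _ HC) as Ho.
  destruct lim_field_lipschitz as [K HK].
  destruct (lipschitz_pos_min (fun x => - lim_field a b c k p q x) K q' hi ltac:(lra)) as [m1 [Hm1 H1]].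
  { intros x y Hx Hy. replace (- _ - - _) with (- (lim_field a b c k p q x - lim_field a b c k p q y)) by ring.
    rewrite Rabs_Ropp. apply HK; lra. }
  { intros x Hx. destruct (lim_field_sign x ltac:(lra)) as [S _]. specialize (S (Hright x ltac:(lra))). lra. }
  destruct (lipschitz_pos_min (lim_field a b c k p q) K lo p' ltac:(lra)) as [m2 [Hm2 H2]].
  { intros x y Hx Hy. apply HK; lra. }
  { intros x Hx. destruct (lim_field_sign x ltac:(lra)) as [_ S]. exact (S (Hleft x ltac:(lra))). }
  (* Half of the minimum speed is given away to the deviation from the limit field, the other half
     remains. *)
  set (m := Rmin m1 m2 / 2). assert (Hm : 0 < m) by (unfold m; assert (0 < Rmin m1 m2) by (now apply Rmin_glb_lt); lra).
  assert (Hmm : 2 * m <= m1 /\ 2 * m <= m2) by (unfold m; pose proof (Rmin_l m1 m2); pose proof (Rmin_r m1 m2); lra).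
  destruct (field_close m Hm) as [d1 [Hd1 F1]].
  destruct (polar_cell_field A B t a b c HJ k p q lo hi Hk core_lt Hden) as [d2 [Hd2 F2]].
  destruct (polar_cell_tangent A B t a b c HJ k p q lo hi Hk core_lt Hden L HL) as [d3 [Hd3 F3]].
  exists (Rmin d1 (Rmin d2 d3)). split; [now repeat apply Rmin_glb_lt|]. intros r0 Hr0.
  pose proof (Rmin_l d1 (Rmin d2 d3)). pose proof (Rmin_r d1 (Rmin d2 d3)). pose proof (Rmin_l d2 d3). pose proof (Rmin_r d2 d3).
  destruct (F2 r0 ltac:(lra)) as [K' [M' HF]].
  assert (HT : trapped (field (the_cell r0)) K' M' lo p' q' hi m).
  { assert (Hcl : forall s x, field (the_cell r0) s x = field (the_cell r0) s (clamp lo hi x)).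
    { intros s x. simpl. rewrite (clamp_id lo hi (clamp lo hi x)); [easy|]. apply clamp_range. lra. }
    split; try easy; try lra.
    - intros s x Hx. rewrite Hcl.
      assert (Hc : q' <= clamp lo hi x <= hi).
      { split; [|apply clamp_range; lra]. unfold clamp. apply Rle_trans with (2 := Rmax_r _ _). apply Rmin_glb; lra. }
      destruct (F1 r0 ltac:(lra) s (clamp lo hi x) (clamp lo hi x) ltac:(lra) ltac:(lra)) as [G _].
      apply Rabs_le_between in G. specialize (H1 _ Hc). lra.
    - intros s x Hx. rewrite Hcl.
      assert (Hc : lo <= clamp lo hi x <= p').
      { split; [apply clamp_range; lra|]. unfold clamp. apply Rmax_lub; [lra|]. apply Rle_trans with (1 := Rmin_r _ _). easy. }
      destruct (F1 r0 ltac:(lra) s (clamp lo hi x) (clamp lo hi x) ltac:(lra) ltac:(lra)) as [G _].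
      apply Rabs_le_between in G. specialize (H2 _ Hc). lra. }
  split; [|now exists K', M', m].
  split; [now apply polar_cell_smooth|split; [apply (polar_cell_bounded A B t k p q lo hi core_lt)|split; [apply F3; lra|]]].
  now exists K', M', p', q', m.
Qed.

(** In the core the gauge has slope zero and the limit field has the sign of [lim_c], which provides
    the two barriers. *)
Lemma fat_cell x1 x2 : p <= x1 < x2 -> x2 <= q -> lim_c a b c x1 < 0 -> 0 < lim_c a b c x2 ->
  exists d, 0 < d /\ forall r0, 0 < r0 <= d -> good_cell L r0 (the_cell r0) /\
    forall r, 0 < r -> lower (the_cell r0) 0 r < upper (the_cell r0) 0 r.
Proof.
  intros Hx1 Hx2 Hc1 Hc2. pose proof (co_order _ _ _ _ _ _ _ HC) as Ho.
  destruct (cell_trapped ((lo + p) / 2) ((q + hi) / 2) ltac:(lra) ltac:(lra)) as [d1 [Hd1 F1]].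
  assert (Hnum : forall x, p <= x <= q -> lim_num a b c k p q x = lim_n a b c x * lim_c a b c x).
  { intros x Hx. destruct (lim_parts a b c Hab k p q x) as [-> _]. unfold gauge_slope. rewrite !Rmax_left by lra. ring. }
  assert (L1 : lim_field a b c k p q x1 < 0).
  { apply lim_field_sign; [lra|]. rewrite Hnum by lra. pose proof (lim_n_pos a b c Hab x1). apply Rmult_pos_neg; easy. }
  assert (L2 : 0 < lim_field a b c k p q x2).
  { apply lim_field_sign; [lra|]. rewrite Hnum by lra. pose proof (lim_n_pos a b c Hab x2). apply Rmult_lt_0_compat; easy. }
  set (m := Rmin (- lim_field a b c k p q x1) (lim_field a b c k p q x2) / 2).
  assert (Hm0 : 0 < Rmin (- lim_field a b c k p q x1) (lim_field a b c k p q x2)) by (apply Rmin_glb_lt; lra).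
  assert (Hm : 0 < m) by (unfold m; lra).
  pose proof (Rmin_l (- lim_field a b c k p q x1) (lim_field a b c k p q x2)) as M1.
  pose proof (Rmin_r (- lim_field a b c k p q x1) (lim_field a b c k p q x2)) as M2.
  destruct (field_close m Hm) as [d2 [Hd2 F2]].
  exists (Rmin d1 d2). split; [now apply Rmin_glb_lt|]. intros r0 Hr0. pose proof (Rmin_l d1 d2). pose proof (Rmin_r d1 d2).
  destruct (F1 r0 ltac:(lra)) as [HG _]. split; [easy|].
  apply (fat_of_barriers L r0 (the_cell r0) x1 x2); try easy; simpl; try lra.
  - intro s. destruct (F2 r0 ltac:(lra) s x1 x1 ltac:(lra) ltac:(lra)) as [G _]. simpl in G. apply Rabs_le_between in G. unfold m in G. lra.
  - intro s. destruct (F2 r0 ltac:(lra) s x2 x2 ltac:(lra) ltac:(lra)) as [G _]. simpl in G. apply Rabs_le_between in G. unfold m in G. lra.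
Qed.

Lemma thin_cell : p = q -> exists d, 0 < d /\ forall r0, 0 < r0 <= d -> good_cell L r0 (the_cell r0) /\
    forall r, 0 < r -> lower (the_cell r0) 0 r = upper (the_cell r0) 0 r.
Proof.
  intro Hpq. pose proof (co_order _ _ _ _ _ _ _ HC) as Ho.
  assert (Hsl : exists mu, 0 < mu /\ small (Floc q) line_dist (fun x => lim_field a b c k p q x + mu * (x - q))).
  { rewrite Hpq. apply thin_lim_field_slope; try easy. apply (co_right _ _ _ _ _ _ _ HC). }
  destruct Hsl as [mu [Hmu Hsm]].
  assert (Hmu4 : 0 < mu / 4) by lra.
  (* Of the slope [- mu] of the limit field, [mu / 4] is lost to its nonlinearity and [mu / 4] to
     the finite size; the contraction rate [mu / 2] remains. *)
  destruct (Floc_elim _ _ (Hsm (mu / 4) Hmu4)) as [e [He H]].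
  set (e' := Rmin (e / 2) (Rmin ((p - lo) / 2) ((hi - q) / 2))).
  assert (He' : 0 < e') by (unfold e'; repeat apply Rmin_glb_lt; lra).
  assert (Hee : e' <= e / 2 /\ e' <= (p - lo) / 2 /\ e' <= (hi - q) / 2).
  { unfold e'. pose proof (Rmin_l (e / 2) (Rmin ((p - lo) / 2) ((hi - q) / 2))). pose proof (Rmin_r (e / 2) (Rmin ((p - lo) / 2) ((hi - q) / 2))).
    pose proof (Rmin_l ((p - lo) / 2) ((hi - q) / 2)). pose proof (Rmin_r ((p - lo) / 2) ((hi - q) / 2)). lra. }
  destruct (cell_trapped (p - e') (q + e') ltac:(lra) ltac:(lra)) as [d1 [Hd1 F1]].
  destruct (field_close (mu / 4) Hmu4) as [d2 [Hd2 F2]].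
  exists (Rmin d1 d2). split; [now apply Rmin_glb_lt|]. intros r0 Hr0. pose proof (Rmin_l d1 d2). pose proof (Rmin_r d1 d2).
  destruct (F1 r0 ltac:(lra)) as [HG [K [M [m HT]]]]. split; [easy|].
  apply (thin_of_contraction L r0 (the_cell r0) K M (p - e') (q + e') m (mu / 2)); try easy; try lra.
  intros s x y Hy Hx.
  destruct (F2 r0 ltac:(lra) s x y ltac:(lra) ltac:(lra)) as [_ G].
  destruct (H x y) as [G' _]; [apply Rabs_def1; lra|apply Rabs_def1; lra|]. cbn [fst snd] in G'. unfold line_dist in G'.
  rewrite (Rabs_pos_eq (x - y)) in G, G' by lra. apply Rabs_le_between in G. apply Rabs_le_between in G'. lra.
Qed.
End CellPackage.

(** * Rings of polar cells around the origin *)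

Lemma finite_uniform (n : nat) (Phi : nat -> R -> Prop) :
  (forall i, (i < n)%nat -> exists d, 0 < d /\ forall x, 0 < x <= d -> Phi i x) ->
  exists d, 0 < d /\ forall i x, (i < n)%nat -> 0 < x <= d -> Phi i x.
Proof.
  induction n as [|n IH]; intro H.
  - exists 1. split; [lra|]. intros i x Hi. lia.
  - destruct IH as [d1 [Hd1 H1]]; [intros i Hi; apply H; lia|]. destruct (H n ltac:(lia)) as [d2 [Hd2 H2]].
    exists (Rmin d1 d2). split; [now apply Rmin_glb_lt|]. pose proof (Rmin_l d1 d2). pose proof (Rmin_r d1 d2).
    intros i x Hi Hx. destruct (Nat.eq_dec i n) as [->|Hn]; [apply H2; lra|apply H1; [lia|lra]].
Qed.

Lemma finite_uniform_above (n : nat) (Phi : nat -> R -> Prop) :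
  (forall i, (i < n)%nat -> exists d, 0 < d /\ forall x, d <= x -> Phi i x) ->
  exists d, 0 < d /\ forall i x, (i < n)%nat -> d <= x -> Phi i x.
Proof.
  induction n as [|n IH]; intro H.
  - exists 1. split; [lra|]. intros i x Hi. lia.
  - destruct IH as [d1 [Hd1 H1]]; [intros i Hi; apply H; lia|]. destruct (H n ltac:(lia)) as [d2 [Hd2 H2]].
    exists (Rmax d1 d2). split; [apply Rlt_le_trans with (1 := Hd1), Rmax_l|]. pose proof (Rmax_l d1 d2). pose proof (Rmax_r d1 d2).
    intros i x Hi Hx. destruct (Nat.eq_dec i n) as [->|Hn]; [apply H2; lra|apply H1; [lia|lra]].
Qed.

Lemma cos_sin_inj x y : cos x = cos y -> sin x = sin y -> Rabs (x - y) <= 2 * PI ->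
  x = y \/ x = y + 2 * PI \/ y = x + 2 * PI.
Proof.
  intros Hc Hs Hxy. set (d := (x - y) / 2).
  assert (Hcd : cos (2 * d) = 1).
  { replace (2 * d) with (x - y) by (unfold d; field). rewrite cos_minus, Hc, Hs. apply cos2_sin2. }
  rewrite cos_2a_sin in Hcd.
  assert (Hsd : sin d = 0).
  { assert (E : sin d * sin d = 0) by lra. apply Rmult_integral in E. tauto. }
  apply Rabs_le_between in Hxy.
  assert (Hd : d = 0 \/ d = PI \/ d = - PI).
  { destruct (Rtotal_order d 0) as [H|[H|H]]; [|now left|].
    - right; right. destruct (Rle_dec d (- PI)) as [Hp|Hp]; [unfold d in *; lra|].
      pose proof (sin_gt_0 (- d) ltac:(lra) ltac:(lra)) as Hg. rewrite sin_neg in Hg. lra.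
    - right; left. destruct (Rle_dec PI d) as [Hp|Hp]; [unfold d in *; lra|].
      pose proof (sin_gt_0 d ltac:(lra) ltac:(lra)). lra. }
  unfold d in Hd. destruct Hd as [H|[H|H]]; lra.
Qed.

Lemma polar_unique r x r' y : 0 < r -> 0 < r' -> (r * cos x, r * sin x) = (r' * cos y, r' * sin y) ->
  r = r' /\ cos x = cos y /\ sin x = sin y.
Proof.
  intros Hr Hr' H. injection H. intros H2 H1.
  assert (E : r * r = r' * r').
  { transitivity ((r * cos x) * (r * cos x) + (r * sin x) * (r * sin x)).
    - transitivity (r * r * (cos x * cos x + sin x * sin x)); [rewrite cos2_sin2; ring|ring].
    - rewrite H1, H2. transitivity (r' * r' * (cos y * cos y + sin y * sin y)); [ring|rewrite cos2_sin2; ring]. }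
  assert (Hrr : r = r') by (apply Rsqr_inj; unfold Rsqr; lra).
  split; [easy|]. subst r'. split; apply (Rmult_eq_reg_l r); lra.
Qed.

Lemma cos_sin_period_nat x n : cos (x + 2 * INR n * PI) = cos x /\ sin (x + 2 * INR n * PI) = sin x.
Proof. split; [apply cos_period|apply sin_period]. Qed.

Lemma angle_in_window th m : exists th', m <= th' <= m + 2 * PI /\ cos th' = cos th /\ sin th' = sin th.
Proof.
  pose proof PI_RGT_0 as HPI.
  set (z := up ((m - th) / (2 * PI))).
  destruct (archimed ((m - th) / (2 * PI))) as [Hz1 Hz2]. fold z in Hz1, Hz2.
  assert (E : (m - th) / (2 * PI) * (2 * PI) = m - th) by (field; lra).
  assert (W : m <= th + 2 * IZR z * PI <= m + 2 * PI).
  { assert ((m - th) / (2 * PI) * (2 * PI) < IZR z * (2 * PI)) by (apply Rmult_lt_compat_r; lra).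
    assert (IZR z * (2 * PI) <= (1 + (m - th) / (2 * PI)) * (2 * PI)) by (apply Rmult_le_compat_r; lra). lra. }
  exists (th + 2 * IZR z * PI). split; [easy|].
  clearbody z. destruct (Z.le_gt_cases 0 z) as [Hz|Hz].
  - rewrite <- (Z2Nat.id z Hz), <- INR_IZR_INZ. apply cos_sin_period_nat.
  - assert (Hn : IZR z = - INR (Z.to_nat (- z))).
    { rewrite INR_IZR_INZ, Z2Nat.id by lia. rewrite opp_IZR. ring. }
    rewrite Hn. destruct (cos_sin_period_nat (th + 2 * - INR (Z.to_nat (- z)) * PI) (Z.to_nat (- z))) as [H1 H2].
    replace (th + 2 * - INR (Z.to_nat (- z)) * PI + 2 * INR (Z.to_nat (- z)) * PI) with th in H1, H2 by ring. now rewrite H1, H2.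
Qed.

Lemma polar_exists (p : R * R) m : p <> (0, 0) -> exists r th, 0 < r /\
  m <= th <= m + 2 * PI /\ p = (r * cos th, r * sin th) /\ r <= Rabs (fst p) + Rabs (snd p).
Proof.
  destruct p as [x y]; simpl. intro Hn.
  set (r := sqrt (x * x + y * y)).
  pose proof (Rle_0_sqr x) as Sx. pose proof (Rle_0_sqr y) as Sy. unfold Rsqr in Sx, Sy.
  assert (Hxy : 0 < x * x + y * y).
  { apply Rnot_le_lt. intro Hle. apply Hn.
    assert (x = 0) by (apply Rsqr_0_uniq; unfold Rsqr; lra). assert (y = 0) by (apply Rsqr_0_uniq; unfold Rsqr; lra). now subst. }
  assert (Hr : 0 < r) by now apply sqrt_lt_R0.
  assert (Hrr : r * r = x * x + y * y) by (apply sqrt_sqrt; lra).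
  clearbody r.
  assert (Hxr : Rabs x <= r) by (apply Rsqr_incr_0_var; [rewrite <- Rsqr_abs; unfold Rsqr; lra|lra]).
  apply Rabs_le_between in Hxr.
  assert (Hir : 0 < / r) by now apply Rinv_0_lt_compat.
  assert (Hu : -1 <= x / r <= 1).
  { unfold Rdiv. split; apply (Rmult_le_reg_r r); try easy; replace (x * / r * r) with x by (field; lra); lra. }
  assert (Hth : exists th, cos th = x / r /\ sin th = y / r).
  { assert (Hs : sin (acos (x / r)) = Rabs y / r).
    { rewrite sin_acos by easy. replace (1 - (x / r)²) with (Rsqr (y / r)).
      - rewrite sqrt_Rsqr_abs. unfold Rdiv. rewrite Rabs_mult, (Rabs_pos_eq (/ r)); [easy|lra].
      - unfold Rsqr. apply (Rmult_eq_reg_r (r * r)); [|rewrite Hrr; lra].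
        transitivity (y * y); [field; lra|]. transitivity (r * r - x * x); [lra|field; lra]. }
    destruct (Rle_dec 0 y) as [Hy|Hy].
    - exists (acos (x / r)). split; [now apply cos_acos|]. now rewrite Hs, Rabs_pos_eq.
    - exists (- acos (x / r)). rewrite cos_neg, sin_neg. split; [now apply cos_acos|]. rewrite Hs, Rabs_left by lra. field. lra. }
  destruct Hth as [th [Hc Hs]]. destruct (angle_in_window th m) as [th' [W [Hc' Hs']]].
  exists r, th'. split; [easy|split; [easy|split]].
  - rewrite Hc', Hs', Hc, Hs. f_equal; field; lra.
  - pose proof (Rabs_pos x). pose proof (Rabs_pos y).
    apply Rsqr_incr_0_var; [|lra]. unfold Rsqr. rewrite Hrr.
    rewrite <- (Rabs_pos_eq (x * x)) by lra. rewrite <- (Rabs_pos_eq (y * y)) by lra. rewrite !Rabs_mult.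
    assert (0 <= Rabs x * Rabs y) by now apply Rmult_le_pos. lra.
Qed.

Section Ring.
Context (A B t : R * R -> R) (a b c : R) (HJ : jet_data A B t a b c) (L : line_field) (HL : contains_directions A B t L).

(** The velocities on both sides of the corner are parallel by [vfield_join]. The angle decreases
    with [r] at the upper side of one cell and increases at the lower side of the next, so the
    factor, the quotient of the two fields, is negative. *)
Lemma polar_cell_adjacent k p q lo hi p' q' lo' hi' r0 :
  good_cell L r0 (polar_cell A B t k p q lo hi r0) -> good_cell L r0 (polar_cell A B t k p' q' lo' hi' r0) ->
  lo <= hi -> lo' <= hi' ->
  (forall r, 0 < r <= r0 -> 0 < pden A B t k p q (r, hi) /\ 0 < pdisc A B t k p q (r, hi)) ->
  (forall r, 0 < r <= r0 -> 0 < pden A B t k p' q' (r, lo')) ->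
  cos hi = cos lo' -> sin hi = sin lo' -> gauge_height k p q hi = gauge_height k p' q' lo' ->
  adjacent r0 (polar_cell A B t k p q lo hi r0) (polar_cell A B t k p' q' lo' hi' r0).
Proof.
  intros HG HG' Hlh Hlh' Hpos Hpos' Hc Hs Hh. split.
  - intro r. unfold point; simpl. now rewrite Hc, Hs, Hh.
  - intros r Hr.
    set (C := polar_cell A B t k p q lo hi r0) in *. set (C' := polar_cell A B t k p' q' lo' hi' r0) in *.
    assert (Hg : field C (ln r) hi < 0).
    { destruct HG as [_ [_ [_ [K [M [p1 [q1 [m HT]]]]]]]]. pose proof (tr_order _ _ _ _ _ _ _ _ HT) as Ho. simpl in Ho.
      pose proof (tr_above _ _ _ _ _ _ _ _ HT (ln r) hi ltac:(lra)). pose proof (tr_pos _ _ _ _ _ _ _ _ HT). lra. }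
    assert (Hg' : 0 < field C' (ln r) lo').
    { destruct HG' as [_ [_ [_ [K [M [p1 [q1 [m HT]]]]]]]]. pose proof (tr_order _ _ _ _ _ _ _ _ HT) as Ho. simpl in Ho.
      pose proof (tr_below _ _ _ _ _ _ _ _ HT (ln r) lo' ltac:(lra)). pose proof (tr_pos _ _ _ _ _ _ _ _ HT). lra. }
    assert (EC : field C (ln r) hi = pfield A B t k p q (r, hi)) by (apply polar_cell_value; lra).
    assert (EC' : field C' (ln r) lo' = pfield A B t k p' q' (r, lo')) by (apply polar_cell_value; lra).
    destruct (Hpos r Hr) as [P1 P2]. pose proof (Hpos' r Hr) as P3.
    assert (Hrad : radius k p' q' r lo' = radius k p q r hi) by (unfold radius; now rewrite Hh).
    assert (Hhat : forall f, hat k p' q' f (r, lo') = hat k p q f (r, hi)).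
    { intro f. unfold hat, polar; cbn [fst snd]. now rewrite Hrad, Hc, Hs. }
    assert (J : (1 - gauge_slope k p' q' lo' * field C' (ln r) lo') * field C (ln r) hi = (1 - gauge_slope k p q hi * field C (ln r) hi) * field C' (ln r) lo').
    { rewrite EC, EC'. unfold pfield; cbn [fst snd]. rewrite !Hhat, <- Hc, <- Hs.
      apply vfield_join; [left; exact P2|apply cos2_sin2|apply Rgt_not_eq; exact P1|].
      apply Rgt_not_eq. unfold pden in P3; cbn [fst snd] in P3. rewrite !Hhat, <- Hc, <- Hs in P3. exact P3. }
    clear EC EC'.
    change (exists e, 0 < e /\ velocity C' r lo' = scale (- e) (velocity C r hi)).
    unfold velocity, scale.
    change (height C' lo') with (gauge_height k p' q' lo'). change (height C hi) with (gauge_height k p q hi).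
    change (slope C' lo') with (gauge_slope k p' q' lo'). change (slope C hi) with (gauge_slope k p q hi).
    set (g := field C (ln r) hi) in *. set (g' := field C' (ln r) lo') in *.
    cbn [fst snd]. rewrite <- Hh, <- Hc, <- Hs.
    set (rho := r * exp (- gauge_height k p q hi)).
    exists (- (g' / g)). split.
    + assert (0 < / - g) by (apply Rinv_0_lt_compat; lra). replace (- (g' / g)) with (g' * / - g) by (field; lra). now apply Rmult_lt_0_compat.
    + assert (J' : 1 - gauge_slope k p' q' lo' * g' = g' / g * (1 - gauge_slope k p q hi * g)).
      { apply (Rmult_eq_reg_r g); [|lra]. rewrite J. field. lra. }
      rewrite J'. f_equal; field; lra.
Qed.

(* [P (S i)] and [Q (S i)] are the ends of the [i]-th core, and cells are
   separated halfway between successive cores. *)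
Record core_ring (n : nat) (P Q : nat -> R) : Prop := {
  cg_n : (0 < n)%nat;
  cg_period : Q n = Q 0%nat + 2 * PI /\ P (S n) = P 1%nat + 2 * PI;
  cg_core : forall i, (i < n)%nat ->
    core a b c ((Q i + P (S i)) / 2) (P (S i)) (Q (S i)) ((Q (S i) + P (S (S i))) / 2) }.

Context (n : nat) (P Q : nat -> R) (HR : core_ring n P Q).

Definition valley (i : nat) : R := (Q i + P (S i)) / 2.

Lemma valley_step i : (i < n)%nat -> valley i < P (S i) /\ P (S i) <= Q (S i) /\ Q (S i) < valley (S i).
Proof. intro Hi. pose proof (co_order _ _ _ _ _ _ _ (cg_core _ _ _ HR i Hi)). unfold valley. lra. Qed.

Lemma valley_mono i j : (i <= j)%nat -> (j <= n)%nat -> valley i <= valley j /\ ((i < j)%nat -> valley i < valley j).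
Proof.
  intros Hij. induction Hij as [|j Hij IH]; intro Hj.
  - split; [lra|lia].
  - destruct (valley_step j ltac:(lia)) as [H1 [H2 H3]]. destruct IH as [H4 H5]; [lia|]. split; [lra|]. intros _. lra.
Qed.

Lemma valley_period : valley n = valley 0 + 2 * PI.
Proof. unfold valley. destruct (cg_period _ _ _ HR) as [-> ->]. field. Qed.

Definition ring_cell (k r0 : R) (i : nat) : cell := polar_cell A B t k (P (S i)) (Q (S i)) (valley i) (valley (S i)) r0.

Lemma gauge_height_above k p q x : q <= x -> p <= q -> gauge_height k p q x = - (k / 2) * (x - q) ^ 2.
Proof. intros Hx Hpq. unfold gauge_height. rewrite (Rmax_right 0 (x - q)), (Rmax_left 0 (p - x)) by lra. ring. Qed.

Lemma gauge_height_below k p q x : x <= p -> p <= q -> gauge_height k p q x = - (k / 2) * (p - x) ^ 2.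
Proof. intros Hx Hpq. unfold gauge_height. rewrite (Rmax_left 0 (x - q)), (Rmax_right 0 (p - x)) by lra. ring. Qed.

(** A valley is at the same distance from the two cores that it separates, and outside a core the
    height depends on that distance alone; hence the star-shaped curves are continuous at the
    corners and close up after a full turn. *)
Lemma next_valley i : (i < n)%nat ->
  cos (valley (S i)) = cos (valley (next n i)) /\ sin (valley (S i)) = sin (valley (next n i)) /\
  forall k, gauge_height k (P (S i)) (Q (S i)) (valley (S i)) = gauge_height k (P (S (next n i))) (Q (S (next n i))) (valley (next n i)).
Proof.
  intro Hi. destruct (valley_step i Hi) as [H1 [H2 H3]].
  destruct (Nat.eq_dec (S i) n) as [E|E].
  - rewrite (next_last n i E). destruct (valley_step 0 (cg_n _ _ _ HR)) as [G1 [G2 G3]].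
    destruct (cg_period _ _ _ HR) as [Q1 Q2]. rewrite <- E in Q1, Q2.
    assert (Hv : valley (S i) = valley 0 + 2 * INR 1 * PI) by (rewrite E, valley_period; simpl; ring).
    split; [|split].
    + rewrite Hv. apply cos_sin_period_nat.
    + rewrite Hv. apply cos_sin_period_nat.
    + intro k. rewrite gauge_height_above, gauge_height_below by lra. unfold valley. rewrite Q1, Q2. f_equal. f_equal. field.
  - rewrite next_succ by lia. destruct (valley_step (S i) ltac:(lia)) as [G1 [G2 G3]].
    split; [easy|split; [easy|]]. intro k. rewrite gauge_height_above, gauge_height_below by lra. unfold valley. f_equal. f_equal. field.
Qed.

Lemma valley_range i x : (i < n)%nat -> valley i <= x <= valley (S i) ->
  valley 0 <= x <= valley 0 + 2 * PI /\ (x = valley 0 -> i = 0%nat) /\ (x = valley 0 + 2 * PI -> S i = n).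
Proof.
  intros Hi Hx. destruct (valley_mono 0 i) as [V1 V1']; try lia. destruct (valley_mono (S i) n) as [V2 V2']; try lia.
  rewrite valley_period in V2, V2'. split; [lra|split].
  - intro E. destruct i as [|i]; [easy|]. specialize (V1' ltac:(lia)). lra.
  - intro E. destruct (Nat.eq_dec (S i) n) as [|Hn]; [easy|]. specialize (V2' ltac:(lia)). lra.
Qed.

Lemma radius_cancel r r' h h' : h = h' -> r * exp (- h) = r' * exp (- h') -> r = r'.
Proof. intros <- H. apply (Rmult_eq_reg_r (exp (- h))); [easy|apply Rgt_not_eq, exp_pos]. Qed.

Lemma ring_cells_injective_lt k r r' x y i j : (i < n)%nat -> (j < n)%nat -> (i < j)%nat ->
  valley i <= x <= valley (S i) -> valley j <= y <= valley (S j) -> x = y ->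
  r * exp (- gauge_height k (P (S i)) (Q (S i)) x) = r' * exp (- gauge_height k (P (S j)) (Q (S j)) y) ->
  r = r' /\ j = next n i /\ x = valley (S i) /\ y = valley j.
Proof.
  intros Hi Hj Hij Hx Hy <- Hrho.
  destruct (valley_mono (S i) j) as [V1 V2]; try lia.
  assert (Hji : j = S i).
  { destruct (Nat.eq_dec j (S i)) as [|Hn]; [easy|]. specialize (V2 ltac:(lia)). lra. }
  assert (Hnx : next n i = j) by (rewrite next_succ; lia).
  destruct (next_valley i Hi) as [_ [_ NV]]. rewrite Hnx in NV.
  assert (E : x = valley (S i)) by lra. assert (E' : x = valley j) by lra.
  split; [|now repeat split].
  apply (radius_cancel r r' _ _ (NV k)). rewrite <- E at 1. now rewrite <- E'.
Qed.

Lemma ring_cells_injective_wrap k r r' x y i j : (i < n)%nat -> (j < n)%nat ->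
  valley i <= x <= valley (S i) -> valley j <= y <= valley (S j) -> x = y + 2 * PI ->
  r * exp (- gauge_height k (P (S i)) (Q (S i)) x) = r' * exp (- gauge_height k (P (S j)) (Q (S j)) y) ->
  r = r' /\ j = next n i /\ x = valley (S i) /\ y = valley j.
Proof.
  intros Hi Hj Hx Hy Hxy Hrho.
  destruct (valley_range i x Hi Hx) as [Wx [_ Hhigh]]. destruct (valley_range j y Hj Hy) as [Wy [Hlow _]].
  assert (Ey : y = valley 0) by lra. assert (Ex : x = valley 0 + 2 * PI) by lra.
  pose proof (Hlow Ey) as J0. pose proof (Hhigh Ex) as In. subst j.
  assert (Hnx : next n i = 0%nat) by (rewrite next_last; lia).
  destruct (next_valley i Hi) as [_ [_ NV]]. rewrite Hnx in NV.
  assert (Exv : x = valley (S i)) by (rewrite In, valley_period; easy).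
  split; [|now repeat split].
  apply (radius_cancel r r' _ _ (NV k)). rewrite <- Exv, <- Ey. exact Hrho.
Qed.

(** All cells lie in one window of angles of length [2 PI]. Equal points have equal Euclidean radii,
    and angles that agree or are the two ends of the window; the heights agree there, hence so do
    the sizes. *)
Lemma ring_cells_injective k r0 : cells_injective n (ring_cell k r0).
Proof.
  intros i j r r' x y Hi Hj Hr Hr' Hx Hy HE.
  change (valley i <= x <= valley (S i)) in Hx. change (valley j <= y <= valley (S j)) in Hy.
  assert (Hrad : 0 < radius k (P (S i)) (Q (S i)) r x) by now apply radius_pos.
  assert (Hrad' : 0 < radius k (P (S j)) (Q (S j)) r' y) by now apply radius_pos.
  destruct (polar_unique _ _ _ _ Hrad Hrad' HE) as [Hrho [Hc Hs]]. clear HE.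
  destruct (valley_range i x Hi Hx) as [Wx _]. destruct (valley_range j y Hj Hy) as [Wy _].
  unfold radius in Hrho.
  destruct (cos_sin_inj x y Hc Hs) as [Hxy|[Hxy|Hxy]].
  - apply Rabs_le. lra.
  - destruct (Nat.lt_trichotomy i j) as [Hij|[Hij|Hij]].
    + destruct (ring_cells_injective_lt k r r' x y i j) as [E1 [E2 [E3 E4]]]; try easy. split; [easy|]. right; left. now repeat split.
    + subst j y. split; [|left; easy]. exact (radius_cancel r r' (gauge_height k (P (S i)) (Q (S i)) x) _ eq_refl Hrho).
    + destruct (ring_cells_injective_lt k r' r y x j i) as [E1 [E2 [E3 E4]]]; try easy. split; [easy|]. right; right. now repeat split.
  - destruct (ring_cells_injective_wrap k r r' x y i j) as [E1 [E2 [E3 E4]]]; try easy. split; [easy|]. right; left. now repeat split.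
  - destruct (ring_cells_injective_wrap k r' r y x j i) as [E1 [E2 [E3 E4]]]; try easy. split; [easy|]. right; right. now repeat split.
Qed.

Lemma valley_window th : valley 0 <= th <= valley 0 + 2 * PI -> exists i, (i < n)%nat /\ valley i <= th <= valley (S i).
Proof.
  rewrite <- valley_period. pose proof (cg_n _ _ _ HR) as Hn.
  assert (H : forall m, (0 < m <= n)%nat -> valley 0 <= th <= valley m -> exists i, (i < m)%nat /\ valley i <= th <= valley (S i)).
  { induction m as [|m IH]; [lia|]. intros Hm Hth. destruct (Rle_dec (valley m) th) as [Hl|Hl].
    - exists m. split; [lia|lra].
    - destruct m as [|m]; [lra|]. destruct IH as [i [Hi Hw]]; [lia|lra|]. exists i. split; [lia|easy]. }
  intro Hth. apply H; [lia|easy].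
Qed.

Lemma ring_cells_cover k r0 : 0 <= k -> 0 < r0 -> cells_cover n (ring_cell k r0) r0.
Proof.
  intros Hk Hr0. assert (Hr2 : 0 < r0 / 2) by lra. exists (mkposreal _ Hr2). intros p [Hp1 Hp2].
  change (Rabs (fst p - 0) < r0 / 2) in Hp1. change (Rabs (snd p - 0) < r0 / 2) in Hp2. rewrite Rminus_0_r in Hp1, Hp2.
  destruct (Classical_Prop.classic (p = (0, 0))) as [->|Hn]; [now left|right].
  destruct (polar_exists p (valley 0) Hn) as [rho [th [Hrho [Hth [Hp Hle]]]]].
  destruct (valley_window th Hth) as [i [Hi Hw]].
  set (h := gauge_height k (P (S i)) (Q (S i)) th).
  (* The height is nowhere positive, so the size does not exceed the Euclidean radius. *)
  assert (Hh : exp h <= 1) by (rewrite <- exp_0; apply exp_le_compat; now apply gauge_height_nonpos).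
  pose proof (exp_pos h) as Hexp.
  assert (Hle' : rho <= r0).
  { apply Rle_trans with (1 := Hle). apply Rlt_le, Rlt_le_trans with (1 := Rplus_lt_compat _ _ _ _ Hp1 Hp2). lra. }
  exists i, (rho * exp h), th. split; [easy|split; [|split; [easy|]]].
  - split; [now apply Rmult_lt_0_compat|]. apply Rle_trans with (rho * 1); [apply Rmult_le_compat_l; lra|rewrite Rmult_1_r; exact Hle'].
  - rewrite Hp. unfold point. change (height (ring_cell k r0 i) th) with h.
    replace (rho * exp h * exp (- h)) with (rho * (exp h * exp (- h))) by ring. rewrite <- exp_plus, Rplus_opp_r, exp_0, Rmult_1_r. easy.
Qed.

Definition sign_conditions (k : R) (i : nat) : Prop :=
  (forall x, valley i <= x <= valley (S i) -> 0 < lim_den a b c k (P (S i)) (Q (S i)) x) /\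
  (forall x, Q (S i) < x <= valley (S i) -> lim_num a b c k (P (S i)) (Q (S i)) x < 0) /\
  (forall x, valley i <= x < P (S i) -> 0 < lim_num a b c k (P (S i)) (Q (S i)) x).

(** The slope [k] comes first and must be common to all cells, since it shapes the star-shaped
    curves on both sides of each corner; the size [r0] is chosen after it. [X] is the extra property
    of the cells, one separatrix or two. *)
Lemma ring_exists (X : R -> nat -> R -> Prop) :
  (forall i k, (i < n)%nat -> 0 <= k -> sign_conditions k i ->
     exists d, 0 < d /\ forall r0, 0 < r0 <= d -> good_cell L r0 (ring_cell k r0 i) /\ X k i r0) ->
  exists k r0, cell_ring L r0 n (ring_cell k r0) /\ forall i, (i < n)%nat -> X k i r0.
Proof.
  intro HX. pose proof (jd_nondegenerate _ _ _ _ _ _ HJ) as Hab.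
  destruct (finite_uniform_above n (fun i k => sign_conditions k i)) as [k [Hk Hsign]].
  { intros i Hi. apply (choose_slope a b c Hab). apply (cg_core _ _ _ HR i Hi). }
  assert (Hs : forall i, (i < n)%nat -> sign_conditions k i) by (intros i Hi; exact (Hsign i k Hi (Rle_refl k))).
  destruct (finite_uniform n (fun i r0 => (good_cell L r0 (ring_cell k r0 i) /\ X k i r0) /\
     forall x, valley i <= x <= valley (S i) -> 0 < pden A B t k (P (S i)) (Q (S i)) (r0, x) /\ 0 < pdisc A B t k (P (S i)) (Q (S i)) (r0, x))) as [d [Hd H]].
  { intros i Hi. destruct (valley_step i Hi) as [V1 [V2 V3]].
    destruct (HX i k Hi (Rlt_le _ _ Hk) (Hs i Hi)) as [d1 [Hd1 H1]].
    destruct (pparts_positive A B t a b c HJ k (P (S i)) (Q (S i)) (valley i) (valley (S i)) (Rlt_le _ _ Hk) ltac:(lra) (proj1 (Hs i Hi))) as [d2 [Hd2 H2]].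
    exists (Rmin d1 d2). split; [now apply Rmin_glb_lt|]. pose proof (Rmin_l d1 d2). pose proof (Rmin_r d1 d2).
    intros r Hr. split; [apply H1; lra|]. intros x Hx. apply H2; [lra|easy]. }
  assert (Hd' : 0 < d <= d) by lra.
  exists k, d. split; [|intros i Hi; exact (proj2 (proj1 (H i d Hi Hd')))].
  assert (HGood : forall i, (i < n)%nat -> good_cell L d (ring_cell k d i)) by (intros i Hi; exact (proj1 (proj1 (H i d Hi Hd')))).
  split.
  - exact Hd.
  - exact HGood.
  - intros i Hi. pose proof (next_lt n i Hi) as Hni.
    destruct (next_valley i Hi) as [N1 [N2 N3]].
    destruct (valley_step i Hi) as [V1 [V2 V3]]. destruct (valley_step _ Hni) as [W1 [W2 W3]].
    apply polar_cell_adjacent.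
    + exact (HGood i Hi).
    + exact (HGood _ Hni).
    + lra.
    + lra.
    + intros r Hr. apply (proj2 (H i r Hi Hr)). lra.
    + intros r Hr. apply (proj2 (H (next n i) r Hni Hr)). lra.
    + exact N1.
    + exact N2.
    + exact (N3 k).
  - apply ring_cells_injective.
  - apply ring_cells_cover; lra.
Qed.

Theorem ring_thin : (forall i, (i < n)%nat -> P (S i) = Q (S i)) -> has_sectors L (0, 0) (repeat hyperbolic n).
Proof.
  intro Hthin.
  destruct (ring_exists (fun k i r0 => forall r, 0 < r -> lower (ring_cell k r0 i) 0 r = upper (ring_cell k r0 i) 0 r)) as [k [r0 [HC HX]]].
  { intros i k Hi Hk [S1 [S2 S3]].
    exact (thin_cell A B t a b c HJ L HL (valley i) (P (S i)) (Q (S i)) (valley (S i)) k (cg_core _ _ _ HR i Hi) Hk S1 S2 S3 (Hthin i Hi)). }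
  apply (thin_sectors L r0 n (ring_cell k r0) HC (cg_n _ _ _ HR)). intros i r Hi. exact (HX i Hi r).
Qed.
End Ring.

Theorem ring_fat A B t a b c L P Q : jet_data A B t a b c -> contains_directions A B t L -> core_ring a b c 1 P Q ->
  (exists x1 x2, P 1%nat <= x1 < x2 /\ x2 <= Q 1%nat /\ lim_c a b c x1 < 0 /\ 0 < lim_c a b c x2) ->
  has_sectors L (0, 0) [parabolic; hyperbolic].
Proof.
  intros HJ HL HR [x1 [x2 [Hx1 [Hx2 [Hc1 Hc2]]]]].
  destruct (ring_exists A B t a b c HJ L 1 P Q HR (fun k i r0 => forall r, 0 < r ->
      lower (ring_cell A B t P Q k r0 0) 0 r < upper (ring_cell A B t P Q k r0 0) 0 r)) as [k [r0 [HC HX]]].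
  { intros i k Hi Hk HS. assert (i = 0%nat) by lia. subst i. destruct HS as [S1 [S2 S3]].
    exact (fat_cell A B t a b c HJ L HL (valley P Q 0) (P 1%nat) (Q 1%nat) (valley P Q 1) k (cg_core _ _ _ _ _ _ HR 0%nat Hi) Hk S1 S2 S3 x1 x2 Hx1 Hx2 Hc1 Hc2). }
  apply (fat_sectors L r0 (ring_cell A B t P Q k r0) HC). intros r Hr. exact (HX 0%nat Nat.lt_0_1 r Hr).
Qed.

(** * Radial directions and the sign of [Delta_m] *)

Lemma lim_cd_identity a b c x :
  lim_d a b c x * (cos x * cos x - sin x * sin x) - lim_c a b c x * (2 * (cos x * sin x)) = b * sin x.
Proof.
  unfold lim_d, lim_c. fold (lim_b b x). set (A := lim_a a b c x). set (B := lim_b b x).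
  transitivity (B * ((cos x * cos x + sin x * sin x) * (cos x * cos x + sin x * sin x))); [ring|rewrite cos2_sin2; ring].
Qed.

(** Where [lim_c = 0], [lim_cd_identity] reads [lim_d cos 2x = b sin x]; this tells which end of a
    root line is radial. *)
Lemma lim_d_sign a b c x : 0 < b -> lim_c a b c x = 0 ->
  0 < (cos x * cos x - sin x * sin x) * sin x -> 0 < lim_d a b c x.
Proof.
  intros Hb Hc Hp. pose proof (lim_cd_identity a b c x) as E. rewrite Hc in E.
  set (D := cos x * cos x - sin x * sin x) in *.
  assert (HD : D <> 0) by (intro H; rewrite H in Hp; lra).
  assert (E2 : lim_d a b c x * (D * D) = b * (D * sin x)).
  { transitivity ((lim_d a b c x * D - 0 * (2 * (cos x * sin x))) * D); [ring|]. rewrite E. ring. }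
  assert (0 < D * D) by (apply Rlt_0_sqr in HD; exact HD).
  assert (0 < lim_d a b c x * (D * D)) by (rewrite E2; now apply Rmult_lt_0_compat).
  apply (Rmult_lt_reg_r (D * D)); lra.
Qed.

(* In particular, if [b (b - a) > 0] all radial directions are saddles. *)
Lemma lim_wronskian a b c x : lim_c a b c x = 0 ->
  lim_dc a b c x * lim_d a b c x = - (b * (b - a)) / 2 - 2 * (lim_d a b c x * lim_d a b c x).
Proof.
  intro Hc. pose proof (cos2_sin2 x) as E.
  set (u := cos x) in *. set (v := sin x) in *.
  assert (HA : lim_a a b c x = lim_d a b c x * (2 * (u * v)) + lim_c a b c x * (u * u - v * v)).
  { unfold lim_d, lim_c. fold u v. transitivity (lim_a a b c x * ((u * u + v * v) * (u * u + v * v))); [rewrite E; ring|ring]. }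
  assert (HB : lim_b b x = lim_d a b c x * (u * u - v * v) - lim_c a b c x * (2 * (u * v))).
  { unfold lim_d, lim_c. fold u v. transitivity (lim_b b x * ((u * u + v * v) * (u * u + v * v))); [rewrite E; ring|ring]. }
  rewrite Hc in HA, HB. rewrite !Rmult_0_l, ?Rplus_0_r, ?Rminus_0_r in *.
  set (d := lim_d a b c x) in *.
  assert (H1 : b * v = d * (u * u - v * v)) by (unfold lim_b in HB; fold v in HB; lra).
  assert (H2 : (b - a) / 2 * u + c / 2 * v = d * (2 * (u * v))) by (unfold lim_a in HA; fold u v in HA; lra).
  unfold lim_dc. fold u v. rewrite HA, HB.
  assert (E4 : (u * u + v * v) * (u * u + v * v) = 1) by (rewrite E; ring).
  (* The Wronskian of [lim_a] and [lim_b], which is constant in the angle. *)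
  assert (HW : ((a - b) / 2 * v + c / 2 * u) * (d * (u * u - v * v)) - (d * (2 * (u * v))) * (b * u) = - (b * (b - a)) / 2).
  { rewrite <- H1, <- H2. transitivity (- (b * (b - a)) / 2 * (u * u + v * v)); [field|rewrite E; ring]. }
  transitivity ((((a - b) / 2 * v + c / 2 * u) * (d * (u * u - v * v)) - (d * (2 * (u * v))) * (b * u))
     - 2 * (d * d) * ((u * u + v * v) * (u * u + v * v))); [ring|]. rewrite HW, E4. ring.
Qed.

Definition cubic (a b c x y : R) : R := (a - b) * x ^ 3 - c * (x ^ 2 * y) + (5 * b - a) * (x * y ^ 2) + c * y ^ 3.

Lemma lim_c_cubic a b c x : lim_c a b c x = - / 2 * cubic a b c (cos x) (sin x).
Proof. unfold lim_c, lim_a, lim_b, cubic. field. Qed.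

(** At [(1, 1)] and [(-1, 1)] the cubic equals [4 b] and [- 4 b], which gives a root in between. Its
    discriminant is that of the quadratic factor times the square of the value of this factor at
    [u], up to the leading coefficient; the last two signs locate the remaining roots with respect
    to 1 and -1. *)
Lemma cubic_split a b c : 0 < b -> a <> b -> exists u m s, -1 < u < 1 /\
  (forall x y, cubic a b c x y = (a - b) * ((x - u * y) * (x ^ 2 + m * (x * y) + s * y ^ 2))) /\
  Delta_m a b c = - (3 / 4) * ((a - b) ^ 4 * (u ^ 2 + m * u + s) ^ 2 * (m ^ 2 - 4 * s)) /\
  0 < (a - b) * (1 + m + s) /\ 0 < (a - b) * (1 - m + s).
Proof.
  intros Hb Hab.
  assert (H1 : cubic a b c 1 1 = 4 * b) by (unfold cubic; ring).
  assert (H2 : cubic a b c (-1) 1 = - (4 * b)) by (unfold cubic; ring).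
  destruct (IVT_gen (fun x => cubic a b c x 1) (-1) 1 0) as [u [Hu Hroot]].
  { intro x. apply continuity_pt_filterlim. apply (ex_derive_continuous (fun x => cubic a b c x 1)). unfold cubic. auto_derive. easy. }
  { rewrite H1, H2, Rmin_left, Rmax_right; lra. }
  rewrite Rmin_left, Rmax_right in Hu by lra.
  assert (Hu1 : u <> 1) by (intros ->; lra). assert (Hu2 : u <> -1) by (intros ->; lra).
  set (al := a - b). assert (Hal : al <> 0) by (unfold al; lra).
  set (m := u - c / al). set (s := (5 * b - a) / al + u * m).
  assert (Hr : al * u ^ 3 - c * u ^ 2 + (5 * b - a) * u + c = 0) by (rewrite <- Hroot; unfold cubic, al; ring).
  assert (Hc : c = - (al * (u * s))).
  { assert (E : al * (u * s) = al * u ^ 3 - c * u ^ 2 + (5 * b - a) * u) by (unfold s, m; field; easy). lra. }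
  assert (Hf : forall x y, cubic a b c x y = al * ((x - u * y) * (x ^ 2 + m * (x * y) + s * y ^ 2))).
  { intros x y. unfold cubic. fold al. 
    transitivity (al * x ^ 3 + al * (m - u) * (x ^ 2 * y) + al * (s - u * m) * (x * y ^ 2) + - (al * (u * s)) * y ^ 3); [|ring].
    rewrite <- Hc. replace (al * (m - u)) with (- c) by (unfold m; field; easy).
    replace (al * (s - u * m)) with (5 * b - a) by (unfold s; field; easy). ring. }
  exists u, m, s. split; [lra|split; [exact Hf|split; [|split]]].
  (* The coefficients of [x^2 y] and [y^3] are opposite. This relation expresses [a], [b], [c]
     through the leading coefficient, [u] and [s], and turns the formula into a polynomial
     identity. *)
  - assert (Hm : m = u * (1 + s)).
    { apply (Rmult_eq_reg_l al); [|easy]. assert (E : al * (m - u) = - c) by (unfold m; field; easy). rewrite Hc in E. lra. }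
    assert (Hbb : b = al * (1 + s) * (1 - u ^ 2) / 4).
    { assert (E : al * (s - u * m) = 5 * b - a) by (unfold s; field; easy). rewrite Hm in E. unfold al in *. lra. }
    assert (Ha : a = al + b) by (unfold al; ring).
    replace (m ^ 2 - 4 * s) with ((u * (1 + s)) ^ 2 - 4 * s) by now rewrite Hm.
    replace (u ^ 2 + m * u + s) with (u ^ 2 + u * (1 + s) * u + s) by now rewrite Hm.
    unfold Delta_m. rewrite Ha. clearbody al m s.
    replace b with (al * (1 + s) * (1 - u ^ 2) / 4) by easy. replace c with (- (al * (u * s))) by easy. field.
  - assert (E : cubic a b c 1 1 = (1 - u) * (al * (1 + m + s))) by (rewrite Hf; ring). rewrite H1 in E.
    apply (Rmult_lt_reg_l (1 - u)); lra.
  - assert (E : cubic a b c (-1) 1 = - ((1 + u) * (al * (1 - m + s)))) by (rewrite Hf; ring). rewrite H2 in E.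
    apply (Rmult_lt_reg_l (1 + u)); lra.
Qed.

Definition acot (u : R) : R := PI / 2 - atan u.

Lemma acot_spec u : 0 < acot u < PI /\ 0 < sin (acot u) /\ cos (acot u) = u * sin (acot u).
Proof.
  pose proof (atan_bound u) as Hb. unfold acot. split; [lra|].
  rewrite sin_shift, cos_shift.
  assert (Hc : 0 < cos (atan u)) by (apply cos_gt_0; lra). split; [easy|].
  pose proof (tan_atan u) as Ht. unfold tan in Ht. rewrite <- Ht at 2. field. lra.
Qed.

Lemma acot_range u : (1 < u -> acot u < PI / 4) /\ (u < -1 -> 3 * PI / 4 < acot u) /\ (-1 < u < 1 -> PI / 4 < acot u < 3 * PI / 4).
Proof.
  pose proof atan_1 as E. assert (E' : atan (-1) = - (PI / 4)) by (rewrite <- E, <- atan_opp; f_equal; ring).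
  unfold acot. split; [|split].
  - intro H. apply atan_increasing in H. lra.
  - intro H. apply atan_increasing in H. lra.
  - intros [H1 H2]. apply atan_increasing in H1. apply atan_increasing in H2. lra.
Qed.

(* [t] is the end of the line of slope [1 / u], a root line of [cubic], at which
   the direction field is radial. *)
Definition outward (u t : R) : Prop := sin t <> 0 /\ cos t = u * sin t /\ 0 < (u * u - 1) * sin t.

Lemma outward_upper u : u < -1 \/ 1 < u -> outward u (acot u) /\ 0 < sin (acot u).
Proof.
  intro Hu. destruct (acot_spec u) as [_ [Hs Hc]]. split; [|easy]. split; [lra|split; [easy|]].
  apply Rmult_lt_0_compat; [|easy]. destruct Hu; nra.
Qed.

Lemma sin_cos_shift_PI x : sin (x + PI) = - sin x /\ cos (x + PI) = - cos x /\ sin (x - PI) = - sin x /\ cos (x - PI) = - cos x.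
Proof.
  split; [apply neg_sin|split; [apply neg_cos|]]. pose proof (neg_sin (x - PI)) as H1. pose proof (neg_cos (x - PI)) as H2.
  replace (x - PI + PI) with x in H1, H2 by ring. lra.
Qed.

Lemma outward_lower u : -1 < u < 1 -> (outward u (acot u + PI) /\ sin (acot u + PI) < 0) /\ (outward u (acot u - PI) /\ sin (acot u - PI) < 0).
Proof.
  intro Hu. destruct (acot_spec u) as [_ [Hs Hc]]. destruct (sin_cos_shift_PI (acot u)) as [E1 [E2 [E3 E4]]].
  assert (Hq : 0 < 1 - u * u) by nra. assert (0 < (1 - u * u) * sin (acot u)) by now apply Rmult_lt_0_compat.
  unfold outward. rewrite E1, E2, E3, E4, Hc. repeat split; lra.
Qed.

Lemma outward_d a b c u t : 0 < b -> outward u t -> lim_c a b c t = 0 -> 0 < lim_d a b c t.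
Proof.
  intros Hb [Hs [Hc Hp]] H0. apply lim_d_sign; try easy. rewrite Hc.
  replace ((u * sin t * (u * sin t) - sin t * sin t) * sin t) with ((sin t * sin t) * ((u * u - 1) * sin t)) by ring.
  apply Rmult_lt_0_compat; [|easy]. apply Rlt_0_sqr in Hs. exact Hs.
Qed.

Lemma linear_factor u t x : sin t <> 0 -> cos t = u * sin t -> cos x - u * sin x = - sin (x - t) / sin t.
Proof. intros Hs Hc. rewrite sin_minus, Hc. field. easy. Qed.

Lemma sin_zero_window y : sin y = 0 -> - (2 * PI) < y < 2 * PI -> y = 0 \/ y = PI \/ y = - PI.
Proof.
  intros Hs Hy. destruct (Rtotal_order y 0) as [H|[H|H]]; [|now left|].
  - right; right. destruct (Rtotal_order (- y) PI) as [G|[G|G]]; [|lra|].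
    + pose proof (sin_gt_0 (- y) ltac:(lra) G) as K. rewrite sin_neg in K. lra.
    + pose proof (sin_lt_0 (- y) ltac:(lra) ltac:(lra)) as K. rewrite sin_neg in K. lra.
  - right; left. destruct (Rtotal_order y PI) as [G|[G|G]]; [|lra|].
    + pose proof (sin_gt_0 y ltac:(lra) G). lra.
    + pose proof (sin_lt_0 y ltac:(lra) ltac:(lra)). lra.
Qed.

Lemma lim_shift a b c x e : e = PI \/ e = - PI -> lim_c a b c (x + e) = - lim_c a b c x /\ lim_d a b c (x + e) = - lim_d a b c x /\
  lim_dc a b c (x + e) = - lim_dc a b c x.
Proof.
  intro He. destruct (sin_cos_shift_PI x) as [E1 [E2 [E3 E4]]].
  assert (Hs : sin (x + e) = - sin x /\ cos (x + e) = - cos x) by (destruct He as [-> | ->]; split; easy).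
  destruct Hs as [Hs Hc]. unfold lim_c, lim_d, lim_dc, lim_a, lim_b. rewrite Hs, Hc. repeat split; ring.
Qed.

(** A change of sign of the jet is a half-turn of the limit field; it reduces [b < 0] to [b > 0]. *)
Lemma lim_neg a b c x : lim_c (- a) (- b) (- c) x = lim_c a b c (x + PI) /\ lim_d (- a) (- b) (- c) x = lim_d a b c (x + PI) /\
  lim_dc (- a) (- b) (- c) x = lim_dc a b c (x + PI).
Proof.
  destruct (lim_shift a b c x PI (or_introl eq_refl)) as [-> [-> ->]].
  unfold lim_c, lim_d, lim_dc, lim_a, lim_b. repeat split; field.
Qed.

Lemma saddle_neg a b c x : saddle (- a) (- b) (- c) x -> saddle a b c (x + PI).
Proof. unfold saddle. destruct (lim_neg a b c x) as [-> [-> ->]]. easy. Qed.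

Lemma core_ring_neg a b c n P Q : core_ring (- a) (- b) (- c) n P Q -> core_ring a b c n (fun i => P i + PI) (fun i => Q i + PI).
Proof.
  intros [H1 [H2 H3] H4]. split; [easy|split; lra|]. intros i Hi.
  assert (Hneg : forall x, lim_c a b c x = lim_c (- a) (- b) (- c) (x - PI) /\ lim_d a b c x = lim_d (- a) (- b) (- c) (x - PI)).
  { intro x. destruct (lim_neg a b c (x - PI)) as [-> [-> _]]. now replace (x - PI + PI) with x by ring. }
  specialize (H4 i Hi). destruct H4 as [A1 A2 A3 A4 A5 A6]. split.
  - lra.
  - now apply saddle_neg.
  - now apply saddle_neg.
  - intros x Hx. destruct (Hneg x) as [-> ->]. apply A4. lra.
  - intros x Hx. destruct (Hneg x) as [-> ->]. apply A5. lra.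
  - intros x Hx. destruct (Hneg x) as [-> ->]. apply A6. lra.
Qed.

Lemma antipodal_inward a b c t x : 0 < lim_d a b c t -> x - t = PI \/ x - t = - PI -> lim_d a b c x < 0.
Proof.
  intros Hd Hx. assert (E : exists e, (e = PI \/ e = - PI) /\ x = t + e) by (exists (x - t); split; [easy|ring]).
  destruct E as [e [He ->]]. destruct (lim_shift a b c t e He) as [_ [-> _]]. lra.
Qed.

(** The quadratic factor has no real root, so it is positive, and its value at [(1, 1)] then gives
    [a > b]. Thus [lim_c] is a negative constant times [sin (x - t)] times a positive function:
    there is a saddle at [t] and an orthogonal direction at its antipode. Lemon, monstar and star
    are the customary names of the three types of umbilic. *)
Lemma lemon_ring a b c : 0 < b -> a <> b -> 0 < Delta_m a b c -> exists P, core_ring a b c 1 P P.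
Proof.
  intros Hb Hab HD. pose proof PI_RGT_0 as HPI.
  destruct (cubic_split a b c Hb Hab) as [u [m [s [Hu [Hf [HDf [H1 H2]]]]]]].
  assert (Hms : m ^ 2 - 4 * s < 0).
  { apply Rnot_le_lt. intro Hle. rewrite HDf in HD.
    assert (0 <= (a - b) ^ 4 * (u ^ 2 + m * u + s) ^ 2 * (m ^ 2 - 4 * s)); [|lra].
    apply Rmult_le_pos; [|easy]. apply Rmult_le_pos; [|apply pow2_ge_0].
    replace ((a - b) ^ 4) with (((a - b) ^ 2) ^ 2) by ring. apply pow2_ge_0. }
  assert (Hquad : forall x y, ~ (x = 0 /\ y = 0) -> 0 < x ^ 2 + m * (x * y) + s * y ^ 2).
  { intros x y Hxy. replace (x ^ 2 + m * (x * y) + s * y ^ 2) with (Rsqr (x + m / 2 * y) + (4 * s - m ^ 2) / 4 * Rsqr y) by (unfold Rsqr; field).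
    pose proof (Rle_0_sqr (x + m / 2 * y)) as S1. pose proof (Rle_0_sqr y) as S2.
    destruct (Req_dec y 0) as [->|Hy].
    - assert (x <> 0) by tauto. rewrite Rmult_0_r, Rplus_0_r. pose proof (Rlt_0_sqr x H). unfold Rsqr in *. lra.
    - pose proof (Rlt_0_sqr y Hy). assert (0 < (4 * s - m ^ 2) / 4 * Rsqr y) by (apply Rmult_lt_0_compat; lra). lra. }
  assert (Hal : 0 < a - b).
  { assert (0 < 1 + m + s) by (specialize (Hquad 1 1 ltac:(lra)); lra).
    apply (Rmult_lt_reg_r (1 + m + s)); lra. }
  set (t := acot u + PI). destruct (outward_lower u Hu) as [[Ho Hst] _]. fold t in Ho, Hst.
  destruct Ho as [Hs [Hc Hp]]. assert (Ho : outward u t) by easy.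
  set (W := fun x => cos x ^ 2 + m * (cos x * sin x) + s * sin x ^ 2).
  assert (HW : forall x, 0 < W x).
  { intro x. apply Hquad. intros [E1 E2]. pose proof (cos2_sin2 x) as E. rewrite E1, E2 in E. lra. }
  set (K := (a - b) / (2 * sin t)).
  assert (HK : K < 0).
  { unfold K. assert (0 < / - sin t) by (apply Rinv_0_lt_compat; lra).
    replace ((a - b) / (2 * sin t)) with (- ((a - b) / 2 * / - sin t)) by (field; easy).
    assert (0 < (a - b) / 2 * / - sin t) by (apply Rmult_lt_0_compat; lra). lra. }
  assert (Hfac : forall x, lim_c a b c x = K * sin (x - t) * W x).
  { intro x. rewrite lim_c_cubic, Hf, (linear_factor u t x Hs Hc). unfold K, W. field. easy. }
  assert (Hc0 : lim_c a b c t = 0) by (rewrite Hfac, Rminus_diag, sin_0; ring).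
  assert (Hd0 : 0 < lim_d a b c t) by now apply (outward_d a b c u).
  assert (Hdc : lim_dc a b c t < 0).
  { assert (E : lim_dc a b c t = K * W t).
    { rewrite <- (is_derive_unique _ _ _ (is_derive_lim_c a b c t)). apply is_derive_unique.
      apply (is_derive_ext (fun x => K * sin (x - t) * W x)); [intro; symmetry; apply Hfac|].
      unfold W. auto_derive; [easy|]. rewrite Rplus_opp_r, cos_0, sin_0. unfold W. ring. }
    rewrite E. apply Rmult_neg_pos; [easy|apply HW]. }
  assert (Hsad : saddle a b c t) by easy.
  assert (Hz : forall x, t - PI <= x <= t + PI -> x <> t -> lim_c a b c x = 0 -> lim_d a b c x < 0).
  { intros x Hx Hxt E. rewrite Hfac in E.
    assert (Hsx : sin (x - t) = 0).
    { apply Rmult_integral in E. destruct E as [E|E]; [|pose proof (HW x); lra].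
      apply Rmult_integral in E. destruct E; lra. }
    apply (antipodal_inward a b c t); [easy|]. destruct (sin_zero_window (x - t) Hsx ltac:(lra)) as [G|[G|G]]; [lra|now left|now right]. }
  (* There is one core, so its neighbours in the ring are its own translates by a full turn. *)
  exists (fun i => match i with 0%nat => t - 2 * PI | 1%nat => t | _ => t + 2 * PI end).
  split; [lia|split; ring|]. intros i Hi. assert (i = 0%nat) by lia. subst i.
  split; try easy; try lra.
  - intros x Hx _. now replace x with t by lra.
  - intros x Hx. apply Hz; lra.
  - intros x Hx. apply Hz; lra.
Qed.

(** As [a < b], the quadratic factor is negative at 1 and -1, so its roots lie beyond them on both
    sides of [u]. The radial ends are in the upper half-plane for these two roots and in the lower
    one for [u], hence they alternate with the orthogonal ends. *)
Lemma star_ring a b c : 0 < b -> a < b -> exists P, core_ring a b c 3 P P.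
Proof.
  intros Hb Hab. pose proof PI_RGT_0 as HPI.
  destruct (cubic_split a b c Hb ltac:(lra)) as [u [m [s [Hu [Hf [_ [H1 H2]]]]]]].
  assert (Q1 : 1 + m + s < 0) by (apply Rnot_le_lt; intro; assert (0 <= (b - a) * (1 + m + s)) by (apply Rmult_le_pos; lra); lra).
  assert (Q2 : 1 - m + s < 0) by (apply Rnot_le_lt; intro; assert (0 <= (b - a) * (1 - m + s)) by (apply Rmult_le_pos; lra); lra).
  assert (Hdisc : 0 < m ^ 2 - 4 * s) by (pose proof (pow2_ge_0 m); lra).
  set (w := sqrt (m ^ 2 - 4 * s)). assert (Hw : 0 < w) by now apply sqrt_lt_R0.
  assert (Hww : w * w = m ^ 2 - 4 * s) by (apply sqrt_sqrt; lra).
  set (u1 := (- m + w) / 2). set (u3 := (- m - w) / 2).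
  assert (Hq : forall x y, x ^ 2 + m * (x * y) + s * y ^ 2 = (x - u1 * y) * (x - u3 * y)).
  { intros x y. unfold u1, u3. transitivity (x ^ 2 + m * (x * y) + (m ^ 2 - w * w) / 4 * y ^ 2); [rewrite Hww; field|field]. }
  assert (Hu1 : 1 < u1).
  { unfold u1. assert (2 + m < w); [|lra]. apply Rnot_le_lt. intro Hle.
    assert (w * w <= (2 + m) * (2 + m)) by (apply Rmult_le_compat; lra). lra. }
  assert (Hu3 : u3 < -1).
  { unfold u3. assert (2 - m < w); [|lra]. apply Rnot_le_lt. intro Hle.
    assert (w * w <= (2 - m) * (2 - m)) by (apply Rmult_le_compat; lra). lra. }
  set (t1 := acot u1). set (t2 := acot u3). set (t3 := acot u + PI).
  destruct (outward_upper u1 (or_intror Hu1)) as [O1 S1]. destruct (outward_upper u3 (or_introl Hu3)) as [O2 S2].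
  destruct (outward_lower u Hu) as [[O3 S3] _]. fold t1 in O1, S1. fold t2 in O2, S2. fold t3 in O3, S3.
  destruct (acot_range u1) as [R1 _]. destruct (acot_range u3) as [_ [R2 _]]. destruct (acot_range u) as [_ [_ R3]].
  specialize (R1 Hu1). specialize (R2 Hu3). specialize (R3 Hu). fold t1 in R1. fold t2 in R2.
  assert (R1' : 0 < t1) by apply acot_spec. assert (R2' : t2 < PI) by apply acot_spec.
  assert (R3' : PI / 4 + PI < t3 < 3 * PI / 4 + PI) by (unfold t3; lra).
  assert (Hfac : forall x, lim_c a b c x = (a - b) / (2 * (sin t1 * sin t2 * sin t3)) * (sin (x - t1) * sin (x - t2) * sin (x - t3))).
  { intro x. rewrite lim_c_cubic, Hf, Hq. destruct O1 as [A1 [A2 _]], O2 as [B1 [B2 _]], O3 as [C1 [C2 _]].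
    rewrite (linear_factor u t3 x), (linear_factor u1 t1 x), (linear_factor u3 t2 x) by easy. field. easy. }
  assert (Z : lim_c a b c t1 = 0 /\ lim_c a b c t2 = 0 /\ lim_c a b c t3 = 0) by (rewrite !Hfac, !Rminus_diag, sin_0; lra).
  destruct Z as [Z1 [Z2 Z3]].
  assert (D1 : 0 < lim_d a b c t1) by now apply (outward_d a b c u1).
  assert (D2 : 0 < lim_d a b c t2) by now apply (outward_d a b c u3).
  assert (D3 : 0 < lim_d a b c t3) by now apply (outward_d a b c u).
  (* By [lim_wronskian], because [b * (b - a)] is positive. *)
  assert (Hsad : forall x, lim_c a b c x = 0 -> 0 < lim_d a b c x -> saddle a b c x).
  { intros x Hx Hd. split; [easy|split; [easy|]]. pose proof (lim_wronskian a b c x Hx) as E.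
    assert (0 < b * (b - a)) by (apply Rmult_lt_0_compat; lra).
    assert (0 < lim_d a b c x * lim_d a b c x) by now apply Rmult_lt_0_compat.
    apply Rnot_le_lt. intro Hle. assert (0 <= lim_dc a b c x * lim_d a b c x) by (apply Rmult_le_pos; lra). lra. }
  pose proof (Hsad _ Z1 D1) as N1. pose proof (Hsad _ Z2 D2) as N2. pose proof (Hsad _ Z3 D3) as N3.
  assert (Hz : forall x, t3 - 2 * PI < x < t1 + 2 * PI -> x <> t1 -> x <> t2 -> x <> t3 -> lim_c a b c x = 0 -> lim_d a b c x < 0).
  { intros x Hx X1 X2 X3 E. rewrite Hfac in E.
    apply Rmult_integral in E. destruct E as [E|E].
    - exfalso. destruct O1 as [A1 _], O2 as [B1 _], O3 as [C1 _].
      assert (P : sin t1 * sin t2 * sin t3 <> 0) by (apply Rmult_integral_contrapositive_currified; [now apply Rmult_integral_contrapositive_currified|easy]).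
      apply Rmult_integral in E. destruct E as [E|E]; [lra|]. apply Rinv_neq_0_compat in E; [easy|lra].
    - apply Rmult_integral in E. destruct E as [E|E]; [apply Rmult_integral in E; destruct E as [E|E]|].
      + apply (antipodal_inward a b c t1); [easy|]. destruct (sin_zero_window _ E ltac:(lra)) as [G|[G|G]]; [lra|now left|now right].
      + apply (antipodal_inward a b c t2); [easy|]. destruct (sin_zero_window _ E ltac:(lra)) as [G|[G|G]]; [lra|now left|now right].
      + apply (antipodal_inward a b c t3); [easy|]. destruct (sin_zero_window _ E ltac:(lra)) as [G|[G|G]]; [lra|now left|now right]. }
  exists (fun i => match i with 0%nat => t3 - 2 * PI | 1%nat => t1 | 2%nat => t2 | 3%nat => t3 | _ => t1 + 2 * PI end).
  split; [lia|split; ring|]. intros i Hi.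
  assert (Hmid : forall t x, t <= x <= t -> x = t) by (intros; lra).
  destruct i as [|[|[|i]]]; [| | |lia].
  - split; try easy; try lra.
    + intros x Hx _. now rewrite (Hmid t1 x Hx).
    + intros x Hx. apply Hz; lra.
    + intros x Hx. apply Hz; lra.
  - split; try easy; try lra.
    + intros x Hx _. now rewrite (Hmid t2 x Hx).
    + intros x Hx. apply Hz; lra.
    + intros x Hx. apply Hz; lra.
  - split; try easy; try lra.
    + intros x Hx _. now rewrite (Hmid t3 x Hx).
    + intros x Hx. apply Hz; lra.
    + intros x Hx. apply Hz; lra.
Qed.

(** With [K < 0] and the three directions in an open half-plane, [lim_c] decreases through the first
    and the third zero and increases through the middle one. The outer two are saddles and bound the
    core; between the zeros [lim_c] is first negative, then positive, and the midpoints serve as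
    barriers. *)
Lemma three_rays_ring a b c K t1 t2 t3 : K < 0 -> t1 < t2 < t3 -> t3 < t1 + PI ->
  (forall x, lim_c a b c x = K * (sin (x - t1) * sin (x - t2) * sin (x - t3))) ->
  0 < lim_d a b c t1 -> 0 < lim_d a b c t2 -> 0 < lim_d a b c t3 ->
  exists P Q, core_ring a b c 1 P Q /\
    exists x1 x2, P 1%nat <= x1 < x2 /\ x2 <= Q 1%nat /\ lim_c a b c x1 < 0 /\ 0 < lim_c a b c x2.
Proof.
  intros HK H12 H31 Hfac D1 D2 D3. pose proof PI_RGT_0 as HPI.
  assert (Hder : forall x, lim_dc a b c x = K * (cos (x - t1) * sin (x - t2) * sin (x - t3) + sin (x - t1) * cos (x - t2) * sin (x - t3) + sin (x - t1) * sin (x - t2) * cos (x - t3))).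
  { intro x. rewrite <- (is_derive_unique _ _ _ (is_derive_lim_c a b c x)). apply is_derive_unique.
    apply (is_derive_ext (fun x => K * (sin (x - t1) * sin (x - t2) * sin (x - t3)))); [intro; symmetry; apply Hfac|].
    auto_derive; [easy|]. unfold Rminus. ring. }
  assert (Hneg : forall y, - PI < y < 0 -> sin y < 0).
  { intros y Hy. pose proof (sin_gt_0 (- y) ltac:(lra) ltac:(lra)) as G. rewrite sin_neg in G. lra. }
  assert (N1 : saddle a b c t1).
  { split; [rewrite Hfac, Rminus_diag, sin_0; ring|split; [easy|]]. rewrite Hder, Rminus_diag, sin_0, cos_0.
    pose proof (Hneg (t1 - t2) ltac:(lra)) as G1. pose proof (Hneg (t1 - t3) ltac:(lra)) as G2.
    assert (0 < - sin (t1 - t2) * - sin (t1 - t3)) by (apply Rmult_lt_0_compat; lra).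
    assert (0 < - K * (- sin (t1 - t2) * - sin (t1 - t3))) by (apply Rmult_lt_0_compat; lra). lra. }
  assert (N3 : saddle a b c t3).
  { split; [rewrite Hfac, Rminus_diag, sin_0; ring|split; [easy|]]. rewrite Hder, Rminus_diag, sin_0, cos_0.
    pose proof (sin_gt_0 (t3 - t1) ltac:(lra) ltac:(lra)) as G1. pose proof (sin_gt_0 (t3 - t2) ltac:(lra) ltac:(lra)) as G2.
    assert (0 < sin (t3 - t1) * sin (t3 - t2)) by (apply Rmult_lt_0_compat; lra).
    assert (0 < - K * (sin (t3 - t1) * sin (t3 - t2))) by (apply Rmult_lt_0_compat; lra). lra. }
  assert (Hz : forall x, t3 - 2 * PI < x < t1 + 2 * PI -> lim_c a b c x = 0 -> x = t1 \/ x = t2 \/ x = t3 \/ lim_d a b c x < 0).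
  { intros x Hx E. rewrite Hfac in E. apply Rmult_integral in E. destruct E as [E|E]; [lra|].
    apply Rmult_integral in E. destruct E as [E|E]; [apply Rmult_integral in E; destruct E as [E|E]|].
    - destruct (sin_zero_window _ E ltac:(lra)) as [G|G]; [left; lra|]. right; right; right. now apply (antipodal_inward a b c t1).
    - destruct (sin_zero_window _ E ltac:(lra)) as [G|G]; [right; left; lra|]. right; right; right. now apply (antipodal_inward a b c t2).
    - destruct (sin_zero_window _ E ltac:(lra)) as [G|G]; [right; right; left; lra|]. right; right; right. now apply (antipodal_inward a b c t3). }
  exists (fun i => match i with 0%nat => t1 - 2 * PI | 1%nat => t1 | _ => t1 + 2 * PI end),
    (fun i => match i with 0%nat => t3 - 2 * PI | 1%nat => t3 | _ => t3 + 2 * PI end).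
  split; [split; [lia|split; ring|]|].
  - intros i Hi. assert (i = 0%nat) by lia. subst i. split; try easy; try lra.
    + intros x Hx E.
      assert (Hx' : t3 - 2 * PI < x < t1 + 2 * PI) by lra.
      destruct (Hz x Hx' E) as [-> |[-> |[-> |G]]]; try easy. exfalso. rewrite Hfac in E.
      apply Rmult_integral in E. destruct E as [E|E]; [lra|].
      assert (X : x = t1 \/ x = t2 \/ x = t3).
      { apply Rmult_integral in E. destruct E as [E|E]; [apply Rmult_integral in E; destruct E as [E|E]|];
          destruct (sin_zero_window _ E ltac:(lra)) as [G'|[G'|G']]; lra. }
      destruct X as [-> |[-> | ->]]; lra.
    + intros x Hx E. destruct (Hz x ltac:(lra) E) as [X|[X|[X|G]]]; try easy; lra.
    + intros x Hx E. destruct (Hz x ltac:(lra) E) as [X|[X|[X|G]]]; try easy; lra.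
  - exists ((t1 + t2) / 2), ((t2 + t3) / 2). split; [lra|split; [lra|]]. rewrite !Hfac. split.
    + pose proof (sin_gt_0 ((t1 + t2) / 2 - t1) ltac:(lra) ltac:(lra)) as G1.
      pose proof (Hneg ((t1 + t2) / 2 - t2) ltac:(lra)) as G2. pose proof (Hneg ((t1 + t2) / 2 - t3) ltac:(lra)) as G3.
      assert (P1 : 0 < - sin ((t1 + t2) / 2 - t2) * - sin ((t1 + t2) / 2 - t3)) by (apply Rmult_lt_0_compat; lra).
      assert (P2 : 0 < sin ((t1 + t2) / 2 - t1) * (- sin ((t1 + t2) / 2 - t2) * - sin ((t1 + t2) / 2 - t3))) by (apply Rmult_lt_0_compat; lra).
      assert (P3 : 0 < - K * (sin ((t1 + t2) / 2 - t1) * (- sin ((t1 + t2) / 2 - t2) * - sin ((t1 + t2) / 2 - t3)))) by (apply Rmult_lt_0_compat; lra). lra.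
    + pose proof (sin_gt_0 ((t2 + t3) / 2 - t1) ltac:(lra) ltac:(lra)) as G1.
      pose proof (sin_gt_0 ((t2 + t3) / 2 - t2) ltac:(lra) ltac:(lra)) as G2. pose proof (Hneg ((t2 + t3) / 2 - t3) ltac:(lra)) as G3.
      assert (P1 : 0 < sin ((t2 + t3) / 2 - t2) * - sin ((t2 + t3) / 2 - t3)) by (apply Rmult_lt_0_compat; lra).
      assert (P2 : 0 < sin ((t2 + t3) / 2 - t1) * (sin ((t2 + t3) / 2 - t2) * - sin ((t2 + t3) / 2 - t3))) by (apply Rmult_lt_0_compat; lra).
      assert (P3 : 0 < - K * (sin ((t2 + t3) / 2 - t1) * (sin ((t2 + t3) / 2 - t2) * - sin ((t2 + t3) / 2 - t3)))) by (apply Rmult_lt_0_compat; lra). lra.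
Qed.

Lemma three_rays_ring_unsorted a b c K p t1 t2 t3 : K < 0 -> t1 <> t2 -> t1 <> t3 -> t2 <> t3 ->
  p < t1 < p + PI -> p < t2 < p + PI -> p < t3 < p + PI ->
  (forall x, lim_c a b c x = K * (sin (x - t1) * sin (x - t2) * sin (x - t3))) ->
  0 < lim_d a b c t1 -> 0 < lim_d a b c t2 -> 0 < lim_d a b c t3 ->
  exists P Q, core_ring a b c 1 P Q /\
    exists x1 x2, P 1%nat <= x1 < x2 /\ x2 <= Q 1%nat /\ lim_c a b c x1 < 0 /\ 0 < lim_c a b c x2.
Proof.
  intros HK H12 H13 H23 W1 W2 W3 Hfac D1 D2 D3.
  destruct (Rdichotomy _ _ H12) as [L12|L12]; destruct (Rdichotomy _ _ H13) as [L13|L13]; destruct (Rdichotomy _ _ H23) as [L23|L23]; try lra.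
  - apply (three_rays_ring a b c K t1 t2 t3); try easy; lra.
  - apply (three_rays_ring a b c K t1 t3 t2); try easy; try lra. intro x. rewrite Hfac. ring.
  - apply (three_rays_ring a b c K t3 t1 t2); try easy; try lra. intro x. rewrite Hfac. ring.
  - apply (three_rays_ring a b c K t2 t1 t3); try easy; try lra. intro x. rewrite Hfac. ring.
  - apply (three_rays_ring a b c K t2 t3 t1); try easy; try lra. intro x. rewrite Hfac. ring.
  - apply (three_rays_ring a b c K t3 t2 t1); try easy; try lra. intro x. rewrite Hfac. ring.
Qed.

(** As [a > b], the quadratic factor is positive at 1 and -1, so its two roots lie together in
    [(-1, 1)], above 1 or below -1. In each case the three radial ends fit in an open half-plane,
    once the angle of the end for [u] is chosen up to a full turn. *)
Lemma monstar_ring a b c : 0 < b -> b < a -> Delta_m a b c < 0 -> exists P Q, core_ring a b c 1 P Q /\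
    exists x1 x2, P 1%nat <= x1 < x2 /\ x2 <= Q 1%nat /\ lim_c a b c x1 < 0 /\ 0 < lim_c a b c x2.
Proof.
  intros Hb Hab HD. pose proof PI_RGT_0 as HPI.
  destruct (cubic_split a b c Hb ltac:(lra)) as [u [m [s [Hu [Hf [HDf [H1 H2]]]]]]].
  assert (Q1 : 0 < 1 + m + s) by (apply (Rmult_lt_reg_l (a - b)); lra).
  assert (Q2 : 0 < 1 - m + s) by (apply (Rmult_lt_reg_l (a - b)); lra).
  rewrite HDf in HD.
  assert (Hprod : 0 < (a - b) ^ 4 * (u ^ 2 + m * u + s) ^ 2 * (m ^ 2 - 4 * s)) by lra.
  assert (Hr : u ^ 2 + m * u + s <> 0) by (intro E; rewrite E in Hprod; lra).
  assert (Hdisc : 0 < m ^ 2 - 4 * s).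
  { apply Rnot_le_lt. intro Hle.
    assert (0 <= (a - b) ^ 4 * (u ^ 2 + m * u + s) ^ 2 * - (m ^ 2 - 4 * s)); [|lra].
    apply Rmult_le_pos; [|lra]. apply Rmult_le_pos; [|apply pow2_ge_0].
    replace ((a - b) ^ 4) with (((a - b) ^ 2) ^ 2) by ring. apply pow2_ge_0. }
  set (w := sqrt (m ^ 2 - 4 * s)). assert (Hw : 0 < w) by now apply sqrt_lt_R0.
  assert (Hww : w * w = m ^ 2 - 4 * s) by (apply sqrt_sqrt; lra).
  set (u1 := (- m + w) / 2). set (u3 := (- m - w) / 2).
  assert (Hq : forall x y, x ^ 2 + m * (x * y) + s * y ^ 2 = (x - u1 * y) * (x - u3 * y)).
  { intros x y. unfold u1, u3. transitivity (x ^ 2 + m * (x * y) + (m ^ 2 - w * w) / 4 * y ^ 2); [rewrite Hww; field|field]. }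
  assert (U1 : u <> u1) by (intro E; apply Hr; replace (u ^ 2 + m * u + s) with (u ^ 2 + m * (u * 1) + s * 1 ^ 2) by ring; rewrite Hq, E; ring).
  assert (U3 : u <> u3) by (intro E; apply Hr; replace (u ^ 2 + m * u + s) with (u ^ 2 + m * (u * 1) + s * 1 ^ 2) by ring; rewrite Hq, E; ring).
  assert (U13 : u1 <> u3) by (unfold u1, u3; lra).
  assert (P1 : 0 < (1 - u1) * (1 - u3)).
  { pose proof (Hq 1 1) as E. replace ((1 - u1 * 1) * (1 - u3 * 1)) with ((1 - u1) * (1 - u3)) in E by ring. lra. }
  assert (P2 : 0 < (1 + u1) * (1 + u3)).
  { pose proof (Hq (-1) 1) as E. replace ((-1 - u1 * 1) * (-1 - u3 * 1)) with ((1 + u1) * (1 + u3)) in E by ring. lra. }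
  assert (Hcases : (-1 < u1 < 1 /\ -1 < u3 < 1) \/ (1 < u1 /\ 1 < u3) \/ (u1 < -1 /\ u3 < -1)).
  { assert (Hlt : u3 < u1) by (unfold u1, u3; lra).
    destruct (Rle_dec 1 u1) as [A|A].
    - right; left. assert (u1 <> 1) by (intros E; rewrite E in P1; lra).
      split; [lra|]. apply Rnot_le_lt. intro B. assert (0 <= (u1 - 1) * (1 - u3)) by (apply Rmult_le_pos; lra). lra.
    - destruct (Rle_dec u3 (-1)) as [B|B].
      + right; right. assert (u3 <> -1) by (intros E; rewrite E in P2; lra).
        split; [|lra]. apply Rnot_le_lt. intro C. assert (0 <= (1 + u1) * - (1 + u3)) by (apply Rmult_le_pos; lra). lra.
      + left. lra. }
  (* [p] is the lower end of the half-plane of angles. The sign of the product of the sines makes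
     the constant in front of the factored [lim_c] negative, as [three_rays_ring] requires. *)
  assert (Hall : forall p t t1 t3, outward u t -> outward u1 t1 -> outward u3 t3 -> sin t * sin t1 * sin t3 < 0 ->
     p < t < p + PI -> p < t1 < p + PI -> p < t3 < p + PI -> exists P Q, core_ring a b c 1 P Q /\
    exists x1 x2, P 1%nat <= x1 < x2 /\ x2 <= Q 1%nat /\ lim_c a b c x1 < 0 /\ 0 < lim_c a b c x2).
  { intros p t t1 t3 O O1 O3 Hs W W1 W3.
    assert (Hfac : forall x, lim_c a b c x = (a - b) / (2 * (sin t * sin t1 * sin t3)) * (sin (x - t) * sin (x - t1) * sin (x - t3))).
    { intro x. rewrite lim_c_cubic, Hf, Hq. destruct O as [A1 [A2 _]], O1 as [B1 [B2 _]], O3 as [C1 [C2 _]].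
      rewrite (linear_factor u t x), (linear_factor u1 t1 x), (linear_factor u3 t3 x) by easy. field. easy. }
    assert (Hcancel : forall v v' z, outward v z -> outward v' z -> v = v').
    { intros v v' z [A1 [A2 _]] [B1 [B2 _]]. apply (Rmult_eq_reg_r (sin z)); [lra|easy]. }
    apply (three_rays_ring_unsorted a b c ((a - b) / (2 * (sin t * sin t1 * sin t3))) p t t1 t3); try easy.
    - replace ((a - b) / (2 * (sin t * sin t1 * sin t3))) with (- ((a - b) / 2 * / - (sin t * sin t1 * sin t3))).
      + assert (0 < / - (sin t * sin t1 * sin t3)) by (apply Rinv_0_lt_compat; lra).
        assert (0 < (a - b) / 2 * / - (sin t * sin t1 * sin t3)) by (apply Rmult_lt_0_compat; lra). lra.
      + destruct O as [A1 _], O1 as [B1 _], O3 as [C1 _]. field. easy.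
    - intros ->. now apply U1, (Hcancel u u1 t1).
    - intros ->. now apply U3, (Hcancel u u3 t3).
    - intros ->. now apply U13, (Hcancel u1 u3 t3).
    - apply (outward_d a b c u); try easy. rewrite Hfac, Rminus_diag, sin_0. ring.
    - apply (outward_d a b c u1); try easy. rewrite Hfac, Rminus_diag, sin_0. ring.
    - apply (outward_d a b c u3); try easy. rewrite Hfac, Rminus_diag, sin_0. ring. }
  destruct (outward_lower u Hu) as [[O S] [O' S']].
  destruct (acot_spec u) as [B _]. destruct (acot_spec u1) as [B1 _]. destruct (acot_spec u3) as [B3 _].
  destruct (acot_range u) as [_ [_ Ru]]. specialize (Ru Hu).
  destruct Hcases as [[C1 C3]|[[C1 C3]|[C1 C3]]].
  - destruct (outward_lower u1 C1) as [[O1 S1] _]. destruct (outward_lower u3 C3) as [[O3 S3] _].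
    apply (Hall PI _ _ _ O O1 O3); try lra.
    assert (0 < - sin (acot u + PI) * - sin (acot u1 + PI)) by (apply Rmult_lt_0_compat; lra).
    assert (0 < - sin (acot u + PI) * - sin (acot u1 + PI) * - sin (acot u3 + PI)) by (apply Rmult_lt_0_compat; lra). lra.
  - destruct (outward_upper u1 (or_intror C1)) as [O1 S1]. destruct (outward_upper u3 (or_intror C3)) as [O3 S3].
    destruct (acot_range u1) as [R1 _]. destruct (acot_range u3) as [R3 _]. specialize (R1 C1). specialize (R3 C3).
    (* The end for [u] is between [- 3 PI / 4] and [- PI / 4], the other two are between 0 and
       [PI / 4]. *)
    apply (Hall (- (3 * PI / 4)) _ _ _ O' O1 O3); try lra.
    assert (0 < - sin (acot u - PI) * sin (acot u1)) by (apply Rmult_lt_0_compat; lra).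
    assert (0 < - sin (acot u - PI) * sin (acot u1) * sin (acot u3)) by (apply Rmult_lt_0_compat; lra). lra.
  - destruct (outward_upper u1 (or_introl C1)) as [O1 S1]. destruct (outward_upper u3 (or_introl C3)) as [O3 S3].
    destruct (acot_range u1) as [_ [R1 _]]. destruct (acot_range u3) as [_ [R3 _]]. specialize (R1 C1). specialize (R3 C3).
    apply (Hall (3 * PI / 4) _ _ _ O O1 O3); try lra.
    assert (0 < - sin (acot u + PI) * sin (acot u1)) by (apply Rmult_lt_0_compat; lra).
    assert (0 < - sin (acot u + PI) * sin (acot u1) * sin (acot u3)) by (apply Rmult_lt_0_compat; lra). lra.
Qed.

Lemma Delta_m_neg a b c : Delta_m (- a) (- b) (- c) = Delta_m a b c.
Proof. unfold Delta_m. ring. Qed.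

Theorem sectors_of_jet A B t a b c L : jet_data A B t a b c -> contains_directions A B t L ->
  (Delta_m a b c > 0 -> has_sectors L (0, 0) [hyperbolic]) /\
  (Delta_m a b c < 0 /\ a / b > 1 -> has_sectors L (0, 0) [parabolic; hyperbolic]) /\
  (a / b < 1 -> has_sectors L (0, 0) [hyperbolic; hyperbolic; hyperbolic]).
Proof.
  intros HJ HL. pose proof (jd_nondegenerate _ _ _ _ _ _ HJ) as Hn.
  assert (Hb : b <> 0) by (intros ->; lra). assert (Hab : a <> b) by (intros ->; apply Hn; ring).
  split; [|split].
  - intro HD. assert (HP : exists P, core_ring a b c 1 P P).
    { destruct (Rdichotomy _ _ Hb) as [Hlt|Hgt].
      - destruct (lemon_ring (- a) (- b) (- c)) as [P HP]; [lra|lra|rewrite Delta_m_neg; lra|].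
        exists (fun i => P i + PI). now apply core_ring_neg.
      - apply lemon_ring; lra. }
    destruct HP as [P HP]. now apply (ring_thin A B t a b c HJ L HL 1 P P HP).
  - intros [HD Hq].
    assert (HP : exists P Q, core_ring a b c 1 P Q /\ exists x1 x2, P 1%nat <= x1 < x2 /\ x2 <= Q 1%nat /\ lim_c a b c x1 < 0 /\ 0 < lim_c a b c x2).
    { assert (Hq' : (a - b) / b > 0) by (replace ((a - b) / b) with (a / b - 1) by (field; easy); lra).
      destruct (Rdichotomy _ _ Hb) as [Hlt|Hgt].
      - assert (a < b).
        { apply Rnot_le_lt. intro Hle. assert (0 < / - b) by (apply Rinv_0_lt_compat; lra).
          assert (0 <= (a - b) * / - b) by (apply Rmult_le_pos; lra).
          replace ((a - b) / b) with (- ((a - b) * / - b)) in Hq' by (field; easy). lra. }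
        destruct (monstar_ring (- a) (- b) (- c)) as [P [Q [HP [x1 [x2 [X1 [X2 [X3 X4]]]]]]]]; [lra|lra|rewrite Delta_m_neg; lra|].
        exists (fun i => P i + PI), (fun i => Q i + PI). split; [now apply core_ring_neg|].
        exists (x1 + PI), (x2 + PI). split; [lra|split; [lra|]].
        destruct (lim_neg a b c x1) as [E1 _]. destruct (lim_neg a b c x2) as [E2 _]. rewrite <- E1, <- E2. easy.
      - assert (b < a).
        { apply Rnot_le_lt. intro Hle. assert (0 < / b) by (apply Rinv_0_lt_compat; lra).
          assert (0 <= (b - a) * / b) by (apply Rmult_le_pos; lra).
          replace ((a - b) / b) with (- ((b - a) * / b)) in Hq' by (field; easy). lra. }
        now apply monstar_ring. }
    destruct HP as [P [Q [HP HX]]]. now apply (ring_fat A B t a b c L P Q).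
  - intro Hq. assert (HP : exists P, core_ring a b c 3 P P).
    { assert (Hq' : (a - b) / b < 0) by (replace ((a - b) / b) with (a / b - 1) by (field; easy); lra).
      destruct (Rdichotomy _ _ Hb) as [Hlt|Hgt].
      - assert (b < a).
        { apply Rnot_le_lt. intro Hle. assert (0 < / - b) by (apply Rinv_0_lt_compat; lra).
          assert (0 <= (b - a) * / - b) by (apply Rmult_le_pos; lra).
          replace ((a - b) / b) with ((b - a) * / - b) in Hq' by (field; easy). lra. }
        destruct (star_ring (- a) (- b) (- c)) as [P HP]; [lra|lra|].
        exists (fun i => P i + PI). now apply core_ring_neg.
      - assert (a < b).
        { apply Rnot_le_lt. intro Hle. assert (0 < / b) by (apply Rinv_0_lt_compat; lra).
          assert (0 <= (a - b) * / b) by (apply Rmult_le_pos; lra). unfold Rdiv in Hq'. lra. }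
        now apply star_ring. }
    destruct HP as [P HP]. now apply (ring_thin A B t a b c HJ L HL 3 P P HP).
Qed.

(** * Principal curvatures *)

Definition binary_form (p q r x y : R) : R := p * x ^ 2 + 2 * q * x * y + r * y ^ 2.

Lemma pair_neq_0 (x y : R) : (x, y) <> (0, 0) -> x <> 0 \/ y <> 0.
Proof.
  intro H. destruct (Req_dec x 0) as [->|]; [|now left]. right. intros ->. now apply H.
Qed.

Lemma binary_form_pos p q r x y : 0 < p -> 0 < p * r - q ^ 2 -> (x, y) <> (0, 0) -> 0 < binary_form p q r x y.
Proof.
  intros Hp HD Hxy. apply (Rmult_lt_reg_l p); [easy|]. rewrite Rmult_0_r.
  replace (p * binary_form p q r x y) with (Rsqr (p * x + q * y) + (p * r - q ^ 2) * Rsqr y) by (unfold binary_form, Rsqr; ring).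
  pose proof (Rle_0_sqr (p * x + q * y)) as S1. destruct (Req_dec y 0) as [->|Hy].
  - destruct (pair_neq_0 _ _ Hxy) as [Hx|]; [|easy]. unfold Rsqr.
    replace ((p * x + q * 0) * (p * x + q * 0) + (p * r - q ^ 2) * (0 * 0)) with (Rsqr (p * x)) by (unfold Rsqr; ring).
    apply Rlt_0_sqr. apply Rmult_integral_contrapositive. split; lra.
  - pose proof (Rmult_lt_0_compat _ _ HD (Rlt_0_sqr _ Hy)). lra.
Qed.

Section Pencil.
Context (E F G : R).
Context (HE : 0 < E).
Context (HD : 0 < E * G - F ^ 2).

Definition pencil_mean e f g := (e * G - 2 * f * F + g * E) / (2 * (E * G - F ^ 2)).
Definition pencil_gauss e f g := (e * g - f ^ 2) / (E * G - F ^ 2).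

(** Up to a positive factor, the discriminant of [det (II - x I)] is a sum of two squares with
    positive weights. *)
Lemma pencil_disc e f g : 0 <= pencil_mean e f g ^ 2 - pencil_gauss e f g.
Proof.
  replace (pencil_mean e f g ^ 2 - pencil_gauss e f g) with
    ((4 * (E * G - F ^ 2) * Rsqr (E * f - e * F) + Rsqr (E * (E * g - e * G) - 2 * F * (E * f - e * F))) * / (Rsqr (2 * (E * G - F ^ 2) * E)))
    by (unfold pencil_mean, pencil_gauss, Rsqr; field; lra).
  apply Rmult_le_pos.
  - pose proof (Rle_0_sqr (E * f - e * F)). pose proof (Rle_0_sqr (E * (E * g - e * G) - 2 * F * (E * f - e * F))).
    assert (0 <= 4 * (E * G - F ^ 2) * Rsqr (E * f - e * F)) by (apply Rmult_le_pos; lra). lra.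
  - apply Rlt_le, Rinv_0_lt_compat, Rlt_0_sqr. assert (0 < (E * G - F ^ 2) * E) by now apply Rmult_lt_0_compat. lra.
Qed.

Lemma pencil_det e f g x : (e - x * E) * (g - x * G) - (f - x * F) ^ 2 =
  (E * G - F ^ 2) * (x ^ 2 - 2 * pencil_mean e f g * x + pencil_gauss e f g).
Proof. unfold pencil_mean, pencil_gauss. field. lra. Qed.

(** The form II - x I has determinant zero, and its trace with respect to I is nonnegative because
    [x] does not exceed the mean; so it is positive semidefinite. *)
Lemma semidefinite_diag e f g x : (e - x * E) * (g - x * G) = (f - x * F) ^ 2 -> x <= pencil_mean e f g -> 0 <= e - x * E.
Proof.
  intros H Hx. apply Rnot_lt_le. intro Hn. set (a := e - x * E) in *. set (b := f - x * F) in *. set (c := g - x * G) in *.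
  assert (I : a * (2 * (E * G - F ^ 2) * (pencil_mean e f g - x)) * E = Rsqr a * (E * G - F ^ 2) + Rsqr (a * F - b * E)).
  { transitivity (a * ((a * G - 2 * b * F + c * E) * E)).
    - unfold pencil_mean, a, b, c. field. lra.
    - transitivity (Rsqr a * (E * G - F ^ 2) + (a * F) ^ 2 - 2 * (a * F) * (b * E) + (a * c) * E ^ 2); [unfold Rsqr; ring|].
      rewrite H. unfold Rsqr. ring. }
  pose proof (Rle_0_sqr (a * F - b * E)) as S1. assert (S2 : 0 < Rsqr a) by (apply Rlt_0_sqr; lra).
  pose proof (Rmult_lt_0_compat _ _ S2 HD).
  assert (0 <= - a * (2 * (E * G - F ^ 2) * (pencil_mean e f g - x)) * E); [|lra].
  apply Rmult_le_pos; [|lra]. apply Rmult_le_pos; [lra|]. apply Rmult_le_pos; lra.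
Qed.

Lemma pencil_lower e f g x : x ^ 2 - 2 * pencil_mean e f g * x + pencil_gauss e f g = 0 -> x <= pencil_mean e f g ->
  (forall u v, x * binary_form E F G u v <= binary_form e f g u v) /\
  exists u v, (u, v) <> (0, 0) /\ binary_form e f g u v = x * binary_form E F G u v.
Proof.
  intros H Hx. pose proof (pencil_det e f g x) as Hdet. rewrite H, Rmult_0_r in Hdet. apply Rminus_diag_uniq in Hdet.
  pose proof (semidefinite_diag e f g x Hdet Hx) as Ha.
  assert (Hform : forall u v, binary_form e f g u v - x * binary_form E F G u v = binary_form (e - x * E) (f - x * F) (g - x * G) u v)
    by (intros; unfold binary_form; ring).
  set (a := e - x * E) in *. set (b := f - x * F) in *. set (c := g - x * G) in *.
  destruct (Rle_lt_or_eq_dec _ _ Ha) as [Ha'|Ha'].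
  - assert (Hm : forall u v, a * binary_form a b c u v = Rsqr (a * u + b * v)).
    { intros u v. unfold binary_form, Rsqr. transitivity (a ^ 2 * u ^ 2 + 2 * a * b * u * v + (a * c) * v ^ 2); [ring|rewrite Hdet; ring]. }
    split.
    + intros u v. specialize (Hform u v). assert (0 <= binary_form a b c u v); [|lra].
      apply (Rmult_le_reg_l a); [easy|]. rewrite Rmult_0_r, Hm. apply Rle_0_sqr.
    (* The kernel of the degenerate form II - x I, where the bound is attained. *)
    + exists (- b), a. split; [intro K; injection K; lra|]. specialize (Hm (- b) a). specialize (Hform (- b) a).
      assert (Z : a * binary_form a b c (- b) a = 0) by (rewrite Hm; unfold Rsqr; ring).
      apply Rmult_integral in Z. destruct Z; lra.
  - rewrite <- Ha' in Hdet. assert (Hb : b = 0) by (apply Rsqr_0_uniq; unfold Rsqr; lra).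
    split.
    + intros u v. specialize (Hform u v). unfold binary_form in Hform at 3. rewrite <- Ha', Hb in Hform.
      assert (0 <= c * v ^ 2); [|lra]. apply Rmult_le_pos; [|apply pow2_ge_0].
      assert (T : a * G - 2 * b * F + c * E = 2 * (E * G - F ^ 2) * (pencil_mean e f g - x)) by (unfold a, b, c, pencil_mean; field; lra).
      rewrite <- Ha', Hb in T. apply (Rmult_le_reg_r E); [easy|]. assert (0 <= 2 * (E * G - F ^ 2) * (pencil_mean e f g - x)) by (apply Rmult_le_pos; lra). lra.
    + exists 1, 0. split; [intro K; injection K; lra|]. specialize (Hform 1 0). unfold binary_form in Hform at 3. rewrite <- Ha' in Hform. lra.
Qed.
End Pencil.

Definition form_mean_curvature (alpha : R -> R -> R3) u v := pencil_mean (ffE alpha u v) (ffF alpha u v) (ffG alpha u v) (sfe alpha u v) (sff alpha u v) (sfg alpha u v).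
Definition form_gauss_curvature (alpha : R -> R -> R3) u v := pencil_gauss (ffE alpha u v) (ffF alpha u v) (ffG alpha u v) (sfe alpha u v) (sff alpha u v) (sfg alpha u v).

Lemma principal_curvatures alpha u v : 0 < ffE alpha u v -> 0 < ffE alpha u v * ffG alpha u v - ffF alpha u v ^ 2 ->
  0 <= form_mean_curvature alpha u v ^ 2 - form_gauss_curvature alpha u v /\
  k1 alpha u v = form_mean_curvature alpha u v - sqrt (form_mean_curvature alpha u v ^ 2 - form_gauss_curvature alpha u v) /\
  k2 alpha u v = form_mean_curvature alpha u v + sqrt (form_mean_curvature alpha u v ^ 2 - form_gauss_curvature alpha u v).
Proof.
  intros HE HD. unfold form_mean_curvature, form_gauss_curvature, k1, k2, normal_curvature_values, normal_curvature, first_form, second_form.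
  set (E := ffE alpha u v) in *. set (F := ffF alpha u v) in *. set (G := ffG alpha u v) in *.
  set (e := sfe alpha u v) in *. set (f := sff alpha u v) in *. set (g := sfg alpha u v) in *.
  set (H := pencil_mean E F G e f g). set (K := pencil_gauss E F G e f g).
  pose proof (pencil_disc E F G HE HD e f g) as Hd. fold H K in Hd.
  set (s := sqrt (H ^ 2 - K)). assert (Hs : s * s = H ^ 2 - K) by now apply sqrt_sqrt. assert (Hs0 : 0 <= s) by apply sqrt_pos.
  assert (Hpos : forall x y, (x, y) <> (0, 0) -> 0 < binary_form E F G x y) by (intros; now apply binary_form_pos).
  split; [easy|]. split.
  - destruct (pencil_lower E F G HE HD e f g (H - s)) as [Hle [x [y [Hxy He]]]]; fold H K; [transitivity (s * s - (H ^ 2 - K)); [ring|lra]|lra|].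
    rewrite (is_glb_Rbar_unique _ (Finite (H - s))); [easy|]. split.
    + intros k [x' [y' [Hn ->]]]. simpl. specialize (Hpos x' y' Hn). apply (Rmult_le_reg_r (binary_form E F G x' y')); [easy|].
      unfold Rdiv. rewrite Rmult_assoc. change (E * x' ^ 2 + 2 * F * x' * y' + G * y' ^ 2) with (binary_form E F G x' y').
      rewrite Rinv_l by lra. rewrite Rmult_1_r. apply Hle.
    + intros b Hb. apply Hb. exists x, y. split; [easy|]. specialize (Hpos x y Hxy).
      change (H - s = binary_form e f g x y / binary_form E F G x y). rewrite He. field. lra.
  (* The maximum for II is the opposite of the minimum for - II. *)
  - assert (Em : pencil_mean E F G (- e) (- f) (- g) = - H) by (unfold H, pencil_mean; field; lra).
    assert (Ek : pencil_gauss E F G (- e) (- f) (- g) = K) by (unfold K, pencil_gauss; field; lra).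
    destruct (pencil_lower E F G HE HD (- e) (- f) (- g) (- (H + s))) as [Hle [x [y [Hxy He]]]]; rewrite ?Em, ?Ek;
      [transitivity (s * s - (H ^ 2 - K)); [ring|lra]|lra|].
    assert (Eb : forall x y, binary_form (- e) (- f) (- g) x y = - binary_form e f g x y) by (intros; unfold binary_form; ring).
    rewrite (is_lub_Rbar_unique _ (Finite (H + s))); [easy|]. split.
    + intros k [x' [y' [Hn ->]]]. simpl. specialize (Hpos x' y' Hn). apply (Rmult_le_reg_r (binary_form E F G x' y')); [easy|].
      unfold Rdiv. rewrite Rmult_assoc. change (E * x' ^ 2 + 2 * F * x' * y' + G * y' ^ 2) with (binary_form E F G x' y').
      rewrite Rinv_l by lra. rewrite Rmult_1_r. specialize (Hle x' y'). rewrite Eb in Hle. unfold binary_form in *. lra.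
    + intros b Hb. apply Hb. exists x, y. split; [easy|]. specialize (Hpos x y Hxy). rewrite Eb in He.
      change (H + s = binary_form e f g x y / binary_form E F G x y). replace (binary_form e f g x y) with ((H + s) * binary_form E F G x y) by lra. field. lra.
Qed.

(* For [(p, q, r)] the coefficients of II - M I, the left-hand side is the
   numerator of [tau_g]: it is the Jacobian of II and I, and replacing II by
   II - M I does not change it. *)
Lemma isotropic_jacobian E F G p q r x y : binary_form p q r x y = 0 ->
  ((q * x + r * y) * (E * x + F * y) - (p * x + q * y) * (F * x + G * y)) * (x ^ 2 + y ^ 2) =
    (q * (x ^ 2 - y ^ 2) + (r - p) * x * y) * binary_form E F G x y /\
  (q * (x ^ 2 - y ^ 2) + (r - p) * x * y) ^ 2 = (q ^ 2 - p * r) * (x ^ 2 + y ^ 2) ^ 2.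
Proof.
  unfold binary_form. intro H. split.
  - transitivity ((q * (x ^ 2 - y ^ 2) + (r - p) * x * y) * (E * x ^ 2 + 2 * F * x * y + G * y ^ 2) +
      (p * x ^ 2 + 2 * q * x * y + r * y ^ 2) * (y * (E * x + F * y) - x * (F * x + G * y))); [ring|rewrite H; ring].
  - set (P := p * x ^ 2 + 2 * q * x * y + r * y ^ 2) in *.
    transitivity ((q ^ 2 - p * r) * (x ^ 2 + y ^ 2) ^ 2 - P * P + (r + p) * P * (x ^ 2 + y ^ 2)); [unfold P; ring|rewrite H; ring].
Qed.

(** * Monge charts *)

Lemma Du_ext f g u v : (forall s t, f s t = g s t) -> Du f u v = Du g u v.
Proof. intro H. apply Derive_ext. intro. apply H. Qed.
Lemma Dv_ext f g u v : (forall s t, f s t = g s t) -> Dv f u v = Dv g u v.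
Proof. intro H. apply Derive_ext. intro. apply H. Qed.
Lemma Du_const c u v : Du (fun _ _ => c) u v = 0.
Proof. exact (Derive_const c _). Qed.
Lemma Dv_const c u v : Dv (fun _ _ => c) u v = 0.
Proof. exact (Derive_const c _). Qed.

Section Monge.
Context (z : R -> R -> R).

Definition area2 u v : R := 1 + Du z u v ^ 2 + Dv z u v ^ 2.

Lemma area2_pos u v : 1 <= area2 u v.
Proof. unfold area2. pose proof (pow2_ge_0 (Du z u v)). pose proof (pow2_ge_0 (Dv z u v)). lra. Qed.

Lemma Du3_monge u v : Du3 (monge z) u v = (1, 0, Du z u v).
Proof.
  unfold Du3. do 2 f_equal.
  - exact (Derive_id u).
  - exact (Derive_const v u).
Qed.

Lemma Dv3_monge u v : Dv3 (monge z) u v = (0, 1, Dv z u v).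
Proof.
  unfold Dv3. do 2 f_equal.
  - exact (Derive_const u v).
  - exact (Derive_id v).
Qed.

Lemma normal_monge u v : normal (monge z) u v =
  (- Du z u v * / sqrt (area2 u v), - Dv z u v * / sqrt (area2 u v), / sqrt (area2 u v)).
Proof.
  unfold normal, vscal, vnorm, vcross, vdot. rewrite Du3_monge, Dv3_monge. unfold pr1, pr2, pr3; cbn [fst snd].
  match goal with |- context [sqrt ?x] => replace x with (area2 u v) by (unfold area2; ring) end.
  f_equal; [f_equal|]; ring.
Qed.

Lemma ffE_monge u v : ffE (monge z) u v = 1 + Du z u v ^ 2.
Proof. unfold ffE. rewrite Du3_monge. unfold vdot, pr1, pr2, pr3; cbn [fst snd]. ring. Qed.
Lemma ffF_monge u v : ffF (monge z) u v = Du z u v * Dv z u v.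
Proof. unfold ffF. rewrite Du3_monge, Dv3_monge. unfold vdot, pr1, pr2, pr3; cbn [fst snd]. ring. Qed.
Lemma ffG_monge u v : ffG (monge z) u v = 1 + Dv z u v ^ 2.
Proof. unfold ffG. rewrite Dv3_monge. unfold vdot, pr1, pr2, pr3; cbn [fst snd]. ring. Qed.

Lemma Du3_Du3_monge u v : Du3 (Du3 (monge z)) u v = (0, 0, Du (Du z) u v).
Proof.
  unfold Du3 at 1. rewrite (Du_ext (fun s t => pr1 (Du3 (monge z) s t)) (fun _ _ => 1)), (Du_ext (fun s t => pr2 (Du3 (monge z) s t)) (fun _ _ => 0)),
    (Du_ext (fun s t => pr3 (Du3 (monge z) s t)) (Du z)), !Du_const; try easy; intros; now rewrite Du3_monge.
Qed.
Lemma Du3_Dv3_monge u v : Du3 (Dv3 (monge z)) u v = (0, 0, Du (Dv z) u v).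
Proof.
  unfold Du3 at 1. rewrite (Du_ext (fun s t => pr1 (Dv3 (monge z) s t)) (fun _ _ => 0)), (Du_ext (fun s t => pr2 (Dv3 (monge z) s t)) (fun _ _ => 1)),
    (Du_ext (fun s t => pr3 (Dv3 (monge z) s t)) (Dv z)), !Du_const; try easy; intros; now rewrite Dv3_monge.
Qed.
Lemma Dv3_Dv3_monge u v : Dv3 (Dv3 (monge z)) u v = (0, 0, Dv (Dv z) u v).
Proof.
  unfold Dv3 at 1. rewrite (Dv_ext (fun s t => pr1 (Dv3 (monge z) s t)) (fun _ _ => 0)), (Dv_ext (fun s t => pr2 (Dv3 (monge z) s t)) (fun _ _ => 1)),
    (Dv_ext (fun s t => pr3 (Dv3 (monge z) s t)) (Dv z)), !Dv_const; try easy; intros; now rewrite Dv3_monge.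
Qed.

Lemma sfe_monge u v : sfe (monge z) u v = Du (Du z) u v * / sqrt (area2 u v).
Proof. unfold sfe. rewrite normal_monge, Du3_Du3_monge. unfold vdot, pr1, pr2, pr3; cbn [fst snd]. ring. Qed.
Lemma sff_monge u v : sff (monge z) u v = Du (Dv z) u v * / sqrt (area2 u v).
Proof. unfold sff. rewrite normal_monge, Du3_Dv3_monge. unfold vdot, pr1, pr2, pr3; cbn [fst snd]. ring. Qed.
Lemma sfg_monge u v : sfg (monge z) u v = Dv (Dv z) u v * / sqrt (area2 u v).
Proof. unfold sfg. rewrite normal_monge, Dv3_Dv3_monge. unfold vdot, pr1, pr2, pr3; cbn [fst snd]. ring. Qed.

Lemma det_monge u v : ffE (monge z) u v * ffG (monge z) u v - ffF (monge z) u v ^ 2 = area2 u v.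
Proof. rewrite ffE_monge, ffF_monge, ffG_monge. unfold area2. ring. Qed.

Section Torsion.
Context (u v : R).
Context (Dpu : ex_derive (fun s => Du z s v) u).
Context (Dqu : ex_derive (fun s => Dv z s v) u).
Context (Dpv : ex_derive (fun t => Du z u t) v).
Context (Dqv : ex_derive (fun t => Dv z u t) v).
Context (mixed : Dv (Du z) u v = Du (Dv z) u v).

(** The derivative of the inverse length stays an unknown [l]: it multiplies [(- p, - q, 1)], so it
    contributes a vector parallel to the normal, which drops out of the torsion. *)
Lemma normal_derivative (p q : R -> R) (x p' q' : R) : is_derive p x p' -> is_derive q x q' ->
  exists l, Derive (fun s => - p s * / sqrt (1 + p s ^ 2 + q s ^ 2)) x = - p' * / sqrt (1 + p x ^ 2 + q x ^ 2) - p x * l /\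
    Derive (fun s => - q s * / sqrt (1 + p s ^ 2 + q s ^ 2)) x = - q' * / sqrt (1 + p x ^ 2 + q x ^ 2) - q x * l /\
    Derive (fun s => / sqrt (1 + p s ^ 2 + q s ^ 2)) x = l.
Proof.
  intros Hp Hq. assert (Hpos : 0 < 1 + p x ^ 2 + q x ^ 2) by (pose proof (pow2_ge_0 (p x)); pose proof (pow2_ge_0 (q x)); lra).
  assert (Hs : sqrt (1 + p x ^ 2 + q x ^ 2) <> 0) by (apply Rgt_not_eq; now apply sqrt_lt_R0).
  assert (H : ex_derive (fun s => / sqrt (1 + p s ^ 2 + q s ^ 2)) x).
  { auto_derive. repeat split; try easy; eexists; eassumption. }
  apply Derive_correct in H. set (l := Derive (fun s => / sqrt (1 + p s ^ 2 + q s ^ 2)) x) in *.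
  exists l. split; [|split; [|easy]]; apply is_derive_unique.
  - assert (A := is_derive_mult _ _ _ _ _ (is_derive_opp _ _ _ Hp) H Rmult_comm). 
    replace (- p' * / sqrt (1 + p x ^ 2 + q x ^ 2) - p x * l) with (plus (mult (opp p') (/ sqrt (1 + p x ^ 2 + q x ^ 2))) (mult (opp (p x)) l)); [exact A|].
    unfold plus, mult, opp; simpl. ring.
  - assert (A := is_derive_mult _ _ _ _ _ (is_derive_opp _ _ _ Hq) H Rmult_comm). 
    replace (- q' * / sqrt (1 + p x ^ 2 + q x ^ 2) - q x * l) with (plus (mult (opp q') (/ sqrt (1 + p x ^ 2 + q x ^ 2))) (mult (opp (q x)) l)); [exact A|].
    unfold plus, mult, opp; simpl. ring.
Qed.

Lemma torsion_monge x y : (x, y) <> (0, 0) -> let alpha := monge z in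
  geodesic_torsion alpha u v x y =
    ((sff alpha u v * x + sfg alpha u v * y) * (ffE alpha u v * x + ffF alpha u v * y)
     - (sfe alpha u v * x + sff alpha u v * y) * (ffF alpha u v * x + ffG alpha u v * y))
    / (sqrt (area2 u v) * binary_form (ffE alpha u v) (ffF alpha u v) (ffG alpha u v) x y).
Proof.
  intros Hxy alpha. 
  destruct (normal_derivative (fun s => Du z s v) (fun s => Dv z s v) u _ _ (Derive_correct _ _ Dpu) (Derive_correct _ _ Dqu)) as [lu [U1 [U2 U3]]].
  destruct (normal_derivative (fun s => Du z u s) (fun s => Dv z u s) v _ _ (Derive_correct _ _ Dpv) (Derive_correct _ _ Dqv)) as [lv [V1 [V2 V3]]].
  assert (NU : Du3 (normal alpha) u v = (- Du (Du z) u v * / sqrt (area2 u v) - Du z u v * lu, - Du (Dv z) u v * / sqrt (area2 u v) - Dv z u v * lu, lu)).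
  { unfold Du3. f_equal; [f_equal|].
    - etransitivity; [|exact U1]. apply Derive_ext. intro s. unfold alpha. now rewrite normal_monge.
    - etransitivity; [|exact U2]. apply Derive_ext. intro s. unfold alpha. now rewrite normal_monge.
    - etransitivity; [|exact U3]. apply Derive_ext. intro s. unfold alpha. now rewrite normal_monge. }
  assert (NV : Dv3 (normal alpha) u v = (- Dv (Du z) u v * / sqrt (area2 u v) - Du z u v * lv, - Dv (Dv z) u v * / sqrt (area2 u v) - Dv z u v * lv, lv)).
  { unfold Dv3. f_equal; [f_equal|].
    - etransitivity; [|exact V1]. apply Derive_ext. intro s. unfold alpha. now rewrite normal_monge.
    - etransitivity; [|exact V2]. apply Derive_ext. intro s. unfold alpha. now rewrite normal_monge.
    - etransitivity; [|exact V3]. apply Derive_ext. intro s. unfold alpha. now rewrite normal_monge. }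
  assert (HI : 0 < binary_form (ffE alpha u v) (ffF alpha u v) (ffG alpha u v) x y).
  { pose proof (area2_pos u v). apply binary_form_pos; [unfold alpha; rewrite ffE_monge; pose proof (pow2_ge_0 (Du z u v)); lra|unfold alpha; rewrite det_monge; lra|easy]. }
  unfold geodesic_torsion. rewrite NU, NV. unfold alpha in *. rewrite mixed. rewrite Du3_monge, Dv3_monge, normal_monge.
  rewrite sff_monge, sfe_monge, sfg_monge. 
  set (I := binary_form _ _ _ x y) in *.
  assert (HI' : vnorm (vadd (vscal x (1, 0, Du z u v)) (vscal y (0, 1, Dv z u v))) = sqrt I).
  { unfold vnorm, I, binary_form. rewrite ffE_monge, ffF_monge, ffG_monge. f_equal. unfold vdot, vadd, vscal, pr1, pr2, pr3; cbn [fst snd]. ring. }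
  rewrite HI'. rewrite ffE_monge, ffF_monge, ffG_monge. clearbody I.
  pose proof (area2_pos u v) as HA. set (s := sqrt (area2 u v)) in *. assert (Hs : 0 < s) by (apply sqrt_lt_R0; lra).
  replace I with (sqrt I * sqrt I) at 3 by (apply sqrt_sqrt; lra). set (r := sqrt I). assert (Hr : 0 < r) by now apply sqrt_lt_R0.
  set (p := Du z u v). set (q := Dv z u v). set (zxx := Du (Du z) u v). set (zxy := Du (Dv z) u v). set (zyy := Dv (Dv z) u v).
  unfold vdot, vcross, vadd, vscal, pr1, pr2, pr3; cbn [fst snd]. field. lra.
Qed.
End Torsion.
End Monge.

Section MongeDirections.
Context (z : R -> R -> R) (u v : R).
Let alpha := monge z.

Lemma monge_forms_pos : 0 < ffE alpha u v /\ 0 < ffE alpha u v * ffG alpha u v - ffF alpha u v ^ 2.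
Proof.
  unfold alpha. rewrite det_monge, ffE_monge. pose proof (area2_pos z u v). pose proof (pow2_ge_0 (Du z u v)). lra.
Qed.

Lemma monge_curvatures : 0 <= form_mean_curvature alpha u v ^ 2 - form_gauss_curvature alpha u v /\
  mean_curvature alpha u v = form_mean_curvature alpha u v /\ gauss_curvature alpha u v = form_gauss_curvature alpha u v.
Proof.
  destruct monge_forms_pos as [HE HD]. destruct (principal_curvatures alpha u v HE HD) as [H0 [H1 H2]].
  unfold mean_curvature, gauss_curvature. rewrite H1, H2. split; [easy|split; [field|]].
  set (s := sqrt _). assert (s * s = form_mean_curvature alpha u v ^ 2 - form_gauss_curvature alpha u v) by now apply sqrt_sqrt.
  transitivity (form_mean_curvature alpha u v ^ 2 - s * s); [ring|lra].
Qed.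

Context (Dpu : ex_derive (fun s => Du z s v) u).
Context (Dqu : ex_derive (fun s => Dv z s v) u).
Context (Dpv : ex_derive (fun t => Du z u t) v).
Context (Dqv : ex_derive (fun t => Dv z u t) v).
Context (mixed : Dv (Du z) u v = Du (Dv z) u v).

(** The sign condition on the Jacobian selects the foliation and, being strict, also forces
    [(k2 - M) (M - k1) > 0], which excludes umbilics. *)
Lemma isotropic_direction U m i x y : U (u, v) -> 0 < form_gauss_curvature alpha u v ->
  let M := calM m alpha u v in
  let p := sfe alpha u v - M * ffE alpha u v in
  let q := sff alpha u v - M * ffF alpha u v in
  let r := sfg alpha u v - M * ffG alpha u v in
  binary_form p q r x y = 0 -> 0 < torsion_sign i * (q * (x ^ 2 - y ^ 2) + (r - p) * x * y) ->
  mean_foliation U alpha m i (u, v) (x, y).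
Proof.
  intros HU HK M p q r Hiso Hsign.
  destruct monge_forms_pos as [HE HD]. destruct (principal_curvatures alpha u v HE HD) as [Hd [Hk1 Hk2]].
  destruct monge_curvatures as [_ [_ HKe]].
  destruct (isotropic_jacobian (ffE alpha u v) (ffF alpha u v) (ffG alpha u v) p q r x y Hiso) as [J1 J2].
  set (La := q * (x ^ 2 - y ^ 2) + (r - p) * x * y) in *.
  assert (HLa : La <> 0) by (intro Z; rewrite Z in Hsign; lra).
  assert (HLa2 : 0 < La ^ 2) by (apply Rlt_0_sqr in HLa; unfold Rsqr in HLa; lra).
  assert (Hw : (x, y) <> (0, 0)) by (intro Z; injection Z as -> ->; apply HLa; unfold La; ring).
  assert (Hn : 0 < x ^ 2 + y ^ 2).
  { pose proof (pow2_ge_0 x). pose proof (pow2_ge_0 y). destruct (Rle_lt_or_eq_dec 0 (x ^ 2 + y ^ 2)) as [|Z]; [lra|easy|]. rewrite <- Z in J2. lra. }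
  pose proof (binary_form_pos _ _ _ x y HE HD Hw) as HI. set (I := binary_form (ffE alpha u v) (ffF alpha u v) (ffG alpha u v) x y) in *.
  (* [pencil_det] at [M], where the characteristic polynomial factors because [k1] and [k2] are the
     mean minus and plus the root of the discriminant. *)
  assert (Hdet : q ^ 2 - p * r = area2 z u v * ((k2 alpha u v - M) * (M - k1 alpha u v))).
  { pose proof (pencil_det _ _ _ HD (sfe alpha u v) (sff alpha u v) (sfg alpha u v) M) as E. fold p q r in E.
    change (pencil_mean _ _ _ _ _ _) with (form_mean_curvature alpha u v) in E. change (pencil_gauss _ _ _ _ _ _) with (form_gauss_curvature alpha u v) in E.
    unfold alpha in E at 1 2 3. rewrite det_monge in E. rewrite Hk1, Hk2. set (s := sqrt _).
    assert (Hs : s * s = form_mean_curvature alpha u v ^ 2 - form_gauss_curvature alpha u v) by now apply sqrt_sqrt.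
    replace ((form_mean_curvature alpha u v + s - M) * (M - (form_mean_curvature alpha u v - s))) with (s * s - (form_mean_curvature alpha u v - M) ^ 2) by ring. rewrite Hs.
    replace (q ^ 2 - p * r) with (- (p * r - q ^ 2)) by ring. rewrite E. ring. }
  rewrite Hdet in J2. set (S := (k2 alpha u v - M) * (M - k1 alpha u v)) in *.
  pose proof (area2_pos z u v) as HA.
  assert (HS : 0 < S).
  { apply (Rmult_lt_reg_l (area2 z u v * (x ^ 2 + y ^ 2) ^ 2)); [apply Rmult_lt_0_compat; [lra|now apply pow_lt]|]. lra. }
  unfold mean_foliation. fold M. split; [easy|]. split; [now rewrite HKe|]. split; [|split; [easy|split]].
  - intro Hum. unfold umbilic in Hum. unfold S in HS. rewrite Hum in HS. pose proof (Rle_0_sqr (M - k2 alpha u v)) as Z. unfold Rsqr in Z. revert Z HS. generalize M (k2 alpha u v). clear. intros a b Z HS. lra.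
  - unfold normal_curvature. apply (Rmult_eq_reg_r I); [|lra]. unfold Rdiv. rewrite Rmult_assoc.
    change (first_form alpha u v x y) with I. rewrite Rinv_l, Rmult_1_r by lra.
    unfold second_form, I, binary_form. unfold binary_form, p, q, r in Hiso. lra.
  - unfold alpha. rewrite torsion_monge by easy. fold alpha I. fold S.
    replace ((sff alpha u v * x + sfg alpha u v * y) * (ffE alpha u v * x + ffF alpha u v * y) -
      (sfe alpha u v * x + sff alpha u v * y) * (ffF alpha u v * x + ffG alpha u v * y))
      with ((q * x + r * y) * (ffE alpha u v * x + ffF alpha u v * y) - (p * x + q * y) * (ffF alpha u v * x + ffG alpha u v * y))
      by (unfold p, q, r; ring).
    set (N := (q * x + r * y) * _ - _) in *. set (s := sqrt (area2 z u v)).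
    assert (Hs : 0 < s) by (apply sqrt_lt_R0; lra). assert (Hss : s * s = area2 z u v) by (apply sqrt_sqrt; lra).
    replace (N / (s * I)) with (La / (s * (x ^ 2 + y ^ 2))).
    2:{ replace N with (La * I / (x ^ 2 + y ^ 2)) by (rewrite <- J1; field; lra). field. lra. }
    (* The square of the torsion is [S], so the torsion is the root of [S] up to the prescribed
       sign. *)
    assert (E : Rsqr (La / (s * (x ^ 2 + y ^ 2))) = S).
    { replace (Rsqr (La / (s * (x ^ 2 + y ^ 2)))) with (La ^ 2 / (s * s * (x ^ 2 + y ^ 2) ^ 2)) by (unfold Rsqr; field; lra).
      rewrite J2, Hss. field. lra. }
    rewrite <- E, sqrt_Rsqr_abs.
    assert (HX : 0 < torsion_sign i * (La / (s * (x ^ 2 + y ^ 2)))).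
    { unfold Rdiv. rewrite <- Rmult_assoc. apply Rmult_lt_0_compat; [easy|]. apply Rinv_0_lt_compat. now apply Rmult_lt_0_compat. }
    set (X := La / _) in *. destruct i; simpl in *.
    + rewrite Rabs_left; lra.
    + rewrite Rabs_right; lra.
Qed.
End MongeDirections.

(** * First-order jets in the plane *)

Lemma plane_small_intro f : f (0, 0) = 0 ->
  (forall eps, 0 < eps -> exists d, 0 < d /\ forall p q : R * R, Rabs (fst p) < d -> Rabs (snd p) < d -> Rabs (fst q) < d -> Rabs (snd q) < d ->
     Rabs (f p - f q) <= eps * plane_dist p q) -> plane_small f.
Proof.
  intros H0 H eps He. destruct (H eps He) as [d [Hd H1]].
  (* Points with coordinates below [/ 2] are at distance at most 1 from the origin, so the bound on
     differences also bounds the values. *)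
  apply (Fplane_intro _ (Rmin d (/ 2))); [apply Rmin_glb_lt; lra|]. pose proof (Rmin_l d (/ 2)). pose proof (Rmin_r d (/ 2)).
  intros p q P1 P2 Q1 Q2. cbn [fst snd]. split; [apply H1; lra|].
  assert (G : forall w : R * R, Rabs (fst w) < Rmin d (/ 2) -> Rabs (snd w) < Rmin d (/ 2) -> Rabs (f w) <= eps).
  { intros w W1 W2. specialize (H1 w (0, 0)). rewrite H0, Rminus_0_r in H1. unfold plane_dist in H1. cbn [fst snd] in H1.
    rewrite !Rminus_0_r, Rabs_R0 in H1. specialize (H1 ltac:(lra) ltac:(lra) Hd Hd).
    apply Rle_trans with (1 := H1). rewrite <- (Rmult_1_r eps) at 2. apply Rmult_le_compat_l; lra. }
  split; now apply G.
Qed.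

Lemma small_mult_vanishing f g : plane_lipschitz f -> plane_lipschitz g -> f (0, 0) = 0 -> g (0, 0) = 0 -> plane_small (fun p => f p * g p).
Proof.
  intros [K [HK Hf]] [K' [HK' Hg]] F0 G0. apply plane_small_intro; [rewrite F0; ring|]. intros eps He.
  destruct (Fplane_elim _ Hf) as [d1 [Hd1 H1]]. destruct (Fplane_elim _ Hg) as [d2 [Hd2 H2]].
  set (d := Rmin (Rmin d1 d2) (eps / (4 * (K * K' + 1)))). assert (HKK : 0 <= K * K') by now apply Rmult_le_pos.
  assert (Hd : 0 < d) by (apply Rmin_glb_lt; [now apply Rmin_glb_lt|apply Rdiv_lt_0_compat; lra]).
  assert (D1 : d <= d1) by (eapply Rle_trans; [apply Rmin_l|apply Rmin_l]). assert (D2 : d <= d2) by (eapply Rle_trans; [apply Rmin_l|apply Rmin_r]).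
  assert (D3 : K * (2 * d) * K' + K * (2 * d) * K' <= eps).
  { assert (d <= eps / (4 * (K * K' + 1))) by apply Rmin_r.
    apply Rle_trans with (4 * (K * K' + 1) * d); [lra|]. apply (Rmult_le_compat_l (4 * (K * K' + 1))) in H; [|lra].
    replace (4 * (K * K' + 1) * (eps / (4 * (K * K' + 1)))) with eps in H by (field; lra). exact H. }
  exists d. split; [easy|]. intros p q P1 P2 Q1 Q2.
  destruct (H1 p q ltac:(lra) ltac:(lra) ltac:(lra) ltac:(lra)) as [A _]. destruct (H2 p q ltac:(lra) ltac:(lra) ltac:(lra) ltac:(lra)) as [B _].
  destruct (H1 p (0, 0) ltac:(lra) ltac:(lra) ltac:(cbn [fst]; rewrite Rabs_R0; lra) ltac:(cbn [snd]; rewrite Rabs_R0; lra)) as [A0 _].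
  destruct (H2 q (0, 0) ltac:(lra) ltac:(lra) ltac:(cbn [fst]; rewrite Rabs_R0; lra) ltac:(cbn [snd]; rewrite Rabs_R0; lra)) as [B0 _].
  cbn [fst snd] in *. rewrite F0, Rminus_0_r in A0. rewrite G0, Rminus_0_r in B0.
  assert (N : forall w : R * R, Rabs (fst w) < d -> Rabs (snd w) < d -> plane_dist w (0, 0) <= 2 * d)
    by (intros w W1 W2; unfold plane_dist; cbn [fst snd]; rewrite !Rminus_0_r; lra).
  pose proof (N p P1 P2) as Np. pose proof (N q Q1 Q2) as Nq. pose proof (plane_dist_pos p q) as HD.
  replace (f p * g p - f q * g q) with (f p * (g p - g q) + (f p - f q) * g q) by ring.
  apply Rle_trans with (1 := Rabs_triang _ _). rewrite !Rabs_mult.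
  assert (T1 : Rabs (f p) * Rabs (g p - g q) <= K * (2 * d) * (K' * plane_dist p q)).
  { apply Rmult_le_compat; try apply Rabs_pos; [|easy]. apply Rle_trans with (1 := A0). now apply Rmult_le_compat_l. }
  assert (T2 : Rabs (f p - f q) * Rabs (g q) <= K * plane_dist p q * (K' * (2 * d))).
  { apply Rmult_le_compat; try apply Rabs_pos; [easy|]. apply Rle_trans with (1 := B0). now apply Rmult_le_compat_l. }
  apply Rle_trans with ((K * (2 * d) * K' + K * (2 * d) * K') * plane_dist p q); [lra|]. now apply Rmult_le_compat_r.
Qed.

Definition affine (c al be : R) (p : R * R) : R := c + al * fst p + be * snd p.
(** Strict differentiability at the origin, with value [c] and gradient [(al, be)]. *)
Definition jet (f : R * R -> R) (c al be : R) : Prop := plane_small (fun p => f p - affine c al be p).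

Lemma affine_lipb c al be : plane_lipschitz (affine c al be).
Proof.
  unfold affine. pose proof plane_dist_pos.
  repeat (apply lipb_plus || apply lipb_mult); try typeclasses eauto; try easy; try (apply lipb_const; [typeclasses eauto|easy]);
    [apply plane_lipb_fst|apply plane_lipb_snd].
Qed.

Lemma jet_approx f c al be : jet f c al be -> plane_approx f (affine c al be).
Proof. intro H. split; [apply affine_lipb|exact H]. Qed.

Lemma jet_lipb f c al be : jet f c al be -> plane_lipschitz f.
Proof. intro H. apply jet_approx in H. now apply (approx_lipb _ _ _ _ H). Qed.

Lemma jet_0 f c al be : jet f c al be -> f (0, 0) = c.
Proof. intro H. apply small_plane_0 in H. unfold affine in H. cbn [fst snd] in H. lra. Qed.

Lemma jet_eq f g c al be c' al' be' : (forall p, f p = g p) -> c = c' -> al = al' -> be = be' -> jet f c al be -> jet g c' al' be'.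
Proof. intros H -> -> -> Hf. apply (small_ext _ _ (fun p => f p - affine c' al' be' p)); [intro p; now rewrite H|exact Hf]. Qed.

Lemma jet_const c : jet (fun _ => c) c 0 0.
Proof.
  apply (small_ext _ _ (fun _ => 0)); [intro; unfold affine; ring|]. apply small_0; [typeclasses eauto|apply plane_dist_pos].
Qed.

Lemma jet_plus f g c al be c' al' be' : jet f c al be -> jet g c' al' be' -> jet (fun p => f p + g p) (c + c') (al + al') (be + be').
Proof.
  intros Hf Hg. apply (small_ext _ _ (fun p => (f p - affine c al be p) + (g p - affine c' al' be' p))); [intro; unfold affine; ring|].
  apply small_plus; [typeclasses eauto|exact Hf|exact Hg].
Qed.

Lemma jet_mult f g c al be c' al' be' : jet f c al be -> jet g c' al' be' ->
  jet (fun p => f p * g p) (c * c') (c * al' + al * c') (c * be' + be * c').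
Proof.
  intros Hf Hg. pose proof plane_dist_pos as HP.
  apply (small_ext _ _ (fun p => (f p - affine c al be p) * g p + affine c al be p * (g p - affine c' al' be' p) + affine 0 al be p * affine 0 al' be' p));
    [intro; unfold affine; ring|].
  apply small_plus; [typeclasses eauto| |].
  - apply small_plus; [typeclasses eauto| |].
    + apply small_mult_l; [typeclasses eauto|easy|exact Hf|now apply (jet_lipb g c' al' be')].
    + apply small_mult_r; [typeclasses eauto|easy|apply affine_lipb|exact Hg].
  - apply small_mult_vanishing; try apply affine_lipb; unfold affine; cbn [fst snd]; ring.
Qed.

Lemma jet_scal f k c al be : jet f c al be -> jet (fun p => k * f p) (k * c) (k * al) (k * be).
Proof. intro H. eapply jet_eq; [| | | |exact (jet_mult _ _ _ _ _ _ _ _ (jet_const k) H)]; intros; cbn; ring. Qed.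

Lemma jet_minus f g c al be c' al' be' : jet f c al be -> jet g c' al' be' -> jet (fun p => f p - g p) (c - c') (al - al') (be - be').
Proof.
  intros Hf Hg. eapply jet_eq; [| | | |exact (jet_plus _ _ _ _ _ _ _ _ Hf (jet_scal _ (-1) _ _ _ Hg))]; intros; cbn; ring.
Qed.

Lemma one_away : away Fplane (fun _ : R * R => 1).
Proof. exists 1. split; [lra|]. apply (Fplane_intro _ 1); [lra|]. intros. lra. Qed.

(** Inverses and roots are taken only of functions with value 1 and zero gradient, namely the area
    factor and its root; for these the rules of [approx] suffice. *)
Lemma jet_one_approx f : jet f 1 0 0 <-> plane_approx f (fun _ => 1).
Proof.
  split.
  - intro H. split; [apply lipb_const; [typeclasses eauto|apply plane_dist_pos]|].
    apply (small_ext _ _ (fun p => f p - affine 1 0 0 p)); [intro; unfold affine; ring|exact H].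
  - intros [_ H]. apply (small_ext _ _ (fun p => f p - 1)); [intro; unfold affine; ring|exact H].
Qed.

Lemma jet_one_inv f : jet f 1 0 0 -> jet (fun p => / f p) 1 0 0.
Proof.
  rewrite !jet_one_approx. intro H. apply (approx_ext _ _ (fun p => / f p) _ (fun _ => / 1)); [easy|intro; apply Rinv_1|].
  apply approx_inv; try typeclasses eauto; [apply plane_dist_pos|easy|apply one_away].
Qed.

Lemma jet_one_sqrt f : jet f 1 0 0 -> jet (fun p => sqrt (f p)) 1 0 0.
Proof.
  rewrite !jet_one_approx. intro H. apply (approx_ext _ _ (fun p => sqrt (f p)) _ (fun _ => sqrt 1)); [easy|intro; apply sqrt_1|].
  apply approx_sqrt; try typeclasses eauto; [apply plane_dist_pos|easy|apply one_away].
Qed.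

Lemma square_of_locally (P : R * R -> Prop) : locally (0, 0) P -> exists d, 0 < d /\ forall x y, Rabs x < d -> Rabs y < d -> P (x, y).
Proof.
  intros [d Hd]. exists d. split; [apply cond_pos|]. intros x y Hx Hy. apply Hd. split; unfold ball; simpl; unfold AbsRing_ball, abs, minus, plus, opp; simpl;
    rewrite Ropp_0, Rplus_0_r; easy.
Qed.

(** The mean value theorem along two sides of the rectangle spanned by the points, with the
    continuity of the partial derivatives at the origin. *)
Lemma jet_C1 U f : open U -> U (0, 0) -> class_C 1 U f -> jet (fun p => f (fst p) (snd p)) (f 0 0) (Du f 0 0) (Dv f 0 0).
Proof.
  intros HU H0 [_ [HD [[HCu _] [HCv _]]]]. apply plane_small_intro; [unfold affine; cbn [fst snd]; ring|]. intros eps He.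
  destruct (square_of_locally U (HU _ H0)) as [d0 [Hd0 HU0]].
  destruct (HCu 0 0 H0 (mkposreal eps He)) as [d1 H1]. destruct (HCv 0 0 H0 (mkposreal eps He)) as [d2 H2]. cbn [pos] in H1, H2.
  exists (Rmin d0 (Rmin d1 d2)). split; [repeat apply Rmin_glb_lt; try easy; apply cond_pos|].
  intros [x y] [x' y']. cbn [fst snd]. intros Hx Hy Hx' Hy'.
  assert (Hd : Rmin d0 (Rmin d1 d2) <= d0 /\ Rmin d0 (Rmin d1 d2) <= d1 /\ Rmin d0 (Rmin d1 d2) <= d2).
  { pose proof (Rmin_l d0 (Rmin d1 d2)). pose proof (Rmin_r d0 (Rmin d1 d2)). pose proof (Rmin_l d1 d2). pose proof (Rmin_r d1 d2). lra. }
  set (d := Rmin d0 (Rmin d1 d2)) in *.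
  assert (Hbt : forall a b c, Rabs a < d -> Rabs b < d -> Rmin a b <= c <= Rmax a b -> Rabs c < d).
  { intros a b c Ha Hb Hc. apply Rabs_def2 in Ha. apply Rabs_def2 in Hb. apply Rabs_def1; unfold Rmin, Rmax in Hc; destruct (Rle_dec a b); lra. }
  assert (HDu : forall a b, Rabs a < d -> Rabs b < d -> is_derive (fun s => f s b) a (Du f a b)).
  { intros a b Ha Hb. apply Derive_correct. exact (proj1 (HD a b (HU0 a b ltac:(lra) ltac:(lra)))). }
  assert (HDv : forall a b, Rabs a < d -> Rabs b < d -> is_derive (fun t => f a t) b (Dv f a b)).
  { intros a b Ha Hb. apply Derive_correct. exact (proj2 (HD a b (HU0 a b ltac:(lra) ltac:(lra)))). }
  destruct (MVT_gen (fun s => f s y) x' x (fun s => Du f s y)) as [c [Hc Ec]].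
  { intros w Hw. apply HDu; [|easy]. apply (Hbt x' x); try easy. lra. }
  { intros w Hw. apply continuity_pt_filterlim. apply (ex_derive_continuous (fun s => f s y)). eexists. apply HDu; [|easy]. now apply (Hbt x' x). }
  destruct (MVT_gen (fun t => f x' t) y' y (fun t => Dv f x' t)) as [e [Hee Ee]].
  { intros w Hw. apply HDv; [easy|]. apply (Hbt y' y); try easy. lra. }
  { intros w Hw. apply continuity_pt_filterlim. apply (ex_derive_continuous (fun t => f x' t)). eexists. apply HDv; [easy|]. now apply (Hbt y' y). }
  cbn beta in Ec, Ee. pose proof (Hbt _ _ _ Hx' Hx Hc) as Hc'. pose proof (Hbt _ _ _ Hy' Hy Hee) as He'.
  unfold affine. cbn [fst snd].
  replace (f x y - (f 0 0 + Du f 0 0 * x + Dv f 0 0 * y) - (f x' y' - (f 0 0 + Du f 0 0 * x' + Dv f 0 0 * y')))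
    with ((Du f c y - Du f 0 0) * (x - x') + (Dv f x' e - Dv f 0 0) * (y - y')) by (transitivity (f x y - f x' y + (f x' y - f x' y') - Du f 0 0 * (x - x') - Dv f 0 0 * (y - y')); [rewrite Ec, Ee|]; ring).
  apply Rle_trans with (1 := Rabs_triang _ _). rewrite !Rabs_mult. unfold plane_dist. cbn [fst snd]. rewrite Rmult_plus_distr_l.
  apply Rplus_le_compat; (apply Rmult_le_compat_r; [apply Rabs_pos|]); apply Rlt_le; [apply H1|apply H2]; rewrite Rminus_0_r; lra.
Qed.

(** * Mean curvature functions near an umbilic *)

Lemma pow_le_abs x r n : Rabs x <= r -> Rabs (x ^ n) <= r ^ n.
Proof. intro H. rewrite <- RPow_abs. apply pow_incr. split; [apply Rabs_pos|easy]. Qed.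

(** A factor [r] on the left replaces the power [r ^ (n - 1)] on the right, so that [n = 0] is no
    exception. *)
Lemma pow_difference r x y n : Rabs x <= r -> Rabs y <= r -> r * Rabs (x ^ n - y ^ n) <= INR n * r ^ n * Rabs (x - y).
Proof.
  intros Hx Hy. assert (Hr : 0 <= r) by (pose proof (Rabs_pos x); lra). induction n as [|n IH].
  - simpl. rewrite Rminus_diag, Rabs_R0. lra.
  - rewrite S_INR. simpl pow. replace (x * x ^ n - y * y ^ n) with (x * (x ^ n - y ^ n) + (x - y) * y ^ n) by ring.
    apply Rle_trans with (r * (Rabs x * Rabs (x ^ n - y ^ n) + Rabs (x - y) * Rabs (y ^ n))).
    + apply Rmult_le_compat_l; [easy|]. rewrite <- !Rabs_mult. apply Rabs_triang.
    + pose proof (pow_le_abs y r n Hy) as Hp.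
      assert (T1 : Rabs x * (r * Rabs (x ^ n - y ^ n)) <= r * (INR n * r ^ n * Rabs (x - y))).
      { apply Rmult_le_compat; try easy; [apply Rabs_pos|]. apply Rmult_le_pos; [easy|apply Rabs_pos]. }
      assert (T2 : r * Rabs (x - y) * Rabs (y ^ n) <= r * Rabs (x - y) * r ^ n).
      { apply Rmult_le_compat_l; [apply Rmult_le_pos; [easy|apply Rabs_pos]|easy]. }
      lra.
Qed.

Lemma monomial_difference r h l h' l' i j : Rabs h <= r -> Rabs l <= r -> Rabs h' <= r -> Rabs l' <= r ->
  r * Rabs (h ^ i * l ^ j - h' ^ i * l' ^ j) <= INR (i + j) * r ^ (i + j) * (Rabs (h - h') + Rabs (l - l')).
Proof.
  intros Hh Hl Hh' Hl'. assert (Hr : 0 <= r) by (pose proof (Rabs_pos h); lra).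
  replace (h ^ i * l ^ j - h' ^ i * l' ^ j) with (h ^ i * (l ^ j - l' ^ j) + (h ^ i - h' ^ i) * l' ^ j) by ring.
  apply Rle_trans with (r * (Rabs (h ^ i) * Rabs (l ^ j - l' ^ j) + Rabs (h ^ i - h' ^ i) * Rabs (l' ^ j))).
  { apply Rmult_le_compat_l; [easy|]. rewrite <- !Rabs_mult. apply Rabs_triang. }
  pose proof (pow_difference r l l' j Hl Hl') as D1. pose proof (pow_difference r h h' i Hh Hh') as D2.
  pose proof (pow_le_abs h r i Hh) as B1. pose proof (pow_le_abs l' r j Hl') as B2.
  assert (T1 : Rabs (h ^ i) * (r * Rabs (l ^ j - l' ^ j)) <= r ^ i * (INR j * r ^ j * Rabs (l - l'))).
  { apply Rmult_le_compat; try easy; [apply Rabs_pos|apply Rmult_le_pos; [easy|apply Rabs_pos]]. }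
  assert (T2 : r * Rabs (h ^ i - h' ^ i) * Rabs (l' ^ j) <= INR i * r ^ i * Rabs (h - h') * r ^ j).
  { apply Rmult_le_compat; try easy; [apply Rmult_le_pos; [easy|apply Rabs_pos]|apply Rabs_pos]. }
  rewrite plus_INR, pow_add.
  assert (Hij : 0 <= r ^ i * r ^ j) by (apply Rmult_le_pos; now apply pow_le).
  assert (0 <= INR i * (r ^ i * r ^ j) * Rabs (l - l')) by (apply Rmult_le_pos; [apply Rmult_le_pos; [apply pos_INR|easy]|apply Rabs_pos]).
  assert (0 <= INR j * (r ^ i * r ^ j) * Rabs (h - h')) by (apply Rmult_le_pos; [apply Rmult_le_pos; [apply pos_INR|easy]|apply Rabs_pos]).
  lra.
Qed.

Lemma INR_le_pow2 n : INR n <= 2 ^ n.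
Proof.
  induction n as [|n IH]; [simpl; lra|]. rewrite S_INR. simpl pow. assert (1 <= 2 ^ n) by (apply pow_R1_Rle; lra). lra.
Qed.

(** The terms from degree 2 on are bounded by a geometric series of sum [c q / (1 - q)], at most
    [2 c q]. The truncated exponent is 0 for [n = 0]. *)
Lemma geometric_tail (d : nat -> R) (T c q : R) : 0 <= c -> 0 <= q <= / 2 -> (forall n, Rabs (d n) <= c * q ^ (n - 1)) -> is_series d T ->
  Rabs (T - (d 0%nat + d 1%nat)) <= 2 * c * q.
Proof.
  intros Hc Hq Hd HS.
  assert (Hp : forall n, 0 <= q ^ n) by (intro; now apply pow_le).
  assert (HN : forall n, Rabs (sum_n d (n + 1) - (d 0%nat + d 1%nat)) <= 2 * c * q - 2 * c * q ^ (n + 1)).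
  { induction n as [|n IH].
    - change (0 + 1)%nat with 1%nat. rewrite (sum_Sn d 0), sum_O. unfold plus; simpl. rewrite Rminus_diag, Rabs_R0. lra.
    - change (S n + 1)%nat with (S (n + 1)). rewrite sum_Sn. unfold plus; simpl.
      replace (sum_n d (n + 1) + d (S (n + 1)) - (d 0%nat + d 1%nat)) with ((sum_n d (n + 1) - (d 0%nat + d 1%nat)) + d (S (n + 1))) by ring.
      apply Rle_trans with (1 := Rabs_triang _ _). specialize (Hd (S (n + 1))). simpl in Hd. rewrite Nat.sub_0_r in Hd.
      assert (0 <= c * q ^ (n + 1)) by (apply Rmult_le_pos; easy).
      assert (c * q ^ (n + 1) * q <= c * q ^ (n + 1) * / 2) by (apply Rmult_le_compat_l; lra). lra. }
  assert (HL : is_lim_seq (fun n => Rabs (sum_n d (n + 1) - (d 0%nat + d 1%nat))) (Rabs (T - (d 0%nat + d 1%nat)))).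
  { apply (is_lim_seq_abs _ (Finite _)). apply (is_lim_seq_minus' _ _ T); [|apply is_lim_seq_const].
    apply (is_lim_seq_incr_n (sum_n d) 1). exact HS. }
  apply (is_lim_seq_le _ _ (Finite _) (Finite _) (fun n => Rle_trans _ _ (2 * c * q) (HN n) ltac:(pose proof (Rmult_le_pos _ _ Hc (Hp (n + 1)%nat)); lra)) HL (is_lim_seq_const _)).
Qed.

(** Two points of [D] are compared term by term in the power series and not along a segment, which
    may leave [D]. So the estimate holds at boundary points too, and umbilics are boundary points of
    [mcf_domain]. *)
Lemma analytic_strict_derivative D m H0 K0 : analytic_within D m H0 K0 -> exists mH mK, forall eps, 0 < eps -> exists d, 0 < d /\
  forall H K H' K', Rabs (H - H0) < d -> Rabs (K - K0) < d -> Rabs (H' - H0) < d -> Rabs (K' - K0) < d ->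
    D H K -> D H' K' -> Rabs (m H K - m H' K' - (mH * (H - H') + mK * (K - K'))) <= eps * (Rabs (H - H') + Rabs (K - K')).
Proof.
  intros [coef [rho [Hrho Han]]]. exists (coef 1%nat 0%nat), (coef 0%nat 1%nat). intros eps He.
  (* At this radius the series of absolute values converges, so that its terms are bounded by some
     [B]. *)
  set (r := rho / 2). assert (Hr : 0 < r) by (unfold r; lra).
  set (a := fun n => sum_n (fun i => Rabs (coef i (n - i)%nat * r ^ i * r ^ (n - i))) n).
  assert (HB : exists B, 0 <= B /\ forall n, a n <= B).
  { assert (Hex : ex_series a) by (apply (Han r r); rewrite Rabs_right; unfold r; lra).
    apply ex_series_lim_0 in Hex. destruct (filterlim_bounded a) as [B HB]; [exists 0; exact Hex|].
    exists B. split; [apply Rle_trans with (1 := norm_ge_0 (a 0%nat)), HB|]. intro n. apply Rle_trans with (1 := Rle_abs _). apply HB. }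
  destruct HB as [B [HB0 HB]].
  (* The first bound gives [q <= / 2], the second [4 * (B / r) * q <= eps]. The 2 in [q] absorbs the
     factor [n] that a monomial of degree [n] acquires, since [n <= 2 ^ n]. *)
  set (R0 := Rmin (r / 4) (eps * r * r / (8 * (B + 1)))).
  assert (HR0 : 0 < R0).
  { apply Rmin_glb_lt; [lra|]. apply Rdiv_lt_0_compat; [|lra]. apply Rmult_lt_0_compat; [|easy]. now apply Rmult_lt_0_compat. }
  assert (HR1 : R0 <= r / 4) by apply Rmin_l.
  set (q := 2 * R0 / r). assert (Hq : 0 <= q <= / 2).
  { unfold q. split; [apply Rlt_le, Rdiv_lt_0_compat; lra|]. apply (Rmult_le_reg_r r); [easy|]. unfold Rdiv. rewrite Rmult_assoc, Rinv_l by lra. lra. }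
  assert (Hqe : 4 * (B / r) * q <= eps).
  { assert (E : R0 <= eps * r * r / (8 * (B + 1))) by apply Rmin_r. unfold q.
    apply Rle_trans with (4 * ((B + 1) / r) * (2 * (eps * r * r / (8 * (B + 1))) / r)).
    - apply Rmult_le_compat; try lra.
      + assert (0 <= B / r) by (apply Rmult_le_pos; [easy|apply Rlt_le; now apply Rinv_0_lt_compat]). lra.
      + unfold q in Hq. lra.
      + apply Rmult_le_compat_l; [lra|]. apply Rmult_le_compat_r; [apply Rlt_le; now apply Rinv_0_lt_compat|lra].
      + apply Rmult_le_compat_r; [apply Rlt_le; now apply Rinv_0_lt_compat|lra].
    - apply Req_le. field. lra. }
  exists R0. split; [easy|]. intros H K H' K' A1 A2 A3 A4 HD HD'.
  set (h := H - H0) in *. set (l := K - K0) in *. set (h' := H' - H0) in *. set (l' := K' - K0) in *.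
  set (delta := Rabs (H - H') + Rabs (K - K')).
  assert (Hdelta : 0 <= delta) by (unfold delta; pose proof (Rabs_pos (H - H')); pose proof (Rabs_pos (K - K')); lra).
  destruct (Han h l) as [_ S1]; [unfold r in *; lra|unfold r in *; lra|]. destruct (Han h' l') as [_ S2]; [unfold r in *; lra|unfold r in *; lra|].
  replace (H0 + h) with H in S1 by (unfold h; ring). replace (K0 + l) with K in S1 by (unfold l; ring).
  replace (H0 + h') with H' in S2 by (unfold h'; ring). replace (K0 + l') with K' in S2 by (unfold l'; ring).
  specialize (S1 HD). specialize (S2 HD').
  pose proof (is_series_minus _ _ _ _ S1 S2) as HS.
  match type of HS with is_series ?f _ => set (d := f) in HS end. change (plus (m H K) (opp (m H' K'))) with (m H K - m H' K') in HS.
  assert (Hd : forall n, d n = sum_n (fun i => coef i (n - i)%nat * (h ^ i * l ^ (n - i) - h' ^ i * l' ^ (n - i))) n).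
  { intro n. unfold d, plus, opp; simpl. rewrite !sum_n_Reals. symmetry.
    transitivity (sum_f_R0 (fun i => coef i (n - i)%nat * h ^ i * l ^ (n - i) - coef i (n - i)%nat * h' ^ i * l' ^ (n - i)) n);
      [apply sum_eq; intros; ring|apply minus_sum]. }
  assert (Hdn : forall n, Rabs (d n) <= B * delta * (2 / r) * q ^ (n - 1)).
  { intro n. destruct n as [|n].
    - rewrite Hd, sum_O. simpl. rewrite Rminus_diag, Rmult_0_r, Rabs_R0, Rmult_1_r.
      apply Rmult_le_pos; [now apply Rmult_le_pos|]. apply Rlt_le, Rdiv_lt_0_compat; lra.
    - apply (Rmult_le_reg_l R0); [easy|]. replace (S n - 1)%nat with n by lia.
      replace (R0 * (B * delta * (2 / r) * q ^ n)) with (B * (q ^ S n * delta)) by (unfold q; simpl; field; lra).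
      rewrite Hd. apply Rle_trans with (a (S n) * (q ^ S n * delta)).
      2:{ apply Rmult_le_compat_r; [|apply HB]. apply Rmult_le_pos; [now apply pow_le|easy]. }
      unfold a. rewrite !sum_n_Reals.
      apply Rle_trans with (R0 * sum_f_R0 (fun i => Rabs (coef i (S n - i)%nat * (h ^ i * l ^ (S n - i) - h' ^ i * l' ^ (S n - i)))) (S n)).
      { apply Rmult_le_compat_l; [lra|]. apply (Rsum_abs (fun i => coef i (S n - i)%nat * (h ^ i * l ^ (S n - i) - h' ^ i * l' ^ (S n - i)))). }
      rewrite scal_sum, Rmult_comm, scal_sum. apply sum_Rle. intros i Hi. rewrite Rmult_comm.
      rewrite Rabs_mult, Rmult_assoc, (Rabs_mult (coef i (S n - i)%nat)).
      assert (M := monomial_difference R0 h l h' l' i (S n - i) ltac:(lra) ltac:(lra) ltac:(lra) ltac:(lra)).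
      replace (i + (S n - i))%nat with (S n) in M by lia.
      replace (h - h') with (H - H') in M by (unfold h, h'; ring). replace (l - l') with (K - K') in M by (unfold l, l'; ring). fold delta in M.
      rewrite <- pow_add. replace (i + (S n - i))%nat with (S n) by lia. rewrite (Rabs_right (r ^ S n)) by (apply Rle_ge, pow_le; lra).
      replace (Rabs (coef i (S n - i)%nat) * r ^ S n * (q ^ S n * delta)) with (Rabs (coef i (S n - i)%nat) * (2 ^ S n * R0 ^ S n * delta)).
      2:{ unfold q, Rdiv. rewrite !Rpow_mult_distr, pow_inv. field. apply pow_nonzero. lra. }
      rewrite <- Rmult_assoc, (Rmult_comm R0), Rmult_assoc. apply Rmult_le_compat_l; [apply Rabs_pos|].
      apply Rle_trans with (1 := M). apply Rmult_le_compat_r; [easy|]. apply Rmult_le_compat_r; [apply pow_le; lra|apply INR_le_pow2]. }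
  pose proof (geometric_tail d _ (B * delta * (2 / r)) q ltac:(apply Rmult_le_pos; [now apply Rmult_le_pos|apply Rlt_le, Rdiv_lt_0_compat; lra]) Hq Hdn HS) as HT.
  assert (E01 : d 0%nat + d 1%nat = coef 1%nat 0%nat * (H - H') + coef 0%nat 1%nat * (K - K')).
  { rewrite !Hd, sum_O, sum_Sn, sum_O. unfold plus; simpl. unfold h, l, h', l'. ring. }
  rewrite E01 in HT. apply Rle_trans with (1 := HT).
  replace (2 * (B * delta * (2 / r)) * q) with (4 * (B / r) * q * delta) by (field; lra). now apply Rmult_le_compat_r.
Qed.

Lemma mcf_at_umbilic m h : mean_curvature_function m -> m h (h ^ 2) = h.
Proof.
  intro Hm. pose proof (mcf_between m Hm h (h ^ 2)) as H. apply Rminus_diag_uniq, Rsqr_0_uniq, Rle_antisym; [|apply Rle_0_sqr].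
  unfold Rsqr. assert (0 <= h ^ 2) by apply pow2_ge_0. specialize (H ltac:(split; lra)). lra.
Qed.

(** Differentiating [m h (h ^ 2) = h] at [k] gives [mH + 2 * k * mK = 1]. As the gradient of [K] is
    [2 * k] times that of [H], the chain rule returns the gradient of [H]. *)
Lemma jet_mcf m H K k h1 h2 : mean_curvature_function m -> k <> 0 ->
  jet H k h1 h2 -> jet K (k ^ 2) (2 * k * h1) (2 * k * h2) ->
  locally (0, 0) (fun p : R * R => mcf_domain (H p) (K p)) -> jet (fun p => m (H p) (K p)) k h1 h2.
Proof.
  intros Hm Hk HH HK Hdom.
  assert (Hkk : 0 < k ^ 2) by (apply Rlt_0_sqr in Hk; unfold Rsqr in Hk; lra).
  destruct (analytic_strict_derivative _ m k (k ^ 2) (mcf_analytic m Hm k (k ^ 2) ltac:(split; lra) Hkk)) as [mH [mK Hd]].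
  assert (Hsum : mH + 2 * k * mK = 1).
  { apply Rminus_diag_uniq. set (w := mH + 2 * k * mK - 1). destruct (Req_dec w 0) as [|Hw]; [easy|]. exfalso.
    apply Rabs_pos_lt in Hw. set (A := 1 + (2 * Rabs k + 1)).
    assert (HA : 1 <= A) by (unfold A; pose proof (Rabs_pos k); lra).
    destruct (Hd (Rabs w / (4 * A)) ltac:(apply Rdiv_lt_0_compat; lra)) as [d [Hd0 Hd1]].
    (* The step from [k] to [k + t] along the parabola [K = H ^ 2]: the error of the strict
       derivative and the quadratic term are each at most a quarter of [Rabs w * t], too little to
       cancel it. *)
    set (t := Rmin (/ 2) (Rmin (d / (4 * A)) (Rabs w / (4 * (Rabs mK + 1))))).
    pose proof (Rabs_pos mK) as HmK.
    assert (Ht : 0 < t) by (repeat apply Rmin_glb_lt; try apply Rdiv_lt_0_compat; lra).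
    assert (T1 : t <= / 2) by apply Rmin_l.
    assert (T2 : t <= d / (4 * A)) by (eapply Rle_trans; [apply Rmin_r|apply Rmin_l]).
    assert (T3 : t <= Rabs w / (4 * (Rabs mK + 1))) by (eapply Rle_trans; [apply Rmin_r|apply Rmin_r]).
    assert (HtA : t * A <= d / 4).
    { apply (Rmult_le_compat_r A) in T2; [|lra]. replace (d / (4 * A) * A) with (d / 4) in T2 by (field; lra). exact T2. }
    assert (HtA' : t <= t * A) by (rewrite <- (Rmult_1_r t) at 1; apply Rmult_le_compat_l; lra).
    assert (HKd : Rabs ((k + t) ^ 2 - k ^ 2) <= t * (A - 1)).
    { replace ((k + t) ^ 2 - k ^ 2) with (t * (2 * k + t)) by ring. rewrite Rabs_mult, (Rabs_right t) by lra.
      apply Rmult_le_compat_l; [lra|]. apply Rle_trans with (1 := Rabs_triang _ _). rewrite Rabs_mult, (Rabs_right 2), (Rabs_right t) by lra. unfold A. lra. }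
    specialize (Hd1 (k + t) ((k + t) ^ 2) k (k ^ 2)).
    replace (k + t - k) with t in Hd1 by ring. rewrite !Rminus_diag, !Rabs_R0, (Rabs_right t) in Hd1 by lra.
    specialize (Hd1 ltac:(lra) ltac:(lra) Hd0 Hd0 ltac:(split; [apply pow2_ge_0|lra]) ltac:(split; [apply pow2_ge_0|lra])).
    rewrite !(mcf_at_umbilic m _ Hm) in Hd1.
    replace (k + t - k - (mH * t + mK * ((k + t) ^ 2 - k ^ 2))) with (- (w * t + mK * (t * t))) in Hd1 by (unfold w; ring). rewrite Rabs_Ropp in Hd1.
    assert (Q1 : Rabs w / (4 * A) * (t + Rabs ((k + t) ^ 2 - k ^ 2)) <= Rabs w / 4 * t).
    { apply Rle_trans with (Rabs w / (4 * A) * (t * A)); [|apply Req_le; field; lra].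
      apply Rmult_le_compat_l; [apply Rlt_le, Rdiv_lt_0_compat; lra|lra]. }
    assert (Q2 : Rabs (w * t) <= Rabs (w * t + mK * (t * t)) + Rabs (mK * (t * t))).
    { pose proof (Rabs_triang (w * t + mK * (t * t)) (- (mK * (t * t)))) as Q. rewrite Rabs_Ropp in Q.
      replace (w * t + mK * (t * t) + - (mK * (t * t))) with (w * t) in Q by ring. exact Q. }
    rewrite !Rabs_mult, (Rabs_right t) in Q2 by lra.
    assert (Q3 : Rabs mK * (t * t) <= Rabs w / 4 * t).
    { rewrite <- Rmult_assoc. apply Rmult_le_compat_r; [lra|]. apply Rle_trans with ((Rabs mK + 1) * t); [apply Rmult_le_compat_r; lra|].
      apply (Rmult_le_compat_l (Rabs mK + 1)) in T3; [|lra]. replace ((Rabs mK + 1) * (Rabs w / (4 * (Rabs mK + 1)))) with (Rabs w / 4) in T3 by (field; lra). exact T3. }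
    assert (0 < Rabs w * t) by now apply Rmult_lt_0_compat. lra. }
  set (N := fun p => mH * (H p - k) + mK * (K p - k ^ 2)).
  assert (HN : jet (fun p => k + N p) k h1 h2).
  { eapply jet_eq; [| | | |exact (jet_plus _ _ _ _ _ _ _ _ (jet_const k) (jet_plus _ _ _ _ _ _ _ _
      (jet_scal _ mH _ _ _ (jet_minus _ _ _ _ _ _ _ _ HH (jet_const k))) (jet_scal _ mK _ _ _ (jet_minus _ _ _ _ _ _ _ _ HK (jet_const (k ^ 2))))))];
      [easy|ring| |].
    - transitivity ((mH + 2 * k * mK) * h1); [ring|rewrite Hsum; ring].
    - transitivity ((mH + 2 * k * mK) * h2); [ring|rewrite Hsum; ring]. }
  apply (small_ext _ _ (fun p => (m (H p) (K p) - (k + N p)) + ((k + N p) - affine k h1 h2 p))); [intro; ring|].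
  apply small_plus; [typeclasses eauto| |exact HN]. apply plane_small_intro.
  { unfold N. rewrite (jet_0 _ _ _ _ HH), (jet_0 _ _ _ _ HK), (mcf_at_umbilic m _ Hm). ring. }
  intros eps He. destruct (jet_lipb _ _ _ _ HH) as [L1 [HL1 B1]]. destruct (jet_lipb _ _ _ _ HK) as [L2 [HL2 B2]].
  destruct (Fplane_elim _ B1) as [d1 [Hd1 B1']]. destruct (Fplane_elim _ B2) as [d2 [Hd2 B2']].
  destruct (square_of_locally _ Hdom) as [d3 [Hd3 B3]].
  set (L := L1 + L2 + 1). assert (HL : 0 < L) by (unfold L; lra).
  destruct (Hd (eps / L) ltac:(now apply Rdiv_lt_0_compat)) as [d4 [Hd4 B4]].
  set (d := Rmin (Rmin d1 d2) (Rmin d3 (d4 / (4 * L)))).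
  assert (Hdd : 0 < d) by (repeat apply Rmin_glb_lt; try easy; apply Rdiv_lt_0_compat; lra).
  assert (D1 : d <= d1) by (eapply Rle_trans; [apply Rmin_l|apply Rmin_l]). assert (D2 : d <= d2) by (eapply Rle_trans; [apply Rmin_l|apply Rmin_r]).
  assert (D3 : d <= d3) by (eapply Rle_trans; [apply Rmin_r|apply Rmin_l]). assert (D4 : d <= d4 / (4 * L)) by (eapply Rle_trans; [apply Rmin_r|apply Rmin_r]).
  assert (D5 : L * (2 * d) < d4).
  { apply (Rmult_le_compat_l (4 * L)) in D4; [|lra]. replace (4 * L * (d4 / (4 * L))) with d4 in D4 by (field; lra).
    assert (0 < L * d) by now apply Rmult_lt_0_compat. lra. }
  assert (Z0 : Rabs (fst ((0, 0) : R * R)) < d /\ Rabs (snd ((0, 0) : R * R)) < d) by (cbn [fst snd]; rewrite Rabs_R0; easy).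
  assert (G : forall p q : R * R, Rabs (fst p) < d -> Rabs (snd p) < d -> Rabs (fst q) < d -> Rabs (snd q) < d ->
    Rabs (H p - H q) + Rabs (K p - K q) <= L * plane_dist p q).
  { intros p q P1 P2 Q1 Q2. pose proof (plane_dist_pos p q).
    destruct (B1' p q ltac:(lra) ltac:(lra) ltac:(lra) ltac:(lra)) as [X1 _]. destruct (B2' p q ltac:(lra) ltac:(lra) ltac:(lra) ltac:(lra)) as [X2 _].
    cbn [fst snd] in X1, X2. unfold L. lra. }
  assert (Near : forall p : R * R, Rabs (fst p) < d -> Rabs (snd p) < d -> Rabs (H p - k) < d4 /\ Rabs (K p - k ^ 2) < d4).
  { intros p P1 P2. specialize (G p (0, 0) P1 P2 (proj1 Z0) (proj2 Z0)).
    rewrite (jet_0 _ _ _ _ HH), (jet_0 _ _ _ _ HK) in G.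
    assert (plane_dist p (0, 0) <= 2 * d) by (unfold plane_dist; cbn [fst snd]; rewrite !Rminus_0_r; lra).
    assert (L * plane_dist p (0, 0) <= L * (2 * d)) by (apply Rmult_le_compat_l; lra).
    pose proof (Rabs_pos (H p - k)). pose proof (Rabs_pos (K p - k ^ 2)). lra. }
  exists d. split; [easy|]. intros p q P1 P2 Q1 Q2.
  destruct (Near p P1 P2) as [N1 N2]. destruct (Near q Q1 Q2) as [N3 N4].
  specialize (B4 (H p) (K p) (H q) (K q) N1 N2 N3 N4). destruct p as [px py], q as [qx qy]. cbn [fst snd] in *.
  specialize (B4 (B3 px py ltac:(lra) ltac:(lra)) (B3 qx qy ltac:(lra) ltac:(lra))).
  unfold N. replace (m (H (px, py)) (K (px, py)) - (k + (mH * (H (px, py) - k) + mK * (K (px, py) - k ^ 2))) -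
    (m (H (qx, qy)) (K (qx, qy)) - (k + (mH * (H (qx, qy) - k) + mK * (K (qx, qy) - k ^ 2)))))
    with (m (H (px, py)) (K (px, py)) - m (H (qx, qy)) (K (qx, qy)) - (mH * (H (px, py) - H (qx, qy)) + mK * (K (px, py) - K (qx, qy)))) by ring.
  apply Rle_trans with (1 := B4). specialize (G (px, py) (qx, qy) P1 P2 Q1 Q2).
  apply Rle_trans with (eps / L * (L * plane_dist (px, py) (qx, qy))); [apply Rmult_le_compat_l; [apply Rlt_le; now apply Rdiv_lt_0_compat|easy]|].
  apply Req_le. field. lra.
Qed.

(** * The jet of the Monge function *)

Lemma class_C_le n m U f : (n <= m)%nat -> class_C m U f -> class_C n U f.
Proof.
  revert m f. induction n as [|n IH]; intros m f Hnm H.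
  - destruct m; simpl in *; tauto.
  - destruct m as [|m]; [lia|]. destruct H as [H0 [H1 [H2 H3]]]. split; [exact H0|split; [exact H1|split; [apply (IH m); [lia|exact H2]|apply (IH m); [lia|exact H3]]]].
Qed.

Lemma class_C_ex_diff_n n U f u v : class_C n U f -> U (u, v) -> ex_diff_n f n u v.
Proof.
  revert f. induction n as [|n IH]; intros f H Hp.
  - split; [now apply H|easy].
  - destruct H as [H0 [H1 [H2 H3]]]. destruct (H1 u v Hp) as [H4 H5].
    split; [now apply H0|]. split; [exact H4|]. split; [exact H5|]. split; [exact (IH _ H2 Hp)|exact (IH _ H3 Hp)].
Qed.

Lemma locally_2d_open U u v (P : R -> R -> Prop) : open U -> U (u, v) -> (forall x y, U (x, y) -> P x y) -> locally_2d P u v.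
Proof.
  intros HU Hp H. apply locally_2d_locally. generalize (HU _ Hp). apply filter_imp. intros [x y] Hxy. now apply H.
Qed.

Lemma schwarz_class_C U f u v : open U -> U (u, v) -> class_C 2 U f -> Dv (Du f) u v = Du (Dv f) u v.
Proof.
  intros HU Hp [_ [H1 [[_ [H2 [_ [H3 _]]]] [_ [H4 [[H5 _] _]]]]]]. symmetry. apply (Schwarz f u v).
  - apply (locally_2d_open U); try easy. intros x y Hxy.
    split; [exact (proj1 (H1 x y Hxy))|split; [exact (proj2 (H1 x y Hxy))|split; [exact (proj1 (H4 x y Hxy))|exact (proj2 (H2 x y Hxy))]]].
  - exact (H5 u v Hp).
  - exact (H3 u v Hp).
Qed.

Lemma vanishing c M d : 0 < d -> (forall x, 0 < x < d -> Rabs c <= M * x) -> c = 0.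
Proof.
  intros Hd H. destruct (Req_dec c 0) as [|Hc]; [easy|]. exfalso. apply Rabs_pos_lt in Hc.
  assert (HM : 0 < Rabs M + 1) by (pose proof (Rabs_pos M); lra).
  set (x := Rmin (d / 2) (Rabs c / (2 * (Rabs M + 1)))).
  assert (Hx : 0 < x) by (apply Rmin_glb_lt; [lra|apply Rdiv_lt_0_compat; lra]).
  assert (X1 : x <= d / 2) by apply Rmin_l. assert (X2 : x <= Rabs c / (2 * (Rabs M + 1))) by apply Rmin_r.
  specialize (H x ltac:(lra)). apply (Rmult_le_compat_l (Rabs M + 1)) in X2; [|lra].
  replace ((Rabs M + 1) * (Rabs c / (2 * (Rabs M + 1)))) with (Rabs c / 2) in X2 by (field; lra).
  assert (M * x <= (Rabs M + 1) * x) by (apply Rmult_le_compat_r; [lra|pose proof (Rle_abs M); lra]). lra.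
Qed.

(** Letting [x] tend to 0 kills the constant term; the estimate can then be divided by [x]. *)
Lemma vanishing_step c e B d n : 0 < d <= 1 -> 0 <= B -> forall g : R -> R, (forall x, 0 < x < d -> Rabs (g x) <= e) ->
  (forall x, 0 < x < d -> Rabs (c + x * g x) <= B * x ^ S n) -> c = 0 /\ forall x, 0 < x < d -> Rabs (g x) <= B * x ^ n.
Proof.
  intros Hd HB g Hg H. assert (Hc : c = 0).
  { apply (vanishing c (B + e) d); [easy|]. intros x Hx. specialize (H x Hx). specialize (Hg x Hx).
    replace c with ((c + x * g x) + - (x * g x)) by ring. apply Rle_trans with (1 := Rabs_triang _ _).
    rewrite Rabs_Ropp, Rabs_mult, (Rabs_right x) by lra.
    assert (x * Rabs (g x) <= x * e) by (apply Rmult_le_compat_l; lra).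
    assert (x ^ n <= 1) by (rewrite <- (pow1 n); apply pow_incr; lra).
    assert (B * x ^ S n <= B * x); [|lra]. apply Rmult_le_compat_l; [easy|]. simpl. assert (x * x ^ n <= x * 1) by (apply Rmult_le_compat_l; lra). lra. }
  split; [easy|]. intros x Hx. specialize (H x Hx). rewrite Hc, Rplus_0_l, Rabs_mult, (Rabs_right x) in H by lra. simpl in H.
  apply (Rmult_le_reg_l x); lra.
Qed.

Lemma cubic_vanishing c0 c1 c2 c3 B d : 0 < d -> 0 <= B ->
  (forall x, 0 < x < d -> Rabs (c0 + c1 * x + c2 * x ^ 2 + c3 * x ^ 3) <= B * x ^ 4) -> c1 = 0 /\ c2 = 0 /\ c3 = 0.
Proof.
  intros Hd HB H. set (d' := Rmin d 1). assert (Hd' : 0 < d' <= 1) by (split; [apply Rmin_glb_lt; lra|apply Rmin_r]).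
  assert (Hdd : d' <= d) by apply Rmin_l.
  assert (Bd : forall p q M N x, 0 < x < d' -> Rabs p <= M -> Rabs q <= N -> Rabs (p + x * q) <= M + N).
  { intros p q M N x Hx Hp Hq. apply Rle_trans with (1 := Rabs_triang _ _). rewrite Rabs_mult, (Rabs_right x) by lra.
    pose proof (Rabs_pos q). assert (x * Rabs q <= 1 * Rabs q) by (apply Rmult_le_compat_r; lra). lra. }
  destruct (vanishing_step c0 (Rabs c1 + (Rabs c2 + Rabs c3)) B d' 3 Hd' HB (fun x => c1 + x * (c2 + x * c3))) as [_ H1].
  { intros x Hx. apply Bd; [easy|apply Rle_refl|]. apply Bd; [easy|apply Rle_refl|apply Rle_refl]. }
  { intros x Hx. replace (c0 + x * (c1 + x * (c2 + x * c3))) with (c0 + c1 * x + c2 * x ^ 2 + c3 * x ^ 3) by ring. apply H. lra. }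
  destruct (vanishing_step c1 (Rabs c2 + Rabs c3) B d' 2 Hd' HB (fun x => c2 + x * c3)) as [E1 H2]; [|exact H1|].
  { intros x Hx. apply Bd; [easy|apply Rle_refl|apply Rle_refl]. }
  destruct (vanishing_step c2 (Rabs c3) B d' 1 Hd' HB (fun x => c3)) as [E2 H3]; [intros; apply Rle_refl|exact H2|].
  split; [easy|split; [easy|]]. apply (vanishing c3 B d'); [lra|]. intros x Hx. specialize (H3 x Hx). lra.
Qed.

Section MongeJet.
Context (U : R * R -> Prop) (z : R -> R -> R) (k a b c : R).
Context (HU : open U).
Context (H0 : U (0, 0)).
Context (Hz : class_C 4 U z).
Context (Hjet : exists B : R, locally (0, 0) (fun p : R * R =>
     let x := fst p in let y := snd p in
     Rabs (z x y - (k / 2 * (x ^ 2 + y ^ 2)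
                    + a / 6 * x ^ 3 + b / 2 * (x * y ^ 2) + c / 6 * y ^ 3))
       <= B * (sqrt (x ^ 2 + y ^ 2)) ^ 4)).

Definition taylor3 (x y : R) : R := z 0 0 + Du z 0 0 * x + Dv z 0 0 * y +
  (Du (Du z) 0 0 * x ^ 2 / 2 + Du (Dv z) 0 0 * (x * y) + Dv (Dv z) 0 0 * y ^ 2 / 2) +
  (Du (Du (Du z)) 0 0 * x ^ 3 / 6 + Du (Du (Dv z)) 0 0 * (x ^ 2 * y) / 2 + Du (Dv (Dv z)) 0 0 * (x * y ^ 2) / 2 + Dv (Dv (Dv z)) 0 0 * y ^ 3 / 6).

Lemma DL_pol_taylor3 x y : DL_pol 3 z 0 0 x y = taylor3 x y.
Proof.
  unfold DL_pol, differential. cbn [sum_f_R0 minus Nat.sub]. unfold Binomial.C. cbn [minus Nat.sub].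
  change (partial_derive 0 0 z 0 0) with (z 0 0). change (partial_derive 1 0 z 0 0) with (Du z 0 0).
  change (partial_derive 0 1 z 0 0) with (Dv z 0 0). change (partial_derive 2 0 z 0 0) with (Du (Du z) 0 0).
  change (partial_derive 1 1 z 0 0) with (Du (Dv z) 0 0). change (partial_derive 0 2 z 0 0) with (Dv (Dv z) 0 0).
  change (partial_derive 3 0 z 0 0) with (Du (Du (Du z)) 0 0). change (partial_derive 2 1 z 0 0) with (Du (Du (Dv z)) 0 0).
  change (partial_derive 1 2 z 0 0) with (Du (Dv (Dv z)) 0 0). change (partial_derive 0 3 z 0 0) with (Dv (Dv (Dv z)) 0 0).
  simpl fact. simpl INR. unfold taylor3. field.
Qed.

Lemma taylor3_jet : exists B d, 0 <= B /\ 0 < d /\ forall x y, Rabs x < d -> Rabs y < d ->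
  Rabs (taylor3 x y - (k / 2 * (x ^ 2 + y ^ 2) + a / 6 * x ^ 3 + b / 2 * (x * y ^ 2) + c / 6 * y ^ 3)) <= B * Rmax (Rabs x) (Rabs y) ^ 4.
Proof.
  destruct (Taylor_Lagrange_2d z 3 0 0) as [D [d1 H1]].
  { apply (locally_2d_open U); try easy. intros x y Hxy. now apply (class_C_ex_diff_n 4 U). }
  destruct Hjet as [B HB]. destruct (square_of_locally _ HB) as [d2 [Hd2 H2]]. cbn [fst snd] in H2.
  (* The 4 is the square of the constant in [x ^ 2 + y ^ 2 <= 2 * M ^ 2]; [D] and [B] come without a
     sign, hence the absolute values. *)
  exists (Rabs D + 4 * Rabs B), (Rmin d1 d2). pose proof (Rabs_pos D). pose proof (Rabs_pos B).
  split; [lra|split; [apply Rmin_glb_lt; [apply cond_pos|easy]|]]. intros x y Hx Hy.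
  pose proof (Rmin_l d1 d2). pose proof (Rmin_r d1 d2). specialize (H2 x y ltac:(lra) ltac:(lra)).
  specialize (H1 x y). rewrite !Rminus_0_r in H1. specialize (H1 ltac:(lra) ltac:(lra)). rewrite DL_pol_taylor3 in H1.
  set (M := Rmax (Rabs x) (Rabs y)) in *. assert (HM : 0 <= M ^ 4) by (apply pow_le; apply Rle_trans with (1 := Rabs_pos x), Rmax_l).
  set (T := k / 2 * _ + _ + _ + _) in *.
  replace (taylor3 x y - T) with (- (z x y - taylor3 x y) + (z x y - T)) by ring.
  apply Rle_trans with (1 := Rabs_triang _ _). rewrite Rabs_Ropp.
  assert (Q1 : D * M ^ 4 <= Rabs D * M ^ 4) by (apply Rmult_le_compat_r; [easy|apply Rle_abs]).
  assert (Hs : sqrt (x ^ 2 + y ^ 2) ^ 4 <= 4 * M ^ 4).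
  { assert (Hn : 0 <= x ^ 2 + y ^ 2) by (pose proof (pow2_ge_0 x); pose proof (pow2_ge_0 y); lra).
    replace (sqrt (x ^ 2 + y ^ 2) ^ 4) with ((x ^ 2 + y ^ 2) ^ 2) by (rewrite <- (sqrt_sqrt _ Hn) at 1; ring).
    replace (4 * M ^ 4) with ((2 * M ^ 2) ^ 2) by ring. apply pow_incr. split; [easy|].
    assert (G : forall w, Rabs w <= M -> w ^ 2 <= M ^ 2) by (intros w Hw; rewrite <- (pow2_abs w); apply pow_incr; split; [apply Rabs_pos|easy]).
    pose proof (G x (Rmax_l _ _)). pose proof (G y (Rmax_r _ _)). lra. }
  assert (Q2 : B * sqrt (x ^ 2 + y ^ 2) ^ 4 <= Rabs B * (4 * M ^ 4)).
  { apply Rle_trans with (Rabs B * sqrt (x ^ 2 + y ^ 2) ^ 4); [apply Rmult_le_compat_r; [apply pow_le, sqrt_pos|apply Rle_abs]|now apply Rmult_le_compat_l]. }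
  lra.
Qed.

(** On each of the lines of directions [(1, 0)], [(0, 1)], [(1, 1)] and [(1, -1)] the difference of
    the two polynomials is a cubic of order [x ^ 4], hence zero. These four lines determine all the
    coefficients of degrees 1 to 3. *)
Lemma monge_derivatives : Du z 0 0 = 0 /\ Dv z 0 0 = 0 /\ Du (Du z) 0 0 = k /\ Du (Dv z) 0 0 = 0 /\ Dv (Dv z) 0 0 = k /\
  Du (Du (Du z)) 0 0 = a /\ Du (Du (Dv z)) 0 0 = 0 /\ Du (Dv (Dv z)) 0 0 = b /\ Dv (Dv (Dv z)) 0 0 = c.
Proof.
  destruct taylor3_jet as [B [d [HB [Hd H]]]]. unfold taylor3 in H.
  assert (L : forall p q c1 c2 c3, Rabs p <= 1 -> Rabs q <= 1 ->
    (forall x, taylor3 (p * x) (q * x) - (k / 2 * ((p * x) ^ 2 + (q * x) ^ 2) + a / 6 * (p * x) ^ 3 + b / 2 * ((p * x) * (q * x) ^ 2) + c / 6 * (q * x) ^ 3)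
       = z 0 0 + c1 * x + c2 * x ^ 2 + c3 * x ^ 3) -> c1 = 0 /\ c2 = 0 /\ c3 = 0).
  { intros p q c1 c2 c3 Hp Hq E. apply (cubic_vanishing (z 0 0) c1 c2 c3 B d Hd HB). intros x Hx. rewrite <- E.
    assert (G : forall w, Rabs w <= 1 -> Rabs (w * x) <= x).
    { intros w Hw. rewrite Rabs_mult, (Rabs_right x) by lra. rewrite <- (Rmult_1_l x) at 2. apply Rmult_le_compat_r; lra. }
    pose proof (G p Hp) as G1. pose proof (G q Hq) as G2.
    apply Rle_trans with (1 := H (p * x) (q * x) ltac:(lra) ltac:(lra)). apply Rmult_le_compat_l; [easy|]. apply pow_incr.
    split; [apply Rle_trans with (1 := Rabs_pos (p * x)), Rmax_l|now apply Rmax_lub]. }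
  assert (A1 : Rabs 1 <= 1) by (rewrite Rabs_R1; lra). assert (A0 : Rabs 0 <= 1) by (rewrite Rabs_R0; lra).
  assert (Am : Rabs (-1) <= 1) by (rewrite Rabs_left; lra).
  destruct (L 1 0 (Du z 0 0) (Du (Du z) 0 0 / 2 - k / 2) (Du (Du (Du z)) 0 0 / 6 - a / 6) A1 A0) as [E1 [E2 E3]]; [intro; unfold taylor3; field|].
  destruct (L 0 1 (Dv z 0 0) (Dv (Dv z) 0 0 / 2 - k / 2) (Dv (Dv (Dv z)) 0 0 / 6 - c / 6) A0 A1) as [E4 [E5 E6]]; [intro; unfold taylor3; field|].
  destruct (L 1 1 (Du z 0 0 + Dv z 0 0) (Du (Du z) 0 0 / 2 + Du (Dv z) 0 0 + Dv (Dv z) 0 0 / 2 - k)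
    (Du (Du (Du z)) 0 0 / 6 + Du (Du (Dv z)) 0 0 / 2 + Du (Dv (Dv z)) 0 0 / 2 + Dv (Dv (Dv z)) 0 0 / 6 - a / 6 - b / 2 - c / 6) A1 A1) as [_ [E8 E9]];
    [intro; unfold taylor3; field|].
  destruct (L 1 (-1) (Du z 0 0 - Dv z 0 0) (Du (Du z) 0 0 / 2 - Du (Dv z) 0 0 + Dv (Dv z) 0 0 / 2 - k)
    (Du (Du (Du z)) 0 0 / 6 - Du (Du (Dv z)) 0 0 / 2 + Du (Dv (Dv z)) 0 0 / 2 - Dv (Dv (Dv z)) 0 0 / 6 - a / 6 - b / 2 + c / 6) A1 Am) as [_ [_ E12]];
    [intro; unfold taylor3; field|].
  repeat split; lra.
Qed.

Lemma monge_jets : let on f := fun p : R * R => f (fst p) (snd p) in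
  jet (on (Du z)) 0 k 0 /\ jet (on (Dv z)) 0 0 k /\
  jet (on (Du (Du z))) k a 0 /\ jet (on (Du (Dv z))) 0 0 b /\ jet (on (Dv (Dv z))) k b c.
Proof.
  intro on. destruct monge_derivatives as [E1 [E2 [E3 [E4 [E5 [E6 [E7 [E8 E9]]]]]]]].
  destruct Hz as [_ [_ [Hu Hv]]]. pose proof Hu as [_ [_ [Huu Huv]]]. pose proof Hv as [_ [_ [Hvu Hvv]]].
  assert (Smix : forall x y, U (x, y) -> Dv (Du z) x y = Du (Dv z) x y).
  { intros x y Hxy. apply (schwarz_class_C U); try easy. apply (class_C_le 2 4); [lia|exact Hz]. }
  assert (S1 : Dv (Du z) 0 0 = 0) by (rewrite (Smix _ _ H0); exact E4).
  assert (S2 : Dv (Du (Du z)) 0 0 = 0).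
  { rewrite (schwarz_class_C U (Du z) 0 0) by (try easy; (apply (class_C_le 2 3); [lia|assumption])). transitivity (Du (Du (Dv z)) 0 0); [|exact E7].
    (* The symmetry of the second derivatives is differentiated once more, so it is used on a
       neighbourhood and not only at the origin. *)
    apply Derive_ext_loc. destruct (square_of_locally U (HU _ H0)) as [d [Hd HUd]]. exists (mkposreal d Hd). intros t Ht.
    apply Smix, HUd; [|now rewrite Rabs_R0]. change (Rabs (t - 0) < d) in Ht. now rewrite Rminus_0_r in Ht. }
  assert (S3 : Dv (Du (Dv z)) 0 0 = b).
  { rewrite (schwarz_class_C U (Dv z) 0 0) by (try easy; (apply (class_C_le 2 3); [lia|assumption])). exact E8. }
  assert (J : forall f n p q r, class_C (S n) U f -> f 0 0 = p -> Du f 0 0 = q -> Dv f 0 0 = r -> jet (on f) p q r).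
  { intros f n p q r Hf <- <- <-. apply (jet_C1 U); try easy. apply (class_C_le 1 (S n)); [lia|exact Hf]. }
  split; [exact (J _ 2%nat _ _ _ Hu E1 E3 S1)|]. split; [exact (J _ 2%nat _ _ _ Hv E2 E4 E5)|].
  split; [exact (J _ 1%nat _ _ _ Huu E3 E6 S2)|]. split; [exact (J _ 1%nat _ _ _ Hvu E4 E7 S3)|exact (J _ 1%nat _ _ _ Hvv E5 E8 E9)].
Qed.
End MongeJet.

(** * The foliations near the umbilic *)

Lemma jet_positive f c al be : jet f c al be -> 0 < c -> exists d, 0 < d /\ forall x y, Rabs x < d -> Rabs y < d -> 0 < f (x, y).
Proof.
  intros Hf Hc. destruct (jet_lipb _ _ _ _ Hf) as [K [HK HF]]. destruct (Fplane_elim _ HF) as [d [Hd H]].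
  set (d' := Rmin d (c / (2 * (K + 1)))). assert (Hd' : 0 < d') by (apply Rmin_glb_lt; [easy|apply Rdiv_lt_0_compat; lra]).
  assert (D1 : d' <= d) by apply Rmin_l. assert (D2 : d' <= c / (2 * (K + 1))) by apply Rmin_r.
  exists d'. split; [easy|]. intros x y Hx Hy.
  destruct (H (x, y) (0, 0)) as [B _]; cbn [fst snd] in *; rewrite ?Rabs_R0; try lra.
  rewrite (jet_0 _ _ _ _ Hf) in B. unfold plane_dist in B. cbn [fst snd] in B. rewrite !Rminus_0_r in B.
  assert (K * (Rabs x + Rabs y) < c).
  { apply Rle_lt_trans with (K * (2 * (c / (2 * (K + 1))))); [apply Rmult_le_compat_l; lra|].
    apply (Rmult_lt_reg_r (K + 1)); [lra|]. replace (K * (2 * (c / (2 * (K + 1)))) * (K + 1)) with (K * c) by (field; lra). lra. }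
  assert (HB : Rabs (f (x, y) - c) < c) by lra. apply Rabs_def2 in HB. lra.
Qed.

Lemma torsion_sign_neq_0 i : torsion_sign i <> 0.
Proof. destruct i; simpl; lra. Qed.

Section Fields.
Context (U : R * R -> Prop) (z : R -> R -> R) (k a b c : R) (m : R -> R -> R) (i : mean_family).
Context (HU : open U).
Context (H0 : U (0, 0)).
Context (Hz : class_C 4 U z).
Context (Hjet : exists B : R, locally (0, 0) (fun p : R * R =>
     let x := fst p in let y := snd p in
     Rabs (z x y - (k / 2 * (x ^ 2 + y ^ 2)
                    + a / 6 * x ^ 3 + b / 2 * (x * y ^ 2) + c / 6 * y ^ 3))
       <= B * (sqrt (x ^ 2 + y ^ 2)) ^ 4)).
Context (Hk : k <> 0).
Context (Hb : b * (b - a) <> 0).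
Context (Hm : mean_curvature_function m).

Let on (f : R -> R -> R) : R * R -> R := fun p => f (fst p) (snd p).

Lemma on_form_jets : jet (on (ffE (monge z))) 1 0 0 /\ jet (on (ffF (monge z))) 0 0 0 /\ jet (on (ffG (monge z))) 1 0 0 /\
  jet (fun p => / sqrt (area2 z (fst p) (snd p))) 1 0 0 /\ jet (fun p => / area2 z (fst p) (snd p)) 1 0 0.
Proof.
  destruct (monge_jets U z k a b c HU H0 Hz Hjet) as [Jp [Jq _]].
  pose proof (jet_mult _ _ _ _ _ _ _ _ Jp Jp) as Jpp. pose proof (jet_mult _ _ _ _ _ _ _ _ Jq Jq) as Jqq. pose proof (jet_mult _ _ _ _ _ _ _ _ Jp Jq) as Jpq.
  assert (JA : jet (fun p => area2 z (fst p) (snd p)) 1 0 0).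
  { eapply jet_eq; [| | | |exact (jet_plus _ _ _ _ _ _ _ _ (jet_plus _ _ _ _ _ _ _ _ (jet_const 1) Jpp) Jqq)]; [intro; unfold area2; ring|ring|ring|ring]. }
  split; [|split; [|split; [|split]]].
  - eapply jet_eq; [| | | |exact (jet_plus _ _ _ _ _ _ _ _ (jet_const 1) Jpp)]; [intro; unfold on; rewrite ffE_monge; ring|ring|ring|ring].
  - eapply jet_eq; [| | | |exact Jpq]; [intro; unfold on; rewrite ffF_monge; ring|ring|ring|ring].
  - eapply jet_eq; [| | | |exact (jet_plus _ _ _ _ _ _ _ _ (jet_const 1) Jqq)]; [intro; unfold on; rewrite ffG_monge; ring|ring|ring|ring].
  - apply (jet_one_inv (fun p => sqrt (area2 z (fst p) (snd p)))). now apply (jet_one_sqrt (fun p => area2 z (fst p) (snd p))).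
  - now apply (jet_one_inv (fun p => area2 z (fst p) (snd p))).
Qed.

Lemma on_second_form_jets : jet (on (sfe (monge z))) k a 0 /\ jet (on (sff (monge z))) 0 0 b /\ jet (on (sfg (monge z))) k b c.
Proof.
  destruct (monge_jets U z k a b c HU H0 Hz Hjet) as [_ [_ [Juu [Juv Jvv]]]]. destruct on_form_jets as [_ [_ [_ [JS _]]]].
  split; [|split].
  - eapply jet_eq; [| | | |exact (jet_mult _ _ _ _ _ _ _ _ Juu JS)]; [intro; unfold on; now rewrite sfe_monge|ring|ring|ring].
  - eapply jet_eq; [| | | |exact (jet_mult _ _ _ _ _ _ _ _ Juv JS)]; [intro; unfold on; now rewrite sff_monge|ring|ring|ring].
  - eapply jet_eq; [| | | |exact (jet_mult _ _ _ _ _ _ _ _ Jvv JS)]; [intro; unfold on; now rewrite sfg_monge|ring|ring|ring].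
Qed.

Lemma on_curvature_jets : jet (on (form_mean_curvature (monge z))) k ((a + b) / 2) (c / 2) /\ jet (on (form_gauss_curvature (monge z))) (k ^ 2) (2 * k * ((a + b) / 2)) (2 * k * (c / 2)).
Proof.
  destruct on_form_jets as [JE [JF [JG [_ JA]]]]. destruct on_second_form_jets as [Je [Jf Jg]].
  pose proof (jet_mult _ _ _ _ _ _ _ _ Je JG) as JeG. pose proof (jet_mult _ _ _ _ _ _ _ _ Jf JF) as JfF. pose proof (jet_mult _ _ _ _ _ _ _ _ Jg JE) as JgE.
  pose proof (jet_mult _ _ _ _ _ _ _ _ Je Jg) as Jeg. pose proof (jet_mult _ _ _ _ _ _ _ _ Jf Jf) as Jff.
  assert (Hdet : forall p : R * R, ffE (monge z) (fst p) (snd p) * ffG (monge z) (fst p) (snd p) - ffF (monge z) (fst p) (snd p) ^ 2 = area2 z (fst p) (snd p))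
    by (intro; apply det_monge).
  assert (Hne : forall p : R * R, area2 z (fst p) (snd p) <> 0) by (intro p; pose proof (area2_pos z (fst p) (snd p)); lra).
  split.
  - eapply jet_eq; [| | | |exact (jet_mult _ _ _ _ _ _ _ _ (jet_scal _ (/ 2) _ _ _ (jet_plus _ _ _ _ _ _ _ _ (jet_minus _ _ _ _ _ _ _ _ JeG (jet_scal _ 2 _ _ _ JfF)) JgE)) JA)];
      [|field|field|field]. intro p. unfold on, form_mean_curvature, pencil_mean. rewrite Hdet. field. apply Hne.
  - eapply jet_eq; [| | | |exact (jet_mult _ _ _ _ _ _ _ _ (jet_minus _ _ _ _ _ _ _ _ Jeg Jff) JA)]; [|field|field|field].
    intro p. unfold on, form_gauss_curvature, pencil_gauss. rewrite Hdet. field. apply Hne.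
Qed.

Lemma gauss_positive : exists d, 0 < d /\ forall x y, Rabs x < d -> Rabs y < d -> 0 < form_gauss_curvature (monge z) x y.
Proof.
  apply (jet_positive _ _ _ _ (proj2 on_curvature_jets)). apply Rlt_0_sqr in Hk. unfold Rsqr in Hk. lra.
Qed.

Lemma on_calM_jet : jet (on (calM m (monge z))) k ((a + b) / 2) (c / 2).
Proof.
  destruct on_curvature_jets as [JH JK].
  assert (J : jet (fun p => m (on (form_mean_curvature (monge z)) p) (on (form_gauss_curvature (monge z)) p)) k ((a + b) / 2) (c / 2)).
  (* Near the origin the Gauss curvature is positive, and it never exceeds the square of the mean
     curvature, so the pair stays in the domain of [m]. *)
  { apply jet_mcf; try easy. destruct gauss_positive as [d [Hd HK]]. exists (mkposreal d Hd). intros [x y] [Hx Hy].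
    change (Rabs (x - 0) < d) in Hx. change (Rabs (y - 0) < d) in Hy. rewrite Rminus_0_r in Hx, Hy. specialize (HK x y Hx Hy).
    destruct (monge_curvatures z x y) as [Hd' _]. unfold on. cbn [fst snd]. split; lra. }
  eapply jet_eq; [|reflexivity|reflexivity|reflexivity|exact J]. intros [x y]. unfold on, calM. cbn [fst snd].
  destruct (monge_curvatures z x y) as [_ [-> ->]]. easy.
Qed.

Definition isotropy_e : R * R -> R := fun p => on (sfe (monge z)) p - on (calM m (monge z)) p * on (ffE (monge z)) p.
Definition isotropy_f : R * R -> R := fun p => on (sff (monge z)) p - on (calM m (monge z)) p * on (ffF (monge z)) p.
Definition isotropy_g : R * R -> R := fun p => on (sfg (monge z)) p - on (calM m (monge z)) p * on (ffG (monge z)) p.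

(** Subtracting [M], whose gradient is that of the mean curvature, removes the trace: the gradients
    of the first and the last coefficient become opposite, which is why [field_t] has zero
    derivative. *)
Lemma isotropy_jets : jet isotropy_e 0 ((a - b) / 2) (- (c / 2)) /\ jet isotropy_f 0 0 b /\ jet isotropy_g 0 ((b - a) / 2) (c / 2).
Proof.
  destruct on_form_jets as [JE [JF [JG _]]]. destruct on_second_form_jets as [Je [Jf Jg]]. pose proof on_calM_jet as JM.
  split; [|split].
  - eapply jet_eq; [| | | |exact (jet_minus _ _ _ _ _ _ _ _ Je (jet_mult _ _ _ _ _ _ _ _ JM JE))]; [easy|field|field|field].
  - eapply jet_eq; [| | | |exact (jet_minus _ _ _ _ _ _ _ _ Jf (jet_mult _ _ _ _ _ _ _ _ JM JF))]; [easy|field|field|field].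
  - eapply jet_eq; [| | | |exact (jet_minus _ _ _ _ _ _ _ _ Jg (jet_mult _ _ _ _ _ _ _ _ JM JG))]; [easy|field|field|field].
Qed.

Let s := torsion_sign i.
(** [p x^2 + 2 q x y + r y^2] equals [A (y^2 - x^2) + 2 B x y + t (x^2 + y^2)] for
    [A = (r - p) / 2], [B = q] and [t = (r + p) / 2]. The factor [s] turns the sign conditions of
    the two families into one inequality and multiplies the jet [(a, b, c)] by [s]. *)
Definition field_A : R * R -> R := fun p => s / 2 * (isotropy_g p - isotropy_e p).
Definition field_B : R * R -> R := fun p => s * isotropy_f p.
Definition field_t : R * R -> R := fun p => s / 2 * (isotropy_g p + isotropy_e p).

Lemma mean_jet_data : jet_data field_A field_B field_t (s * a) (s * b) (s * c).
Proof.
  destruct isotropy_jets as [Je [Jf Jg]]. split.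
  - apply (small_ext _ _ (fun p => field_A p - affine 0 ((s * b - s * a) / 2) (s * c / 2) p)); [intro; unfold affine; ring|].
    eapply jet_eq; [| | | |exact (jet_scal _ (s / 2) _ _ _ (jet_minus _ _ _ _ _ _ _ _ Jg Je))]; [easy|field|field|field].
  - apply (small_ext _ _ (fun p => field_B p - affine 0 0 (s * b) p)); [intro; unfold affine; ring|].
    eapply jet_eq; [| | | |exact (jet_scal _ s _ _ _ Jf)]; [easy|field|field|field].
  - apply (small_ext _ _ (fun p => field_t p - affine 0 0 0 p)); [intro; unfold affine; ring|].
    eapply jet_eq; [| | | |exact (jet_scal _ (s / 2) _ _ _ (jet_plus _ _ _ _ _ _ _ _ Jg Je))]; [easy|field|field|field].
  - intro E. apply Hb. pose proof (torsion_sign_neq_0 i) as Hs. fold s in Hs.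
    apply (Rmult_eq_reg_l (s * s)); [rewrite Rmult_0_r, <- E; ring|now apply Rmult_integral_contrapositive].
Qed.

Lemma mean_directions : contains_directions field_A field_B field_t (mean_foliation U (monge z) m i).
Proof.
  destruct gauss_positive as [d1 [Hd1 HK]]. destruct (square_of_locally U (HU _ H0)) as [d2 [Hd2 HU2]].
  exists (Rmin d1 d2). split; [now apply Rmin_glb_lt|]. intros [u v] [x y] _ Hu Hv. cbn [fst snd] in *.
  pose proof (Rmin_l d1 d2). pose proof (Rmin_r d1 d2). assert (HUp : U (u, v)) by (apply HU2; lra).
  assert (HKp : 0 < form_gauss_curvature (monge z) u v) by (apply HK; lra).
  intros E L. destruct Hz as [_ [_ [[_ [Hu' _]] [_ [Hv' _]]]]]. destruct (Hu' u v HUp) as [D1 D2]. destruct (Hv' u v HUp) as [D3 D4].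
  apply isotropic_direction; try easy.
  - apply (schwarz_class_C U); try easy. apply (class_C_le 2 4); [lia|exact Hz].
  - unfold field_A, field_B, field_t, isotropy_e, isotropy_f, isotropy_g, on in E. cbn [fst snd] in E. unfold binary_form.
    assert (Hs : s <> 0) by apply torsion_sign_neq_0. apply (Rmult_eq_reg_l s); [|easy]. rewrite Rmult_0_r, <- E. field.
  - unfold field_A, field_B, field_t, isotropy_e, isotropy_f, isotropy_g, on in L. cbn [fst snd] in L. fold s.
    eapply Rlt_le_trans; [exact L|]. apply Req_le. field.
Qed.
End Fields.

Theorem proposition1 (r : nat) (U : R * R -> Prop) (z : R -> R -> R) (k a b c : R)
  (hr : (4 <= r)%nat) (hU : open U) (h0 : U (0, 0))
  (himm : Cr_immersion r U (monge z))
  (humb : umbilic (monge z) 0 0)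
  (hjet : exists B : R, locally (0, 0) (fun p : R * R =>
     let x := fst p in let y := snd p in
     Rabs (z x y - (k / 2 * (x ^ 2 + y ^ 2)
                    + a / 6 * x ^ 3 + b / 2 * (x * y ^ 2) + c / 6 * y ^ 3))
       <= B * (sqrt (x ^ 2 + y ^ 2)) ^ 4))
  (hkab : k * b * (b - a) <> 0) :
  forall m : R -> R -> R, mean_curvature_function m ->
  forall i : mean_family,
    let Fol := mean_foliation U (monge z) m i in
    (Delta_m a b c > 0 -> has_sectors Fol (0, 0) [hyperbolic]) /\
    (Delta_m a b c < 0 /\ a / b > 1 -> has_sectors Fol (0, 0) [parabolic; hyperbolic]) /\
    (a / b < 1 -> has_sectors Fol (0, 0) [hyperbolic; hyperbolic; hyperbolic]).
Proof.
  intros m Hm i Fol.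
  assert (Hk : k <> 0) by (intros ->; apply hkab; ring).
  assert (Hb : b <> 0) by (intros ->; apply hkab; ring).
  assert (Hbb : b * (b - a) <> 0) by (intro E; apply hkab; rewrite Rmult_assoc, E; ring).
  assert (Hz : class_C 4 U z) by (apply (class_C_le 4 r _ _ hr); exact (proj1 (proj2 (proj2 himm)))).
  pose proof (sectors_of_jet _ _ _ _ _ _ Fol (mean_jet_data U z k a b c m i hU h0 Hz hjet Hk Hbb Hm)
    (mean_directions U z k a b c m i hU h0 Hz hjet Hk)) as H.
  (* For the minimal family the jet changes sign, but [Delta_m] and [a / b] do not. *)
  destruct i; simpl torsion_sign in H.
  - replace (-1 * a) with (- a) in H by ring. replace (-1 * b) with (- b) in H by ring. replace (-1 * c) with (- c) in H by ring.
    rewrite Delta_m_neg in H. replace (- a / - b) with (a / b) in H by (field; easy). exact H.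
  - rewrite !Rmult_1_l in H. exact H.
Qed.
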